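(* Let $F\colon\mathscr{T}\to\mathscr{S}$ be a tensor-triangulated functor (respectively, for some $2\le N\le\infty$, an $N$-tensor-triangulated functor), with $\mathscr{T}$ idempotent complete. Suppose that $F$ admits a right adjoint $G$ whose kernel is closed under the tensor product, and that the adjunction $F\dashv G$ satisfies the right projection formula. If the commutative algebra $G(\mathbb{1})\in\mathscr{T}$ is separable, then there is an induced equivalence $$(\mathscr{S}/\ker G)^\natural\cong G(\mathbb{1})\text{-}\mathrm{Mod}_{\mathscr{T}}$$ of tensor-triangulated categories (respectively, of $N$-tensor-triangulated categories).
   Context: A tensor-triangulated category is a triangulated category with a compatible closed symmetric monoidal structure $(\otimes,\mathbb{1})$ (compatibility in the sense of Hovey–Palmieri–Strickland, Definition A.2.1); a tensor-triangulated functor is a triangulated functor that is also strong symmetric monoidal. For $2\le N\le\infty$, an $N$-triangulated category (triangulated category of order $N$, in the sense of Balmer's paper ''Separability and triangulated categories'') is a suspended category with, as part of the structure, a class of distinguished $n$-triangles for each finite $n$ with $2\le n\le N$, satisfying higher octahedral axioms: an $n$-triangle is a diagram built on a chain of $n$ objects and $n-1$ composable morphisms (its base), containing cones of all composites in the chain; the distinguished ones are closed under isomorphism and under the standard bookkeeping operations (faces, degeneracies, rotation with the appropriate sign), every base extends to a distinguished $n$-triangle, and every morphism of bases of distinguished $n$-triangles extends to a morphism of $n$-triangles. A $2$-triangulated category is the same as a pre-triangulated category; Verdier's triangulated categories lie between $2$- and $3$-triangulated. An $N$-triangulated functor commutes with suspension and preserves distinguished $n$-triangles for all $n\le N$. $N$-tensor-triangulated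 categories and functors are obtained by replacing ''triangulated'' by ''$N$-triangulated'' throughout. $\ker G=\{s\in\mathscr{S}: G(s)\cong0\}$; it is closed under the tensor product if $s,s'\in\ker G$ implies $s\otimes s'\in\ker G$. $\mathscr{S}/\ker G$ is the Verdier quotient, with tensor structure inherited from $\mathscr{S}$, and $(-)^\natural$ is idempotent completion. $G$ is lax symmetric monoidal, so $G(\mathbb{1})$ is a commutative algebra. The right projection formula is the statement that the canonical map $t\otimes G(s)\to G(F(t)\otimes s)$ is an isomorphism for all $t\in\mathscr{T}$, $s\in\mathscr{S}$. An algebra $(A,\mu,u)$ (associative unital monoid) is separable if there is $\sigma\colon A\to A\otimes A$ with $\mu\sigma=\mathrm{id}_A$ and $(1\otimes\mu)(\sigma\otimes1)=\sigma\mu=(\mu\otimes1)(1\otimes\sigma)$. $A\text{-}\mathrm{Mod}_{\mathscr{T}}$ is the Eilenberg–Moore category of $A$-modules in $\mathscr{T}$. For $A$ commutative separable, it inherits from $\mathscr{T}$ a triangulation (pre-triangulation a priori when $\mathscr{T}$ is triangulated in the usual sense; of order $N$ if $\mathscr{T}$ is $N$-triangulated) whose distinguished triangles are exactly those whose underlying diagrams in $\mathscr{T}$ are distinguished, and a tensor structure which is the idempotent completion of the one on the Kleisli category of free modules. The equivalence is induced by the comparison functor $\mathscr{S}\to G(\mathbb{1})\text{-}\mathrm{Mod}_{\mathscr{T}}$ sending $s$ to $G(s)$ with its canonical $G(\mathbb{1})$-action. *)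

(* Defs.v *)
From Stdlib Require Import Setoid Morphisms Arith.

Set Implicit Arguments.
Unset Strict Implicit.
Unset Printing Implicit Defensive.

Declare Scope cat_scope.
Delimit Scope cat_scope with cat.
Open Scope cat_scope.

Reserved Notation "f == g" (at level 70, no associativity).
Reserved Notation "g \o f" (at level 45, left associativity).
Reserved Notation "x ⊗ y" (at level 40, left associativity).
Reserved Notation "f ⊠ g" (at level 40, left associativity).

(* Hom-sets are setoids, so that localizations need no quotient types;
   equality of objects is never used. *)
Record Cat := MkCat {
  ob :> Type;
  hom : ob -> ob -> Type;
  heq : forall x y : ob, hom x y -> hom x y -> Prop;
  idm : forall x : ob, hom x x;
  comp : forall x y z : ob, hom y z -> hom x y -> hom x z;
  heq_equiv : forall x y : ob, Equivalence (@heq x y);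
  comp_proper : forall x y z : ob,
    Proper (@heq y z ==> @heq x y ==> @heq x z) (@comp x y z);
  comp_assoc : forall (w x y z : ob)
    (h : hom y z) (g : hom x y) (f : hom w x),
    heq (comp (comp h g) f) (comp h (comp g f));
  comp_idl : forall (x y : ob) (f : hom x y), heq (comp (idm y) f) f;
  comp_idr : forall (x y : ob) (f : hom x y), heq (comp f (idm x)) f
}.

Arguments hom {c} x y.
Arguments heq {c x y} f g.
Arguments idm {c} x.
Arguments comp {c x y z} g f.

Notation "f == g" := (heq f g) : cat_scope.
Notation "g \o f" := (comp g f) : cat_scope.

#[global] Existing Instance heq_equiv.
#[global] Existing Instance comp_proper.

Definition is_iso {C : Cat} {x y : C} (f : hom x y) : Prop :=
  exists g : hom y x, g \o f == idm x /\ f \o g == idm y.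

Record Iso {C : Cat} (x y : C) := MkIso {
  iso_fwd :> hom x y;
  iso_inv : hom y x;
  iso_invl : iso_inv \o iso_fwd == idm x;
  iso_invr : iso_fwd \o iso_inv == idm y
}.

Definition is_zero {C : Cat} (x : C) : Prop :=
  forall y : C,
    (exists f : hom x y, forall g : hom x y, g == f) /\
    (exists f : hom y x, forall g : hom y x, g == f).

Definition idempotent_complete (C : Cat) : Prop :=
  forall (x : C) (e : hom x x), e \o e == e ->
  exists (y : C) (r : hom x y) (s : hom y x), r \o s == idm y /\ s \o r == e.

Record Functor (C D : Cat) := MkFunctor {
  fob :> C -> D;
  fmor : forall {x y : C}, hom x y -> hom (fob x) (fob y);
  fmor_proper : forall x y : C, Proper (@heq C x y ==> heq) (@fmor x y);
  fmor_id : forall x : C, fmor (idm x) == idm (fob x);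
  fmor_comp : forall (x y z : C) (g : hom y z) (f : hom x y),
    fmor (g \o f) == fmor g \o fmor f
}.

#[global] Existing Instance fmor_proper.

Definition functor_id (C : Cat) : Functor C C.
Proof.
  refine (@MkFunctor C C (fun x => x) (fun _ _ f => f) _ _ _).
  - intros x y f g H; exact H.
  - reflexivity.
  - reflexivity.
Defined.

Definition functor_comp {B C D : Cat} (G : Functor C D) (F : Functor B C) :
  Functor B D.
Proof.
  refine (@MkFunctor B D (fun x => G (F x)) (fun _ _ f => fmor G (fmor F f))
            _ _ _).
  - intros x y f g H; now rewrite H.
  - intros x; now rewrite !fmor_id.
  - intros x y z g f; now rewrite !fmor_comp.
Defined.

Record NatIso {C D : Cat} (F G : Functor C D) := MkNatIso {
  nat_iso :> forall x : C, Iso (F x) (G x);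
  nat_iso_natural : forall (x y : C) (f : hom x y),
    nat_iso y \o fmor F f == fmor G f \o nat_iso x
}.

Definition naturally_isomorphic {C D : Cat} (F G : Functor C D) : Prop :=
  inhabited (NatIso F G).

Definition is_equivalence {C D : Cat} (F : Functor C D) : Prop :=
  exists G : Functor D C,
    naturally_isomorphic (functor_comp G F) (functor_id C) /\
    naturally_isomorphic (functor_comp F G) (functor_id D).

Record Adjunction {C D : Cat} (F : Functor C D) (G : Functor D C) := MkAdj {
  unit_adj : forall x : C, hom x (G (F x));
  counit_adj : forall y : D, hom (F (G y)) y;
  unit_natural : forall (x y : C) (f : hom x y),
    unit_adj y \o f == fmor G (fmor F f) \o unit_adj x;
  counit_natural : forall (x y : D) (f : hom x y),
    counit_adj y \o fmor F (fmor G f) == f \o counit_adj x;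
  adj_triangle_l : forall x : C,
    counit_adj (F x) \o fmor F (unit_adj x) == idm (F x);
  adj_triangle_r : forall y : D,
    fmor G (counit_adj y) \o unit_adj (G y) == idm (G y)
}.

Class PreAdd (C : Cat) := {
  zerom : forall x y : C, hom x y;
  addm : forall {x y : C}, hom x y -> hom x y -> hom x y;
  oppm : forall {x y : C}, hom x y -> hom x y;
  addm_proper : forall x y : C,
    Proper (heq ==> heq ==> heq) (@addm x y);
  oppm_proper : forall x y : C, Proper (heq ==> heq) (@oppm x y);
  addm_assoc : forall (x y : C) (f g h : hom x y),
    addm (addm f g) h == addm f (addm g h);
  addm_comm : forall (x y : C) (f g : hom x y), addm f g == addm g f;
  addm_zero : forall (x y : C) (f : hom x y), addm (zerom x y) f == f;
  addm_opp : forall (x y : C) (f : hom x y), addm (oppm f) f == zerom x y;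
  comp_addl : forall (x y z : C) (g h : hom y z) (f : hom x y),
    addm g h \o f == addm (g \o f) (h \o f);
  comp_addr : forall (x y z : C) (g : hom y z) (f h : hom x y),
    g \o addm f h == addm (g \o f) (g \o h)
}.

Definition is_additive (C : Cat) {aC : PreAdd C} : Prop :=
  (exists z : C, is_zero z) /\
  (forall x y : C, exists (s : C) (i : hom x s) (j : hom y s)
     (p : hom s x) (q : hom s y),
     p \o i == idm x /\ q \o j == idm y /\
     p \o j == zerom y x /\ q \o i == zerom x y /\
     addm (i \o p) (j \o q) == idm s).

Arguments is_additive C {aC}.

Definition is_additive_functor {C D : Cat} {aC : PreAdd C} {aD : PreAdd D}
    (F : Functor C D) : Prop :=
  forall (x y : C) (f g : hom x y),
    fmor F (addm f g) == addm (fmor F f) (fmor F g).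

(* An n-triangle with base X(0,1) -> X(0,2) -> ... -> X(0,n): the objects
   X(i,j), for 0 <= i <= j <= n, are the cones of X(0,i) -> X(0,j) (so
   X(i,i) = 0), together with the maps X(i,j) -> X(i',j') for i <= i' and
   j <= j', and the connecting maps X(j,k) -> Sigma X(i,j) for i <= j <= k.
   This is one fundamental domain of the periodic diagram determined by
   X(j, i+n+1) = Sigma X(i,j).

   The families are indexed by all natural numbers so that no proof of a bound
   has to be carried around; only the indices in range are ever constrained,
   and all the notions below (in particular isomorphism) ignore the others. *)
Record ndiag {C : Cat} (Sg : Functor C C) := MkNdiag {
  nob : nat -> nat -> C;
  ntr : forall i j i' j' : nat, hom (nob i j) (nob i' j');
  nbd : forall i j k : nat, hom (nob j k) (Sg (nob i j))
}.

(* For n = 2 this is X(0,1) -> X(0,2) -> X(1,2) -> Sigma X(0,1), with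
   consecutive composites zero because they factor through some X(i,i). *)
Definition is_ntriangle {C : Cat} {Sg : Functor C C} (n : nat)
    (X : ndiag Sg) : Prop :=
  (forall i, i <= n -> is_zero (nob X i i)) /\
  (forall i j, i <= j <= n -> ntr X i j i j == idm (nob X i j)) /\
  (forall i j i' j' i'' j'',
     i <= j <= n -> i' <= j' <= n -> i'' <= j'' <= n ->
     i <= i' <= i'' -> j <= j' <= j'' ->
     ntr X i' j' i'' j'' \o ntr X i j i' j' == ntr X i j i'' j'') /\
  (forall i j k i' j' k',
     i <= j <= k -> i' <= j' <= k' -> k <= n -> k' <= n ->
     i <= i' -> j <= j' -> k <= k' ->
     nbd X i' j' k' \o ntr X j k j' k'
       == fmor Sg (ntr X i j i' j') \o nbd X i j k).

Definition is_nmorphism {C : Cat} {Sg : Functor C C} (n : nat)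
    (X Y : ndiag Sg) (w : forall i j, hom (nob X i j) (nob Y i j)) : Prop :=
  (forall i j i' j', i <= j <= n -> i' <= j' <= n -> i <= i' -> j <= j' ->
     ntr Y i j i' j' \o w i j == w i' j' \o ntr X i j i' j') /\
  (forall i j k, i <= j <= k -> k <= n ->
     nbd Y i j k \o w j k == fmor Sg (w i j) \o nbd X i j k).

Definition nretract {C : Cat} {Sg : Functor C C} (n : nat)
    (X Y : ndiag Sg) : Prop :=
  exists s r, is_nmorphism n (X := X) (Y := Y) s /\
    is_nmorphism n (X := Y) (Y := X) r /\
    (forall i j, i <= j <= n -> r i j \o s i j == idm (nob X i j)).

Definition nisomorphic {C : Cat} {Sg : Functor C C} (n : nat)
    (X Y : ndiag Sg) : Prop :=
  exists s r, is_nmorphism n (X := X) (Y := Y) s /\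
    is_nmorphism n (X := Y) (Y := X) r /\
    (forall i j, i <= j <= n -> r i j \o s i j == idm (nob X i j)) /\
    (forall i j, i <= j <= n -> s i j \o r i j == idm (nob Y i j)).

Definition monotone_upto (m n : nat) (phi : nat -> nat) : Prop :=
  forall i j, i <= j <= m -> phi i <= phi j <= n.

(* Faces for injective phi, degeneracies for surjective phi. *)
Definition nreindex {C : Cat} {Sg : Functor C C} (phi : nat -> nat)
    (X : ndiag Sg) : ndiag Sg :=
  @MkNdiag C Sg
    (fun i j => nob X (phi i) (phi j))
    (fun i j i' j' => ntr X (phi i) (phi j) (phi i') (phi j'))
    (fun i j k => nbd X (phi i) (phi j) (phi k)).

(* The rotated n-triangle Y has base X(0,n) -> X(1,n) -> ... -> X(n-1,n), that
   is Y(0,j) = X(j-1,n) for j > 0, and Y(i,j) = Sigma X(i-1,j-1) for i > 0.  In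
   the periodic diagram it is Y(i,j) = X(j-1, i+n), except that the sign of
   every connecting map is changed.  For n = 2, (f, g, h) becomes
   (g, h, - Sigma f). *)
Definition rot_ob {C : Cat} {Sg : Functor C C} (n : nat) (X : ndiag Sg)
    (i j : nat) : C :=
  match i, j with
  | S i, _ => Sg (nob X i (pred j))
  | 0, S j => nob X j n
  | 0, 0 => nob X 0 0
  end.

Definition rot_tr {C : Cat} {aC : PreAdd C} {Sg : Functor C C} (n : nat)
    (X : ndiag Sg) (i j i' j' : nat) :
    hom (rot_ob n X i j) (rot_ob n X i' j') :=
  match i, j, i', j'
    return hom (rot_ob n X i j) (rot_ob n X i' j') with
  | S i, j, S i', j' => fmor Sg (ntr X i (pred j) i' (pred j'))
  | 0, S j, 0, S j' => ntr X j n j' n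
  | 0, S j, S i', j' => nbd X i' (pred j') n \o ntr X j n (pred j') n
  | i, j, i', j' => zerom (rot_ob n X i j) (rot_ob n X i' j')
  end.

Definition rot_bd {C : Cat} {aC : PreAdd C} {Sg : Functor C C} (n : nat)
    (X : ndiag Sg) (i j k : nat) :
    hom (rot_ob n X j k) (Sg (rot_ob n X i j)) :=
  match i, j, k return hom (rot_ob n X j k) (Sg (rot_ob n X i j)) with
  | S i, S j, k => oppm (fmor Sg (nbd X i j (pred k)))
  | 0, S j, k => oppm (fmor Sg (ntr X j (pred k) j n))
  | i, j, k => zerom (rot_ob n X j k) (Sg (rot_ob n X i j))
  end.

Definition nrotate {C : Cat} {aC : PreAdd C} {Sg : Functor C C} (n : nat)
    (X : ndiag Sg) : ndiag Sg :=
  @MkNdiag C Sg (rot_ob n X) (rot_tr n X) (rot_bd n X).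

(* The base of X is (isomorphic to) the chain b 1 -> b 2 -> ... -> b n. *)
Definition nextends {C : Cat} {Sg : Functor C C} (n : nat) (X : ndiag Sg)
    (b : nat -> C) (f : forall i, hom (b i) (b (S i))) : Prop :=
  exists v : forall i, hom (b i) (nob X 0 i),
    (forall i, 1 <= i <= n -> is_iso (v i)) /\
    (forall i, 1 <= i < n -> ntr X 0 i 0 (S i) \o v i == v (S i) \o f i).

Inductive tri_order :=
| Verdier
| OrderN (N : nat)
| OrderInf.

Definition valid_order (o : tri_order) : Prop :=
  match o with OrderN N => 2 <= N | _ => True end.

Definition in_range (o : tri_order) (n : nat) : Prop :=
  2 <= n /\
  match o with Verdier => n <= 2 | OrderN N => n <= N | OrderInf => True end.

(* The usual triangulated categories are obtained for o = Verdier, and those of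
   order N <= infinity for o = OrderN N and o = OrderInf.  Closure under the
   inverse of rotation follows from the other axioms.  [tri_octahedral] is the octahedral axiom: f, g and g \o f have cones fitting
   in a 3-triangle all of whose faces are distinguished. *)
Class Tri (o : tri_order) (C : Cat) := {
  tri_add :: PreAdd C;
  tri_additive : is_additive C;
  susp : Functor C C;
  susp_equivalence : is_equivalence susp;
  dist : nat -> ndiag susp -> Prop;
  dist_ntriangle : forall n X, in_range o n -> dist n X -> is_ntriangle n X;
  dist_iso : forall n X Y, in_range o n -> dist n X ->
    is_ntriangle n Y -> nisomorphic n X Y -> dist n Y;
  dist_reindex : forall m n X phi, in_range o m -> in_range o n ->
    dist n X -> monotone_upto m n phi -> dist m (nreindex phi X);
  dist_rotate : forall n X, in_range o n -> dist n X -> dist n (nrotate n X);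
  tri_extend_base : forall n b f, in_range o n ->
    exists X, dist n X /\ nextends n X (b := b) f;
  tri_extend_morphism : forall n X Y
    (u : forall i, hom (nob X 0 i) (nob Y 0 i)),
    in_range o n -> dist n X -> dist n Y ->
    (forall i, 1 <= i < n ->
       ntr Y 0 i 0 (S i) \o u i == u (S i) \o ntr X 0 i 0 (S i)) ->
    exists w, is_nmorphism n (X := X) (Y := Y) w /\
      (forall i, 1 <= i <= n -> w 0 i == u i);
  tri_octahedral : o = Verdier -> forall b f,
    exists X : ndiag susp, is_ntriangle 3 X /\ nextends 3 X (b := b) f /\
      (forall phi, monotone_upto 2 3 phi ->
         phi 0 < phi 1 -> phi 1 < phi 2 -> dist 2 (nreindex phi X))
}.

Definition nimage {C D : Cat} {Sg : Functor C C} {Sg' : Functor D D}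
    (F : Functor C D) (th : forall x : C, hom (F (Sg x)) (Sg' (F x)))
    (X : ndiag Sg) : ndiag Sg' :=
  @MkNdiag D Sg'
    (fun i j => F (nob X i j))
    (fun i j i' j' => fmor F (ntr X i j i' j'))
    (fun i j k => th (nob X i j) \o fmor F (nbd X i j k)).

Record TriFunctor {o : tri_order} {C D : Cat} {tC : Tri o C} {tD : Tri o D}
    (F : Functor C D) := {
  trif_additive : is_additive_functor F;
  trif_susp : NatIso (functor_comp F susp) (functor_comp susp F);
  trif_dist : forall n X, in_range o n -> dist n X ->
    dist n (nimage (F := F) (fun x => trif_susp x) X)
}.

Class SymMon (C : Cat) := {
  tens : C -> C -> C;
  tensm : forall {x y x' y' : C},
    hom x x' -> hom y y' -> hom (tens x y) (tens x' y');
  one : C;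
  assoc : forall x y z : C, Iso (tens (tens x y) z) (tens x (tens y z));
  lunit : forall x : C, Iso (tens one x) x;
  runit : forall x : C, Iso (tens x one) x;
  braid : forall x y : C, hom (tens x y) (tens y x);
  tensm_proper : forall x y x' y' : C,
    Proper (heq ==> heq ==> heq) (@tensm x y x' y');
  tensm_id : forall x y : C, tensm (idm x) (idm y) == idm (tens x y);
  tensm_comp : forall (x y x' y' x'' y'' : C) (f' : hom x' x'')
    (f : hom x x') (g' : hom y' y'') (g : hom y y'),
    tensm (f' \o f) (g' \o g) == tensm f' g' \o tensm f g;
  assoc_natural : forall (x y z x' y' z' : C)
    (f : hom x x') (g : hom y y') (h : hom z z'),
    assoc x' y' z' \o tensm (tensm f g) h
      == tensm f (tensm g h) \o assoc x y z;
  lunit_natural : forall (x y : C) (f : hom x y),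
    lunit y \o tensm (idm one) f == f \o lunit x;
  runit_natural : forall (x y : C) (f : hom x y),
    runit y \o tensm f (idm one) == f \o runit x;
  braid_natural : forall (x y x' y' : C) (f : hom x x') (g : hom y y'),
    braid x' y' \o tensm f g == tensm g f \o braid x y;
  pentagon : forall w x y z : C,
    tensm (idm w) (assoc x y z) \o assoc w (tens x y) z
      \o tensm (assoc w x y) (idm z)
    == assoc w x (tens y z) \o assoc (tens w x) y z;
  unit_triangle : forall x y : C,
    tensm (idm x) (lunit y) \o assoc x one y == tensm (runit x) (idm y);
  hexagon : forall x y z : C,
    assoc y z x \o braid x (tens y z) \o assoc x y z
    == tensm (idm y) (braid x z) \o assoc y x z \o tensm (braid x y) (idm z);
  braid_involutive : forall x y : C, braid y x \o braid x y == idm (tens x y)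
}.

#[global] Existing Instance tensm_proper.

Notation "x ⊗ y" := (tens x y) : cat_scope.
Notation "f ⊠ g" := (tensm f g) : cat_scope.

Record MonFunctor {C D : Cat} {mC : SymMon C} {mD : SymMon D}
    (F : Functor C D) := {
  monf : forall x y : C, Iso (F x ⊗ F y) (F (x ⊗ y));
  monf_one : Iso one (F one);
  monf_natural : forall (x y x' y' : C) (f : hom x x') (g : hom y y'),
    fmor F (f ⊠ g) \o monf x y == monf x' y' \o (fmor F f ⊠ fmor F g);
  monf_assoc : forall x y z : C,
    fmor F (assoc x y z) \o monf (x ⊗ y) z \o (monf x y ⊠ idm (F z))
    == monf x (y ⊗ z) \o (idm (F x) ⊠ monf y z)
         \o assoc (F x) (F y) (F z);
  monf_lunit : forall x : C,
    fmor F (lunit x) \o monf one x \o (monf_one ⊠ idm (F x))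
    == lunit (F x);
  monf_runit : forall x : C,
    fmor F (runit x) \o monf x one \o (idm (F x) ⊠ monf_one)
    == runit (F x);
  monf_braid : forall x y : C,
    fmor F (braid x y) \o monf x y == monf y x \o braid (F x) (F y)
}.

Record IntHom (C : Cat) {mC : SymMon C} := {
  ihom : C -> C -> C;
  ev : forall x w : C, hom (ihom x w ⊗ x) w;
  curry : forall {a x w : C}, hom (a ⊗ x) w -> hom a (ihom x w);
  ev_curry : forall (a x w : C) (f : hom (a ⊗ x) w),
    ev x w \o (curry f ⊠ idm x) == f;
  curry_unique : forall (a x w : C) (f : hom (a ⊗ x) w)
    (g : hom a (ihom x w)), ev x w \o (g ⊠ idm x) == f -> g == curry f
}.

Arguments IntHom C {mC}.
Arguments ihom {C mC} H x w : rename.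
Arguments ev {C mC} H x w : rename.
Arguments curry {C mC} H {a x w} f : rename.

Definition ihom_pre {C : Cat} {mC : SymMon C} (H : IntHom C) {x y : C}
    (f : hom x y) (w : C) : hom (ihom H y w) (ihom H x w) :=
  curry H (ev H y w \o (idm (ihom H y w) ⊠ f)).

(* The conditions of Hovey-Palmieri-Strickland, Definition A.2.1, other than
   closedness.  Their sign condition on S^r ⊗ S^s, S^r = Sigma^r 1, follows
   for all r and s from the case r = s = 1 by naturality and coherence. *)
Class TensorTri (o : tri_order) (C : Cat) := {
  tt_tri :: Tri o C;
  tt_mon :: SymMon C;
  stens : forall x y : C, Iso (susp x ⊗ y) (susp (x ⊗ y));
  stens_natural : forall (x y x' y' : C) (f : hom x x') (g : hom y y'),
    stens x' y' \o (fmor susp f ⊠ g)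
      == fmor susp (f ⊠ g) \o stens x y;
  stens_runit : forall x : C,
    fmor susp (runit x) \o stens x one == runit (susp x);
  stens_assoc : forall x y z : C,
    fmor susp (assoc x y z) \o stens (x ⊗ y) z \o (stens x y ⊠ idm z)
    == stens x (y ⊗ z) \o assoc (susp x) y z;
  stens_dist : forall n (X : ndiag susp) (w : C), in_range o n -> dist n X ->
    dist n (@MkNdiag C susp
      (fun i j => nob X i j ⊗ w)
      (fun i j i' j' => ntr X i j i' j' ⊠ idm w)
      (fun i j k => stens (nob X i j) w \o (nbd X i j k ⊠ idm w)));
  stens_sign : braid (susp one) (susp one) == oppm (idm (susp one ⊗ susp one))
}.

Definition stens_r {o : tri_order} {C : Cat} {tC : TensorTri o C} (x y : C) :
    hom (x ⊗ susp y) (susp (x ⊗ y)) :=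
  fmor susp (braid y x) \o stens y x \o braid x (susp y).

(* Sigma F(Sigma x, w) -> F(x, w): the transpose of
   Sigma F ⊗ x = Sigma (F ⊗ x) = F ⊗ Sigma x -> w, F = F(Sigma x, w). *)
Definition ihom_susp {o : tri_order} {C : Cat} {tC : TensorTri o C}
    (H : IntHom C) (x w : C) :
    hom (susp (ihom H (susp x) w)) (ihom H x w) :=
  let F := ihom H (susp x) w in
  curry H (ev H (susp x) w \o braid (susp x) F \o iso_inv (stens x F)
             \o fmor susp (braid F x) \o stens F x).

(* Exactness of F(-, w).  For n = 2 the triangle obtained from (f, g, h) is
     F(Z,w) -> F(Y,w) -> F(X,w) -> Sigma F(Z,w),
   the last map being Sigma F(h,w) up to the identification [ihom_susp]; this
   is the rotation of the triangle
     Sigma^-1 F(X,w) -> F(Z,w) -> F(Y,w) -> F(X,w)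
   with first map - F(h,w) of Hovey-Palmieri-Strickland.  Exactness of F(w, -)
   is automatic for the right adjoint of - ⊗ w. *)
Definition ihom_exact {o : tri_order} {C : Cat} {tC : TensorTri o C}
    (H : IntHom C) : Prop :=
  exists k : forall x w : C, hom (ihom H x w) (susp (ihom H (susp x) w)),
    (forall x w : C, k x w \o ihom_susp H x w == idm _ /\
                     ihom_susp H x w \o k x w == idm _) /\
    (forall n (X : ndiag susp) (w : C), in_range o n -> dist n X ->
      dist n (@MkNdiag C susp
        (fun i j => ihom H (nob X (n - j) (n - i)) w)
        (fun i j i' j' =>
           ihom_pre H (ntr X (n - j') (n - i') (n - j) (n - i)) w)
        (fun i j k' =>
           fmor susp (ihom_pre H (nbd X (n - k') (n - j) (n - i)) w)
             \o k (nob X (n - k') (n - j)) w))).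

Class TTCat (o : tri_order) (C : Cat) := {
  ttc_tensor :: TensorTri o C;
  ttc_closed : exists H : IntHom C, ihom_exact H
}.

(* As usual, the two families of structure isomorphisms are required to be
   compatible with Sigma x ⊗ y = Sigma (x ⊗ y). *)
Record TTFunctor {o : tri_order} {C D : Cat} {tC : TensorTri o C}
    {tD : TensorTri o D} (F : Functor C D) := {
  ttf_tri :> TriFunctor F;
  ttf_mon :> MonFunctor F;
  ttf_compat : forall x y : C,
    trif_susp ttf_tri (x ⊗ y) \o fmor F (stens x y)
      \o monf ttf_mon (susp x) y
    == fmor susp (monf ttf_mon x y) \o stens (F x) (F y)
         \o (trif_susp ttf_tri x ⊠ idm (F y))
}.

(* A quasi-inverse is then automatically a tensor-triangulated functor. *)
Definition TTEquivalence {o : tri_order} {C D : Cat} {tC : TTCat o C}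
    {tD : TTCat o D} (F : Functor C D) : Prop :=
  inhabited (TTFunctor F) /\ is_equivalence F.

Definition in_kernel {S T : Cat} (G : Functor S T) (s : S) : Prop :=
  is_zero (G s).

Definition kernel_tensor_closed {S T : Cat} {mS : SymMon S}
    (G : Functor S T) : Prop :=
  forall s s' : S, in_kernel G s -> in_kernel G s' -> in_kernel G (s ⊗ s').

Definition lax {T S : Cat} {mT : SymMon T} {mS : SymMon S} {F : Functor T S}
    (mF : MonFunctor F) {G : Functor S T} (adj : Adjunction F G) (x y : S) :
    hom (G x ⊗ G y) (G (x ⊗ y)) :=
  fmor G (counit_adj adj x ⊠ counit_adj adj y)
    \o fmor G (iso_inv (monf mF (G x) (G y)))
    \o unit_adj adj (G x ⊗ G y).

Definition lax_one {T S : Cat} {mT : SymMon T} {mS : SymMon S}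
    {F : Functor T S} (mF : MonFunctor F) {G : Functor S T}
    (adj : Adjunction F G) : hom one (G one) :=
  fmor G (iso_inv (monf_one mF)) \o unit_adj adj one.

Definition projection_map {T S : Cat} {mT : SymMon T} {mS : SymMon S}
    {F : Functor T S} (mF : MonFunctor F) {G : Functor S T}
    (adj : Adjunction F G) (t : T) (s : S) :
    hom (t ⊗ G s) (G (F t ⊗ s)) :=
  fmor G (idm (F t) ⊠ counit_adj adj s)
    \o fmor G (iso_inv (monf mF t (G s)))
    \o unit_adj adj (t ⊗ G s).

Definition right_projection_formula {T S : Cat} {mT : SymMon T}
    {mS : SymMon S} {F : Functor T S} (mF : MonFunctor F) {G : Functor S T}
    (adj : Adjunction F G) : Prop :=
  forall (t : T) (s : S), is_iso (projection_map mF adj t s).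

Record Algebra (T : Cat) {mT : SymMon T} := MkAlgebra {
  acar :> T;
  amul : hom (acar ⊗ acar) acar;
  aone : hom one acar;
  amul_assoc : amul \o (amul ⊠ idm acar)
    == amul \o (idm acar ⊠ amul) \o assoc acar acar acar;
  amul_onel : amul \o (aone ⊠ idm acar) == lunit acar;
  amul_oner : amul \o (idm acar ⊠ aone) == runit acar
}.

Arguments Algebra T {mT}.

Definition separable {T : Cat} {mT : SymMon T} (A : Algebra T) : Prop :=
  exists s : hom A (A ⊗ A),
    amul A \o s == idm (acar A) /\
    (idm (acar A) ⊠ amul A) \o assoc A A A \o (s ⊠ idm (acar A))
      == s \o amul A /\
    (amul A ⊠ idm (acar A)) \o iso_inv (assoc A A A)
      \o (idm (acar A) ⊠ s)
      == s \o amul A.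

Record Module {T : Cat} {mT : SymMon T} (A : Algebra T) := MkModule {
  mcar :> T;
  mact : hom (A ⊗ mcar) mcar;
  mact_assoc : mact \o (amul A ⊠ idm mcar)
    == mact \o (idm (acar A) ⊠ mact) \o assoc A A mcar;
  mact_one : mact \o (aone A ⊠ idm mcar) == lunit mcar
}.

Record ModHom {T : Cat} {mT : SymMon T} {A : Algebra T} (M N : Module A) :=
  MkModHom {
  mhom :> hom (mcar M) (mcar N);
  mhom_linear : mhom \o mact M == mact N \o (idm (acar A) ⊠ mhom)
}.

Definition module_cat {T : Cat} {mT : SymMon T} (A : Algebra T) : Cat.
Proof.
  refine (@MkCat (Module A) (@ModHom T mT A) (fun M N f g => heq f g)
    (fun M => @MkModHom T mT A M M (idm (mcar M)) _)
    (fun M N P g f => @MkModHom T mT A M P (g \o f) _) _ _ _ _ _).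
Unshelve.
  - intros M N; split.
    + intros f; reflexivity.
    + intros f g H; now symmetry.
    + intros f g h H1 H2; now transitivity (mhom g).
  - intros M N P g g' Hg f f' Hf; cbn in *; now rewrite Hg, Hf.
  - intros; apply comp_assoc.
  - intros; apply comp_idl.
  - intros; apply comp_idr.
  - now rewrite tensm_id, comp_idl, comp_idr.
  - rewrite comp_assoc, mhom_linear, <- comp_assoc, mhom_linear, comp_assoc.
    now rewrite <- tensm_comp, comp_idl.
Defined.

Definition forget {T : Cat} {mT : SymMon T} (A : Algebra T) :
  Functor (module_cat A) T.
Proof.
  refine (@MkFunctor (module_cat A) T (fun M => mcar M)
            (fun M N f => mhom f) _ _ _).
  - intros M N f g H; exact H.
  - reflexivity.
  - reflexivity.
Defined.

Lemma precomp {C : Cat} {x y z : C} {g : hom y z} {f : hom x y}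
    {h : hom x z} : g \o f == h ->
  forall (w : C) (k : hom z w), k \o g \o f == k \o h.
Proof. intros H w k; now rewrite comp_assoc, H. Qed.

Lemma precomp2 {C : Cat} {x y y' z : C} {g : hom y z} {f : hom x y}
    {g' : hom y' z} {f' : hom x y'} : g \o f == g' \o f' ->
  forall (w : C) (k : hom z w), k \o g \o f == k \o g' \o f'.
Proof. intros H w k; now rewrite comp_assoc, H, comp_assoc. Qed.

Lemma iso_epi {C : Cat} {x y z : C} (i : Iso x y) (f g : hom y z) :
  f \o i == g \o i -> f == g.
Proof.
  intros H; rewrite <- (comp_idr f), <- (comp_idr g), <- (iso_invr i).
  now rewrite <- !comp_assoc, H.
Qed.

Lemma iso_mono {C : Cat} {x y z : C} (i : Iso y z) (f g : hom x y) :
  i \o f == i \o g -> f == g.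
Proof.
  intros H; rewrite <- (comp_idl f), <- (comp_idl g), <- (iso_invl i).
  now rewrite !comp_assoc, H.
Qed.

Lemma tensm_split {C : Cat} {mC : SymMon C} {x y x' y' x'' y'' : C}
    (f' : hom x' x'') (f : hom x x') (g' : hom y' y'') (g : hom y y') :
  (f' ⊠ g') \o (f ⊠ g) == (f' \o f) ⊠ (g' \o g).
Proof. symmetry; apply tensm_comp. Qed.

Lemma tensm_cancel_l {C : Cat} {mC : SymMon C} {x y : C} (f g : hom x y) :
  idm one ⊠ f == idm one ⊠ g -> f == g.
Proof.
  intros H; apply (iso_epi (i := lunit x)).
  now rewrite <- !lunit_natural, H.
Qed.

Lemma lunit_tens {C : Cat} {mC : SymMon C} (x y : C) :
  lunit (x ⊗ y) \o assoc one x y == lunit x ⊠ idm y.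
Proof.
  apply tensm_cancel_l.
  apply (iso_epi (i := assoc one (one ⊗ x) y)).
  assert (E : forall z (f g : hom ((one ⊗ (one ⊗ x)) ⊗ y) z),
    f \o (assoc one one x ⊠ idm y) == g \o (assoc one one x ⊠ idm y) -> f == g).
  { intros z f g H.
    rewrite <- (comp_idr f), <- (comp_idr g), <- tensm_id.
    rewrite <- (iso_invr (assoc one one x)), <- (comp_idl (idm y)), tensm_comp.
    now rewrite <- !comp_assoc, H. }
  apply E; clear E.
  rewrite <- (assoc_natural (idm one) (lunit x) (idm y)).
  rewrite (comp_assoc (assoc _ _ _)), tensm_split, unit_triangle, comp_idl.
  rewrite assoc_natural, tensm_id, <- unit_triangle.
  rewrite <- (comp_idl (idm one)) at 1.
  rewrite tensm_comp, (comp_assoc (idm one ⊠ lunit (x ⊗ y)) (_ ⊠ _)).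
  rewrite (comp_assoc (idm one ⊠ lunit (x ⊗ y)) (_ \o _)), pentagon.
  now rewrite <- comp_assoc.
Qed.

Lemma lunit_runit_one {C : Cat} {mC : SymMon C} : lunit one == runit (one (C := C)).
Proof.
  assert (H : lunit (one (C := C)) ⊠ idm one == runit one ⊠ idm one).
  { rewrite <- lunit_tens, <- unit_triangle.
    enough (E : lunit (one ⊗ one) == idm one ⊠ lunit (one (C := C)))
      by now rewrite E.
    apply (iso_mono (i := lunit one)); now rewrite lunit_natural. }
  apply (iso_epi (i := runit _)); now rewrite <- !runit_natural, H.
Qed.

Lemma adj_faithful {T S : Cat} {F : Functor T S} {G : Functor S T}
    (adj : Adjunction F G) (t : T) (s : S) (f g : hom t (G s)) :
  counit_adj adj s \o fmor F f == counit_adj adj s \o fmor F g -> f == g.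
Proof.
  assert (E : forall h : hom t (G s),
    fmor G (counit_adj adj s \o fmor F h) \o unit_adj adj t == h).
  { intros h; rewrite fmor_comp, comp_assoc, <- unit_natural, <- comp_assoc.
    now rewrite adj_triangle_r, comp_idl. }
  intros H; rewrite <- (E f), <- (E g); now rewrite H.
Qed.

Lemma lax_counit {T S : Cat} {mT : SymMon T} {mS : SymMon S}
    {F : Functor T S} (mF : MonFunctor F) {G : Functor S T}
    (adj : Adjunction F G) (x y : S) :
  counit_adj adj (x ⊗ y) \o fmor F (lax mF adj x y) \o monf mF (G x) (G y)
    == counit_adj adj x ⊠ counit_adj adj y.
Proof.
  unfold lax; rewrite !fmor_comp, <- !comp_assoc, counit_natural.
  rewrite (precomp2 (counit_natural adj _)).
  rewrite (precomp (adj_triangle_l adj _)), comp_idr.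
  rewrite (precomp (iso_invl _)); apply comp_idr.
Qed.

Lemma lax_one_counit {T S : Cat} {mT : SymMon T} {mS : SymMon S}
    {F : Functor T S} (mF : MonFunctor F) {G : Functor S T}
    (adj : Adjunction F G) :
  counit_adj adj one \o fmor F (lax_one mF adj) \o monf_one mF == idm one.
Proof.
  unfold lax_one; rewrite !fmor_comp, <- !comp_assoc, counit_natural.
  rewrite (precomp (adj_triangle_l adj _)), comp_idr.
  apply iso_invl.
Qed.

Lemma lax_natural {T S : Cat} {mT : SymMon T} {mS : SymMon S}
    {F : Functor T S} (mF : MonFunctor F) {G : Functor S T}
    (adj : Adjunction F G) (x y x' y' : S) (f : hom x x') (g : hom y y') :
  lax mF adj x' y' \o (fmor G f ⊠ fmor G g)
    == fmor G (f ⊠ g) \o lax mF adj x y.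
Proof.
  apply (adj_faithful (adj := adj)).
  apply (iso_epi (i := monf mF (G x) (G y))).
  rewrite !fmor_comp, <- !comp_assoc, counit_natural.
  rewrite (precomp2 (monf_natural mF _ _)), lax_counit.
  rewrite (comp_assoc (f ⊠ g) _ (fmor F _)).
  rewrite (comp_assoc (f ⊠ g)), lax_counit, !tensm_split.
  now rewrite !counit_natural.
Qed.

Lemma lax_assoc {T S : Cat} {mT : SymMon T} {mS : SymMon S}
    {F : Functor T S} (mF : MonFunctor F) {G : Functor S T}
    (adj : Adjunction F G) (x y z : S) :
  fmor G (assoc x y z) \o lax mF adj (x ⊗ y) z \o (lax mF adj x y ⊠ idm (G z))
    == lax mF adj x (y ⊗ z) \o (idm (G x) ⊠ lax mF adj y z)
         \o assoc (G x) (G y) (G z).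
Proof.
  apply (adj_faithful (adj := adj)).
  apply (iso_epi (i := monf mF (G x ⊗ G y) (G z))).
  assert (E : forall w (f g : hom (F (G x ⊗ G y) ⊗ F (G z)) w),
    f \o (monf mF (G x) (G y) ⊠ idm _) == g \o (monf mF (G x) (G y) ⊠ idm _)
    -> f == g).
  { intros w f g H.
    rewrite <- (comp_idr f), <- (comp_idr g), <- tensm_id.
    rewrite <- (iso_invr (monf mF (G x) (G y))).
    rewrite <- (comp_idl (idm (F (G z)))), tensm_comp.
    now rewrite <- !comp_assoc, H. }
  apply E; clear E.
  rewrite !fmor_comp, <- !comp_assoc, counit_natural.
  rewrite (precomp2 (monf_natural mF _ _)).
  rewrite (comp_assoc (assoc x y z) _ (fmor F _)).
  rewrite (comp_assoc (assoc x y z) _ (monf _ _ _)), lax_counit.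
  rewrite (precomp (tensm_split _ _ _ _)), (precomp (tensm_split _ _ _ _)).
  rewrite fmor_id, comp_idl, comp_idr, <- comp_assoc, lax_counit.
  rewrite !(comp_assoc _ (fmor F (assoc _ _ _))).
  rewrite !(comp_assoc _ (_ \o monf _ _ _)), monf_assoc, <- !comp_assoc.
  rewrite (precomp2 (monf_natural mF _ _)), lax_counit, !tensm_split.
  rewrite fmor_id, !comp_idr, lax_counit, assoc_natural.
  reflexivity.
Qed.

Lemma lax_lunit {T S : Cat} {mT : SymMon T} {mS : SymMon S}
    {F : Functor T S} (mF : MonFunctor F) {G : Functor S T}
    (adj : Adjunction F G) (x : S) :
  fmor G (lunit x) \o lax mF adj one x \o (lax_one mF adj ⊠ idm (G x))
    == lunit (G x).
Proof.
  apply (adj_faithful (adj := adj)).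
  apply (iso_epi (i := monf mF one (G x))).
  assert (E : forall w (f g : hom (F one ⊗ F (G x)) w),
    f \o (monf_one mF ⊠ idm _) == g \o (monf_one mF ⊠ idm _) -> f == g).
  { intros w f g H.
    rewrite <- (comp_idr f), <- (comp_idr g), <- tensm_id.
    rewrite <- (iso_invr (monf_one mF)).
    rewrite <- (comp_idl (idm (F (G x)))), tensm_comp.
    now rewrite <- !comp_assoc, H. }
  apply E; clear E.
  rewrite !fmor_comp, <- !comp_assoc, counit_natural.
  rewrite (precomp2 (monf_natural mF _ _)).
  rewrite (comp_assoc (lunit x) _ (fmor F _)).
  rewrite (comp_assoc (lunit x) _ (monf _ _ _)), lax_counit.
  rewrite (precomp (tensm_split _ _ _ _)), (precomp (tensm_split _ _ _ _)).
  rewrite fmor_id, !comp_idr, <- (comp_assoc _ _ (monf_one mF)), lax_one_counit.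
  rewrite lunit_natural, !(comp_assoc (counit_adj _ _)).
  now rewrite monf_lunit.
Qed.

Lemma lax_runit {T S : Cat} {mT : SymMon T} {mS : SymMon S}
    {F : Functor T S} (mF : MonFunctor F) {G : Functor S T}
    (adj : Adjunction F G) (x : S) :
  fmor G (runit x) \o lax mF adj x one \o (idm (G x) ⊠ lax_one mF adj)
    == runit (G x).
Proof.
  apply (adj_faithful (adj := adj)).
  apply (iso_epi (i := monf mF (G x) one)).
  assert (E : forall w (f g : hom (F (G x) ⊗ F one) w),
    f \o (idm _ ⊠ monf_one mF) == g \o (idm _ ⊠ monf_one mF) -> f == g).
  { intros w f g H.
    rewrite <- (comp_idr f), <- (comp_idr g), <- tensm_id.
    rewrite <- (iso_invr (monf_one mF)).
    rewrite <- (comp_idl (idm (F (G x)))), tensm_comp.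
    now rewrite <- !comp_assoc, H. }
  apply E; clear E.
  rewrite !fmor_comp, <- !comp_assoc, counit_natural.
  rewrite (precomp2 (monf_natural mF _ _)).
  rewrite (comp_assoc (runit x) _ (fmor F _)).
  rewrite (comp_assoc (runit x) _ (monf _ _ _)), lax_counit.
  rewrite (precomp (tensm_split _ _ _ _)), (precomp (tensm_split _ _ _ _)).
  rewrite fmor_id, !comp_idr, <- (comp_assoc _ _ (monf_one mF)), lax_one_counit.
  rewrite runit_natural, !(comp_assoc (counit_adj _ _)).
  now rewrite monf_runit.
Qed.

Lemma comparison_assoc {T S : Cat} {mT : SymMon T} {mS : SymMon S}
    {F : Functor T S} (mF : MonFunctor F) {G : Functor S T}
    (adj : Adjunction F G) (s : S) :
  fmor G (lunit s) \o lax mF adj one s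
    \o ((fmor G (lunit one) \o lax mF adj one one) ⊠ idm (G s))
  == fmor G (lunit s) \o lax mF adj one s
       \o (idm (G one) ⊠ (fmor G (lunit s) \o lax mF adj one s))
       \o assoc (G one) (G one) (G s).
Proof.
  assert (E1 : (fmor G (lunit one) \o lax mF adj one one) ⊠ idm (G s)
    == (fmor G (lunit one) ⊠ fmor G (idm s))
         \o (lax mF adj one one ⊠ idm (G s)))
    by now rewrite tensm_split, fmor_id, comp_idl.
  assert (E2 : idm (G one) ⊠ (fmor G (lunit s) \o lax mF adj one s)
    == (fmor G (idm one) ⊠ fmor G (lunit s))
         \o (idm (G one) ⊠ lax mF adj one s))
    by now rewrite tensm_split, fmor_id, comp_idl.
  rewrite E1, E2, <- !comp_assoc, !(precomp2 (lax_natural mF adj _ _)).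
  rewrite (comp_assoc _ _ (idm (G one) ⊠ _)).
  rewrite (comp_assoc _ _ (assoc (G one) (G one) (G s))).
  rewrite <- (lax_assoc mF adj one one s), <- !comp_assoc, <- !fmor_comp.
  rewrite (comp_assoc _ (idm one ⊠ lunit s)), unit_triangle, lunit_runit_one.
  reflexivity.
Qed.

Definition unit_algebra {T S : Cat} {mT : SymMon T} {mS : SymMon S}
    {F : Functor T S} (mF : MonFunctor F) {G : Functor S T}
    (adj : Adjunction F G) : Algebra T.
Proof.
  refine (@MkAlgebra T mT (G one) (fmor G (lunit one) \o lax mF adj one one)
            (lax_one mF adj) _ _ _).
  - apply comparison_assoc.
  - apply lax_lunit.
  - rewrite <- (lax_runit mF adj one).
    now rewrite lunit_runit_one.
Defined.

Definition comparison_module {T S : Cat} {mT : SymMon T} {mS : SymMon S}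
    {F : Functor T S} (mF : MonFunctor F) {G : Functor S T}
    (adj : Adjunction F G) (s : S) : Module (unit_algebra mF adj).
Proof.
  refine (@MkModule T mT (unit_algebra mF adj) (G s)
            (fmor G (lunit s) \o lax mF adj one s) _ _).
  - apply comparison_assoc.
  - apply lax_lunit.
Defined.

Definition comparison {T S : Cat} {mT : SymMon T} {mS : SymMon S}
    {F : Functor T S} (mF : MonFunctor F) {G : Functor S T}
    (adj : Adjunction F G) : Functor S (module_cat (unit_algebra mF adj)).
Proof.
  refine (@MkFunctor S (module_cat (unit_algebra mF adj))
    (comparison_module mF adj)
    (fun s s' f => @MkModHom T mT (unit_algebra mF adj)
       (comparison_module mF adj s) (comparison_module mF adj s')
       (fmor G f) _) _ _ _).
Unshelve.
  - intros s s' f g H; cbn; now rewrite H.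
  - intros s; cbn; apply fmor_id.
  - intros s s' s'' g f; cbn; apply fmor_comp.
  - cbn; rewrite <- (fmor_id G one), comp_assoc, lax_natural.
    now rewrite <- !comp_assoc, <- !fmor_comp, lunit_natural.
Defined.

Definition free_module {T : Cat} {mT : SymMon T} (A : Algebra T) (x : T) :
  Module A.
Proof.
  refine (@MkModule T mT A (A ⊗ x)
    ((amul A ⊠ idm x) \o iso_inv (assoc A A x)) _ _).
  - apply (iso_epi (i := assoc (A ⊗ A) A x)).
    assert (N : forall (a b c a' b' c' : T)
      (f : hom a a') (g : hom b b') (h : hom c c'),
      iso_inv (assoc a' b' c') \o (f ⊠ (g ⊠ h))
        == ((f ⊠ g) ⊠ h) \o iso_inv (assoc a b c)).
    { intros; apply (iso_epi (i := assoc a b c)).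
      rewrite !comp_assoc, <- assoc_natural, iso_invl, comp_idr.
      now rewrite <- comp_assoc, iso_invl, comp_idl. }
    assert (E1 : amul A ⊠ idm (A ⊗ x) == amul A ⊠ (idm (acar A) ⊠ idm x))
      by now rewrite tensm_id.
    assert (E2 : idm (acar A) ⊠ ((amul A ⊠ idm x) \o iso_inv (assoc A A x))
      == (idm (acar A) ⊠ (amul A ⊠ idm x))
           \o (idm (acar A) ⊠ iso_inv (assoc A A x)))
      by now rewrite tensm_split, comp_idl.
    assert (E3 : (amul A \o (idm (acar A) ⊠ amul A) \o assoc A A A) ⊠ idm x
      == (amul A ⊠ idm x) \o ((idm (acar A) ⊠ amul A) ⊠ idm x)
           \o (assoc A A A ⊠ idm x))
      by now rewrite !tensm_split, !comp_idl.
    assert (E4 : (idm (acar A) ⊠ iso_inv (assoc A A x))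
      \o (idm (acar A) ⊠ assoc A A x) == idm _)
      by now rewrite tensm_split, comp_idl, iso_invl, tensm_id.
    rewrite E1, E2, (precomp2 (N _ _ _ _ _ _ (amul A) (idm _) (idm x))).
    rewrite (precomp (iso_invl (assoc (A ⊗ A) A x))), comp_idr.
    rewrite tensm_split, comp_idl, amul_assoc, E3.
    rewrite <- !comp_assoc.
    rewrite (precomp2 (N _ _ _ _ _ _ (idm (acar A)) (amul A) (idm x))).
    rewrite (comp_assoc _ (assoc A A (A ⊗ x))), <- pentagon, <- !comp_assoc.
    rewrite (precomp E4), comp_idr.
    now rewrite (precomp (iso_invl _)), comp_idr.
  - apply (iso_epi (i := assoc one A x)).
    rewrite <- (tensm_id A x), lunit_tens, comp_assoc, <- assoc_natural.
    rewrite <- comp_assoc, (precomp (iso_invl _)), comp_idr.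
    now rewrite tensm_split, amul_onel, comp_idl.
Defined.

Definition free {T : Cat} {mT : SymMon T} (A : Algebra T) :
  Functor T (module_cat A).
Proof.
  refine (@MkFunctor T (module_cat A) (free_module A)
    (fun x y f => @MkModHom T mT A (free_module A x) (free_module A y)
       (idm (acar A) ⊠ f) _) _ _ _).
Unshelve.
  - intros x y f g H; cbn; now rewrite H.
  - intros x; cbn; apply tensm_id.
  - intros x y z g f; cbn; now rewrite tensm_split, comp_idl.
  - cbn; apply (iso_epi (i := assoc A A x)).
    rewrite !comp_assoc, iso_invl, comp_idr, <- assoc_natural.
    rewrite <- (comp_assoc (iso_inv _)), iso_invl, comp_idl.
    now rewrite !tensm_split, tensm_id, !comp_idl, !comp_idr.
Defined.

(* The tensor product of two morphisms f, g of free modules in the Kleisli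
   category.  A morphism free x -> free x' is determined by the composite
   x -> A ⊗ x -> A ⊗ x', which is how Kleisli morphisms are usually given. *)
Definition swap_middle {T : Cat} {mT : SymMon T} (a x b y : T) :
    hom ((a ⊗ x) ⊗ (b ⊗ y)) ((a ⊗ b) ⊗ (x ⊗ y)) :=
  iso_inv (assoc a b (x ⊗ y))
    \o (idm a ⊠ (assoc b x y \o (braid x b ⊠ idm y) \o iso_inv (assoc x b y)))
    \o assoc a x (b ⊗ y).

Definition kleisli {T : Cat} {mT : SymMon T} {A : Algebra T} {x x' : T}
    (f : hom (free A x) (free A x')) : hom x (A ⊗ x') :=
  mhom f \o (aone A ⊠ idm x) \o iso_inv (lunit x).

Definition kleisli_tens {T : Cat} {mT : SymMon T} {A : Algebra T}
    {x x' y y' : T} (f : hom (free A x) (free A x'))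
    (g : hom (free A y) (free A y')) :
    hom (A ⊗ (x ⊗ y)) (A ⊗ (x' ⊗ y')) :=
  mact (free_module A (x' ⊗ y'))
    \o (idm (acar A) ⊠
         ((amul A ⊠ idm (x' ⊗ y')) \o swap_middle A x' A y'
            \o (kleisli f ⊠ kleisli g))).

(* The tensor-triangulated structure tM on A-modules is the one inherited from
   T:
   - Sigma M is the object Sigma M of T with the action of A induced by
     A ⊗ Sigma M = Sigma (A ⊗ M), and the distinguished n-triangles are those
     whose underlying diagram in T is distinguished;
   - free modules form a tensor functor out of the Kleisli category: free is
     strong monoidal on T, and its structure maps are natural for all morphisms
     of free modules.  Every module being a retract of a free one when A is
     separable, this determines the tensor product as the idempotent
     completion of that of the Kleisli category. *)
Definition is_module_structure {o : tri_order} {T : Cat}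
    {tT : TensorTri o T} (A : Algebra T)
    (tM : TensorTri o (module_cat A)) : Prop :=
  exists (tU : TriFunctor (forget A)) (tF : TTFunctor (free A)),
    (forall M : Module A,
       trif_susp tU M \o mact (susp (M : module_cat A) : Module A)
       == fmor susp (mact M) \o stens_r (acar A) (mcar M)
            \o (idm (acar A) ⊠ trif_susp tU M)) /\
    (forall n (X : ndiag susp), in_range o n ->
       (dist n X <->
        dist n (nimage (F := forget A) (fun M => trif_susp tU M) X))) /\
    (forall x : T,
       trif_susp tU (free A x) \o fmor (forget A) (trif_susp tF x)
       == stens_r (acar A) x) /\
    (forall (x x' y y' : T) (f : hom (free A x) (free A x'))
       (g : hom (free A y) (free A y')),
       fmor (forget A) (monf tF x' y' \o (f ⊠ g))
       == kleisli_tens f g \o fmor (forget A) (monf tF x y)).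

Definition cone_in_kernel {o : tri_order} {S T : Cat} {tS : Tri o S}
    (G : Functor S T) (x y : S) (f : hom x y) : Prop :=
  exists (X : ndiag susp) (u : Iso x (nob X 0 1)) (v : Iso y (nob X 0 2)),
    dist 2 X /\ ntr X 0 1 0 2 \o u == v \o f /\ in_kernel G (nob X 1 2).

Inductive loc_hom {C : Cat} (W : forall x y : C, hom x y -> Prop) :
    C -> C -> Type :=
| loc_gen (x y : C) (f : hom x y) : loc_hom W x y
| loc_inv (x y : C) (w : hom x y) (Ww : W x y w) : loc_hom W y x
| loc_comp (x y z : C) (g : loc_hom W y z) (f : loc_hom W x y) :
    loc_hom W x z.

Inductive loc_eq {C : Cat} (W : forall x y : C, hom x y -> Prop) :
    forall x y : C, loc_hom W x y -> loc_hom W x y -> Prop :=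
| loc_refl x y (f : loc_hom W x y) : loc_eq f f
| loc_sym x y (f g : loc_hom W x y) : loc_eq f g -> loc_eq g f
| loc_trans x y (f g h : loc_hom W x y) :
    loc_eq f g -> loc_eq g h -> loc_eq f h
| loc_congr x y z (g g' : loc_hom W y z) (f f' : loc_hom W x y) :
    loc_eq g g' -> loc_eq f f' -> loc_eq (loc_comp g f) (loc_comp g' f')
| loc_assoc w x y z (h : loc_hom W y z) (g : loc_hom W x y)
    (f : loc_hom W w x) :
    loc_eq (loc_comp (loc_comp h g) f) (loc_comp h (loc_comp g f))
| loc_idl x y (f : loc_hom W x y) : loc_eq (loc_comp (loc_gen W (idm y)) f) f
| loc_idr x y (f : loc_hom W x y) : loc_eq (loc_comp f (loc_gen W (idm x))) f
| loc_gen_eq x y (f g : hom x y) : f == g -> loc_eq (loc_gen W f) (loc_gen W g)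
| loc_gen_comp x y z (g : hom y z) (f : hom x y) :
    loc_eq (loc_gen W (g \o f)) (loc_comp (loc_gen W g) (loc_gen W f))
| loc_invl x y (w : hom x y) (Ww : W x y w) :
    loc_eq (loc_comp (loc_inv Ww) (loc_gen W w)) (loc_gen W (idm x))
| loc_invr x y (w : hom x y) (Ww : W x y w) :
    loc_eq (loc_comp (loc_gen W w) (loc_inv Ww)) (loc_gen W (idm y)).

Definition localization {C : Cat} (W : forall x y : C, hom x y -> Prop) : Cat.
Proof.
  refine (@MkCat C (loc_hom W) (@loc_eq C W) (fun x => loc_gen W (idm x))
            (@loc_comp C W) _ _ _ _ _).
  - intros x y; split.
    + intros f; apply loc_refl.
    + intros f g; apply loc_sym.
    + intros f g h; apply loc_trans.
  - intros x y z g g' Hg f f' Hf; now apply loc_congr.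
  - intros; apply loc_assoc.
  - intros; apply loc_idl.
  - intros; apply loc_idr.
Defined.

Definition localize {C : Cat} (W : forall x y : C, hom x y -> Prop) :
  Functor C (localization W).
Proof.
  refine (@MkFunctor C (localization W) (fun x => x)
            (fun x y f => loc_gen W f) _ _ _).
  - intros x y f g H; now apply loc_gen_eq.
  - intros x; apply loc_refl.
  - intros x y z g f; apply loc_gen_comp.
Defined.

Definition verdier_quotient {o : tri_order} {S T : Cat} {tS : Tri o S}
    (G : Functor S T) : Cat :=
  localization (cone_in_kernel (o := o) G).

Definition quotient_functor {o : tri_order} {S T : Cat} {tS : Tri o S}
    (G : Functor S T) : Functor S (verdier_quotient (o := o) G) :=
  localize (cone_in_kernel (o := o) G).

(* The structure inherited from S: the quotient functor is a tensor-triangulated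
   functor, and every distinguished n-triangle comes from S up to isomorphism.
   Since the quotient functor is a localization, this determines all the rest
   of the structure up to unique isomorphism. *)
Definition is_verdier_structure {o : tri_order} {S T : Cat}
    {tS : TensorTri o S} (G : Functor S T)
    (tQ : TensorTri o (verdier_quotient (o := o) G)) : Prop :=
  exists tq : TTFunctor (quotient_functor (o := o) G),
    forall n (X : ndiag susp), in_range o n ->
      (dist n X <->
       is_ntriangle n X /\
       exists Y, dist n Y /\
         nisomorphic n X
           (nimage (F := quotient_functor (o := o) G)
              (fun s => trif_susp tq s) Y)).

Record KarOb (C : Cat) := MkKarOb {
  kob : C;
  kidem : hom kob kob;
  kidem_idem : kidem \o kidem == kidem
}.

Record KarHom {C : Cat} (x y : KarOb C) := MkKarHom {
  kmor :> hom (kob x) (kob y);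
  kmor_l : kidem y \o kmor == kmor;
  kmor_r : kmor \o kidem x == kmor
}.

Definition idempotent_completion (C : Cat) : Cat.
Proof.
  refine (@MkCat (KarOb C) (@KarHom C) (fun x y f g => heq f g)
    (fun x => @MkKarHom C x x (kidem x) (kidem_idem x) (kidem_idem x))
    (fun x y z g f => @MkKarHom C x z (g \o f) _ _) _ _ _ _ _).
Unshelve.
  - intros x y; split.
    + intros f; reflexivity.
    + intros f g H; now symmetry.
    + intros f g h H1 H2; now transitivity (kmor g).
  - intros x y z g g' Hg f f' Hf; cbn in *; now rewrite Hg, Hf.
  - intros; apply comp_assoc.
  - intros; apply kmor_l.
  - intros; apply kmor_r.
  - now rewrite <- comp_assoc, kmor_l.
  - now rewrite comp_assoc, kmor_r.
Defined.

Definition to_completion (C : Cat) : Functor C (idempotent_completion C).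
Proof.
  refine (@MkFunctor C (idempotent_completion C)
    (fun x => @MkKarOb C x (idm x) (comp_idl (idm x)))
    (fun x y f => @MkKarHom C (@MkKarOb C x (idm x) (comp_idl (idm x)))
       (@MkKarOb C y (idm y) (comp_idl (idm y))) f
       (comp_idl f) (comp_idr f)) _ _ _).
  - intros x y f g H; exact H.
  - intros x; cbn; reflexivity.
  - intros x y z g f; cbn; reflexivity.
Defined.

(* The structure inherited from C: the inclusion is a tensor-triangulated
   functor, and an n-triangle is distinguished when it is a direct summand of a
   distinguished n-triangle of C. *)
Definition is_completion_structure {o : tri_order} {C : Cat}
    (tC : TensorTri o C) (tK : TensorTri o (idempotent_completion C)) : Prop :=
  exists ti : TTFunctor (to_completion C),
    forall n (X : ndiag susp), in_range o n ->
      (dist n X <->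
       is_ntriangle n X /\
       exists Y, dist n Y /\
         nretract n X
           (nimage (F := to_completion C) (fun x => trif_susp ti x) Y)).

(* Main.v *)
(* Write A = G(1), D for the category of A-modules, K : S -> D for the
   comparison functor and Q = S / ker G.  By the projection formula K (F t) is
   the free module on t, so that Hom_S (F t, s) = Hom_D (K (F t), K s), and by
   separability every module is a retract of a free one.  Separability also
   gives K eps_s : K (F (G s)) -> K s a natural section, and this yields, for
   each s, a morphism w : z -> s inverted by G which factors through eps_s.
   Therefore ker G is a tensor ideal and K induces a fully faithful functor
   Q -> D.  As D is idempotent complete and each of its objects is a retract of
   some K (F t), the completion of Q is equivalent to D.

   The triangulation comes from D, where the forgetful functor creates it:
   morphisms of triangles are made linear by averaging, and triangles on a given
   base are split off free ones by lifting idempotents.  It is pulled back to Q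
   and to its completion.  The tensor product comes from S: it descends to Q,
   extends to the completion and is transported to D, where it agrees on free
   modules with that of the Kleisli category.  Internal homs in the completion
   and in D are retracts of those of S. *)

Require Import Defs.
From Stdlib Require Import Setoid Morphisms Arith Lia ClassicalEpsilon.

Set Implicit Arguments.
Unset Strict Implicit.
Unset Printing Implicit Defensive.

(** * Isomorphisms and additive functors *)

(** Only products of two objects of ker G are assumed to stay in ker G. That it is an ideal rests on
    a map [w : z -> x] inverted by G and factoring through eps_x. For k in the kernel, the cone of k
    ⊗ w is the product of k with the cone of w, two kernel objects, so G inverts k ⊗ w; yet this map
    factors through k ⊗ F (G x), which G kills by the projection formula. Hence G (k ⊗ x) = 0.
    Idempotents are lifted along n-triangles because a filled endomorphism w that is idempotent on
    the base makes w w - w vanish there, hence square to zero at every vertex; 3 w^2 - 2 w^3 is then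
    an honest idempotent with the same base. For [o = Verdier] this does not reach octahedra:
    morphisms of bases extend only for 2-triangles. The octahedral axiom for modules is therefore
    taken from S, and the idempotents of a 3-triangle that cut out the wanted base are written down
    explicitly. Equivalences, splittings and inverses are existence statements; choice turns them
    into functors and diagrams. *)

Lemma precomp3 {C : Cat} {a b c z : C} {h : hom c z} {g : hom b c}
    {f : hom a b} {r : hom a z} : h \o g \o f == r ->
  forall (w : C) (k : hom z w), k \o h \o g \o f == k \o r.
Proof. intros H w k; now rewrite <- H, !comp_assoc. Qed.

Lemma precomp4 {C : Cat} {a b c d z : C} {i : hom d z} {h : hom c d}
    {g : hom b c} {f : hom a b} {r : hom a z} : i \o h \o g \o f == r ->
  forall (w : C) (k : hom z w), k \o i \o h \o g \o f == k \o r.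
Proof. intros H w k; now rewrite <- H, !comp_assoc. Qed.

(* [rw] rewrites with an equation between composites modulo associativity. *)
Ltac la := rewrite <- ?comp_assoc.
Tactic Notation "rw" uconstr(c) :=
  first [rewrite c | rewrite (precomp c) | rewrite (precomp3 c)
        | rewrite (precomp4 c)]; la.
Ltac idc := rewrite ?comp_idl, ?comp_idr.

(** [is_iso] is a proposition, so an inverse has to be chosen before it can enter a construction of
    data. *)
Definition iso_of {C : Cat} {x y : C} {f : hom x y} (H : is_iso f) : Iso x y :=
  MkIso (proj1 (proj2_sig (constructive_indefinite_description _ H)))
        (proj2 (proj2_sig (constructive_indefinite_description _ H))).

Definition iso_id {C : Cat} (x : C) : Iso x x :=
  MkIso (comp_idl (idm x)) (comp_idl (idm x)).

Definition iso_sym {C : Cat} {x y : C} (i : Iso x y) : Iso y x :=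
  MkIso (iso_invr i) (iso_invl i).

Definition iso_comp {C : Cat} {x y z : C} (j : Iso y z) (i : Iso x y) :
  Iso x z.
Proof.
  refine (@MkIso C x z (j \o i) (iso_inv i \o iso_inv j) _ _).
  - la; rw (iso_invl j); idc; apply iso_invl.
  - la; rw (iso_invr i); idc; apply iso_invr.
Defined.

Definition fiso {C D : Cat} (F : Functor C D) {x y : C} (i : Iso x y) :
  Iso (F x) (F y).
Proof.
  refine (@MkIso D (F x) (F y) (fmor F i) (fmor F (iso_inv i)) _ _);
    now rewrite <- fmor_comp, ?iso_invl, ?iso_invr, fmor_id.
Defined.

Lemma is_iso_iso {C : Cat} {x y : C} (i : Iso x y) : is_iso i.
Proof. exists (iso_inv i); split; [apply iso_invl | apply iso_invr]. Qed.

Lemma is_iso_proper {C : Cat} {x y : C} (f g : hom x y) :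
  f == g -> is_iso f -> is_iso g.
Proof.
  intros E [h [H1 H2]]; exists h; now rewrite <- E.
Qed.

#[global] Instance is_iso_Proper (C : Cat) (x y : C) :
  Proper (heq ==> iff) (@is_iso C x y).
Proof.
  intros f g E; split; apply is_iso_proper; [exact E | now symmetry].
Qed.

Lemma is_iso_comp {C : Cat} {x y z : C} (g : hom y z) (f : hom x y) :
  is_iso g -> is_iso f -> is_iso (g \o f).
Proof.
  intros Hg Hf; exact (is_iso_iso (iso_comp (iso_of Hg) (iso_of Hf))).
Qed.

Lemma is_iso_inv {C : Cat} {x y : C} (i : Iso x y) : is_iso (iso_inv i).
Proof. exact (is_iso_iso (iso_sym i)). Qed.

Lemma is_iso_fmor {C D : Cat} (F : Functor C D) {x y : C} (f : hom x y) :
  is_iso f -> is_iso (fmor F f).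
Proof. intros H; exact (is_iso_iso (fiso F (iso_of H))). Qed.

Lemma is_iso_cancel_l {C : Cat} {x y z : C} (g : hom y z) (f : hom x y) :
  is_iso g -> is_iso (g \o f) -> is_iso f.
Proof.
  intros Hg Hgf; apply (is_iso_proper (f := iso_inv (iso_of Hg) \o (g \o f))).
  - la; rw (iso_invl (iso_of Hg)); apply comp_idl.
  - apply is_iso_comp; [apply is_iso_inv | exact Hgf].
Qed.

Lemma is_iso_cancel_r {C : Cat} {x y z : C} (g : hom y z) (f : hom x y) :
  is_iso f -> is_iso (g \o f) -> is_iso g.
Proof.
  intros Hf Hgf; apply (is_iso_proper (f := (g \o f) \o iso_inv (iso_of Hf))).
  - rw (iso_invr (iso_of Hf)); apply comp_idr.
  - apply is_iso_comp; [exact Hgf | apply is_iso_inv].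
Qed.

Lemma split_mono {C : Cat} {x y z : C} {r : hom z y} {s : hom y z}
    (H : r \o s == idm y) (f g : hom x y) : s \o f == s \o g -> f == g.
Proof.
  intros E; rewrite <- (comp_idl f), <- (comp_idl g), <- H.
  now rewrite !comp_assoc, E.
Qed.

Lemma split_epi {C : Cat} {x y z : C} {r : hom z y} {s : hom y z}
    (H : r \o s == idm y) (f g : hom y x) : f \o r == g \o r -> f == g.
Proof.
  intros E; rewrite <- (comp_idr f), <- (comp_idr g), <- H.
  now rewrite <- !comp_assoc, E.
Qed.

(** A preimage [g] of the identity is a right inverse; injectivity cancels [f] in
    [f \o (g \o f) == f], so it is a left inverse too. *)
Lemma yoneda_iso {C : Cat} {x y : C} (f : hom x y) :
  (forall t (v : hom t y), exists u : hom t x, f \o u == v) ->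
  (forall t (u u' : hom t x), f \o u == f \o u' -> u == u') ->
  is_iso f.
Proof.
  intros Hs Hi; destruct (Hs _ (idm y)) as [g Hg]; exists g; split; trivial.
  apply Hi; la; rewrite Hg; now idc.
Qed.

#[global] Existing Instance addm_proper.
#[global] Existing Instance oppm_proper.

Section PreAdditive.
Context {C : Cat} {aC : PreAdd C}.

Lemma addm_zero_r (x y : C) (f : hom x y) : addm f (zerom x y) == f.
Proof. now rewrite addm_comm, addm_zero. Qed.

Lemma addm_opp_r (x y : C) (f : hom x y) : addm f (oppm f) == zerom x y.
Proof. now rewrite addm_comm, addm_opp. Qed.

Lemma addm_cancel_l (x y : C) (f g h : hom x y) :
  addm f g == addm f h -> g == h.
Proof.
  intros E; rewrite <- (addm_zero g), <- (addm_zero h), <- (addm_opp f).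
  now rewrite !addm_assoc, E.
Qed.

Lemma addm_cancel_r (x y : C) (f g h : hom x y) :
  addm g f == addm h f -> g == h.
Proof.
  intros E; apply (addm_cancel_l (f := f)).
  now rewrite (addm_comm f g), (addm_comm f h).
Qed.

Lemma comp_zerol (x y z : C) (f : hom x y) :
  zerom y z \o f == zerom x z.
Proof.
  apply (addm_cancel_l (f := zerom y z \o f)).
  now rewrite <- comp_addl, addm_zero, addm_zero_r.
Qed.

Lemma comp_zeror (x y z : C) (g : hom y z) :
  g \o zerom x y == zerom x z.
Proof.
  apply (addm_cancel_l (f := g \o zerom x y)).
  now rewrite <- comp_addr, addm_zero, addm_zero_r.
Qed.

Lemma opp_unique (x y : C) (f g : hom x y) :
  addm f g == zerom x y -> g == oppm f.
Proof.
  intros E; apply (addm_cancel_l (f := f)); now rewrite addm_opp_r.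
Qed.

Lemma oppm_opp (x y : C) (f : hom x y) : oppm (oppm f) == f.
Proof. symmetry; apply opp_unique, addm_opp. Qed.

Lemma oppm_inj (x y : C) (f g : hom x y) : oppm f == oppm g -> f == g.
Proof. intros E; now rewrite <- (oppm_opp f), E, oppm_opp. Qed.

Lemma oppm_zero (x y : C) : oppm (zerom x y) == zerom x y.
Proof. symmetry; apply opp_unique; now rewrite addm_zero. Qed.

Lemma oppm_add (x y : C) (f g : hom x y) :
  oppm (addm f g) == addm (oppm f) (oppm g).
Proof.
  symmetry; apply opp_unique.
  rewrite (addm_comm f g), addm_assoc, <- (addm_assoc f), addm_opp_r.
  now rewrite addm_zero, addm_opp_r.
Qed.

Lemma comp_oppl (x y z : C) (g : hom y z) (f : hom x y) :
  oppm g \o f == oppm (g \o f).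
Proof.
  apply opp_unique; now rewrite <- comp_addl, addm_opp_r, comp_zerol.
Qed.

Lemma comp_oppr (x y z : C) (g : hom y z) (f : hom x y) :
  g \o oppm f == oppm (g \o f).
Proof.
  apply opp_unique; now rewrite <- comp_addr, addm_opp_r, comp_zeror.
Qed.

Definition subm {x y : C} (f g : hom x y) : hom x y := addm f (oppm g).

#[global] Instance subm_proper (x y : C) :
  Proper (heq ==> heq ==> heq) (@subm x y).
Proof. intros f f' Hf g g' Hg; unfold subm; now rewrite Hf, Hg. Qed.

Lemma subm_eq (x y : C) (f g : hom x y) : subm f g == zerom x y <-> f == g.
Proof.
  split; intros E.
  - apply (addm_cancel_r (f := oppm g)); unfold subm in E.
    now rewrite E, addm_opp_r.
  - unfold subm; now rewrite E, addm_opp_r.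
Qed.

Lemma comp_subl (x y z : C) (g h : hom y z) (f : hom x y) :
  subm g h \o f == subm (g \o f) (h \o f).
Proof. unfold subm; now rewrite comp_addl, comp_oppl. Qed.

Lemma comp_subr (x y z : C) (g : hom y z) (f h : hom x y) :
  g \o subm f h == subm (g \o f) (g \o h).
Proof. unfold subm; now rewrite comp_addr, comp_oppr. Qed.

Lemma subm_zero (x y : C) (f : hom x y) : subm f (zerom x y) == f.
Proof. unfold subm; now rewrite oppm_zero, addm_zero_r. Qed.

Lemma subm_add (x y : C) (f g : hom x y) : addm (subm f g) g == f.
Proof. unfold subm; now rewrite addm_assoc, addm_opp, addm_zero_r. Qed.

Lemma add_subm (x y : C) (f g : hom x y) : addm g (subm f g) == f.
Proof. now rewrite addm_comm, subm_add. Qed.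

Lemma is_zero_idm (x : C) : is_zero x <-> idm x == zerom x x.
Proof.
  split.
  - intros H; destruct (H x) as [[f Hf] _]; now rewrite (Hf (idm x)), (Hf (zerom x x)).
  - intros E y; split.
    + exists (zerom x y); intros g.
      now rewrite <- (comp_idr g), E, comp_zeror.
    + exists (zerom y x); intros g.
      now rewrite <- (comp_idl g), E, comp_zerol.
Qed.

Lemma from_zero (x y : C) (f g : hom x y) : is_zero x -> f == g.
Proof.
  intros H; destruct (H y) as [[h Hh] _]; now rewrite (Hh f), (Hh g).
Qed.

Lemma to_zero (x y : C) (f g : hom x y) : is_zero y -> f == g.
Proof.
  intros H; destruct (H x) as [_ [h Hh]]; now rewrite (Hh f), (Hh g).
Qed.

Lemma is_zero_retract (x y : C) (s : hom x y) (r : hom y x) :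
  r \o s == idm x -> is_zero y -> is_zero x.
Proof.
  intros E Hy; apply is_zero_idm; rewrite <- E.
  rewrite (to_zero s (zerom x y) Hy); apply comp_zeror.
Qed.

Lemma is_zero_isom (x y : C) (i : Iso x y) : is_zero y -> is_zero x.
Proof. apply (is_zero_retract (iso_invl i)). Qed.
End PreAdditive.

Section AdditiveFunctor.
Context {C D : Cat} {aC : PreAdd C} {aD : PreAdd D} (F : Functor C D).
Hypothesis hF : is_additive_functor F.

Lemma fmor_zero (x y : C) : fmor F (zerom x y) == zerom (F x) (F y).
Proof.
  apply (addm_cancel_l (f := fmor F (zerom x y))).
  now rewrite <- hF, addm_zero, addm_zero_r.
Qed.

Lemma fmor_opp (x y : C) (f : hom x y) : fmor F (oppm f) == oppm (fmor F f).
Proof. apply opp_unique; now rewrite <- hF, addm_opp_r, fmor_zero. Qed.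

Lemma fmor_is_zero (x : C) : is_zero x -> is_zero (F x).
Proof.
  rewrite !is_zero_idm; intros E; now rewrite <- fmor_id, E, fmor_zero.
Qed.
End AdditiveFunctor.

(** On a biproduct [s] of two copies of [x], the sum f + g is the diagonal i + j followed by f p + g
    q. A functor respects this factorisation once the images of the two injections are jointly epic,
    a condition that equivalences and left adjoints both meet. *)
Lemma additive_of_coproducts {C D : Cat} {aC : PreAdd C} {aD : PreAdd D}
    (F : Functor C D) :
  is_additive C ->
  (forall x y : C, fmor F (zerom x y) == zerom (F x) (F y)) ->
  (forall (x y s : C) (i : hom x s) (j : hom y s) (p : hom s x) (q : hom s y),
     addm (i \o p) (j \o q) == idm s ->
     forall z (f g : hom (F s) z), f \o fmor F i == g \o fmor F i ->
       f \o fmor F j == g \o fmor F j -> f == g) ->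
  is_additive_functor F.
Proof.
  intros [_ HC] H0 Hepi x y f g.
  destruct (HC x x) as [s [i [j [p [q [Hpi [Hqj [Hpj [Hqi Hs]]]]]]]]].
  assert (Fpi : fmor F p \o fmor F i == idm _)
    by now rewrite <- fmor_comp, Hpi, fmor_id.
  assert (Fqj : fmor F q \o fmor F j == idm _)
    by now rewrite <- fmor_comp, Hqj, fmor_id.
  assert (Fpj : fmor F p \o fmor F j == zerom _ _)
    by now rewrite <- fmor_comp, Hpj, H0.
  assert (Fqi : fmor F q \o fmor F i == zerom _ _)
    by now rewrite <- fmor_comp, Hqi, H0.
  (* The image of the biproduct is again a biproduct: by joint epimorphy the identity is checked on
     the two injections. *)
  assert (FS : addm (fmor F i \o fmor F p) (fmor F j \o fmor F q) == idm _).
  { apply (Hepi _ _ _ i j p q Hs); rewrite comp_addl, !comp_assoc;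
      rewrite ?Fpi, ?Fqi, ?Fpj, ?Fqj, !comp_idr, comp_idl, comp_zeror;
      [apply addm_zero_r | apply addm_zero]. }
  assert (E1 : fmor F (addm i j) == addm (fmor F i) (fmor F j)).
  { rewrite <- (comp_idl (fmor F (addm i j))), <- FS, comp_addl, !comp_assoc.
    rewrite <- !fmor_comp, !comp_addr, Hpi, Hqj, Hpj, Hqi.
    now rewrite !comp_zeror, !comp_idr, ?addm_zero, ?addm_zero_r. }
  assert (E2 : fmor F (addm (f \o p) (g \o q))
    == addm (fmor F f \o fmor F p) (fmor F g \o fmor F q)).
  { apply (Hepi _ _ _ i j p q Hs); rewrite comp_addl, !comp_assoc;
      rewrite ?Fpi, ?Fqi, ?Fpj, ?Fqj, <- fmor_comp, comp_addl, !comp_assoc;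
      rewrite ?Hpi, ?Hqi, ?Hpj, ?Hqj, !comp_zeror, !comp_idr;
      now rewrite ?addm_zero, ?addm_zero_r. }
  assert (E3 : addm f g == addm (f \o p) (g \o q) \o addm i j).
  { rewrite comp_addl, !comp_addr, !comp_assoc, Hpi, Hqj, Hpj, Hqi.
    now rewrite !comp_zeror, !comp_idr, ?addm_zero, ?addm_zero_r. }
  rewrite E3, fmor_comp, E2, E1, comp_addl, !comp_addr, !comp_assoc.
  rewrite Fpi, Fqj, Fpj, Fqi.
  now rewrite !comp_zeror, !comp_idr, ?addm_zero, ?addm_zero_r.
Qed.

Definition faithful {C D : Cat} (F : Functor C D) : Prop :=
  forall (x y : C) (f g : hom x y), fmor F f == fmor F g -> f == g.

Definition full {C D : Cat} (F : Functor C D) : Prop :=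
  forall (x y : C) (f : hom (F x) (F y)), exists g : hom x y, fmor F g == f.

Definition ess_surj {C D : Cat} (F : Functor C D) : Prop :=
  forall y : D, exists x : C, inhabited (Iso (F x) y).

Section FullyFaithful.
Context {C D : Cat} (F : Functor C D) (hf : full F) (hF : faithful F).

Definition preim {x y : C} (f : hom (F x) (F y)) : hom x y :=
  proj1_sig (constructive_indefinite_description _ (hf f)).

Lemma fmor_preim {x y : C} (f : hom (F x) (F y)) : fmor F (preim f) == f.
Proof. exact (proj2_sig (constructive_indefinite_description _ (hf f))). Qed.

Lemma preim_proper (x y : C) : Proper (heq ==> heq) (@preim x y).
Proof. intros f g E; apply hF; now rewrite !fmor_preim. Qed.

Definition preim_iso {x y : C} (i : Iso (F x) (F y)) : Iso x y.
Proof.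
  refine (@MkIso C x y (preim i) (preim (iso_inv i)) _ _);
    apply hF; rewrite fmor_comp, !fmor_preim, fmor_id;
    [apply iso_invl | apply iso_invr].
Defined.

Lemma ff_reflects_iso (x y : C) (f : hom x y) : is_iso (fmor F f) -> is_iso f.
Proof.
  intros H; exists (preim (iso_inv (iso_of H))).
  split; apply hF; rewrite fmor_comp, fmor_preim, fmor_id;
    [apply (iso_invl (iso_of H)) | apply (iso_invr (iso_of H))].
Qed.

Context (he : ess_surj F).

Definition qinv_ob (y : D) : C :=
  proj1_sig (constructive_indefinite_description _ (he y)).

Lemma qinv_inh (y : D) : inhabited (Iso (F (qinv_ob y)) y).
Proof. exact (proj2_sig (constructive_indefinite_description _ (he y))). Qed.

Definition qinv_iso (y : D) : Iso (F (qinv_ob y)) y :=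
  epsilon (qinv_inh y) (fun _ => True).

Definition qinv : Functor D C.
Proof.
  refine (@MkFunctor D C qinv_ob
    (fun x y f => preim (iso_inv (qinv_iso y) \o f \o qinv_iso x)) _ _ _).
  - intros x y f g E; apply preim_proper; now rewrite E.
  - intros x; apply hF; rewrite fmor_preim, fmor_id, comp_idr.
    apply iso_invl.
  - intros x y z g f; apply hF; rewrite fmor_comp, !fmor_preim; la.
    rw (iso_invr (qinv_iso y)); now rewrite comp_idr.
Defined.

Lemma fmor_qinv {x y : D} (f : hom x y) :
  fmor F (fmor qinv f) == iso_inv (qinv_iso y) \o f \o qinv_iso x.
Proof. apply fmor_preim. Qed.

Definition qinv_unit (x : C) : Iso (qinv (F x)) x :=
  preim_iso (qinv_iso (F x)).

Lemma qinv_unit_natural {x y : C} (f : hom x y) :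
  qinv_unit y \o fmor qinv (fmor F f) == f \o qinv_unit x.
Proof.
  apply hF; rewrite !fmor_comp, fmor_qinv; cbn; rewrite !fmor_preim; la.
  rw (iso_invr (qinv_iso (F y))); now rewrite comp_idl.
Qed.

Lemma fmor_qinv_unit (x : C) : fmor F (qinv_unit x) == qinv_iso (F x).
Proof. apply fmor_preim. Qed.

Lemma ff_equivalence : is_equivalence F.
Proof.
  exists qinv; split; constructor.
  - exact (@MkNatIso C C (functor_comp qinv F) (functor_id C) qinv_unit
             (fun x y f => qinv_unit_natural f)).
  - refine (@MkNatIso D D (functor_comp F qinv) (functor_id D) qinv_iso _).
    intros x y f; cbn; rewrite fmor_preim; la.
    rw (iso_invr (qinv_iso y)); now rewrite comp_idl.
Qed.
End FullyFaithful.

Section EquivalenceFF.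
Context {C D : Cat} (F : Functor C D) (H : is_equivalence F).

Lemma equivalence_faithful : faithful F.
Proof.
  destruct H as [G [[a] [b]]]; intros x y f g E.
  apply (iso_epi (i := a x)).
  pose proof (nat_iso_natural a f) as N1.
  pose proof (nat_iso_natural a g) as N2; cbn in N1, N2.
  now rewrite <- N1, <- N2, E.
Qed.

Lemma equivalence_full : full F.
Proof.
  destruct H as [G [[a] [b]]].
  assert (FG : faithful G).
  { intros x y f g E.
    apply (iso_epi (i := b x)).
    pose proof (nat_iso_natural b f) as N1.
    pose proof (nat_iso_natural b g) as N2; cbn in N1, N2.
    now rewrite <- N1, <- N2, E. }
  intros x y f; exists (a y \o fmor G f \o iso_inv (a x)).
  apply FG.
  pose proof (nat_iso_natural a (a y \o fmor G f \o iso_inv (a x))) as N.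
  cbn in N; apply (iso_mono (i := a y)); rewrite N.
  rw (iso_invl (a x)); now rewrite comp_idr.
Qed.

Lemma equivalence_ess_surj : ess_surj F.
Proof.
  destruct H as [G [_ [b]]]; intros y; exists (G y); constructor; exact (b y).
Qed.

(** An equivalence preserves zero objects and biproducts, which determine sums of morphisms. The
    suspension is only assumed to be an equivalence, and this supplies its additivity. *)
Lemma equivalence_additive {aC : PreAdd C} {aD : PreAdd D} :
  is_additive C -> is_additive_functor F.
Proof.
  intros HC; apply additive_of_coproducts; trivial.
  - destruct HC as [[z Hz] _].
    assert (Fz : is_zero (F z)).
    { apply is_zero_idm; destruct (equivalence_full (zerom (F z) (F z))) as [g Hg].
      now rewrite <- Hg, (from_zero g (idm z) Hz), fmor_id. }
    intros x y; assert (E : zerom x y == zerom z y \o zerom x z)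
      by now rewrite comp_zerol.
    rewrite E, fmor_comp, (to_zero (fmor F (zerom x z)) (zerom _ _) Fz).
    apply comp_zeror.
  - intros x y s i j p q Hs z f g Ei Ej.
    destruct (equivalence_ess_surj z) as [z' [e]].
    destruct (equivalence_full (iso_inv e \o f)) as [f' Hf'].
    destruct (equivalence_full (iso_inv e \o g)) as [g' Hg'].
    apply (iso_mono (i := iso_sym e)); cbn; rewrite <- Hf', <- Hg'.
    assert (E : f' == g'); [|now rewrite E].
    rewrite <- (comp_idr f'), <- (comp_idr g'), <- Hs, !comp_addr.
    rewrite <- !comp_assoc.
    assert (E1 : f' \o i == g' \o i)
      by (apply equivalence_faithful; now rewrite !fmor_comp, Hf', Hg', !comp_assoc, Ei).
    assert (E2 : f' \o j == g' \o j)
      by (apply equivalence_faithful; now rewrite !fmor_comp, Hf', Hg', !comp_assoc, Ej).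
    now rewrite E1, E2.
Qed.
End EquivalenceFF.

(** The transpose [tr] has to respect [==], be injective and be natural in its source; joint
    epimorphy of the images uses just that. In this form the lemma applies directly to currying,
    without making a functor of [R]. *)
Lemma left_adjoint_additive {C D : Cat} {aC : PreAdd C} {aD : PreAdd D}
    (F : Functor C D)
    (R : D -> C) (tr : forall x y, hom (F x) y -> hom x (R y)) :
  (forall x y, Proper (heq ==> heq) (tr x y)) ->
  (forall x y (f g : hom (F x) y), tr x y f == tr x y g -> f == g) ->
  (forall x' x y (f : hom (F x) y) (h : hom x' x),
     tr _ _ (f \o fmor F h) == tr _ _ f \o h) ->
  is_additive C -> is_additive_functor F.
Proof.
  intros Hp Hinj Hnat HC; apply additive_of_coproducts; trivial.
  - destruct HC as [[z Hz] _]; intros x y.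
    assert (Fz : is_zero (F z))
      by (apply is_zero_idm, Hinj, from_zero, Hz).
    assert (E : zerom x y == zerom z y \o zerom x z)
      by now rewrite comp_zerol.
    rewrite E, fmor_comp, (to_zero (fmor F (zerom x z)) (zerom _ _) Fz).
    apply comp_zeror.
  - intros x y s i j p q Hs z f g Ei Ej; apply Hinj.
    rewrite <- (comp_idr (tr _ _ f)), <- (comp_idr (tr _ _ g)), <- Hs.
    rewrite !comp_addr, <- !comp_assoc.
    assert (E1 : tr _ _ f \o i == tr _ _ g \o i)
      by (rewrite <- !Hnat; now apply Hp).
    assert (E2 : tr _ _ f \o j == tr _ _ g \o j)
      by (rewrite <- !Hnat; now apply Hp).
    now rewrite E1, E2.
Qed.

(** * n-triangles *)

Lemma in_range_two (o : tri_order) : valid_order o -> in_range o 2.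
Proof. destruct o; cbn; repeat split; auto with arith. Qed.

Section NTriangles.
Context {C : Cat} {aC : PreAdd C} {Sg : Functor C C}.
Implicit Types X Y Z : ndiag Sg.

(** Exactness under [hom t] of the faces with vertices 0, i, j. This part of distinguishedness
    passes to retracts and to images under a right adjoint, where distinguishedness itself is still
    to be proved, and it suffices for the five lemma. *)
Definition hexact (n : nat) X : Prop :=
  forall t i j, i <= j <= n ->
  (forall v : hom t (nob X 0 j), ntr X 0 j i j \o v == zerom _ _ ->
     exists u, v == ntr X 0 i 0 j \o u) /\
  (forall v : hom t (nob X i j), nbd X 0 i j \o v == zerom _ _ ->
     exists u, v == ntr X 0 j i j \o u) /\
  (forall v : hom t (Sg (nob X 0 i)),
     fmor Sg (ntr X 0 i 0 j) \o v == zerom _ _ ->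
     exists u, v == nbd X 0 i j \o u).

Lemma nmorphism_comp n X Y Z w w' :
  is_nmorphism n (X := X) (Y := Y) w -> is_nmorphism n (X := Y) (Y := Z) w' ->
  is_nmorphism n (X := X) (Y := Z) (fun i j => w' i j \o w i j).
Proof.
  intros [H1 H2] [K1 K2]; split.
  - intros i j i' j' ? ? ? ?; la; rewrite K1 by assumption.
    rewrite !comp_assoc, H1 by assumption; reflexivity.
  - intros i j k ? ?; la; rewrite K2 by assumption.
    now rewrite fmor_comp, !comp_assoc, H2 by assumption.
Qed.

Lemma nmorphism_id n X : is_nmorphism n (X := X) (Y := X) (fun i j => idm _).
Proof.
  split; intros; rewrite ?fmor_id; now idc.
Qed.

Lemma nmorphism_inverse n X Y w w' :
  is_nmorphism n (X := X) (Y := Y) w ->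
  (forall i j, i <= j <= n -> w' i j \o w i j == idm _) ->
  (forall i j, i <= j <= n -> w i j \o w' i j == idm _) ->
  is_nmorphism n (X := Y) (Y := X) w'.
Proof.
  intros [H1 H2] Hl Hr; split.
  - intros i j i' j' Hi Hi' ? ?.
    apply (split_mono (Hl _ _ Hi')); la; rewrite <- H1 by assumption.
    rw (Hr _ _ Hi); rw (Hr _ _ Hi'); now idc.
  - intros i j k Hi Hk.
    assert (Hij : i <= j <= n) by lia.
    assert (Hjk : j <= k <= n) by lia.
    assert (E : fmor Sg (w' i j) \o fmor Sg (w i j) == idm _)
      by now rewrite <- fmor_comp, (Hl _ _ Hij), fmor_id.
    assert (E' : fmor Sg (w i j) \o fmor Sg (w' i j) == idm _)
      by now rewrite <- fmor_comp, (Hr _ _ Hij), fmor_id.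
    apply (split_mono E); la; rewrite <- H2 by assumption.
    rw (Hr _ _ Hjk); rw E'; now idc.
Qed.

Lemma nisomorphic_of_iso n X Y w :
  is_nmorphism n (X := X) (Y := Y) w ->
  (forall i j, i <= j <= n -> is_iso (w i j)) -> nisomorphic n X Y.
Proof.
  intros Hw Hi.
  assert (H : forall i j, exists g : hom (nob Y i j) (nob X i j),
    i <= j <= n -> g \o w i j == idm _ /\ w i j \o g == idm _).
  { intros i j; destruct (le_dec i j) as [H1|H1];
      [destruct (le_dec j n) as [H2|H2]|].
    - destruct (Hi i j (conj H1 H2)) as [g Hg]; now exists g.
    (* Outside the range nothing is required of [g]; a zero map fills the place. *)
    - exists (zerom _ _); lia.
    - exists (zerom _ _); lia. }
  pose (w' := fun i j => proj1_sig (constructive_indefinite_description _ (H i j))).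
  assert (Hw' : forall i j, i <= j <= n ->
    w' i j \o w i j == idm _ /\ w i j \o w' i j == idm _)
    by (intros i j; exact (proj2_sig (constructive_indefinite_description _ (H i j)))).
  exists w, w'; repeat split; trivial; try (intros; now apply Hw'); try apply Hw.
  all: apply (nmorphism_inverse Hw); intros; now apply Hw'.
Qed.

Lemma nisomorphic_sym n X Y : nisomorphic n X Y -> nisomorphic n Y X.
Proof. intros [s [r [Hs [Hr [E1 E2]]]]]; now exists r, s. Qed.

Lemma nisomorphic_trans n X Y Z :
  nisomorphic n X Y -> nisomorphic n Y Z -> nisomorphic n X Z.
Proof.
  intros [s [r [Hs [Hr [E1 E2]]]]] [s' [r' [Hs' [Hr' [E1' E2']]]]].
  exists (fun i j => s' i j \o s i j), (fun i j => r i j \o r' i j).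
  split; [exact (nmorphism_comp Hs Hs')|split; [exact (nmorphism_comp Hr' Hr)|]].
  split; intros i j H; la.
  - rw (E1' i j H); rewrite comp_idr; now apply E1.
  - rw (E2 i j H); rewrite comp_idr; now apply E2'.
Qed.

Lemma nretract_trans n X Y Z :
  nretract n X Y -> nretract n Y Z -> nretract n X Z.
Proof.
  intros [s [r [Hs [Hr E1]]]] [s' [r' [Hs' [Hr' E1']]]].
  exists (fun i j => s' i j \o s i j), (fun i j => r i j \o r' i j).
  split; [exact (nmorphism_comp Hs Hs')|split; [exact (nmorphism_comp Hr' Hr)|]].
  intros i j H; la.
  rw (E1' i j H); rewrite comp_idr; now apply E1.
Qed.

Lemma nisomorphic_retract n X Y : nisomorphic n X Y -> nretract n X Y.
Proof. intros [s [r [Hs [Hr [E1 E2]]]]]; now exists s, r. Qed.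

Lemma nisomorphic_ext n (ob' : nat -> nat -> C) tr1 bd1 tr2 bd2 :
  (forall i j i' j', i <= j <= n -> i' <= j' <= n -> i <= i' -> j <= j' ->
     tr1 i j i' j' == tr2 i j i' j') ->
  (forall i j k, i <= j <= k -> k <= n -> bd1 i j k == bd2 i j k) ->
  nisomorphic n (@MkNdiag C Sg ob' tr1 bd1) (@MkNdiag C Sg ob' tr2 bd2).
Proof.
  intros H1 H2.
  apply (@nisomorphic_of_iso n (@MkNdiag C Sg ob' tr1 bd1)
           (@MkNdiag C Sg ob' tr2 bd2) (fun i j => idm _)).
  - split; cbn; intros; rewrite ?fmor_id; idc; symmetry; auto.
  - intros i j _; exists (idm _); split; apply comp_idl.
Qed.

Lemma ntriangle_iso n X Y :
  is_ntriangle n X -> nisomorphic n X Y -> is_ntriangle n Y.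
Proof.
  intros [X1 [X2 [X3 X4]]] [s [r [[S1 S2] [[R1 R2] [E1 E2]]]]].
  split; [|split; [|split]].
  - intros i Hi; apply (is_zero_retract (E2 i i (conj (le_n i) Hi))); now apply X1.
  - intros i j H; apply (split_epi (E2 i j H)).
    rewrite S1, X2 by (auto; lia); now idc.
  - intros i j i' j' i'' j'' H H' H'' A1 A2.
    apply (split_epi (E2 i j H)); rewrite !comp_assoc.
    rewrite (S1 i j i' j'), (S1 i j i'' j'') by lia; la.
    rewrite (S1 i' j' i'' j'') by lia; now rw (X3 i j i' j' i'' j'' H H' H'' A1 A2).
  - intros i j k i' j' k' ? ? ? ? ? ? ?.
    assert (Hjk : j <= k <= n) by lia; apply (split_epi (E2 j k Hjk)).
    rewrite !comp_assoc; rewrite (S1 j k j' k') by lia.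
    rewrite (S2 i j k) by lia; la; rewrite (S2 i' j' k') by lia.
    rewrite <- fmor_comp, (S1 i j i' j'), fmor_comp by lia.
    rewrite !comp_assoc, (X4 i j k) by lia; reflexivity.
Qed.

Section Exactness.
Context (hSg : is_additive_functor Sg).

Lemma ntriangle_zero1 n X i j : is_ntriangle n X -> i <= j <= n ->
  ntr X 0 j i j \o ntr X 0 i 0 j == zerom _ _.
Proof.
  intros [H1 [H2 [H3 H4]]] H.
  rewrite H3 by lia; rewrite <- (H3 0 i i i i j) by lia.
  rewrite (to_zero (ntr X 0 i i i) (zerom _ _)) by (apply H1; lia).
  apply comp_zeror.
Qed.

Lemma ntriangle_zero2 n X i j : is_ntriangle n X -> i <= j <= n ->
  nbd X 0 i j \o ntr X 0 j i j == zerom _ _.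
Proof.
  intros [H1 [H2 [H3 H4]]] H.
  rewrite (H4 0 0 j 0 i j) by lia.
  rewrite (to_zero (nbd X 0 0 j) (zerom _ _)); [apply comp_zeror|].
  apply fmor_is_zero; trivial; apply H1; lia.
Qed.

Lemma ntriangle_zero3 n X i j : is_ntriangle n X -> i <= j <= n ->
  fmor Sg (ntr X 0 i 0 j) \o nbd X 0 i j == zerom _ _.
Proof.
  intros [H1 [H2 [H3 H4]]] H.
  rewrite <- (H4 0 i j 0 j j) by lia.
  rewrite (from_zero (nbd X 0 j j) (zerom _ _)); [apply comp_zerol|].
  apply H1; lia.
Qed.

Lemma hexact_retract n X Y :
  nretract n Y X -> hexact n X -> hexact n Y.
Proof.
  intros [s [r [[S1 S2] [[R1 R2] E]]]] HX t i j Hij.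
  destruct (HX t i j Hij) as [Ha [Hb Hc]].
  assert (Hi : 0 <= i <= n) by lia; assert (Hj : 0 <= j <= n) by lia.
  assert (EE : forall k l, k <= l <= n -> fmor Sg (r k l) \o fmor Sg (s k l) == idm _)
    by (intros k l Hkl; now rewrite <- fmor_comp, E, fmor_id).
  split; [|split]; intros v Hv.
  - destruct (Ha (s 0 j \o v)) as [u Hu].
    { la; rewrite S1 by lia; now rewrite comp_assoc, Hv, comp_zeror. }
    exists (r 0 i \o u); la; rewrite R1 by lia.
    rewrite comp_assoc, <- Hu; la; now rewrite (E _ _ Hj), comp_idl.
  - destruct (Hb (s i j \o v)) as [u Hu].
    { la; rewrite S2 by lia; now rewrite comp_assoc, Hv, comp_zeror. }
    exists (r 0 j \o u); la; rewrite R1 by lia.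
    rewrite comp_assoc, <- Hu; la; now rewrite (E _ _ Hij), comp_idl.
  - destruct (Hc (fmor Sg (s 0 i) \o v)) as [u Hu].
    { la; rewrite <- fmor_comp, S1, fmor_comp by lia.
      now rewrite comp_assoc, Hv, comp_zeror. }
    exists (r i j \o u); la; rewrite R2 by lia.
    rewrite comp_assoc, <- Hu; la; now rewrite (EE _ _ Hi), comp_idl.
Qed.

(** The usual diagram chase on elements [hom t _]: the face with vertices 0, i, j is compared at
    X(0,i), X(0,j) and Sigma X(0,i), where the maps are invertible by hypothesis. *)
Lemma five_lemma n X Y w :
  is_ntriangle n X -> is_ntriangle n Y -> hexact n X -> hexact n Y ->
  is_nmorphism n (X := X) (Y := Y) w ->
  (forall i, 1 <= i <= n -> is_iso (w 0 i)) ->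
  forall i j, i <= j <= n -> is_iso (w i j).
Proof.
  intros TX TY HX HY [W1 W2] Hb i j Hij.
  (* X(0,0) is not part of the base, but it is zero on both sides. *)
  assert (Hb0 : forall i, i <= n -> is_iso (w 0 i)).
  { intros [|k] Hk; [|apply Hb; lia].
    exists (zerom _ _); split; apply from_zero; [apply TX | apply TY]; lia. }
  destruct (Hb0 i ltac:(lia)) as [gi [Gi1 Gi2]].
  destruct (Hb0 j ltac:(lia)) as [gj [Gj1 Gj2]].
  assert (SG1 : fmor Sg gi \o fmor Sg (w 0 i) == idm _)
    by now rewrite <- fmor_comp, Gi1, fmor_id.
  assert (SG2 : fmor Sg (w 0 i) \o fmor Sg gi == idm _)
    by now rewrite <- fmor_comp, Gi2, fmor_id.
  assert (Hgij : gj \o ntr Y 0 i 0 j == ntr X 0 i 0 j \o gi).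
  { apply (split_mono Gj1); la; rewrite Gj2, comp_idl, <- W1 by lia.
    now rw Gi2; rewrite comp_idr. }
  apply yoneda_iso.
  - intros t v.
    destruct (HX t i j Hij) as [_ [_ Xc]].
    destruct (Xc (fmor Sg gi \o (nbd Y 0 i j \o v))) as [a Ha].
    { la; rewrite <- fmor_comp, <- Hgij, fmor_comp.
      rw (ntriangle_zero3 TY Hij); now rewrite comp_zeror, comp_zerol. }
    destruct (HY t i j Hij) as [_ [Yb _]].
    (* After subtracting the image of [a], the rest is killed by the connecting map, so it comes
       from Y(0,j), where [w] is invertible. *)
    destruct (Yb (subm v (w i j \o a))) as [c Hc].
    { rewrite comp_subr; apply subm_eq; la; rewrite W2 by lia.
      rewrite comp_assoc, <- Ha; la; now rewrite SG2, comp_idl. }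
    exists (addm (ntr X 0 j i j \o (gj \o c)) a).
    rewrite comp_addr; la; rewrite <- W1 by lia; rw Gj2; rewrite comp_idr, <- Hc.
    apply subm_add.
  - intros t u u' E; apply subm_eq.
    assert (E0 : w i j \o subm u u' == zerom _ _)
      by (rewrite comp_subr; now apply subm_eq).
    generalize dependent (subm u u'); intros d Hd.
    destruct (HX t i j Hij) as [_ [Xb _]].
    destruct (Xb d) as [c Hc].
    { apply (split_mono SG1); la; rewrite <- W2 by lia.
      now rewrite comp_assoc, Hd, !comp_zeror. }
    destruct (HY t i j Hij) as [Ya _].
    destruct (Ya (w 0 j \o c)) as [e He].
    { la; rewrite W1 by lia; now rewrite comp_assoc, <- Hc. }
    rewrite Hc, <- (comp_idl c), <- Gj1, comp_assoc, He; la.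
    rw Hgij; rw (ntriangle_zero1 TX Hij); now rewrite !comp_zerol.
Qed.
End Exactness.
End NTriangles.

(** * Exactness, uniqueness and retracts of distinguished n-triangles *)

Section Triangulated.
Context {o : tri_order} {C : Cat} {tC : Tri o C} (ho : valid_order o).
Notation Sg := (susp (Tri := tC)).

Lemma susp_additive : is_additive_functor Sg.
Proof. apply (equivalence_additive susp_equivalence), tri_additive. Qed.

Lemma susp_faithful : faithful Sg.
Proof. exact (equivalence_faithful susp_equivalence). Qed.

Lemma susp_full : full Sg.
Proof. exact (equivalence_full susp_equivalence). Qed.

Lemma susp_ess_surj : ess_surj Sg.
Proof. exact (equivalence_ess_surj susp_equivalence). Qed.

Let r2 : in_range o 2 := in_range_two ho.

(** Chains are indexed by all of [nat], a base by 1, ..., n. Entry 0 and the entries beyond 2 are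
    fillers. *)
Definition chain2_ob (x y : C) (i : nat) : C :=
  match i with S (S _) => y | _ => x end.

Definition chain2_mor {x y : C} (f : hom x y) (i : nat) :
    hom (chain2_ob x y i) (chain2_ob x y (S i)) :=
  match i with 0 => idm x | 1 => f | S (S _) => idm y end.

Lemma extend2 {x y : C} (f : hom x y) :
  exists (X : ndiag Sg) (u : Iso x (nob X 0 1)) (v : Iso y (nob X 0 2)),
    dist 2 X /\ ntr X 0 1 0 2 \o u == v \o f.
Proof.
  destruct (tri_extend_base (chain2_mor f) r2) as [X [HX [v [Hv Hn]]]].
  exists X, (iso_of (Hv 1 ltac:(lia))), (iso_of (Hv 2 ltac:(lia))).
  split; [exact HX | exact (Hn 1 ltac:(lia))].
Qed.

Definition base2 {X Y : ndiag Sg} (u : hom (nob X 0 1) (nob Y 0 1))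
    (v : hom (nob X 0 2) (nob Y 0 2)) (i : nat) : hom (nob X 0 i) (nob Y 0 i) :=
  match i with 1 => u | 2 => v | _ => zerom _ _ end.

Lemma extend2_morphism {X Y : ndiag Sg} (u : hom (nob X 0 1) (nob Y 0 1))
    (v : hom (nob X 0 2) (nob Y 0 2)) :
  dist 2 X -> dist 2 Y -> ntr Y 0 1 0 2 \o u == v \o ntr X 0 1 0 2 ->
  exists w : hom (nob X 1 2) (nob Y 1 2),
    ntr Y 0 2 1 2 \o v == w \o ntr X 0 2 1 2 /\
    nbd Y 0 1 2 \o w == fmor Sg u \o nbd X 0 1 2.
Proof.
  intros HX HY E.
  destruct (tri_extend_morphism (u := base2 u v) r2 HX HY) as [w [[W1 W2] Hw]].
  - intros i Hi; assert (i = 1) by lia; now subst.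
  - exists (w 1 2).
    pose proof (Hw 1 ltac:(lia)) as E1; pose proof (Hw 2 ltac:(lia)) as E2.
    cbn in E1, E2; rewrite <- E1, <- E2.
    split; [apply W1; lia | apply W2; lia].
Qed.

Lemma dist_nt {n} {X : ndiag Sg} : in_range o n -> dist n X -> is_ntriangle n X.
Proof. apply dist_ntriangle. Qed.

Lemma ntr_id {n} {X : ndiag Sg} i j : is_ntriangle n X -> i <= j <= n ->
  ntr X i j i j == idm _.
Proof. intros [_ [H _]]; apply H. Qed.

(** The degenerate triangle t = t -> 0, a reindexing of a triangle on the identity, is compared with
    X. Both are rotated once, so that the known components are [v] and 0; the third one,
    desuspended, is the lift. The signs of the two rotated connecting maps cancel. *)
Lemma dist2_exact1 {X : ndiag Sg} (t : C) (v : hom t (nob X 0 2)) :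
  dist 2 X -> ntr X 0 2 1 2 \o v == zerom _ _ ->
  exists u, v == ntr X 0 1 0 2 \o u.
Proof.
  intros HX Hv.
  destruct (extend2 (idm t)) as [Y0 [a [b [HY0 HE]]]].
  set (phi := fun i => match i with 0 => 0 | _ => 1 end).
  assert (Hphi : monotone_upto 2 2 phi)
    by (intros [|[|i]] [|[|j]] H; cbn; lia).
  pose proof (dist_reindex r2 r2 HY0 Hphi) as HY.
  set (Y := nreindex phi Y0) in *.
  pose proof (dist_rotate r2 HY) as HrY; pose proof (dist_rotate r2 HX) as HrX.
  destruct (@extend2_morphism (nrotate 2 Y) (nrotate 2 X) (v \o iso_inv a)
              (zerom _ _) HrY HrX) as [w [_ W2]].
  { cbn; la; now rewrite Hv, !comp_zerol. }
  cbn in w, W2.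
  destruct (susp_full w) as [w' Hw'].
  exists (w' \o a); la.
  apply (iso_epi (i := iso_sym a)); cbn [iso_fwd iso_sym].
  rw (iso_invr a); rewrite comp_idr; apply susp_faithful, oppm_inj.
  rewrite (fmor_comp _ (ntr X 0 1 0 2)), Hw', <- comp_oppl, W2.
  assert (E : fmor Sg (ntr Y0 0 1 0 1) == idm _)
    by (rewrite (ntr_id (dist_nt r2 HY0)) by lia; apply fmor_id).
  cbn; rewrite E, comp_oppr; now idc.
Qed.

Lemma rot_bd_id {X : ndiag Sg} : dist 2 X ->
  nbd X 0 1 2 \o ntr X 1 2 1 2 == nbd X 0 1 2.
Proof.
  intros HX; rewrite (ntr_id (dist_nt r2 HX)) by lia; apply comp_idr.
Qed.

Lemma dist2_exact2 {X : ndiag Sg} (t : C) (v : hom t (nob X 1 2)) :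
  dist 2 X -> nbd X 0 1 2 \o v == zerom _ _ ->
  exists u, v == ntr X 0 2 1 2 \o u.
Proof.
  intros HX Hv.
  apply (@dist2_exact1 (nrotate 2 X) t v (dist_rotate r2 HX)).
  cbn; now rewrite (rot_bd_id HX).
Qed.

Lemma dist2_exact3 {X : ndiag Sg} (t : C) (v : hom t (Sg (nob X 0 1))) :
  dist 2 X -> fmor Sg (ntr X 0 1 0 2) \o v == zerom _ _ ->
  exists u, v == nbd X 0 1 2 \o u.
Proof.
  intros HX Hv; pose proof (dist_rotate r2 HX) as HR.
  destruct (@dist2_exact2 (nrotate 2 X) t v HR) as [u Hu].
  - cbn; rewrite comp_oppl, Hv; apply oppm_zero.
  - exists u; rewrite Hu; cbn; now rewrite (rot_bd_id HX).
Qed.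

(** Dual to the lifting property: the degenerate triangle 0 -> t = t is the target, and no rotation
    is involved. *)
Lemma dist2_coexact1 {X : ndiag Sg} (t : C) (v : hom (nob X 0 2) t) :
  dist 2 X -> v \o ntr X 0 1 0 2 == zerom _ _ ->
  exists u, v == u \o ntr X 0 2 1 2.
Proof.
  intros HX Hv.
  destruct (extend2 (idm t)) as [Y0 [a [b [HY0 HE]]]].
  set (phi := fun i => match i with 0 | 1 => 0 | _ => 1 end).
  assert (Hphi : monotone_upto 2 2 phi)
    by (intros [|[|i]] [|[|j]] H; cbn; lia).
  pose proof (dist_reindex r2 r2 HY0 Hphi) as HY.
  set (Y := nreindex phi Y0) in *.
  destruct (@extend2_morphism X Y (zerom _ _) (a \o v) HX HY) as [w [W1 _]].
  { cbn; rewrite (comp_assoc a v), Hv; now rewrite !comp_zeror. }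
  cbn in w, W1.
  rewrite (ntr_id (dist_nt r2 HY0)) in W1 by lia; rewrite comp_idl in W1.
  exists (iso_inv a \o w); rewrite comp_assoc, <- W1; la.
  rw (iso_invl a); now idc.
Qed.

(** Each condition lives on the 2-triangle with vertices 0, i, j, which is a reindexing of X even
    when i = 0 or i = j. *)
Lemma dist_hexact n (X : ndiag Sg) : in_range o n -> dist n X -> hexact n X.
Proof.
  intros Hn HX t i j Hij.
  set (phi := fun k => match k with 0 => 0 | 1 => i | _ => j end).
  assert (Hphi : monotone_upto 2 n phi)
    by (intros [|[|k]] [|[|l]] H; cbn; lia).
  pose proof (dist_reindex r2 Hn HX Hphi) as HY.
  split; [|split].
  - exact (fun v => @dist2_exact1 (nreindex phi X) t v HY).
  - exact (fun v => @dist2_exact2 (nreindex phi X) t v HY).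
  - exact (fun v => @dist2_exact3 (nreindex phi X) t v HY).
Qed.

Lemma extend2_isom {X Y : ndiag Sg} (u : hom (nob X 0 1) (nob Y 0 1))
    (v : hom (nob X 0 2) (nob Y 0 2)) :
  dist 2 X -> dist 2 Y -> ntr Y 0 1 0 2 \o u == v \o ntr X 0 1 0 2 ->
  exists w : hom (nob X 1 2) (nob Y 1 2),
    ntr Y 0 2 1 2 \o v == w \o ntr X 0 2 1 2 /\
    nbd Y 0 1 2 \o w == fmor Sg u \o nbd X 0 1 2 /\
    (is_iso u -> is_iso v -> is_iso w).
Proof.
  intros HX HY E.
  destruct (tri_extend_morphism (u := base2 u v) r2 HX HY) as [w [[W1 W2] Hw]].
  - intros i Hi; assert (i = 1) by lia; now subst.
  - exists (w 1 2).
    pose proof (Hw 1 ltac:(lia)) as E1; pose proof (Hw 2 ltac:(lia)) as E2.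
    cbn in E1, E2; rewrite <- E1, <- E2.
    split; [apply W1; lia | split; [apply W2; lia|]].
    intros Iu Iv; refine (five_lemma (dist_nt r2 HX) (dist_nt r2 HY)
      (dist_hexact r2 HX) (dist_hexact r2 HY) (conj W1 W2) _ _); [|lia].
    intros i Hi; assert (Hi' : i = 1 \/ i = 2) by lia.
    now destruct Hi'; subst.
Qed.

(** The way new distinguished triangles are recognised: an exact candidate receives a map from a
    distinguished triangle on its base, and the five lemma makes that map an isomorphism. *)
Lemma dist_criterion n (Z Y : ndiag Sg) w : in_range o n ->
  dist n Z -> is_ntriangle n Y -> hexact n Y ->
  is_nmorphism n (X := Z) (Y := Y) w ->
  (forall i, 1 <= i <= n -> is_iso (w 0 i)) ->
  nisomorphic n Z Y /\ dist n Y.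
Proof.
  intros Hn HZ TY EY Hw Hb.
  assert (I : nisomorphic n Z Y).
  { apply (nisomorphic_of_iso Hw).
    apply (five_lemma (dist_nt Hn HZ) TY
             (dist_hexact Hn HZ) EY Hw Hb). }
  split; [exact I | exact (dist_iso Hn HZ TY I)].
Qed.

Lemma nextends_inv n (X : ndiag Sg) (b : nat -> C) f :
  nextends n X (b := b) f ->
  exists (v : forall i, hom (b i) (nob X 0 i)) (v' : forall i, hom (nob X 0 i) (b i)),
    (forall i, 1 <= i <= n -> v' i \o v i == idm _ /\ v i \o v' i == idm _) /\
    (forall i, 1 <= i < n -> ntr X 0 i 0 (S i) \o v i == v (S i) \o f i) /\
    (forall i, 1 <= i < n -> f i \o v' i == v' (S i) \o ntr X 0 i 0 (S i)).
Proof.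
  intros [v [Hv Hn]].
  assert (H : forall i, exists g : hom (nob X 0 i) (b i),
    1 <= i <= n -> g \o v i == idm _ /\ v i \o g == idm _).
  { intros i; destruct (le_dec 1 i) as [H1|H1];
      [destruct (le_dec i n) as [H2|H2]|].
    - destruct (Hv i (conj H1 H2)) as [g Hg]; now exists g.
    - exists (zerom _ _); lia.
    - exists (zerom _ _); lia. }
  pose (v' := fun i => proj1_sig (constructive_indefinite_description _ (H i))).
  assert (Hv' : forall i, 1 <= i <= n ->
    v' i \o v i == idm _ /\ v i \o v' i == idm _)
    by (intros i; exact (proj2_sig (constructive_indefinite_description _ (H i)))).
  exists v, v'; split; [exact Hv'|split; [exact Hn|]].
  intros i Hi.
  apply (split_mono (proj1 (Hv' (S i) ltac:(lia)))); la.
  rewrite <- Hn by lia; rewrite (proj2 (Hv' (S i) ltac:(lia))), comp_idl.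
  rw (proj2 (Hv' i ltac:(lia))); now idc.
Qed.

(** A distinguished [Z] on the base of [Y] maps to [D] by the extension axiom, then to [Y] by the
    retraction. The composite is invertible on the base since r s = 1 there, and [Y] inherits
    exactness from [D]. *)
Lemma dist_retract n (Y D : ndiag Sg) : in_range o n ->
  is_ntriangle n Y -> dist n D -> nretract n Y D -> dist n Y.
Proof.
  intros Hn TY HD HR.
  pose proof (hexact_retract HR (dist_hexact Hn HD)) as EY.
  destruct HR as [s [r [Hs [Hr E]]]].
  destruct (tri_extend_base (fun i => ntr Y 0 i 0 (S i)) Hn) as [Z [HZ Hext]].
  destruct (nextends_inv Hext) as [v [v' [Hv [N1 N2]]]].
  destruct (tri_extend_morphism (X := Z) (Y := D)
              (u := fun i => s 0 i \o v' i) Hn HZ HD) as [w [Hw Hb]].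
  { intros i Hi; la; rewrite (proj1 Hs) by lia; rewrite !comp_assoc.
    now rewrite N2 by lia. }
  apply (@dist_criterion n Z Y (fun i j => r i j \o w i j) Hn HZ TY EY).
  - exact (nmorphism_comp Hw Hr).
  - intros i Hi; apply (is_iso_proper (f := v' i)).
    + rewrite Hb by lia; la; rewrite E by lia; now idc.
    + exists (v i); destruct (Hv i Hi); now split.
Qed.

Lemma dist_unique n (X Y : ndiag Sg) u : in_range o n ->
  dist n X -> dist n Y ->
  (forall i, 1 <= i < n ->
     ntr Y 0 i 0 (S i) \o u i == u (S i) \o ntr X 0 i 0 (S i)) ->
  (forall i, 1 <= i <= n -> is_iso (u i)) ->
  nisomorphic n X Y.
Proof.
  intros Hn HX HY Hu Hi.
  destruct (tri_extend_morphism Hn HX HY Hu) as [w [Hw Hb]].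
  apply (@dist_criterion n X Y w Hn HX (dist_nt Hn HY) (dist_hexact Hn HY) Hw).
  intros i H; apply (is_iso_proper (f := u i)); [symmetry|]; auto.
Qed.

(** Rotation backwards. The connecting map of a triangle on [g] is desuspended to a map [f], and a
    triangle is built on [f]. After two rotations of the first and three of the second the bases
    agree; the resulting isomorphism of third vertices is desuspended. *)
Lemma fiber {a k : C} (g : hom a k) :
  exists (Z : ndiag Sg) (v : Iso a (nob Z 0 2)) (m : Iso k (nob Z 1 2)),
    dist 2 Z /\ ntr Z 0 2 1 2 \o v == m \o g.
Proof.
  destruct (extend2 g) as [Y [u [v [HY Hg]]]].
  destruct (susp_ess_surj (nob Y 1 2)) as [z [e]].
  destruct (susp_full (iso_inv (fiso Sg u) \o nbd Y 0 1 2 \o e)) as [f Hf].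
  destruct (extend2 f) as [Z [p [q [HZ HF]]]].
  pose proof (dist_rotate r2 HY) as HY1; pose proof (dist_rotate r2 HY1) as HY2.
  pose proof (dist_rotate r2 HZ) as HZ1; pose proof (dist_rotate r2 HZ1) as HZ2.
  pose proof (dist_rotate r2 HZ2) as HZ3.
  pose (i1 := iso_comp (fiso Sg p) (iso_sym e) : Iso (nob Y 1 2) (Sg (nob Z 0 1))).
  pose (i2 := iso_comp (fiso Sg q) (iso_sym (fiso Sg u))
         : Iso (Sg (nob Y 0 1)) (Sg (nob Z 0 2))).
  (* The base map of the threefold rotation is minus a suspension; the sign is absorbed by replacing
     [i2] with its negative. *)
  assert (E : oppm (fmor Sg (ntr Z 0 1 0 2)) \o i1 == oppm i2 \o nbd Y 0 1 2).
  { rewrite !comp_oppl; apply oppm_proper; cbn; la.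
    rewrite <- (fmor_comp Sg (ntr Z 0 1 0 2)), HF, fmor_comp, Hf; la.
    rw (iso_invr e); cbn; now idc. }
  destruct (@extend2_isom (nrotate 2 (nrotate 2 Y))
    (nrotate 2 (nrotate 2 (nrotate 2 Z))) i1 (oppm i2) HY2 HZ3) as [w [W1 [_ W3]]].
  { cbn; rewrite (rot_bd_id HY).
    rewrite (ntr_id (dist_nt r2 HZ)), fmor_id, comp_idr by lia. exact E. }
  cbn in w, W1.
  assert (Iw : is_iso w).
  { apply W3; [apply is_iso_iso|].
    exists (oppm (iso_inv i2)); rewrite !comp_oppl, !comp_oppr, !oppm_opp.
    split; [apply iso_invl | apply iso_invr]. }
  assert (Im : is_iso (oppm w \o fmor Sg v)).
  { apply is_iso_comp; [|apply is_iso_fmor, is_iso_iso].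
    destruct Iw as [w' [H1 H2]]; exists (oppm w').
    now rewrite !comp_oppl, !comp_oppr, !oppm_opp. }
  exists Z, q, (preim_iso susp_full susp_faithful (iso_of Im)).
  split; [exact HZ|]; apply susp_faithful.
  rewrite !fmor_comp; cbn; rewrite fmor_preim.
  rewrite (ntr_id (dist_nt r2 HY)), (ntr_id (dist_nt r2 HZ)) in W1 by lia.
  rewrite !fmor_id, !comp_idr, comp_oppl, !comp_oppr, oppm_opp in W1.
  rewrite <- comp_assoc in W1.
  rewrite (comp_assoc (oppm w)), <- (fmor_comp Sg v g), <- Hg, fmor_comp; la.
  rewrite comp_oppl, <- W1; la.
  rewrite (comp_assoc _ _ (fmor Sg u)), <- (fmor_comp Sg (iso_inv u)).
  rewrite iso_invl, fmor_id; now idc.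
Qed.
End Triangulated.

(** * Triangulated functors *)

Section Image.
Context {C D : Cat} {aC : PreAdd C} {aD : PreAdd D}
  {Sg : Functor C C} {Sg' : Functor D D} (F : Functor C D)
  (th : forall x : C, hom (F (Sg x)) (Sg' (F x)))
  (th_nat : forall (x y : C) (f : hom x y),
     th y \o fmor F (fmor Sg f) == fmor Sg' (fmor F f) \o th x).
Implicit Types X Y : ndiag Sg.

Lemma nimage_nmorphism n X Y w :
  is_nmorphism n (X := X) (Y := Y) w ->
  is_nmorphism n (X := nimage th X) (Y := nimage th Y) (fun i j => fmor F (w i j)).
Proof.
  intros [H1 H2]; split; cbn; intros.
  - now rewrite <- !fmor_comp, H1 by assumption.
  - rewrite comp_assoc, <- fmor_comp, H2, fmor_comp by assumption; la.
    now rewrite th_nat.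
Qed.

Lemma nimage_retract n X Y : nretract n X Y -> nretract n (nimage th X) (nimage th Y).
Proof.
  intros [s [r [Hs [Hr E]]]].
  exists (fun i j => fmor F (s i j)), (fun i j => fmor F (r i j)).
  split; [|split]; try now apply nimage_nmorphism.
  intros; cbn; now rewrite <- fmor_comp, E, fmor_id.
Qed.

Lemma nimage_isomorphic n X Y :
  nisomorphic n X Y -> nisomorphic n (nimage th X) (nimage th Y).
Proof.
  intros [s [r [Hs [Hr [E E']]]]].
  exists (fun i j => fmor F (s i j)), (fun i j => fmor F (r i j)).
  split; [|split; [|split]]; try now apply nimage_nmorphism.
  all: intros; cbn; now rewrite <- fmor_comp, ?E, ?E', fmor_id.
Qed.

Lemma nimage_ntriangle n X : (forall x, is_zero x -> is_zero (F x)) ->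
  is_ntriangle n X -> is_ntriangle n (nimage th X).
Proof.
  intros hF [H1 [H2 [H3 H4]]]; split; [|split; [|split]]; cbn; intros.
  - now apply hF, H1.
  - now rewrite H2, fmor_id.
  - now rewrite <- fmor_comp, H3.
  - rewrite comp_assoc, <- fmor_comp, (H4 i j k), fmor_comp by assumption; la.
    now rewrite th_nat.
Qed.

Lemma ntriangle_reflect n X : faithful F -> is_additive_functor F ->
  (forall x, is_iso (th x)) ->
  is_ntriangle n (nimage th X) -> is_ntriangle n X.
Proof.
  intros hF aF hth [H1 [H2 [H3 H4]]]; split; [|split; [|split]]; cbn in *;
    [intros i Hi|intros i j Hi| |intros i j k i' j' k' B1 B2 B3 B4 B5 B6 B7]; intros.
  - apply is_zero_idm, hF; rewrite fmor_id, (fmor_zero aF).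
    now apply is_zero_idm, H1.
  - apply hF; now rewrite H2, fmor_id.
  - apply hF; now rewrite fmor_comp, H3.
  - apply hF; rewrite !fmor_comp; apply (iso_mono (i := iso_of (hth _))); cbn.
    la; rewrite (H4 i j k), th_nat by assumption; now la.
Qed.

Lemma nmorphism_reflect n X Y w : faithful F -> (forall x, is_iso (th x)) ->
  is_nmorphism n (X := nimage th X) (Y := nimage th Y) (fun i j => fmor F (w i j)) ->
  is_nmorphism n (X := X) (Y := Y) w.
Proof.
  intros hF hth [H1 H2]; split; cbn in *; intros.
  - apply hF; now rewrite !fmor_comp, H1.
  - apply hF; rewrite !fmor_comp; apply (iso_mono (i := iso_of (hth _))); cbn.
    la; rewrite H2, th_nat by assumption; now la.
Qed.

(** Rotation introduces suspensions, with which [F] commutes only up to [th]: the isomorphism is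
    [th] at the suspended vertices and the identity at the others. *)
Lemma nimage_rotate n X : is_additive_functor F ->
  (forall x, is_iso (th x)) -> 0 < n ->
  nisomorphic n (nimage th (nrotate n X)) (nrotate n (nimage th X)).
Proof.
  intros aF hth Hn.
  pose (w := fun i j => match i, j
    return hom (F (rot_ob n X i j)) (rot_ob n (nimage th X) i j) with
    | S i, j => th _
    | 0, S j => idm _
    | 0, 0 => idm _ end).
  apply (@nisomorphic_of_iso D aD Sg' n (nimage th (nrotate n X))
           (nrotate n (nimage th X)) w).
  - split.
    + intros [|i] [|j] [|i'] [|j'] H H' ? ?; cbn; try lia; idc;
        rewrite ?fmor_comp, ?(fmor_zero aF), ?comp_zeror; la; try reflexivity.
      now rewrite th_nat.
    + intros [|i] [|j] [|k] H H'; cbn; try lia; idc;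
        rewrite ?fmor_id, ?(fmor_zero aF), ?comp_zeror, ?comp_zerol; idc;
        try reflexivity.
      * now rewrite (fmor_opp aF), comp_oppr, th_nat, <- comp_oppl.
      * rewrite (fmor_opp aF), !comp_oppr, comp_oppl; apply oppm_proper.
        rewrite (th_nat (nbd X i j k)), fmor_comp; now la.
  - intros [|i] [|j] H; cbn; try apply hth; exists (idm _); split; apply comp_idl.
Qed.
End Image.

Lemma nimage_ext {C D : Cat} {aD : PreAdd D} {Sg : Functor C C} {Sg' : Functor D D}
    (F F' : Functor C D)
    (th : forall x : C, hom (F (Sg x)) (Sg' (F x)))
    (th' : forall x : C, hom (F' (Sg x)) (Sg' (F' x)))
    (a : NatIso F F') :
  (forall x, th' x \o a (Sg x) == fmor Sg' (a x) \o th x) ->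
  forall n (X : ndiag Sg), nisomorphic n (nimage th X) (nimage th' X).
Proof.
  intros E n X.
  apply (@nisomorphic_of_iso D aD Sg' n (nimage th X) (nimage th' X)
           (fun i j => a (nob X i j))).
  - split; cbn; intros.
    + symmetry; apply nat_iso_natural.
    + rewrite comp_assoc, <- nat_iso_natural; la; now rewrite E.
  - intros; apply is_iso_iso.
Qed.

Lemma nimage_nimage {B C D : Cat} {aD : PreAdd D} {Sg0 : Functor B B}
    {Sg : Functor C C} {Sg' : Functor D D} (F : Functor B C) (G : Functor C D)
    (th : forall x : B, hom (F (Sg0 x)) (Sg (F x)))
    (th' : forall x : C, hom (G (Sg x)) (Sg' (G x)))
    (th'' : forall x : B, hom (G (F (Sg0 x))) (Sg' (G (F x)))) :
  (forall x, th'' x == th' (F x) \o fmor G (th x)) ->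
  forall n (X : ndiag Sg0),
  nisomorphic n (nimage (F := functor_comp G F) th'' X) (nimage th' (nimage th X)).
Proof.
  intros E n X; unfold nimage; cbn; apply nisomorphic_ext; intros; try reflexivity.
  now rewrite E, fmor_comp; la.
Qed.

Section TriFunctors.
Context {o : tri_order} (ho : valid_order o).

Section Compose.
Context {B C D : Cat} {tB : Tri o B} {tC : Tri o C} {tD : Tri o D}
  {F : Functor B C} {G : Functor C D} (tG : TriFunctor G) (tF : TriFunctor F).

Definition susp_comp_nat :
  NatIso (functor_comp (functor_comp G F) susp) (functor_comp susp (functor_comp G F)).
Proof.
  refine (@MkNatIso B D (functor_comp (functor_comp G F) susp)
            (functor_comp susp (functor_comp G F))
            (fun x => iso_comp (trif_susp tG (F x)) (fiso G (trif_susp tF x))) _).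
  intros x y f; cbn; la.
  rewrite comp_assoc, <- fmor_comp.
  pose proof (nat_iso_natural (trif_susp tF) f) as E; cbn in E; rewrite E.
  rewrite fmor_comp; la.
  pose proof (nat_iso_natural (trif_susp tG) (fmor F f)) as E'; cbn in E'.
  now rewrite E'.
Defined.

Lemma trif_is_natural (x y : B) (f : hom x y) :
  trif_susp tF y \o fmor F (fmor susp f) == fmor susp (fmor F f) \o trif_susp tF x.
Proof. exact (nat_iso_natural (trif_susp tF) f). Qed.

End Compose.

Definition trifunctor_comp {B C D : Cat} {tB : Tri o B} {tC : Tri o C} {tD : Tri o D}
  {F : Functor B C} {G : Functor C D} (tG : TriFunctor G) (tF : TriFunctor F) :
  TriFunctor (functor_comp G F).
Proof.
  unshelve refine (@Build_TriFunctor o B D tB tD (functor_comp G F) _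
                     (susp_comp_nat tG tF) _).
  - intros x y f g; cbn; now rewrite (trif_additive tF), (trif_additive tG).
  - intros n X Hn HX.
    refine (dist_iso Hn (trif_dist tG Hn (trif_dist tF Hn HX)) _ _).
    + apply nimage_ntriangle.
      * intros x y f; exact (nat_iso_natural (susp_comp_nat tG tF) f).
      * intros x Hx; cbn; apply fmor_is_zero; [apply (trif_additive tG)|].
        now apply fmor_is_zero; [apply (trif_additive tF)|].
      * exact (dist_ntriangle Hn HX).
    + apply nisomorphic_sym, nimage_nimage; intros x; reflexivity.
Defined.

Section Transport.
Context {C D : Cat} {tC : Tri o C} {tD : Tri o D} {F F' : Functor C D}
  (tF : TriFunctor F) (a : NatIso F F').

Definition susp_transport_nat :
  NatIso (functor_comp F' susp) (functor_comp susp F').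
Proof.
  refine (@MkNatIso C D (functor_comp F' susp) (functor_comp susp F')
    (fun x => iso_comp (fiso susp (a x))
                (iso_comp (trif_susp tF x) (iso_sym (a (susp x))))) _).
  intros x y f; cbn; la.
  apply (iso_epi (i := a (susp x))).
  pose proof (nat_iso_natural a (fmor susp f)) as E; cbn in E.
  rewrite comp_assoc, <- E; la; rw (iso_invl (a (susp y))); rw (iso_invl (a (susp x))).
  rewrite !comp_idr; rw (trif_is_natural tF f).
  rewrite <- (fmor_comp susp (a y)), (nat_iso_natural a f), fmor_comp; now la.
Defined.

Lemma susp_transport_nat_eq x :
  susp_transport_nat x \o a (susp x) == fmor susp (a x) \o trif_susp tF x.
Proof. cbn; la; rw (iso_invl (a (susp x))); now idc. Qed.

Definition trifunctor_transport : TriFunctor F'.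
Proof.
  unshelve refine (@Build_TriFunctor o C D tC tD F' _ susp_transport_nat _).
  - intros x y f g; apply (iso_epi (i := a x)).
    rewrite comp_addl, <- !nat_iso_natural, (trif_additive tF).
    now rewrite comp_addr.
  - intros n X Hn HX; pose proof (trif_dist tF Hn HX) as HF.
    assert (I : nisomorphic n (nimage (F := F) (fun x => trif_susp tF x) X)
                  (nimage (F := F') (fun x => susp_transport_nat x) X)).
    { apply (nimage_ext (a := a)); exact susp_transport_nat_eq. }
    exact (dist_iso Hn HF (ntriangle_iso (dist_ntriangle Hn HF) I) I).
Defined.
End Transport.
End TriFunctors.

(** * Coherence of the tensor product and of the suspension *)

Section Monoidal.
Context {C : Cat} {mC : SymMon C}.

Definition tens_iso {x y x' y' : C} (i : Iso x x') (j : Iso y y') :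
  Iso (x ⊗ y) (x' ⊗ y').
Proof.
  refine (@MkIso C (x ⊗ y) (x' ⊗ y') (i ⊠ j) (iso_inv i ⊠ iso_inv j) _ _);
    rewrite tensm_split, ?iso_invl, ?iso_invr; apply tensm_id.
Defined.

Lemma tens_l_comp {x y z w : C} (g : hom y z) (f : hom x y) :
  (g \o f) ⊠ idm w == (g ⊠ idm w) \o (f ⊠ idm w).
Proof. now rewrite tensm_split, comp_idl. Qed.

Lemma tens_r_comp {x y z w : C} (g : hom y z) (f : hom x y) :
  idm w ⊠ (g \o f) == (idm w ⊠ g) \o (idm w ⊠ f).
Proof. now rewrite tensm_split, comp_idl. Qed.

Lemma tens_lr {x y x' y' : C} (f : hom x x') (g : hom y y') :
  f ⊠ g == (f ⊠ idm y') \o (idm x ⊠ g).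
Proof. rewrite tensm_split; now idc. Qed.

Lemma tens_rl {x y x' y' : C} (f : hom x x') (g : hom y y') :
  f ⊠ g == (idm x' ⊠ g) \o (f ⊠ idm y).
Proof. rewrite tensm_split; now idc. Qed.

Lemma assoc_inv_natural {x y z x' y' z' : C} (f : hom x x') (g : hom y y')
    (h : hom z z') :
  iso_inv (assoc x' y' z') \o (f ⊠ (g ⊠ h))
    == ((f ⊠ g) ⊠ h) \o iso_inv (assoc x y z).
Proof.
  apply (iso_epi (i := assoc x y z)); rw (iso_invl (assoc x y z)).
  rewrite comp_assoc, <- assoc_natural; la; rw (iso_invl (assoc x' y' z')).
  now idc.
Qed.

Definition braid_iso (x y : C) : Iso (x ⊗ y) (y ⊗ x) :=
  MkIso (braid_involutive x y) (braid_involutive y x).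

Lemma tensm_cancel_r {x y : C} (f g : hom x y) :
  f ⊠ idm one == g ⊠ idm one -> f == g.
Proof.
  intros H; apply (iso_epi (i := runit x)).
  now rewrite <- !runit_natural, H.
Qed.

(** Follows from the hexagon for x, 1, 1, after tensoring with 1, which reflects equality of
    morphisms. *)
Lemma lunit_braid (x : C) : lunit x \o braid x one == runit x.
Proof.
  apply tensm_cancel_r, (iso_mono (i := braid_iso x one)); cbn.
  symmetry; rewrite tens_l_comp; la.
  rewrite <- unit_triangle; la; rewrite braid_natural.
  rewrite <- lunit_tens, !comp_assoc, <- (comp_assoc (assoc _ _ _)), hexagon; la.
  rewrite lunit_natural, (comp_assoc _ (lunit _)), lunit_tens.
  now la.
Qed.

Lemma runit_braid (x : C) : runit x \o braid one x == lunit x.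
Proof.
  rewrite <- lunit_braid, comp_assoc, braid_involutive; now idc.
Qed.

Lemma unit_triangle_inv (x y : C) :
  (runit x ⊠ idm y) \o iso_inv (assoc x one y) == idm x ⊠ lunit y.
Proof.
  rewrite <- unit_triangle; rw (iso_invr (assoc x one y)); now idc.
Qed.

Lemma lunit_tens_inv (x y : C) :
  (lunit x ⊠ idm y) \o iso_inv (assoc one x y) == lunit (x ⊗ y).
Proof.
  rewrite <- lunit_tens; rw (iso_invr (assoc one x y)); now idc.
Qed.

Lemma lunit_swap_middle (a b : C) :
  lunit (a ⊗ b) \o (lunit one ⊠ idm (a ⊗ b)) \o swap_middle one a one b
    == lunit a ⊠ lunit b.
Proof.
  unfold swap_middle; la.
  rewrite (comp_assoc (lunit (a ⊗ b))), lunit_tens_inv.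
  rewrite (comp_assoc (lunit (a ⊗ b))), lunit_natural; la.
  rw (lunit_tens a b).
  rewrite <- tens_l_comp, lunit_braid, unit_triangle_inv.
  rw (lunit_tens a (one ⊗ b)).
  rewrite tensm_split; now idc.
Qed.

(** The hexagon with a product in the first argument of the braiding; it comes from the given one
    because the braiding is an involution. *)
Lemma hexagon_inv (x z y : C) :
  braid (z ⊗ y) x \o iso_inv (assoc z y x) \o (idm z ⊠ braid x y)
    == assoc x z y \o (braid z x ⊠ idm y) \o iso_inv (assoc z x y).
Proof.
  assert (E : (braid x z ⊠ idm y) \o (braid z x ⊠ idm y) == idm _)
    by now rewrite <- tens_l_comp, braid_involutive, tensm_id.
  assert (E' : (braid z x ⊠ idm y) \o (braid x z ⊠ idm y) == idm _)
    by now rewrite <- tens_l_comp, braid_involutive, tensm_id.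
  apply (iso_epi (i := assoc z x y)).
  rw (iso_invl (assoc z x y)); rewrite comp_idr.
  apply (split_epi (r := braid x z ⊠ idm y) E).
  rw E'; rewrite comp_idr.
  rw (symmetry (hexagon x z y)); rw (iso_invl (assoc z y x)); rewrite comp_idr.
  rewrite braid_involutive; now idc.
Qed.
End Monoidal.

Section Suspension.
Context {o : tri_order} {C : Cat} {tC : TensorTri o C}.

Lemma braid_stens (x y : C) :
  fmor susp (braid x y) \o stens_r x y == stens y x \o braid x (susp y).
Proof.
  unfold stens_r; la; rewrite <- fmor_comp, braid_involutive, fmor_id.
  now idc.
Qed.

Lemma stens_r_braid (x y : C) :
  stens_r x y \o braid (susp y) x == fmor susp (braid y x) \o stens y x.
Proof. unfold stens_r; rw (braid_involutive (susp y) x); now idc. Qed.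

Lemma stens_r_natural (x y x' y' : C) (f : hom x x') (g : hom y y') :
  stens_r x' y' \o (f ⊠ fmor susp g) == fmor susp (f ⊠ g) \o stens_r x y.
Proof.
  unfold stens_r; la; rw (braid_natural f (fmor susp g)).
  rw (stens_natural g f).
  now rewrite <- !(fmor_comp susp), braid_natural.
Qed.

Definition stens_r_iso (x y : C) : Iso (x ⊗ susp y) (susp (x ⊗ y)) :=
  iso_comp (fiso susp (braid_iso y x))
    (iso_comp (stens y x) (braid_iso x (susp y))).

Lemma stens_r_isoE (x y : C) : stens_r_iso x y == stens_r x y.
Proof. cbn; unfold stens_r; now la. Qed.

Lemma stens_r_lunit (y : C) :
  fmor susp (lunit y) \o stens_r one y == lunit (susp y).
Proof.
  unfold stens_r; la; rewrite <- fmor_comp, lunit_braid, stens_runit.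
  apply runit_braid.
Qed.

(** [TensorTri] postulates coherence for a suspension in the first factor. Braidings move the
    suspension to the middle factor, and the hexagon turns the axiom into this mixed form. *)
Lemma stens_r_stens (x z y : C) :
  fmor susp (assoc x z y) \o stens (x ⊗ z) y \o (stens_r x z ⊠ idm y)
    == stens_r x (z ⊗ y) \o (idm x ⊠ stens z y) \o assoc x (susp z) y.
Proof.
  assert (L : fmor susp (assoc x z y) \o stens (x ⊗ z) y \o (stens_r x z ⊠ idm y)
    == fmor susp (assoc x z y \o (braid z x ⊠ idm y) \o iso_inv (assoc z x y))
         \o stens z (x ⊗ y) \o assoc (susp z) x y \o (braid x (susp z) ⊠ idm y)).
  { unfold stens_r; rewrite !tens_l_comp; la.
    rw (stens_natural (braid z x) (idm y)); rewrite !fmor_comp.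
    rw (symmetry (stens_assoc z x y)).
    rewrite (comp_assoc _ (fmor susp (iso_inv _)) (fmor susp (assoc z x y))).
    rewrite <- (fmor_comp susp (iso_inv (assoc z x y)) (assoc z x y)), iso_invl, fmor_id.
    now idc. }
  rewrite L; clear L; rewrite <- hexagon_inv, !fmor_comp.
  unfold stens_r.
  rw (symmetry (stens_natural (idm z) (braid x y))).
  rewrite fmor_id.
  rw (symmetry (hexagon x (susp z) y)).
  rw (braid_natural (idm x) (stens z y)).
  assert (E : fmor susp (iso_inv (assoc z y x)) \o stens z (y ⊗ x)
      \o assoc (susp z) y x == stens (z ⊗ y) x \o (stens z y ⊠ idm x)).
  { apply (iso_mono (i := fiso susp (assoc z y x))); cbn; la.
    rewrite <- (fmor_comp susp (assoc z y x)), iso_invr, fmor_id, comp_idl.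
    now rw (stens_assoc z y x). }
  rw E; reflexivity.
Qed.

(** A braiding brings the suspension from the last factor to the middle one, where [stens_r_stens]
    applies. *)
Lemma stens_r_assoc (x y z : C) :
  fmor susp (assoc x y z) \o stens_r (x ⊗ y) z
    == stens_r x (y ⊗ z) \o (idm x ⊠ stens_r y z) \o assoc x y (susp z).
Proof.
  assert (E : assoc x y z \o braid z (x ⊗ y)
    == (idm x ⊠ braid z y) \o assoc x z y \o (braid z x ⊠ idm y)
         \o iso_inv (assoc z x y)).
  { rewrite <- hexagon; rw (iso_invr (assoc z x y)); now idc. }
  assert (E2 : (braid (susp z) x ⊠ idm y) \o iso_inv (assoc (susp z) x y)
      \o braid (x ⊗ y) (susp z)
    == iso_inv (assoc x (susp z) y) \o (idm x ⊠ braid y (susp z))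
         \o assoc x y (susp z)).
  { apply (iso_mono (i := assoc x (susp z) y)); la.
    rw (iso_invr (assoc x (susp z) y)); rewrite comp_idl.
    apply (iso_mono (i := tens_iso (iso_id x) (braid_iso (susp z) y))); cbn; la.
    rw (symmetry (hexagon (susp z) x y)).
    rw (iso_invr (assoc (susp z) x y)); rewrite comp_idr.
    rw (braid_involutive (x ⊗ y) (susp z)); rewrite comp_idr.
    rewrite <- tens_r_comp, braid_involutive, tensm_id; now idc. }
  unfold stens_r at 1; la; rewrite <- (fmor_comp susp (assoc x y z)), E.
  rewrite !fmor_comp.
  assert (E3 : fmor susp (iso_inv (assoc z x y)) \o stens z (x ⊗ y)
    == stens (z ⊗ x) y \o (stens z x ⊠ idm y) \o iso_inv (assoc (susp z) x y)).
  { apply (iso_epi (i := assoc (susp z) x y)).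
    rw (iso_invl (assoc (susp z) x y)); rewrite comp_idr.
    apply (iso_mono (i := fiso susp (assoc z x y))); cbn; la.
    rewrite <- (fmor_comp susp (assoc z x y)), iso_invr, fmor_id, comp_idl.
    now rewrite stens_assoc. }
  rw E3; rw (symmetry (stens_natural (braid z x) (idm y))).
  rw (symmetry (tens_l_comp (fmor susp (braid z x)) (stens z x))).
  rewrite <- stens_r_braid, tens_l_comp; la.
  rw E2; rw (stens_r_stens x z y).
  rewrite <- (stens_r_natural (idm x) (braid z y)).
  rw (iso_invr (assoc x (susp z) y)); rewrite comp_idr.
  rw (symmetry (tens_r_comp (stens z y) (braid y (susp z)))).
  rewrite <- braid_stens, tens_r_comp; la.
  rw (symmetry (tens_r_comp (fmor susp (braid z y)) (fmor susp (braid y z)))).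
  rewrite <- fmor_comp, braid_involutive, fmor_id, tensm_id; now idc.
Qed.
End Suspension.

Section MonFunctors.
Context {C D : Cat} {mC : SymMon C} {mD : SymMon D} {F : Functor C D}
  (mF : MonFunctor F).

Lemma monf_assoc_inv (x y z : C) :
  fmor F (iso_inv (assoc x y z)) \o monf mF x (y ⊗ z) \o (idm (F x) ⊠ monf mF y z)
    == monf mF (x ⊗ y) z \o (monf mF x y ⊠ idm (F z))
         \o iso_inv (assoc (F x) (F y) (F z)).
Proof.
  apply (iso_epi (i := assoc (F x) (F y) (F z))).
  rw (iso_invl (assoc (F x) (F y) (F z))); rewrite comp_idr.
  rw (symmetry (monf_assoc mF x y z)); rewrite <- fmor_comp, iso_invl, fmor_id.
  now idc.
Qed.

Lemma monf_natural_l {x x' y : C} (f : hom x x') :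
  fmor F (f ⊠ idm y) \o monf mF x y == monf mF x' y \o (fmor F f ⊠ idm (F y)).
Proof. now rewrite monf_natural, fmor_id. Qed.

Lemma monf_natural_r {x y y' : C} (f : hom y y') :
  fmor F (idm x ⊠ f) \o monf mF x y == monf mF x y' \o (idm (F x) ⊠ fmor F f).
Proof. now rewrite monf_natural, fmor_id. Qed.

Lemma monf_swap_middle (a x b y : C) :
  fmor F (swap_middle a x b y) \o monf mF (a ⊗ x) (b ⊗ y)
      \o (monf mF a x ⊠ monf mF b y)
    == monf mF (a ⊗ b) (x ⊗ y) \o (monf mF a b ⊠ monf mF x y)
         \o swap_middle (F a) (F x) (F b) (F y).
Proof.
  assert (M : fmor F (assoc b x y \o (braid x b ⊠ idm y) \o iso_inv (assoc x b y))
      \o monf mF x (b ⊗ y) \o (idm (F x) ⊠ monf mF b y)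
    == monf mF b (x ⊗ y) \o (idm (F b) ⊠ monf mF x y)
       \o (assoc (F b) (F x) (F y) \o (braid (F x) (F b) ⊠ idm (F y))
              \o iso_inv (assoc (F x) (F b) (F y)))).
  { rewrite !fmor_comp; la; rw (monf_assoc_inv x b y).
    rw (monf_natural_l (y := y) (braid x b)).
    rw (symmetry (tens_l_comp (w := F y) (fmor F (braid x b)) (monf mF x b))).
    rewrite monf_braid, tens_l_comp; la.
    now rw (monf_assoc mF b x y). }
  unfold swap_middle.
  set (m := assoc b x y \o (braid x b ⊠ idm y) \o iso_inv (assoc x b y)) in *.
  set (m' := assoc (F b) (F x) (F y) \o (braid (F x) (F b) ⊠ idm (F y))
              \o iso_inv (assoc (F x) (F b) (F y))) in *.
  rewrite !fmor_comp, (tens_lr (monf mF a x)); la.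
  rw (monf_assoc mF a x (b ⊗ y)).
  rewrite <- (tensm_id (F a) (F x)); rw (assoc_natural (idm (F a)) (idm (F x)) (monf mF b y)).
  rw (monf_natural_r (x := a) m).
  rw (symmetry (tens_r_comp (w := F a) (fmor F m) (monf mF x (b ⊗ y)))).
  rw (symmetry (tens_r_comp (w := F a) (fmor F m \o monf mF x (b ⊗ y)) (idm (F x) ⊠ monf mF b y))).
  rewrite M, !tens_r_comp; la.
  rw (monf_assoc_inv a b (x ⊗ y)).
  rw (assoc_inv_natural (idm (F a)) (idm (F b)) (monf mF x y)).
  now rw (tensm_split (monf mF a b) (idm (F a) ⊠ idm (F b)) (idm _) (monf mF x y));
    rewrite tensm_id, comp_idl, comp_idr.
Qed.
End MonFunctors.

Section MonCompose.
Context {B C D : Cat} {mB : SymMon B} {mC : SymMon C} {mD : SymMon D}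
  {F : Functor B C} {G : Functor C D} (mG : MonFunctor G) (mF : MonFunctor F).

Definition monfunctor_comp : MonFunctor (functor_comp G F).
Proof.
  unshelve refine (@Build_MonFunctor B D mB mD (functor_comp G F)
    (fun x y => iso_comp (fiso G (monf mF x y)) (monf mG (F x) (F y)))
    (iso_comp (fiso G (monf_one mF)) (monf_one mG)) _ _ _ _ _).
  - intros x y x' y' f g; cbn; la.
    rewrite <- fmor_comp, monf_natural, fmor_comp, !comp_assoc.
    now rewrite monf_natural.
  - intros x y z; cbn; rewrite tens_l_comp, tens_r_comp; la.
    rw (symmetry (monf_natural_l mG (y := F z) (monf mF x y))).
    rewrite <- !(fmor_comp G), monf_assoc, !fmor_comp; la.
    rw (monf_assoc mG (F x) (F y) (F z)).
    now rw (monf_natural_r mG (x := F x) (monf mF y z)).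
  - intros x; cbn; rewrite tens_l_comp; la.
    rw (symmetry (monf_natural_l mG (y := F x) (monf_one mF))).
    rewrite <- !(fmor_comp G), monf_lunit; apply monf_lunit.
  - intros x; cbn; rewrite tens_r_comp; la.
    rw (symmetry (monf_natural_r mG (x := F x) (monf_one mF))).
    rewrite <- !(fmor_comp G), monf_runit; apply monf_runit.
  - intros x y; cbn; la.
    rewrite <- fmor_comp, monf_braid, fmor_comp, !comp_assoc.
    now rewrite monf_braid.
Defined.
End MonCompose.

Section MonTransport.
Context {C D : Cat} {mC : SymMon C} {mD : SymMon D} {F F' : Functor C D}
  (mF : MonFunctor F) (a : NatIso F F').

Definition monfunctor_transport : MonFunctor F'.
Proof.
  assert (tii : forall x y, (iso_inv (a x) ⊠ iso_inv (a y)) \o (a x ⊠ a y) == idm _)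
    by (intros; now rewrite tensm_split, !iso_invl, tensm_id).
  unshelve refine (@Build_MonFunctor C D mC mD F'
    (fun x y => iso_comp (a (x ⊗ y))
       (iso_comp (monf mF x y) (iso_sym (tens_iso (a x) (a y)))))
    (iso_comp (a one) (monf_one mF)) _ _ _ _ _).
  - intros x y x' y' f g; cbn; la.
    apply (iso_epi (i := tens_iso (a x) (a y))); cbn.
    rw (tii x y); rewrite comp_idr, <- (nat_iso_natural a (f ⊠ g)); la.
    rw (monf_natural mF f g); rewrite (comp_assoc _ _ (a x ⊠ a y)), tensm_split.
    rewrite <- !nat_iso_natural, <- tensm_split; la.
    rw (tii x' y'); now idc.
  - intros x y z; cbn.
    apply (iso_epi (i := tens_iso (tens_iso (a x) (a y)) (a z))); cbn; la.
    rewrite (comp_assoc _ (_ ⊠ idm _)), tensm_split; la.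
    rewrite !comp_assoc, (tii x y), comp_idl, comp_idr; la.
    rewrite (comp_assoc _ (_ ⊠ _) (_ ⊠ _)), tensm_split; la.
    rewrite iso_invl, comp_idl, (iso_invl (a z)).
    rewrite <- (nat_iso_natural a (assoc x y z)); la.
    rw (monf_assoc mF x y z).
    rw (assoc_natural (a x) (a y) (a z)).
    rewrite !comp_assoc, <- (comp_assoc (idm _ ⊠ _)), tensm_split; la.
    rewrite (comp_assoc _ (iso_inv (a x) ⊠ _)), tensm_split; la.
    rw (tii y z); idc; rewrite iso_invl.
    now rewrite (iso_invl (a (y ⊗ z))), comp_idl; la.
  - intros x; cbn; apply (iso_epi (i := tens_iso (iso_id one) (a x))); cbn; la.
    rw (tensm_split (a one \o monf_one mF) (idm one) (idm _) (a x)); idc.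
    rewrite (comp_assoc _ (_ ⊠ _) (_ ⊠ _)), tensm_split; la.
    rewrite (iso_invl (a one)), (iso_invl (a x)), comp_idl.
    rewrite <- (nat_iso_natural a (lunit x)); la.
    rewrite !(comp_assoc (a x)), monf_lunit; symmetry; apply lunit_natural.
  - intros x; cbn; apply (iso_epi (i := tens_iso (a x) (iso_id one))); cbn; la.
    rw (tensm_split (idm _) (a x) (a one \o monf_one mF) (idm one)); idc.
    rewrite (comp_assoc _ (_ ⊠ _) (_ ⊠ _)), tensm_split; la.
    rewrite (iso_invl (a one)), (iso_invl (a x)), comp_idl.
    rewrite <- (nat_iso_natural a (runit x)); la.
    rewrite !(comp_assoc (a x)), monf_runit; symmetry; apply runit_natural.
  - intros x y; cbn; la; rewrite <- nat_iso_natural; la.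
    rw (monf_braid mF x y); now rw (braid_natural (iso_inv (a x)) (iso_inv (a y))).
Defined.

Lemma monfunctor_transportE (x y : C) :
  monf monfunctor_transport x y
    == a (x ⊗ y) \o monf mF x y \o (iso_inv (a x) ⊠ iso_inv (a y)).
Proof. cbn; now la. Qed.
End MonTransport.

Ltac fcbn := cbn [fob fmor functor_comp functor_id].
Tactic Notation "fcbn" "in" hyp(H) := cbn [fob fmor functor_comp functor_id] in H.

Lemma fmor_merge {C D : Cat} (F : Functor C D) {x y z : C} (g : hom y z)
    (f : hom x y) {w : D} (k : hom (F z) w) :
  k \o fmor F g \o fmor F f == k \o fmor F (g \o f).
Proof. now rewrite fmor_comp, comp_assoc. Qed.

Arguments fmor_merge {C D} F {x y z} g f {w} k.

Section TTFunctors.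
Context {o : tri_order}.

Lemma ttf_stens_r {C D : Cat} {tC : TensorTri o C} {tD : TensorTri o D}
    {F : Functor C D} (tF : TTFunctor F) (x y : C) :
  trif_susp tF (x ⊗ y) \o fmor F (stens_r x y) \o monf tF x (susp y)
    == fmor susp (monf tF x y) \o stens_r (F x) (F y)
         \o (idm (F x) ⊠ trif_susp tF y).
Proof.
  unfold stens_r; rewrite !fmor_comp; la.
  rw (trif_is_natural tF (braid y x)).
  rw (monf_braid tF x (susp y)).
  rw (ttf_compat tF y x).
  rw (symmetry (braid_natural (idm (F x)) (trif_susp tF y))).
  fcbn; rewrite <- (fmor_comp susp (fmor F (braid y x))), monf_braid, fmor_comp.
  reflexivity.
Qed.

Section Compose.
Context {B C D : Cat} {tB : TensorTri o B} {tC : TensorTri o C}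
  {tD : TensorTri o D} {F : Functor B C} {G : Functor C D}
  (tG : TTFunctor G) (tF : TTFunctor F).

Definition ttfunctor_comp : TTFunctor (functor_comp G F).
Proof.
  refine (@Build_TTFunctor o B D tB tD (functor_comp G F)
            (trifunctor_comp tG tF) (monfunctor_comp tG tF) _).
  intros x y; cbn; rewrite tens_l_comp; la; fcbn.
  pose proof (monf_natural_l tG (y := F y) (trif_susp tF x)) as E.
  pose proof (ttf_compat tF x y) as E1.
  pose proof (trif_is_natural tG (monf tF x y)) as E2.
  pose proof (ttf_compat tG (F x) (F y)) as E3.
  fcbn in E; fcbn in E1; fcbn in E2; fcbn in E3.
  rewrite !(fmor_merge G); la; rewrite E1.
  rewrite !fmor_comp; la; rewrite E2.
  rewrite (precomp E); la; rewrite (precomp3 E3); now la.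
Defined.
End Compose.

Section Transport.
Context {C D : Cat} {tC : TensorTri o C} {tD : TensorTri o D}
  {F F' : Functor C D} (tF : TTFunctor F) (a : NatIso F F').

Definition ttfunctor_transport : TTFunctor F'.
Proof.
  refine (@Build_TTFunctor o C D tC tD F' (trifunctor_transport tF a)
            (monfunctor_transport tF a) _).
  intros x y; apply (iso_epi (i := tens_iso (a (susp x)) (a y))).
  assert (tii : forall x y, (iso_inv (a x) ⊠ iso_inv (a y)) \o (a x ⊠ a y) == idm _)
    by (intros; now rewrite tensm_split, !iso_invl, tensm_id).
  assert (E0 : (susp_transport_nat tF a x ⊠ idm (F' y)) \o (a (susp x) ⊠ a y)
    == (fmor susp (a x) ⊠ a y) \o (trif_susp tF x ⊠ idm (F y))).
  { rewrite !tensm_split, susp_transport_nat_eq; now idc. }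
  pose proof (susp_transport_nat_eq tF a (x ⊗ y)) as E1.
  cbn [trif_susp trifunctor_transport ttf_tri ttf_mon tens_iso iso_fwd].
  change (functor_comp F' susp x) with (F' (susp x)) in *.
  change (functor_comp susp F' x) with (susp (F' x)) in *.
  rewrite !monfunctor_transportE.
  rewrite !comp_assoc, E0; la.
  rewrite (comp_assoc _ (_ ⊠ _) (a _ ⊠ a _)), tii, comp_idr.
  rewrite (comp_assoc _ (fmor F' (stens x y))), <- (nat_iso_natural a (stens x y)); la.
  rewrite E1.
  pose proof (ttf_compat tF x y) as E3; fcbn in E3; fcbn.
  rewrite (precomp3 E3); la; rewrite (precomp (stens_natural (a x) (a y))); la.
  assert (E4 : fmor susp (a (x ⊗ y) \o monf tF x y \o iso_inv (a x) ⊠ iso_inv (a y))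
    \o fmor susp (a x ⊠ a y) == fmor susp (a (x ⊗ y) \o monf tF x y)).
  { rewrite <- fmor_comp, comp_assoc, tii; now idc. }
  rewrite E4, fmor_comp; reflexivity.
Defined.

Lemma ttfunctor_transport_susp (x : C) :
  trif_susp ttfunctor_transport x
    == fmor susp (a x) \o trif_susp tF x \o iso_inv (a (susp x)).
Proof. cbn; now la. Qed.

End Transport.
End TTFunctors.

(** * Created triangulations and lifting of idempotents *)

Section Create.
Context {o : tri_order} (ho : valid_order o) {C D : Cat} {tD : Tri o D}
  {aC : PreAdd C} (Sg : Functor C C) (U : Functor C D)
  (sI : NatIso (functor_comp U Sg) (functor_comp susp U)).

Definition created_dist (n : nat) (X : ndiag Sg) : Prop :=
  dist n (nimage (F := U) (fun x => sI x) X).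

Lemma sI_natural (x y : C) (f : hom x y) :
  sI y \o fmor U (fmor Sg f) == fmor susp (fmor U f) \o sI x.
Proof. exact (nat_iso_natural sI f). Qed.

Context (addC : is_additive C) (eqS : is_equivalence Sg)
  (fU : faithful U) (aU : is_additive_functor U).

Lemma created_ntriangle n X : in_range o n -> created_dist n X -> is_ntriangle n X.
Proof.
  intros Hn HX; apply (ntriangle_reflect sI_natural fU aU (fun x => is_iso_iso (sI x))).
  exact (dist_ntriangle Hn HX).
Qed.

Lemma created_iso n X Y : in_range o n -> created_dist n X ->
  is_ntriangle n Y -> nisomorphic n X Y -> created_dist n Y.
Proof.
  intros Hn HX TY I; refine (dist_iso Hn HX _ (nimage_isomorphic sI_natural I)).
  apply (nimage_ntriangle sI_natural); [|exact TY].
  intros x; apply (fmor_is_zero aU).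
Qed.

Lemma created_rotate n X : in_range o n -> created_dist n X ->
  created_dist n (nrotate n X).
Proof.
  intros Hn HX; pose proof (dist_rotate Hn HX) as HR.
  assert (I := nisomorphic_sym (nimage_rotate sI_natural X aU
    (fun x => is_iso_iso (sI x)) (n := n) ltac:(destruct Hn; lia))).
  exact (dist_iso Hn HR (ntriangle_iso (dist_ntriangle Hn HR) I) I).
Qed.

(** The other axioms are inherited along a faithful additive [U]. Filling of bases, extension of
    morphisms and octahedra are not formal and stay parameters: they are met by different means for
    modules, for the quotient and for its completion. *)
Definition tri_create
    (Hb : forall n b (f : forall i, hom (b i) (b (S i))), in_range o n ->
       exists X, created_dist n X /\ nextends n X f)
    (Hm : forall n X Y (u : forall i, hom (nob X 0 i) (nob Y 0 i)),
       in_range o n -> created_dist n X -> created_dist n Y ->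
       (forall i, 1 <= i < n ->
          ntr Y 0 i 0 (S i) \o u i == u (S i) \o ntr X 0 i 0 (S i)) ->
       exists w, is_nmorphism n (X := X) (Y := Y) w /\
         (forall i, 1 <= i <= n -> w 0 i == u i))
    (Ho : o = Verdier -> forall b (f : forall i, hom (b i) (b (S i))),
       exists X : ndiag Sg, is_ntriangle 3 X /\ nextends 3 X f /\
         (forall phi, monotone_upto 2 3 phi ->
            phi 0 < phi 1 -> phi 1 < phi 2 -> created_dist 2 (nreindex phi X))) :
  Tri o C :=
  @Build_Tri o C aC addC Sg eqS created_dist created_ntriangle created_iso
    (fun m n X phi Hm Hn HX Hphi => dist_reindex Hm Hn HX Hphi)
    created_rotate Hb Hm Ho.

Lemma full_extend_morphism : full U ->
  forall n X Y (u : forall i, hom (nob X 0 i) (nob Y 0 i)),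
  in_range o n -> created_dist n X -> created_dist n Y ->
  (forall i, 1 <= i < n ->
     ntr Y 0 i 0 (S i) \o u i == u (S i) \o ntr X 0 i 0 (S i)) ->
  exists w, is_nmorphism n (X := X) (Y := Y) w /\
    (forall i, 1 <= i <= n -> w 0 i == u i).
Proof.
  intros hU n X Y u Hn HX HY Hu.
  destruct (tri_extend_morphism (X := nimage (F := U) (fun x => sI x) X)
      (Y := nimage (F := U) (fun x => sI x) Y) (u := fun i => fmor U (u i)) Hn HX HY)
    as [w [[W1 W2] Hw]].
  { intros i Hi; cbn; now rewrite <- !fmor_comp, Hu. }
  exists (fun i j => preim hU (w i j)); split.
  - apply (nmorphism_reflect sI_natural fU (fun x => is_iso_iso (sI x))).
    split; intros; rewrite !fmor_preim; [now apply W1 | now apply W2].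
  - intros i Hi; apply fU; rewrite fmor_preim; exact (Hw i Hi).
Qed.
End Create.

(** * Splitting and lifting idempotents of n-triangles *)

Section Split.
Context {C : Cat} {aC : PreAdd C} {Sg : Functor C C}.

(** Each vertex is split separately and the structure maps are conjugated by the splittings. The
    relations survive because [e] commutes with the structure maps: an [e] in the middle of a
    composite moves to its end and is absorbed. *)
Lemma nsplit (hC : idempotent_complete C) n (X : ndiag Sg) e :
  is_ntriangle n X -> is_nmorphism n (X := X) (Y := X) e ->
  (forall i j, i <= j <= n -> e i j \o e i j == e i j) ->
  exists (Z : ndiag Sg) s r, is_ntriangle n Z /\
    is_nmorphism n (X := Z) (Y := X) s /\ is_nmorphism n (X := X) (Y := Z) r /\
    (forall i j, i <= j <= n -> r i j \o s i j == idm _) /\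
    (forall i j, i <= j <= n -> s i j \o r i j == e i j).
Proof.
  intros [X1 [X2 [X3 X4]]] [E1 E2] He.
  (* Object, retraction and section are packed together, so that one choice yields a consistent
     triple. *)
  assert (H : forall i j, exists p : {y : C & (hom (nob X i j) y * hom y (nob X i j))%type},
    i <= j <= n -> fst (projT2 p) \o snd (projT2 p) == idm _ /\
                   snd (projT2 p) \o fst (projT2 p) == e i j).
  { intros i j; destruct (le_dec i j) as [H1|H1];
      [destruct (le_dec j n) as [H2|H2]|].
    - destruct (hC _ _ (He i j (conj H1 H2))) as [y [r [s Hrs]]].
      exists (existT _ y (r, s)); intros _; exact Hrs.
    - exists (existT _ (nob X i j) (idm _, idm _)); lia.
    - exists (existT _ (nob X i j) (idm _, idm _)); lia. }
  pose (p := fun i j => proj1_sig (constructive_indefinite_description _ (H i j))).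
  assert (Hp : forall i j, i <= j <= n ->
    fst (projT2 (p i j)) \o snd (projT2 (p i j)) == idm _ /\
    snd (projT2 (p i j)) \o fst (projT2 (p i j)) == e i j)
    by (intros i j; exact (proj2_sig (constructive_indefinite_description _ (H i j)))).
  pose (y := fun i j => projT1 (p i j)).
  pose (r := fun i j => fst (projT2 (p i j)) : hom (nob X i j) (y i j)).
  pose (s := fun i j => snd (projT2 (p i j)) : hom (y i j) (nob X i j)).
  assert (rs : forall i j, i <= j <= n -> r i j \o s i j == idm (y i j)) by apply Hp.
  assert (sr : forall i j, i <= j <= n -> s i j \o r i j == e i j) by apply Hp.
  clearbody r s; clearbody y; clear p H Hp.
  pose (Z := @MkNdiag C Sg y (fun i j i' j' => r i' j' \o ntr X i j i' j' \o s i j)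
               (fun i j k => fmor Sg (r i j) \o nbd X i j k \o s j k)).
  assert (es : forall i j, i <= j <= n -> e i j \o s i j == s i j).
  { intros i j Hij; rewrite <- (sr i j Hij), comp_assoc, rs by assumption.
    apply comp_idr. }
  assert (re : forall i j, i <= j <= n -> r i j \o e i j == r i j).
  { intros i j Hij; rewrite <- (sr i j Hij); la; rewrite rs by assumption.
    apply comp_idl. }
  assert (Hs : is_nmorphism n (X := Z) (Y := X) s).
  { split; cbn; intros.
    - la; rewrite sr by assumption.
      now rewrite <- E1, comp_assoc, es by assumption.
    - la; rewrite <- fmor_comp, sr, <- E2 by lia.
      now rewrite comp_assoc, es by lia. }
  assert (Hr : is_nmorphism n (X := X) (Y := Z) r).
  { split; cbn; intros.
    - rewrite comp_assoc, sr by assumption.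
      rewrite comp_assoc, E1 by assumption; la; now rewrite re by assumption.
    - rewrite comp_assoc, sr by lia.
      rewrite comp_assoc, E2 by lia; la.
      now rewrite <- fmor_comp, re by lia. }
  exists Z, s, r; split; [|split; [exact Hs|split; [exact Hr|split; trivial]]].
  split; [|split; [|split]].
  - intros i Hi; apply (is_zero_retract (rs i i ltac:(lia))); auto.
  - intros i j Hij; cbn; rewrite X2 by assumption; idc; auto.
  - intros i j i' j' i'' j'' H1 H2 H3 H4 H5; cbn; la.
    rw (sr i' j' H2);
    rewrite (precomp (E1 i' j' i'' j'' H2 H3 ltac:(lia) ltac:(lia))); la.
    rewrite re by assumption.
    now rewrite (precomp (X3 i j i' j' i'' j'' H1 H2 H3 H4 H5)).
  - intros i j k i' j' k' H1 H2 H3 H4 H5 H6 H7; cbn; rewrite !fmor_comp; la.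
    rewrite (precomp (sr j' k' ltac:(lia))).
    rewrite (precomp (E2 i' j' k' H2 H4)); la.
    rewrite <- (fmor_comp Sg (r i' j')), re by lia.
    rewrite (precomp (X4 i j k i' j' k' H1 H2 H3 H4 H5 H6 H7)); la.
    rewrite (comp_assoc _ _ (fmor Sg (r i j))), <- (fmor_comp Sg (s i j)), sr by lia.
    rewrite (precomp (symmetry (E2 i j k H1 H3))); la.
    now rewrite (precomp (es j k ltac:(lia))).
Qed.

Lemma nmorphism_add (aS : is_additive_functor Sg) n (X Y : ndiag Sg) w w' :
  is_nmorphism n (X := X) (Y := Y) w -> is_nmorphism n (X := X) (Y := Y) w' ->
  is_nmorphism n (X := X) (Y := Y) (fun i j => addm (w i j) (w' i j)).
Proof.
  intros [H1 H2] [K1 K2]; split; intros; rewrite comp_addr.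
  - now rewrite H1, K1, comp_addl.
  - now rewrite H2, K2, aS, comp_addl.
Qed.

Lemma nmorphism_opp (aS : is_additive_functor Sg) n (X Y : ndiag Sg) w :
  is_nmorphism n (X := X) (Y := Y) w ->
  is_nmorphism n (X := X) (Y := Y) (fun i j => oppm (w i j)).
Proof.
  intros [H1 H2]; split; intros; rewrite comp_oppr, ?(fmor_opp aS), comp_oppl.
  - now rewrite H1.
  - now rewrite H2.
Qed.

(* [e] is the classical 3 w^2 - 2 w^3. *)
Lemma lift_idempotent {x : C} (w h : hom x x) :
  h == subm (w \o w) w -> h \o h == zerom x x ->
  let e := addm w (subm h (addm (w \o h) (w \o h))) in e \o e == e.
Proof.
  intros Hh hh e.
  assert (c : w \o h == h \o w)
    by (rewrite Hh, comp_subr, comp_subl, comp_assoc; reflexivity).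
  assert (ww : w \o w == addm w h)
    by (rewrite Hh; symmetry; apply add_subm).
  assert (wwh : w \o (w \o h) == w \o h).
  { rewrite <- comp_assoc, ww, comp_addl, hh; apply addm_zero_r. }
  set (k := subm h (addm (w \o h) (w \o h))) in *.
  assert (hk : h \o k == zerom x x).
  { unfold k; rewrite comp_subr, comp_addr, <- comp_assoc, <- c, comp_assoc, hh.
    rewrite comp_zeror, addm_zero; apply subm_zero. }
  assert (kk : k \o k == zerom x x).
  { unfold k at 1; rewrite comp_subl, comp_addl, comp_assoc, hk, comp_zeror.
    rewrite addm_zero; apply subm_zero. }
  assert (wk : w \o k == oppm (w \o h)).
  { unfold k; rewrite comp_subr, comp_addr, wwh; unfold subm.
    rewrite oppm_add, <- addm_assoc, addm_opp_r; apply addm_zero. }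
  assert (kw : k \o w == oppm (w \o h)).
  { unfold k; rewrite comp_subl, comp_addl, comp_assoc, <- c, wwh; unfold subm.
    rewrite oppm_add, <- addm_assoc, addm_opp_r; apply addm_zero. }
  unfold e; rewrite comp_addl, !comp_addr, ww, wk, kw, kk, addm_zero_r.
  rewrite !addm_assoc; apply addm_proper; [reflexivity|].
  unfold k, subm; now rewrite oppm_add.
Qed.

(** A polynomial with integer coefficients in an endomorphism of diagrams is again one. The last
    clause keeps the components that are idempotent already, so the base is not disturbed. *)
Lemma nlift_idempotent (aS : is_additive_functor Sg) n (X : ndiag Sg) w :
  is_nmorphism n (X := X) (Y := X) w ->
  (forall i j, i <= j <= n ->
     subm (w i j \o w i j) (w i j) \o subm (w i j \o w i j) (w i j) == zerom _ _) ->
  exists e, is_nmorphism n (X := X) (Y := X) e /\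
    (forall i j, i <= j <= n -> e i j \o e i j == e i j) /\
    (forall i j, w i j \o w i j == w i j -> e i j == w i j).
Proof.
  intros Hw hh.
  pose (h := fun i j => subm (w i j \o w i j) (w i j)).
  assert (Hh : is_nmorphism n (X := X) (Y := X) h)
    by exact (nmorphism_add aS (nmorphism_comp Hw Hw) (nmorphism_opp aS Hw)).
  pose proof (nmorphism_comp Hh Hw) as Hwh.
  exists (fun i j => addm (w i j)
    (subm (h i j) (addm (w i j \o h i j) (w i j \o h i j)))).
  split; [|split].
  - exact (nmorphism_add aS Hw (nmorphism_add aS Hh
      (nmorphism_opp aS (nmorphism_add aS Hwh Hwh)))).
  - intros i j Hij; apply lift_idempotent; [reflexivity | now apply hh].
  - intros i j E.
    assert (E0 : h i j == zerom _ _) by now apply subm_eq.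
    now rewrite E0, comp_zeror, addm_zero, subm_zero, addm_zero_r.
Qed.

(** As [h] vanishes on X(0,i), the connecting map of X(i,j) kills its values, so [h] factors through
    X(0,j); applied once more, it vanishes there. *)
Lemma square_zero (aS : is_additive_functor Sg) n (X : ndiag Sg) h :
  is_ntriangle n X ->
  hexact n X -> is_nmorphism n (X := X) (Y := X) h ->
  (forall i, 1 <= i <= n -> h 0 i == zerom _ _) ->
  forall i j, i <= j <= n -> h i j \o h i j == zerom _ _.
Proof.
  intros TX HX [H1 H2] H0 i j Hij.
  assert (H0' : forall k, k <= n -> h 0 k == zerom _ _).
  { intros [|k] Hk; [apply from_zero, TX; lia | apply H0; lia]. }
  destruct (HX (nob X i j) i j Hij) as [_ [Hb _]].
  destruct (Hb (h i j)) as [a Ha].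
  { rewrite H2, H0', (fmor_zero aS) by lia; apply comp_zerol. }
  rewrite Ha at 2; la; rewrite <- H1, H0' by lia.
  now rewrite comp_zeror, comp_zerol.
Qed.
End Split.

(** * Modules over a separable algebra *)

Definition tensor_right {C : Cat} {mC : SymMon C} (w : C) : Functor C C.
Proof.
  refine (@MkFunctor C C (fun x => x ⊗ w) (fun x y f => f ⊠ idm w) _ _ _).
  - intros x y f g E; now rewrite E.
  - intros x; apply tensm_id.
  - intros x y z g f; apply tens_l_comp.
Defined.

Definition tensor_left {C : Cat} {mC : SymMon C} (w : C) : Functor C C.
Proof.
  refine (@MkFunctor C C (fun x => w ⊗ x) (fun x y f => idm w ⊠ f) _ _ _).
  - intros x y f g E; now rewrite E.
  - intros x; apply tensm_id.
  - intros x y z g f; apply tens_r_comp.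
Defined.

Lemma curry_proper {C : Cat} {mC : SymMon C} (H : IntHom C) (a x w : C) :
  Proper (heq ==> heq) (@curry C mC H a x w).
Proof.
  intros f g E; apply curry_unique; now rewrite ev_curry.
Qed.

Lemma tensor_right_additive {C : Cat} {aC : PreAdd C} {mC : SymMon C}
    (H : IntHom C) (w : C) : is_additive C -> is_additive_functor (tensor_right w).
Proof.
  apply left_adjoint_additive with (R := ihom H w) (tr := fun x y f => curry H f).
  - intros x y; apply curry_proper.
  - intros x y f g E; rewrite <- (ev_curry H f), <- (ev_curry H g); now rewrite E.
  - intros x' x y f h; cbn; symmetry; apply curry_unique.
    now rewrite tens_l_comp, <- comp_assoc, ev_curry.
Qed.

(** True when the tensor product is closed, since - ⊗ w is then a left adjoint. Stated as a
    property, it can be assumed without fixing an internal hom. *)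
Definition tens_additive {C : Cat} {aC : PreAdd C} (mC : SymMon C) : Prop :=
  forall w : C, is_additive_functor (tensor_right (mC := mC) w).

Lemma tensor_left_additive {C : Cat} {aC : PreAdd C} {mC : SymMon C} :
  tens_additive mC -> forall w : C, is_additive_functor (tensor_left w).
Proof.
  intros H w x y f g; cbn.
  apply (iso_epi (i := braid_iso x w)); cbn.
  rewrite <- braid_natural, comp_addl, <- !braid_natural, <- comp_addr.
  now rewrite (H w x y f g).
Qed.

Section FreeModules.
Context {T : Cat} {mT : SymMon T} {A : Algebra T}.

Definition free_unit (x : T) : hom x (A ⊗ x) :=
  (aone A ⊠ idm x) \o iso_inv (lunit x).

Lemma mact_free_unit (M : Module A) : mact M \o free_unit (mcar M) == idm _.
Proof.
  unfold free_unit; la; rewrite mact_one; apply iso_invr.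
Qed.

Lemma free_unit_natural {x y : T} (f : hom x y) :
  free_unit y \o f == (idm (acar A) ⊠ f) \o free_unit x.
Proof.
  assert (E : iso_inv (lunit y) \o f == (idm one ⊠ f) \o iso_inv (lunit x)).
  { symmetry; apply (iso_mono (i := lunit y)); la.
    rewrite lunit_natural, iso_invr; rw (iso_invr (lunit x)); now idc. }
  unfold free_unit; rewrite comp_assoc, E; la.
  now rewrite <- tens_lr, <- tens_rl.
Qed.

Lemma act_free_unit (x : T) :
  mact (free_module A x) \o (idm (acar A) ⊠ free_unit x) == idm _.
Proof.
  cbn; unfold free_unit; rewrite tens_r_comp; la.
  rw (assoc_inv_natural (idm (acar A)) (aone A) (idm x)).
  rw (symmetry (tens_l_comp (w := x) (amul A) (idm (acar A) ⊠ aone A))).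
  rewrite amul_oner, unit_triangle_inv, <- tens_r_comp, iso_invr.
  apply tensm_id.
Qed.

Definition free_lin {x : T} (N : Module A) (f : hom x (mcar N)) :
  ModHom (free_module A x) N.
Proof.
  refine (@MkModHom T mT A (free_module A x) N (mact N \o (idm (acar A) ⊠ f)) _).
  cbn; la.
  assert (E : (idm (acar A) ⊠ f) \o (amul A ⊠ idm x)
    == (amul A ⊠ idm (mcar N)) \o ((idm (acar A) ⊠ idm (acar A)) ⊠ f))
    by (rewrite !tensm_split, tensm_id; now idc).
  rw E; rewrite mact_assoc.
  rw (symmetry (assoc_inv_natural (idm (acar A)) (idm (acar A)) f)).
  rw (iso_invr (assoc A A (mcar N))); rewrite comp_idr, tens_r_comp; now la.
Defined.

Lemma free_lin_unit {x : T} (N : Module A) (f : hom x (mcar N)) :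
  free_lin f \o free_unit x == f.
Proof.
  cbn; la; rewrite comp_assoc, <- free_unit_natural; la.
  rewrite mact_free_unit; now idc.
Qed.

Lemma free_lin_eta {x : T} (N : Module A) (h : ModHom (free_module A x) N) :
  mact N \o (idm (acar A) ⊠ (h \o free_unit x)) == h.
Proof.
  rewrite tens_r_comp; la; rewrite <- mhom_linear; la.
  rewrite comp_assoc; pose proof (act_free_unit x) as E; cbn in E.
  cbn; rewrite E; now idc.
Qed.

Lemma free_lin_ext {x : T} (N : Module A) (h h' : ModHom (free_module A x) N) :
  h \o free_unit x == h' \o free_unit x -> mhom h == mhom h'.
Proof.
  intros E; now rewrite <- (free_lin_eta h), <- (free_lin_eta h'), E.
Qed.

Section Separable.
Context (s : hom A (A ⊗ A))
  (s1 : amul A \o s == idm (acar A))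
  (s2 : (idm (acar A) ⊠ amul A) \o assoc A A A \o (s ⊠ idm (acar A)) == s \o amul A)
  (s3 : (amul A ⊠ idm (acar A)) \o iso_inv (assoc A A A) \o (idm (acar A) ⊠ s)
          == s \o amul A).

(* The A-linear section of the action A ⊗ M -> M given by the separability
   idempotent s(1). *)
Definition section_hom (M : Module A) : hom (mcar M) (A ⊗ mcar M) :=
  (idm (acar A) ⊠ mact M) \o assoc A A (mcar M) \o ((s \o aone A) ⊠ idm (mcar M))
    \o iso_inv (lunit (mcar M)).

Lemma mact_section (M : Module A) : mact M \o section_hom M == idm _.
Proof.
  unfold section_hom; la; rewrite <- mact_assoc.
  rw (symmetry (tens_l_comp (w := mcar M) (amul A) (s \o aone A))).
  rewrite s1, comp_idl, mact_one; apply iso_invr.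
Qed.

Lemma lunit_inv_natural {x y : T} (f : hom x y) :
  iso_inv (lunit y) \o f == (idm one ⊠ f) \o iso_inv (lunit x).
Proof.
  symmetry; apply (iso_mono (i := lunit y)); la.
  rewrite lunit_natural, iso_invr; rw (iso_invr (lunit x)); now idc.
Qed.

Lemma section_natural (M N : Module A) (f : ModHom M N) :
  (idm (acar A) ⊠ f) \o section_hom M == section_hom N \o f.
Proof.
  unfold section_hom; rw (lunit_inv_natural (mhom f)).
  rewrite <- tens_r_comp, mhom_linear, tens_r_comp.
  rw (symmetry (assoc_natural (idm (acar A)) (idm (acar A)) f)).
  rewrite tensm_id.
  rw (tensm_split (idm (A ⊗ A)) (s \o aone A) f (idm (mcar M))).
  rw (tensm_split (s \o aone A) (idm one) (idm (mcar N)) f); now idc.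
Qed.

(** Both sides equal the map a ⊗ m -> s(a) m: the left one by the first bimodule identity of [s],
    the right one by the second. *)
Lemma section_linear (M : Module A) :
  section_hom M \o mact M
    == mact (free_module A (mcar M)) \o (idm (acar A) ⊠ section_hom M).
Proof.
  assert (L : section_hom M \o mact M ==
    (idm (acar A) ⊠ mact M) \o assoc (acar A) (acar A) (mcar M) \o (s ⊠ idm (mcar M))).
  { unfold section_hom; rw (lunit_inv_natural (mact M)).
    assert (E1 : ((s \o aone A) ⊠ idm (mcar M)) \o (idm one ⊠ mact M)
      == ((idm (acar A) ⊠ idm (acar A)) ⊠ mact M) \o ((s \o aone A) ⊠ idm ((acar A) ⊗ (mcar M))))
      by (rewrite !tensm_split, tensm_id; now idc).
    rw E1; rw (assoc_natural (idm (acar A)) (idm (acar A)) (mact M)).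
    rw (symmetry (tens_r_comp (w := acar A) (mact M) (idm (acar A) ⊠ mact M))).
    assert (E2 : mact M \o (idm (acar A) ⊠ mact M)
      == mact M \o (amul A ⊠ idm (mcar M)) \o iso_inv (assoc (acar A) (acar A) (mcar M))).
    { rewrite mact_assoc; rw (iso_invr (assoc A A (mcar M))); now idc. }
    rewrite E2, !tens_r_comp; la.
    assert (E3 : (idm (acar A) ⊠ iso_inv (assoc (acar A) (acar A) (mcar M))) \o assoc (acar A) (acar A) ((acar A) ⊗ (mcar M))
      == assoc (acar A) ((acar A) ⊗ (acar A)) (mcar M) \o (assoc (acar A) (acar A) (acar A) ⊠ idm (mcar M)) \o iso_inv (assoc ((acar A) ⊗ (acar A)) (acar A) (mcar M))).
    { apply (iso_epi (i := assoc ((acar A) ⊗ (acar A)) (acar A) (mcar M))).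
      rw (iso_invl (assoc ((acar A) ⊗ (acar A)) (acar A) (mcar M))); rewrite comp_idr.
      apply (iso_mono (i := tens_iso (iso_id (acar A)) (assoc (acar A) (acar A) (mcar M)))); cbn; la.
      rewrite <- tens_r_comp, iso_invr, tensm_id, comp_idl.
      now rewrite pentagon. }
    rw E3.
    assert (E4 : (s \o aone A) ⊠ idm (A ⊗ mcar M)
      == (s \o aone A) ⊠ (idm (acar A) ⊠ idm (mcar M))) by now rewrite tensm_id.
    rw E4.
    rw (assoc_inv_natural (s \o aone A) (idm (acar A)) (idm (mcar M))).
    rw (symmetry (assoc_natural (idm (acar A)) (amul A) (idm (mcar M)))).
    rw (symmetry (tens_l_comp (w := mcar M) (idm (acar A) ⊠ amul A) (assoc (acar A) (acar A) (acar A)))).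
    rw (symmetry (tens_l_comp (w := mcar M) ((idm (acar A) ⊠ amul A) \o assoc (acar A) (acar A) (acar A)) ((s \o aone A) ⊠ idm (acar A)))).
    rewrite (tens_l_comp (w := acar A) s (aone A)); la.
    rewrite s2, (comp_assoc s), amul_onel, tens_l_comp; la.
    rw (lunit_tens_inv (acar A) (mcar M)).
    rw (iso_invr (lunit ((acar A) ⊗ (mcar M)))); now idc. }
  rewrite L; clear L; symmetry; cbn.
  unfold section_hom; rewrite !tens_r_comp; la.
  rw (assoc_inv_natural (idm (acar A)) (idm (acar A)) (mact M)).
  assert (E1 : (amul A ⊠ idm (mcar M)) \o ((idm (acar A) ⊠ idm (acar A)) ⊠ mact M)
    == (idm (acar A) ⊠ mact M) \o (amul A ⊠ (idm (acar A) ⊠ idm (mcar M))))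
    by (rewrite !tensm_split, !tensm_id; now idc).
  rw E1.
  assert (E3 : iso_inv (assoc (acar A) (acar A) ((acar A) ⊗ (mcar M))) \o (idm (acar A) ⊠ assoc (acar A) (acar A) (mcar M))
    == assoc ((acar A) ⊗ (acar A)) (acar A) (mcar M) \o (iso_inv (assoc (acar A) (acar A) (acar A)) ⊠ idm (mcar M))
         \o iso_inv (assoc (acar A) ((acar A) ⊗ (acar A)) (mcar M))).
  { apply (iso_epi (i := assoc (acar A) ((acar A) ⊗ (acar A)) (mcar M))).
    rw (iso_invl (assoc (acar A) ((acar A) ⊗ (acar A)) (mcar M))); rewrite comp_idr.
    apply (iso_mono (i := assoc (acar A) (acar A) ((acar A) ⊗ (mcar M)))); la.
    rewrite iso_invr, comp_idl.
    rewrite <- pentagon; la.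
    rw (symmetry (tens_l_comp (w := mcar M) (assoc (acar A) (acar A) (acar A)) (iso_inv (assoc (acar A) (acar A) (acar A))))).
    rewrite iso_invr, tensm_id; now idc. }
  rw E3.
  rw (symmetry (assoc_natural (amul A) (idm (acar A)) (idm (mcar M)))).
  rw (assoc_inv_natural (idm (acar A)) (s \o aone A) (idm (mcar M))).
  rw (symmetry (tens_l_comp (w := mcar M) (amul A ⊠ idm (acar A)) (iso_inv (assoc (acar A) (acar A) (acar A))))).
  rw (symmetry (tens_l_comp (w := mcar M) ((amul A ⊠ idm (acar A)) \o iso_inv (assoc (acar A) (acar A) (acar A))) (idm (acar A) ⊠ (s \o aone A)))).
  rewrite (tens_r_comp (w := acar A) s (aone A)); la.
  rewrite s3, (comp_assoc s), amul_oner, tens_l_comp; la.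
  rw (unit_triangle_inv (acar A) (mcar M)).
  rw (symmetry (tens_r_comp (w := acar A) (lunit (mcar M)) (iso_inv (lunit (mcar M))))).
  rewrite iso_invr, tensm_id; now idc.
Qed.

Definition section_mor (M : Module A) : ModHom M (free_module A (mcar M)) :=
  @MkModHom T mT A M (free_module A (mcar M)) (section_hom M) (section_linear M).

(** The separable analogue of averaging over a group: a projection of the morphisms of T onto the
    linear ones, compatible with composition by linear maps on either side. *)
Definition average {M N : Module A} (f : hom (mcar M) (mcar N)) : ModHom M N :=
  (free_lin f : hom (free_module A (mcar M) : module_cat A) N) \o section_mor M.

Lemma average_proper (M N : Module A) (f g : hom (mcar M) (mcar N)) :
  f == g -> mhom (average f) == mhom (average g).
Proof. intros E; cbn; now rewrite E. Qed.

Lemma average_linear (M N : Module A) (f : ModHom M N) :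
  mhom (average (mhom f)) == f.
Proof.
  cbn; rewrite <- mhom_linear; la; rewrite comp_assoc, mact_section; now idc.
Qed.

Lemma average_post (M N P : Module A) (g : ModHom N P)
    (f : hom (mcar M) (mcar N)) :
  mhom (average (g \o f)) == g \o average f.
Proof.
  cbn; rewrite tens_r_comp; la; now rewrite mhom_linear.
Qed.

Lemma average_pre (M N P : Module A) (g : hom (mcar N) (mcar P))
    (f : ModHom M N) :
  mhom (average (g \o f)) == average g \o f.
Proof.
  cbn; rewrite tens_r_comp; la; now rw (section_natural f).
Qed.
End Separable.
End FreeModules.

Section TensorDist.
Context {o : tri_order} {T : Cat} {tT : TensorTri o T}.

Lemma stens_r_dist n (X : ndiag susp) (a : T) : in_range o n -> dist n X ->
  dist n (nimage (F := tensor_left a) (stens_r a) X).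
Proof.
  intros Hn HX; pose proof (stens_dist a Hn HX) as HD.
  match type of HD with dist _ ?P => pose (Y := P) end.
  assert (I : nisomorphic n Y (nimage (F := tensor_left a) (stens_r a) X)).
  { apply (@nisomorphic_of_iso T _ susp n Y (nimage (F := tensor_left a) (stens_r a) X)
             (fun i j => braid (nob X i j) a)).
    - split; cbn; intros.
      + symmetry; apply braid_natural.
      + la; rewrite <- stens_r_braid.
        now rw (braid_natural (nbd X i j k) (idm a)).
    - intros i j _; exact (is_iso_iso (braid_iso _ _)). }
  exact (dist_iso Hn HD (ntriangle_iso (dist_ntriangle Hn HD) I) I).
Qed.
End TensorDist.

(** * Biproducts, suspension and idempotents of modules *)

Section ModuleTri.
Context {o : tri_order} (ho : valid_order o) {T : Cat} {tT : TensorTri o T}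
  (hT : idempotent_complete T) (hadd : tens_additive (C := T) tt_mon)
  (A : Algebra T) (s : hom A (A ⊗ A))
  (s1 : amul A \o s == idm (acar A))
  (s2 : (idm (acar A) ⊠ amul A) \o assoc A A A \o (s ⊠ idm (acar A)) == s \o amul A)
  (s3 : (amul A ⊠ idm (acar A)) \o iso_inv (assoc A A A) \o (idm (acar A) ⊠ s)
          == s \o amul A).
Notation D := (module_cat A).

Let addl (x y : T) (f g : hom x y) :
  idm (acar A) ⊠ addm f g == addm (idm (acar A) ⊠ f) (idm (acar A) ⊠ g)
  := @tensor_left_additive T _ _ hadd A x y f g.

Let zerol (x y : T) : idm (acar A) ⊠ zerom x y == zerom (A ⊗ x) (A ⊗ y)
  := fmor_zero (@tensor_left_additive T _ _ hadd A) x y.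

Let oppl (x y : T) (f : hom x y) : idm (acar A) ⊠ oppm f == oppm (idm (acar A) ⊠ f)
  := fmor_opp (@tensor_left_additive T _ _ hadd A) f.

Definition module_preadd : PreAdd D.
Proof.
  refine (@Build_PreAdd D
    (fun M N => @MkModHom T tt_mon A M N (zerom (mcar M) (mcar N)) _)
    (fun M N f g => @MkModHom T tt_mon A M N (addm (mhom f) (mhom g)) _)
    (fun M N f => @MkModHom T tt_mon A M N (oppm (mhom f)) _)
    _ _ _ _ _ _ _ _).
Unshelve.
  - intros M N f f' Hf g g' Hg; cbn in *; now rewrite Hf, Hg.
  - intros M N f f' Hf; cbn in *; now rewrite Hf.
  - intros; cbn; apply addm_assoc.
  - intros; cbn; apply addm_comm.
  - intros; cbn; apply addm_zero.
  - intros; cbn; apply addm_opp.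
  - intros; cbn; apply comp_addl.
  - intros; cbn; apply comp_addr.
  - now rewrite zerol, comp_zerol, comp_zeror.
  - now rewrite addl, comp_addl, comp_addr, !mhom_linear.
  - now rewrite oppl, comp_oppl, comp_oppr, mhom_linear.
Defined.
#[local] Existing Instance module_preadd.

Lemma forget_additive : is_additive_functor (forget A).
Proof. intros M N f g; reflexivity. Qed.

Lemma forget_faithful : faithful (forget A).
Proof. intros M N f g E; exact E. Qed.

Lemma module_is_zero (M : D) : is_zero (mcar M) -> is_zero M.
Proof. intros H; apply is_zero_idm; cbn; now apply is_zero_idm. Qed.

Lemma module_is_iso (M N : D) (f : hom M N) : is_iso (mhom f) -> is_iso f.
Proof.
  intros [g [H1 H2]]; cbn in f.
  assert (L : g \o mact N == mact M \o (idm (acar A) ⊠ g)).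
  { apply (split_mono H1); la; rewrite H2, comp_idl, mhom_linear.
    rw (symmetry (tens_r_comp (w := acar A) (mhom f) g)).
    rewrite H2, tensm_id; now idc. }
  exists (@MkModHom T tt_mon A N M g L : hom (c := D) N M); split; assumption.
Qed.

Lemma module_additive : is_additive D.
Proof.
  destruct (tri_additive (Tri := tt_tri)) as [[z Hz] Hb]; split.
  - exists (@MkModule T tt_mon A z (zerom _ _)
      (to_zero _ _ Hz) (to_zero _ _ Hz)); now apply module_is_zero.
  - intros M N.
    destruct (Hb (mcar M) (mcar N)) as [S [i [j [p [q [pi [qj [pj [qi HS]]]]]]]]].
    (* The direct sum action, transported to [S]. As [p] and [q] are jointly monic, the module laws
       are checked after each of them. *)
    pose (act := addm (i \o mact M \o (idm (acar A) ⊠ p))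
                      (j \o mact N \o (idm (acar A) ⊠ q))).
    assert (pa : p \o act == mact M \o (idm (acar A) ⊠ p)).
    { unfold act; rewrite comp_addr; la; rewrite pi, pj, comp_idl, !comp_zerol.
      apply addm_zero_r. }
    assert (qa : q \o act == mact N \o (idm (acar A) ⊠ q)).
    { unfold act; rewrite comp_addr; la; rewrite qi, qj, comp_idl, !comp_zerol.
      apply addm_zero. }
    clearbody act.
    assert (jm : forall t (f g : hom t S), p \o f == p \o g -> q \o f == q \o g -> f == g).
    { intros t f g Hp Hq; rewrite <- (comp_idl f), <- (comp_idl g), <- HS.
      now rewrite !comp_addl, !comp_assoc, Hp, Hq. }
    assert (aux : forall (P : Module A) (k : hom S (mcar P)),
      k \o act == mact P \o (idm (acar A) ⊠ k) ->
      k \o (act \o (amul A ⊠ idm S))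
        == k \o (act \o (idm (acar A) ⊠ act) \o assoc A A S)).
    { intros P k Hk; la; rewrite Hk.
      rw (symmetry (tens_r_comp (w := acar A) k act)); rewrite Hk.
      rw (tensm_split (idm (acar A)) (amul A) k (idm S)); idc.
      rewrite tens_r_comp; la.
      rw (symmetry (assoc_natural (idm (acar A)) (idm (acar A)) k)).
      rw (symmetry (mact_assoc P)).
      rw (tensm_split (amul A) (idm (acar A) ⊠ idm (acar A)) (idm (mcar P)) k).
      rewrite tensm_id; now idc. }
    assert (aux1 : forall (P : Module A) (k : hom S (mcar P)),
      k \o act == mact P \o (idm (acar A) ⊠ k) ->
      k \o (act \o (aone A ⊠ idm S)) == k \o lunit S).
    { intros P k Hk; la; rewrite Hk.
      rw (tensm_split (idm (acar A)) (aone A) k (idm S)); idc.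
      rewrite tens_lr; la; rewrite mact_one; apply lunit_natural. }
    pose (MS := @MkModule T tt_mon A S act
      (jm _ _ _ (aux M p pa) (aux N q qa)) (jm _ _ _ (aux1 M p pa) (aux1 N q qa))).
    assert (Li : i \o mact M == act \o (idm (acar A) ⊠ i)).
    { apply jm; la; rewrite ?pi, ?qi, ?pa, ?qa; la;
        rewrite comp_assoc, <- tens_r_comp, ?pi, ?qi, ?tensm_id, ?zerol.
      - now idc.
      - now rewrite comp_zerol, comp_zeror. }
    assert (Lj : j \o mact N == act \o (idm (acar A) ⊠ j)).
    { apply jm; la; rewrite ?pj, ?qj, ?pa, ?qa; la;
        rewrite comp_assoc, <- tens_r_comp, ?pj, ?qj, ?tensm_id, ?zerol.
      - now rewrite comp_zerol, comp_zeror.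
      - now idc. }
    exists MS, (@MkModHom T tt_mon A M MS i Li), (@MkModHom T tt_mon A N MS j Lj),
      (@MkModHom T tt_mon A MS M p pa), (@MkModHom T tt_mon A MS N q qa).
    cbn; auto.
Qed.

Definition module_susp_ob (M : Module A) : Module A.
Proof.
  refine (@MkModule T tt_mon A (susp (mcar M))
    (fmor susp (mact M) \o stens_r (acar A) (mcar M)) _ _).
  - rewrite <- (fmor_id susp (mcar M)) at 1.
    rw (stens_r_natural (amul A) (idm (mcar M))).
    rewrite tens_r_comp; la.
    rw (stens_r_natural (idm (acar A)) (mact M)).
    rw (symmetry (stens_r_assoc A A (mcar M))).
    now rewrite <- !fmor_comp, mact_assoc.
  - rewrite <- (fmor_id susp (mcar M)) at 1.
    rw (stens_r_natural (aone A) (idm (mcar M))).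
    rewrite <- fmor_comp, mact_one; apply stens_r_lunit.
Defined.

Definition module_susp : Functor D D.
Proof.
  refine (@MkFunctor D D module_susp_ob
    (fun M N f => @MkModHom T tt_mon A (module_susp_ob M) (module_susp_ob N)
       (fmor susp (mhom f)) _) _ _ _).
Unshelve.
  - intros M N f g E; cbn in *; now rewrite E.
  - intros M; cbn; apply fmor_id.
  - intros M N P g f; cbn; apply fmor_comp.
  - cbn; la; rewrite <- fmor_comp, mhom_linear, fmor_comp.
    rw (symmetry (stens_r_natural (idm (acar A)) (mhom f))); now la.
Defined.

Definition forget_susp : NatIso (functor_comp (forget A) module_susp)
    (functor_comp susp (forget A)).
Proof.
  refine (@MkNatIso D T (functor_comp (forget A) module_susp)
    (functor_comp susp (forget A)) (fun M => iso_id (susp (mcar M))) _).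
  intros; cbn; now idc.
Defined.

Lemma module_susp_equivalence : is_equivalence module_susp.
Proof.
  assert (sF : faithful (susp (C := T))) by apply susp_faithful.
  assert (full' : full module_susp).
  { intros M N [f Hf]; cbn in f, Hf.
    destruct (susp_full f) as [g Hg].
    assert (L : g \o mact M == mact N \o (idm (acar A) ⊠ g)).
    { apply sF, (iso_epi (i := stens_r_iso A (mcar M))); rewrite stens_r_isoE.
      rewrite !fmor_comp, Hg; rewrite <- (comp_assoc f) in Hf; rw Hf.
      rw (symmetry (stens_r_natural (idm (acar A)) g)); now rewrite Hg; la. }
    exists (@MkModHom T tt_mon A M N g L); exact Hg. }
  assert (faith' : faithful module_susp)
    by (intros M N f g E; cbn in *; now apply sF).
  apply (ff_equivalence full' faith').
  intros M; destruct (susp_ess_surj (mcar M)) as [y [e]].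
  (* The action on the desuspension [y] is that of [M] carried along [e] and [stens_r_iso], then
     desuspended by fullness. *)
  destruct (susp_full (iso_inv e \o mact M \o (idm (acar A) ⊠ e)
                \o iso_inv (stens_r_iso A y))) as [a Ha].
  assert (Ha' : fmor susp a \o stens_r A y == iso_inv e \o mact M \o (idm (acar A) ⊠ e)).
  { rewrite Ha, <- stens_r_isoE; rw (iso_invl (stens_r_iso A y)); now idc. }
  clear Ha.
  assert (H1 : a \o (amul A ⊠ idm y) == a \o (idm (acar A) ⊠ a) \o assoc A A y).
  { apply sF, (iso_epi (i := stens_r_iso (A ⊗ A) y)); rewrite stens_r_isoE.
    rewrite !fmor_comp; la.
    rw (symmetry (stens_r_natural (amul A) (idm y))).
    rw Ha'; rw (stens_r_assoc A A y).
    rw (symmetry (stens_r_natural (idm (acar A)) a)); rw Ha'.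
    rw (symmetry (tens_r_comp (w := acar A) (fmor susp a) (stens_r A y))).
    rewrite Ha'.
    rw (symmetry (tens_r_comp (w := acar A) e (iso_inv e \o mact M \o (idm (acar A) ⊠ e)))).
    rewrite iso_invr, comp_idl, tens_r_comp; la.
    rw (symmetry (assoc_natural (idm (acar A)) (idm (acar A)) e)).
    rw (symmetry (mact_assoc M)).
    rewrite (comp_assoc _ (amul A ⊠ _) (_ ⊠ _)), (comp_assoc _ (_ ⊠ iso_fwd e) (amul A ⊠ _)).
    rewrite !tensm_split, tensm_id, fmor_id; now idc. }
  assert (H2 : a \o (aone A ⊠ idm y) == lunit y).
  { apply sF, (iso_epi (i := stens_r_iso one y)); rewrite stens_r_isoE.
    rewrite !fmor_comp; la.
    rw (symmetry (stens_r_natural (aone A) (idm y))).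
    rw Ha'; rewrite fmor_id.
    rewrite (comp_assoc _ (_ ⊠ iso_fwd e)), tensm_split; idc.
    rewrite tens_lr; la.
    rw (mact_one M); rw (lunit_natural e).
    rewrite (iso_invl e), stens_r_lunit; now idc. }
  exists (@MkModule T tt_mon A y a H1 H2); constructor.
  assert (L : e \o (fmor susp a \o stens_r A y) == mact M \o (idm (acar A) ⊠ e)).
  { rewrite Ha'; la; rewrite (iso_invr e); now idc. }
  refine (iso_of (x := module_susp (@MkModule T tt_mon A y a H1 H2)) (y := M)
    (f := @MkModHom T tt_mon A (module_susp_ob (@MkModule T tt_mon A y a H1 H2)) M e L) _).
  apply module_is_iso, is_iso_iso.
Qed.

Lemma module_idempotent_complete : idempotent_complete D.
Proof.
  intros M e He; destruct (hT He) as [y [r [i [ri ir]]]]; cbn in e.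
  (* [A] acts on the image [y] through [M]: include, act, retract. Linearity of [e] makes the
     inclusion and the retraction linear. *)
  assert (La : i \o (r \o mact M \o (idm (acar A) ⊠ i)) == mact M \o (idm (acar A) ⊠ i)).
  { la; rewrite ir, mhom_linear; rw (symmetry (tens_r_comp (w := acar A) (mhom e) i)).
    rewrite <- ir; rewrite (comp_assoc i r i), ri; now idc. }
  assert (Ra : r \o mact M == r \o mact M \o (idm (acar A) ⊠ i) \o (idm (acar A) ⊠ r)).
  { rw (symmetry (tens_r_comp (w := acar A) i r)); rewrite ir.
    rw (symmetry (mhom_linear e)); rewrite <- ir; la; rewrite ri; now idc. }
  assert (H1 : (r \o mact M \o (idm (acar A) ⊠ i)) \o (amul A ⊠ idm y)
    == (r \o mact M \o (idm (acar A) ⊠ i))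
         \o (idm (acar A) ⊠ (r \o mact M \o (idm (acar A) ⊠ i))) \o assoc A A y).
  { rw (symmetry (tens_r_comp (w := acar A) i (r \o mact M \o (idm (acar A) ⊠ i)))).
    assert (La' := La); rewrite <- !comp_assoc in La'.
    rewrite La', tens_r_comp; la.
    rw (symmetry (assoc_natural (idm (acar A)) (idm (acar A)) i)).
    rw (symmetry (mact_assoc M)).
    rewrite (comp_assoc _ (amul A ⊠ _) (_ ⊠ _)), (comp_assoc _ (_ ⊠ i) (amul A ⊠ _)).
    rewrite !tensm_split, tensm_id; now idc. }
  assert (H2 : (r \o mact M \o (idm (acar A) ⊠ i)) \o (aone A ⊠ idm y) == lunit y).
  { rewrite (comp_assoc _ (_ ⊠ i)), tensm_split; idc.
    rewrite tens_lr; la; rw (mact_one M); rw (lunit_natural i).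
    rewrite ri; now idc. }
  pose (Y := @MkModule T tt_mon A y _ H1 H2).
  exists Y, (@MkModHom T tt_mon A M Y r Ra), (@MkModHom T tt_mon A Y M i La).
  split; assumption.
Qed.
End ModuleTri.

(** * The triangulation of the category of modules *)

Section ModuleTri.
Context {o : tri_order} (ho : valid_order o) {T : Cat} {tT : TensorTri o T}
  (hT : idempotent_complete T) (hadd : tens_additive (C := T) tt_mon)
  (A : Algebra T) (s : hom A (A ⊗ A))
  (s1 : amul A \o s == idm (acar A))
  (s2 : (idm (acar A) ⊠ amul A) \o assoc A A A \o (s ⊠ idm (acar A)) == s \o amul A)
  (s3 : (amul A ⊠ idm (acar A)) \o iso_inv (assoc A A A) \o (idm (acar A) ⊠ s)
          == s \o amul A).
Notation D := (module_cat A).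
#[local] Instance mpa : PreAdd D := module_preadd hadd A.
Notation Sg := (module_susp A).
Notation avg := (average s2 s3).
Notation und X := (nimage (F := forget A) (fun M => forget_susp A M) X).

Definition module_dist (n : nat) (X : ndiag Sg) : Prop :=
  created_dist (U := forget A) (forget_susp A) n X.

(** This makes averaging commute with the suspension, which the squares with connecting maps
    require. *)
Lemma section_susp (M : Module A) :
  stens_r A (mcar M) \o section_hom s (module_susp_ob M)
    == fmor susp (section_hom s M).
Proof.
  unfold section_hom; cbn; rewrite tens_r_comp; la.
  rw (stens_r_natural (idm (acar A)) (mact M)).
  rw (symmetry (stens_r_assoc A A (mcar M))).
  rewrite <- (fmor_id susp (mcar M)).
  rw (stens_r_natural (s \o aone A) (idm (mcar M))).
  rewrite !fmor_comp; la.
  assert (E : stens_r one (mcar M) \o iso_inv (lunit (susp (mcar M)))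
    == fmor susp (iso_inv (lunit (mcar M)))).
  { apply (iso_mono (i := fiso susp (lunit (mcar M)))); cbn; la.
    rewrite stens_r_lunit, iso_invr, <- fmor_comp, iso_invr, fmor_id; reflexivity. }
  now rw E.
Qed.

Lemma average_susp (M N : Module A) (f : hom (mcar M) (mcar N)) :
  mhom (average s2 s3 (M := module_susp_ob M) (N := module_susp_ob N) (fmor susp f))
    == fmor susp (avg f).
Proof.
  cbn; la; rw (stens_r_natural (idm (acar A)) f).
  now rw (section_susp M); rewrite !fmor_comp; la.
Qed.

Lemma und_nmorphism n (X Y : ndiag Sg) (w : forall i j, hom (nob X i j) (nob Y i j)) :
  is_nmorphism n (X := und X) (Y := und Y) (fun i j => mhom (w i j)) <->
  is_nmorphism n (X := X) (Y := Y) w.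
Proof.
  split.
  - apply (nmorphism_reflect (F := forget A) (th := fun M => forget_susp A M)
      (fun x y f => nat_iso_natural (forget_susp A) f) (@forget_faithful _ _ _ A)
      (fun M => is_iso_iso (forget_susp A M)) (X := X) (Y := Y) (w := w)).
  - apply (nimage_nmorphism (F := forget A) (th := fun M => forget_susp A M)
      (fun x y f => nat_iso_natural (forget_susp A) f) (X := X) (Y := Y) (w := w)).
Qed.

Lemma module_extend_morphism n (X Y : ndiag Sg)
    (u : forall i, hom (nob X 0 i) (nob Y 0 i)) :
  in_range o n -> module_dist n X -> module_dist n Y ->
  (forall i, 1 <= i < n ->
     ntr Y 0 i 0 (S i) \o u i == u (S i) \o ntr X 0 i 0 (S i)) ->
  exists w, is_nmorphism n (X := X) (Y := Y) w /\
    (forall i, 1 <= i <= n -> w 0 i == u i).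
Proof.
  intros Hn HX HY Hu.
  destruct (tri_extend_morphism (X := und X) (Y := und Y)
    (u := fun i => mhom (u i)) Hn HX HY) as [w [[W1 W2] Hw]].
  { intros i Hi; exact (Hu i Hi). }
  (* Linear structure maps move in and out of an average. On the base the components are linear
     already, so averaging leaves them unchanged. *)
  exists (fun i j => avg (w i j)); split.
  - split; intros.
    + pose proof (W1 i j i' j' H H0 H1 H2) as E; cbn [ntr nimage] in E.
      change (mhom (ntr Y i j i' j') \o mhom (avg (w i j))
        == mhom (avg (w i' j')) \o mhom (ntr X i j i' j')).
      rewrite <- (average_post s2 s3 (ntr Y i j i' j')), <- (average_pre s2 s3 (w i' j')).
      apply average_proper; exact E.
    + pose proof (W2 i j k H H0) as E; cbn in E; rewrite !comp_idl in E.
      change (mhom (nbd Y i j k) \o mhom (avg (w j k))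
              == fmor susp (mhom (avg (w i j))) \o mhom (nbd X i j k)).
      rewrite <- (average_post s2 s3 (nbd Y i j k)), <- average_susp.
      refine (transitivity _ (average_pre s2 s3 (N := module_susp_ob (nob X i j))
        (P := module_susp_ob (nob Y i j)) (fmor susp (w i j)) (nbd X i j k))).
      apply (average_proper s2 s3 (N := module_susp_ob (nob Y i j))); exact E.
  - intros i Hi.
    change (mhom (avg (w 0 i)) == mhom (u i)).
    rewrite <- (average_linear s1 s2 s3 (u i)); apply average_proper; exact (Hw i Hi).
Qed.

Definition free_susp (x : T) : hom (free A (susp x)) (Sg (free A x)).
Proof.
  refine (@MkModHom T tt_mon A (free_module A (susp x)) (module_susp_ob (free_module A x))
            (stens_r A x) _).
  cbn; rewrite fmor_comp; la.
  assert (E : fmor susp (iso_inv (assoc A A x)) \o stens_r A (A ⊗ x)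
      \o (idm (acar A) ⊠ stens_r A x)
    == stens_r (A ⊗ A) x \o iso_inv (assoc A A (susp x))).
  { apply (iso_epi (i := assoc A A (susp x))).
    rw (iso_invl (assoc A A (susp x))); rewrite comp_idr.
    rw (symmetry (stens_r_assoc A A x)).
    rewrite <- fmor_comp, iso_invl, fmor_id; now idc. }
  rw E; rewrite <- (fmor_id susp x).
  now rw (stens_r_natural (amul A) (idm x)).
Defined.

Notation freed X := (nimage (F := free A) free_susp X).

Lemma freed_dist n (X : ndiag (susp (C := T))) :
  in_range o n -> dist n X -> module_dist n (freed X).
Proof.
  intros Hn HX; pose proof (stens_r_dist (acar A) Hn HX) as HD.
  assert (I : nisomorphic n (nimage (F := tensor_left (acar A)) (stens_r A) X)
                (und (freed X))).
  { unfold nimage; cbn; apply nisomorphic_ext; intros; [reflexivity | now idc]. }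
  exact (dist_iso Hn HD (ntriangle_iso (dist_ntriangle Hn HD) I) I).
Qed.

Lemma module_ntriangle n (X : ndiag Sg) : in_range o n -> module_dist n X ->
  is_ntriangle n X.
Proof.
  apply (created_ntriangle (sI := forget_susp A) (@forget_faithful _ _ _ A)
           (forget_additive hadd (A := A))).
Qed.

Lemma module_dist_retract n (X Y : ndiag Sg) : in_range o n ->
  is_ntriangle n Y -> module_dist n X -> nretract n Y X -> module_dist n Y.
Proof.
  intros Hn TY HX HR; refine (dist_retract ho Hn _ HX _).
  - refine (nimage_ntriangle (fun x y f => nat_iso_natural (forget_susp A) f) _ TY).
    intros x; apply (fmor_is_zero (forget_additive hadd (A := A))).
  - exact (nimage_retract (fun x y f => nat_iso_natural (forget_susp A) f) HR).
Qed.

Definition act_mor (M : Module A) : hom (free A (mcar M)) (M : D) :=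
  free_lin (idm (mcar M)).

Lemma act_morE (M : Module A) : mhom (act_mor M) == mact M.
Proof. cbn; rewrite tensm_id; apply comp_idr. Qed.

Definition sec_mor (M : D) : hom M (free A (mcar M)) := section_mor s2 s3 M.

Lemma act_mor_section (M : Module A) :
  act_mor M \o sec_mor M == idm (c := D) M.
Proof.
  change (mhom (act_mor M) \o section_hom s M == idm (mcar M)).
  rewrite act_morE; exact (mact_section s1 M).
Qed.

Lemma section_mor_natural (M N : D) (f : hom M N) :
  fmor (free A) (mhom f) \o sec_mor M == sec_mor N \o f.
Proof. exact (section_natural s f). Qed.

Lemma act_mor_natural (M N : D) (f : hom M N) :
  f \o act_mor M == act_mor N \o fmor (free A) (mhom f).
Proof.
  change (mhom f \o mhom (act_mor M) == mhom (act_mor N) \o (idm (acar A) ⊠ mhom f)).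
  rewrite !act_morE; apply mhom_linear.
Qed.

(* The idempotents [p i \o q i] of the base lift to an idempotent of [Y]. *)
Lemma module_split_base n (b : nat -> D) (f : forall i, hom (b i) (b (S i)))
    (Y : ndiag Sg) (p : forall i, hom (b i) (nob Y 0 i))
    (q : forall i, hom (nob Y 0 i) (b i)) :
  in_range o n -> module_dist n Y ->
  (forall i, 1 <= i <= n -> q i \o p i == idm (b i)) ->
  (forall i, 1 <= i < n -> ntr Y 0 i 0 (S i) \o p i == p (S i) \o f i) ->
  (forall i, 1 <= i < n -> f i \o q i == q (S i) \o ntr Y 0 i 0 (S i)) ->
  exists X, module_dist n X /\ nextends n X f.
Proof.
  intros Hn HF qp Np Nq.
  pose proof (module_ntriangle Hn HF) as TF.
  destruct (module_extend_morphism (X := Y) (Y := Y)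
    (u := fun i => p i \o q i) Hn HF HF) as [w [Hw Hb]].
  { intros i Hi; la; rewrite Np, comp_assoc, Nq by assumption; now la. }
  assert (aS : is_additive_functor Sg) by
    (apply (equivalence_additive (module_susp_equivalence A)), module_additive).
  assert (w0 : forall i, 1 <= i <= n -> w 0 i \o w 0 i == w 0 i).
  { intros i Hi; rewrite Hb by assumption; la.
    now rewrite (comp_assoc (p i)), qp, comp_idr by assumption. }
  destruct (nlift_idempotent aS Hw) as [e [He [ee Ee]]].
  { intros i j Hij.
    pose proof (nmorphism_add aS (nmorphism_comp Hw Hw) (nmorphism_opp aS Hw)) as Hh.
    (* [w] is idempotent on the base, so w w - w vanishes there. Exactness is available for the
       underlying diagram in T, and the square is shown to be zero in T. *)
    refine (square_zero (X := und Y)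
      (h := fun i j => mhom (subm (w i j \o w i j) (w i j)))
      susp_additive (dist_nt Hn HF) (dist_hexact ho Hn HF) _ _ Hij).
    - apply und_nmorphism; exact Hh.
    - intros k Hk; exact (proj2 (subm_eq _ _) (w0 k Hk)). }
  assert (e0 : forall i, 1 <= i <= n -> e 0 i == p i \o q i).
  { intros i Hi; rewrite (Ee 0 i (w0 i Hi)); now apply Hb. }
  clear w Hw Hb w0 Ee.
  destruct (nsplit (module_idempotent_complete hT (A := A)) TF He ee)
    as [Z [i' [r [TZ [Hs [Hr [ri ir]]]]]]].
  exists Z; split.
  - apply (module_dist_retract (X := Y)); trivial.
    exists i', r; auto.
  - exists (fun i => r 0 i \o p i); split.
    + intros i Hi; exists (q i \o i' 0 i).
      assert (E1 : (q i \o i' 0 i) \o (r 0 i \o p i) == idm (b i)).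
      { la; rewrite (comp_assoc (q i)), ir, e0 by lia; la.
        rewrite qp, comp_idl by assumption; now apply qp. }
      assert (E2 : (r 0 i \o p i) \o (q i \o i' 0 i) == idm _).
      { la; rewrite (comp_assoc (r 0 i)), <- e0, <- ir by lia; la.
        rewrite ri, comp_idl by lia; apply ri; lia. }
      now split.
    + intros i Hi; la; rewrite (proj1 Hr) by lia.
      rewrite comp_assoc, Np by assumption; now la.
Qed.

Lemma module_extend_base n (b : nat -> D) (f : forall i, hom (b i) (b (S i))) :
  in_range o n -> exists X, module_dist n X /\ nextends n X f.
Proof.
  intros Hn.
  destruct (tri_extend_base (b := fun i => mcar (b i)) (fun i => mhom (f i)) Hn)
    as [X [HX HE]].
  destruct (nextends_inv HE) as [v [v' [Hv [N1 N2]]]].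
  pose proof (freed_dist Hn HX) as HF.
  pose (p := fun i => fmor (free A) (v i) \o sec_mor (b i)
          : hom (b i) (nob (freed X) 0 i)).
  pose (q := fun i => act_mor (b i) \o fmor (free A) (v' i)
          : hom (nob (freed X) 0 i) (b i)).
  assert (qp : forall i, 1 <= i <= n -> q i \o p i == idm (b i)).
  { intros i Hi; unfold p, q.
    change (act_mor (b i) \o fmor (free A) (v' i) \o (fmor (free A) (v i) \o sec_mor (b i))
      == idm (b i)).
    la; rewrite (comp_assoc (act_mor _)), <- fmor_comp.
    rewrite (proj1 (Hv i Hi)), fmor_id, comp_idr; apply act_mor_section. }
  assert (Np : forall i, 1 <= i < n ->
    ntr (freed X) 0 i 0 (S i) \o p i == p (S i) \o f i).
  { intros i Hi; unfold p; cbn [ntr nimage].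
    change (fmor (free A) (ntr X 0 i 0 (S i)) \o (fmor (free A) (v i) \o sec_mor (b i))
      == fmor (free A) (v (S i)) \o sec_mor (b (S i)) \o f i).
    la; rewrite <- fmor_comp, N1, fmor_comp by assumption; la.
    rewrite (comp_assoc _ _ (sec_mor (b i))).
    rewrite (section_mor_natural (f i)); now la. }
  assert (Nq : forall i, 1 <= i < n ->
    f i \o q i == q (S i) \o ntr (freed X) 0 i 0 (S i)).
  { intros i Hi; unfold q; cbn [ntr nimage].
    change (f i \o (act_mor (b i) \o fmor (free A) (v' i))
      == act_mor (b (S i)) \o fmor (free A) (v' (S i))
           \o fmor (free A) (ntr X 0 i 0 (S i))).
    la; rewrite act_mor_natural, !comp_assoc, <- !fmor_comp, N2 by assumption.
    reflexivity. }
  exact (module_split_base Hn HF qp Np Nq).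
Qed.

(** The octahedral axiom stays a parameter: for the algebra G(1) it is brought over from S along the
    comparison functor. *)
Definition module_tri
  (Ho : o = Verdier -> forall (b : nat -> D) (f : forall i, hom (b i) (b (S i))),
       exists X : ndiag Sg, is_ntriangle 3 X /\ nextends 3 X f /\
         (forall phi, monotone_upto 2 3 phi ->
            phi 0 < phi 1 -> phi 1 < phi 2 -> module_dist 2 (nreindex phi X))) :
  Tri o D :=
  tri_create (sI := forget_susp A) (module_additive hadd A)
    (module_susp_equivalence A)
    (@forget_faithful _ _ _ A) (forget_additive hadd (A := A))
    module_extend_base module_extend_morphism Ho.
End ModuleTri.

(** * The adjunction and the comparison functor *)

Section Adjoint.
Context {T S : Cat} {F : Functor T S} {G : Functor S T} (adj : Adjunction F G).
Notation eta := (unit_adj adj).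
Notation eps := (counit_adj adj).

Lemma adj_l {t : T} {s : S} (f : hom (F t) s) :
  eps s \o fmor F (fmor G f \o eta t) == f.
Proof.
  rewrite fmor_comp; la; rewrite counit_natural; rw (adj_triangle_l adj t); now idc.
Qed.

Lemma adj_r {t : T} {s : S} (g : hom t (G s)) :
  fmor G (eps s \o fmor F g) \o eta t == g.
Proof.
  rewrite fmor_comp; rw (symmetry (unit_natural adj g)).
  rw (adj_triangle_r adj s); now idc.
Qed.

Lemma right_adjoint_additive {aT : PreAdd T} {aS : PreAdd S} :
  is_additive_functor F -> is_additive_functor G.
Proof.
  intros hF x y f g; apply (adj_faithful (adj := adj)).
  now rewrite hF, comp_addr, !counit_natural, comp_addl.
Qed.
End Adjoint.

(** * The right adjoint of a triangulated functor *)

Section TriAdjoint.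
Context {o : tri_order} (ho : valid_order o) {T S : Cat} {tT : Tri o T} {tS : Tri o S}
  {F : Functor T S} (tF : TriFunctor F) {G : Functor S T} (adj : Adjunction F G).
Notation eta := (unit_adj adj).
Notation eps := (counit_adj adj).
Notation phi t := (trif_susp tF t).

Lemma G_additive : is_additive_functor G.
Proof. apply (right_adjoint_additive adj), (trif_additive tF). Qed.

Lemma phi_natural (x y : T) (f : hom x y) :
  phi y \o fmor F (fmor susp f) == fmor susp (fmor F f) \o phi x.
Proof. exact (trif_is_natural tF f). Qed.

(** The mate, under the adjunction, of the isomorphism between F Sigma and Sigma F. *)
Definition susp_mate (s : S) : hom (susp (G s)) (G (susp s)) :=
  fmor G (fmor susp (eps s) \o phi (G s)) \o eta (susp (G s)).

Lemma susp_mate_counit (s : S) :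
  eps (susp s) \o fmor F (susp_mate s) == fmor susp (eps s) \o phi (G s).
Proof. exact (adj_l adj (t := susp (G s)) (s := susp s) _). Qed.

Lemma susp_mate_counit' (s : S) {t : T} (g : hom t (G s)) :
  eps (susp s) \o fmor F (susp_mate s \o fmor susp g)
    == fmor susp (eps s \o fmor F g) \o phi t.
Proof.
  rewrite fmor_comp; la; rewrite susp_mate_counit; rw (phi_natural g).
  now rewrite fmor_comp.
Qed.

Lemma susp_mate_natural (x y : S) (f : hom x y) :
  susp_mate y \o fmor susp (fmor G f) == fmor G (fmor susp f) \o susp_mate x.
Proof.
  apply (adj_faithful (adj := adj)); rewrite susp_mate_counit', (fmor_comp F); la.
  rewrite !counit_natural, (comp_assoc (fmor susp f)), susp_mate_counit; la.
  now rewrite fmor_comp.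
Qed.

Lemma yoneda_susp {x y : T} (f : hom x y) :
  (forall t (v : hom (susp t) y), exists u : hom (susp t) x, f \o u == v) ->
  (forall t (u u' : hom (susp t) x), f \o u == f \o u' -> u == u') -> is_iso f.
Proof.
  intros Hs Hi; apply yoneda_iso.
  - intros t v; destruct (susp_ess_surj t) as [t' [e]].
    destruct (Hs t' (v \o e)) as [u Hu]; exists (u \o iso_inv e).
    la; rewrite Hu; rw (iso_invr e); now idc.
  - intros t u u' E; destruct (susp_ess_surj t) as [t' [e]].
    apply (iso_epi (i := e)), Hi; la; now rewrite E.
Qed.

(** Tested on maps from suspensions, which are all objects up to isomorphism: by adjunction and full
    faithfulness of [susp], a map from Sigma t to either side is the same as a map F t -> s. *)
Lemma susp_mate_is_iso (s : S) : is_iso (susp_mate s).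
Proof.
  apply yoneda_susp.
  - intros t v.
    destruct (susp_full (eps (susp s) \o fmor F v \o iso_inv (phi t))) as [g Hg].
    exists (fmor susp (fmor G g \o eta t)).
    apply (adj_faithful (adj := adj)); rewrite susp_mate_counit', adj_l, Hg.
    rw (iso_invl (phi t)); now idc.
  - intros t u u' E.
    destruct (susp_full u) as [a Ha]; destruct (susp_full u') as [a' Ha'].
    rewrite <- Ha, <- Ha' in E |- *.
    assert (E' : eps (susp s) \o fmor F (susp_mate s \o fmor susp a)
      == eps (susp s) \o fmor F (susp_mate s \o fmor susp a')) by now rewrite E.
    rewrite !susp_mate_counit' in E'; apply (iso_epi (i := phi t)) in E'.
    apply susp_faithful in E'; apply (adj_faithful (adj := adj)) in E'.
    now rewrite E'.
Qed.

Definition gamma : NatIso (functor_comp G susp) (functor_comp susp G).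
Proof.
  refine (@MkNatIso S T (functor_comp G susp) (functor_comp susp G)
    (fun s => iso_sym (iso_of (susp_mate_is_iso s))) _).
  intros x y f; cbn.
  apply (iso_mono (i := iso_of (susp_mate_is_iso y))); la.
  rewrite iso_invr, comp_idl.
  apply (iso_epi (i := iso_of (susp_mate_is_iso x))).
  rw (iso_invl (iso_of (susp_mate_is_iso x))); rewrite comp_idr.
  symmetry; apply susp_mate_natural.
Defined.

Lemma gamma_mate (s : S) : gamma s \o susp_mate s == idm _.
Proof. exact (iso_invl (iso_of (susp_mate_is_iso s))). Qed.

Lemma mate_gamma (s : S) : susp_mate s \o gamma s == idm _.
Proof. exact (iso_invr (iso_of (susp_mate_is_iso s))). Qed.

Lemma gamma_natural (x y : S) (f : hom x y) :
  gamma y \o fmor G (fmor susp f) == fmor susp (fmor G f) \o gamma x.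
Proof. exact (nat_iso_natural gamma f). Qed.

Notation imG X := (nimage (F := G) (fun s => gamma s) X).

Lemma G_ntriangle n (X : ndiag (susp (Tri := tS))) :
  is_ntriangle n X -> is_ntriangle n (imG X).
Proof.
  apply nimage_ntriangle; [exact gamma_natural|].
  intros x; apply (fmor_is_zero G_additive).
Qed.

(** Maps t -> G y are maps F t -> y, so exactness of X at F t gives exactness of its image at t; the
    suspended place also uses the mate. *)
Lemma G_hexact n (X : ndiag (susp (Tri := tS))) :
  hexact n X -> hexact n (imG X).
Proof.
  intros HX t i j Hij; destruct (HX (F t) i j Hij) as [Ha [Hb Hc]]; cbn.
  split; [|split]; intros v Hv.
  - destruct (Ha (eps _ \o fmor F v)) as [u Hu].
    { la; rewrite <- counit_natural, comp_assoc, <- fmor_comp, Hv.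
      rewrite (fmor_zero (trif_additive tF)); apply comp_zeror. }
    exists (fmor G u \o eta t); apply (adj_faithful (adj := adj)).
    rewrite Hu, fmor_comp; la; rewrite counit_natural, comp_assoc.
    now rewrite adj_l.
  - destruct (Hb (eps _ \o fmor F v)) as [u Hu].
    { la; rewrite <- counit_natural, comp_assoc, <- fmor_comp.
      assert (E : fmor G (nbd X 0 i j) \o v == zerom _ _).
      { apply (iso_mono (i := gamma (nob X 0 i))); la; rewrite Hv.
        now rewrite comp_zeror. }
      rewrite E, (fmor_zero (trif_additive tF)); apply comp_zeror. }
    exists (fmor G u \o eta t); apply (adj_faithful (adj := adj)).
    rewrite Hu, fmor_comp; la; rewrite counit_natural, comp_assoc.
    now rewrite adj_l.
  - destruct (Hc (eps _ \o fmor F (susp_mate _ \o v))) as [u Hu].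
    { la; rewrite <- counit_natural, comp_assoc, <- fmor_comp; la.
      rewrite <- susp_mate_natural, comp_assoc, Hv, comp_zeror.
      rewrite (fmor_zero (trif_additive tF)); apply comp_zeror. }
    exists (fmor G u \o eta t).
    assert (E : susp_mate _ \o v == fmor G (nbd X 0 i j) \o (fmor G u \o eta t)).
    { apply (adj_faithful (adj := adj)).
      rewrite Hu, fmor_comp; la; rewrite counit_natural, comp_assoc.
      now rewrite adj_l. }
    rewrite comp_assoc, <- E; la; rewrite gamma_mate; now idc.
Qed.

(** Take a distinguished [Y] on the base of G X. The counits on the base extend to F Y -> X, and the
    transpose Y -> G X is invertible on the base, being there the inverse of the identification
    [v]. *)
Lemma G_dist n (X : ndiag (susp (Tri := tS))) :
  in_range o n -> dist n X -> dist n (imG X).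
Proof.
  intros Hn HX.
  destruct (tri_extend_base (fun i => fmor G (ntr X 0 i 0 (Datatypes.S i))) Hn) as [Y [HY HE]].
  destruct (nextends_inv HE) as [v [v' [Hv [N1 N2]]]].
  pose proof (trif_dist tF Hn HY) as HFY.
  destruct (tri_extend_morphism (X := nimage (F := F) (fun x => trif_susp tF x) Y)
    (Y := X) (u := fun i => eps (nob X 0 i) \o fmor F (v' i)) Hn HFY HX)
    as [w [[W1 W2] Hw]].
  { intros i Hi; cbn; la; rewrite <- counit_natural, comp_assoc, <- fmor_comp.
    now rewrite N2, fmor_comp by assumption; la. }
  cbn in w, W1, W2, Hw.
  apply (@dist_criterion o T tT ho n Y (imG X)
           (fun i j => fmor G (w i j) \o eta (nob Y i j)) Hn HY).
  - apply G_ntriangle, (dist_ntriangle Hn HX).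
  - apply G_hexact, (dist_hexact ho Hn HX).
  - split; cbn; intros.
    + la; rewrite <- fmor_comp, W1, fmor_comp by assumption.
      rewrite !comp_assoc; now rewrite unit_natural.
    + rewrite !comp_assoc;
      assert (E : fmor G (nbd X i j k) \o (fmor G (w j k) \o eta (nob Y j k))
        == susp_mate (nob X i j) \o fmor susp (fmor G (w i j) \o eta (nob Y i j))
             \o nbd Y i j k).
      { apply (adj_faithful (adj := adj)).
        rewrite (fmor_comp F (susp_mate _ \o _)); la.
        rewrite susp_mate_counit', adj_l.
        rewrite !(fmor_comp F); la; rewrite counit_natural.
        rw (counit_natural adj (w j k)); rw (adj_triangle_l adj (nob Y j k)).
        rewrite comp_idr, W2 by assumption; now la. }
      rewrite E; la; pose proof (gamma_mate (nob X i j)) as E'; cbn in E'.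
      cbn; now rewrite E', comp_idl.
  - intros i Hi; cbn; apply (is_iso_proper (f := v' i)).
    + rewrite (Hw i Hi); symmetry; apply adj_r.
    + exists (v i); now destruct (Hv i Hi).
Qed.

End TriAdjoint.

(** * Free modules and the comparison functor *)

Section MonAdjoint.
Context {T S : Cat} {mT : SymMon T} {mS : SymMon S} {F : Functor T S}
  (mF : MonFunctor F) {G : Functor S T} (adj : Adjunction F G).
Notation eta := (unit_adj adj).
Notation eps := (counit_adj adj).
Notation A := (unit_algebra mF adj).
Notation K := (comparison mF adj).

Lemma act_counit (s : S) :
  eps s \o fmor F (mact (comparison_module mF adj s)) \o monf mF (G one) (G s)
    == lunit s \o (eps one ⊠ eps s).
Proof.
  cbn; rewrite fmor_comp; la; rewrite counit_natural, !comp_assoc.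
  rewrite <- (comp_assoc (eps (one ⊗ s))), lax_counit; reflexivity.
Qed.

Definition theta (t : T) : hom (free A t) (K (F t)) :=
  free_lin (N := comparison_module mF adj (F t)) (eta t).

Lemma theta_counit (t : T) :
  eps (F t) \o fmor F (mhom (theta t)) \o monf mF (G one) t
    == lunit (F t) \o (eps one ⊠ idm (F t)).
Proof.
  unfold theta; cbn -[comparison_module].
  change (eps (F t) \o fmor F (mact (comparison_module mF adj (F t)) \o (idm (G one) ⊠ eta t))
    \o monf mF (G one) t == lunit (F t) \o (eps one ⊠ idm (F t))).
  rewrite fmor_comp; la; rewrite (comp_assoc _ _ (monf mF (G one) t)).
  rewrite (monf_natural_r mF (x := G one) (eta t)); la.
  rewrite act_counit; la; rewrite comp_assoc, tensm_split.
  now rewrite adj_triangle_l, comp_idr.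
Qed.

Lemma theta_unit (t : T) : mhom (theta t) \o free_unit (A := A) t == eta t.
Proof. apply (@free_lin_unit T mT A t (comparison_module mF adj (F t))). Qed.

Lemma theta_natural {x y : T} (f : hom x y) :
  theta y \o fmor (free A) f == fmor K (fmor F f) \o theta x.
Proof.
  apply (@free_lin_ext T mT A x (comparison_module mF adj (F y))
    (theta y \o fmor (free A) f : hom (c := module_cat A) _ _)
    (fmor K (fmor F f) \o theta x : hom (c := module_cat A) _ _)).
  change (mhom (theta y) \o (idm (G one) ⊠ f) \o free_unit (A := A) x
    == fmor G (fmor F f) \o mhom (theta x) \o free_unit (A := A) x).
  rewrite !comp_assoc, theta_unit, <- unit_natural.
  pose proof (free_unit_natural (A := A) f) as E; cbn in E; rewrite <- E.
  la; now rewrite theta_unit.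
Qed.

Lemma projection_counit (t : T) (s : S) :
  eps (F t ⊗ s) \o fmor F (projection_map mF adj t s) \o monf mF t (G s)
    == idm (F t) ⊠ eps s.
Proof.
  unfold projection_map; rewrite <- fmor_comp, adj_l; la.
  rewrite comp_assoc, iso_invl; now idc.
Qed.

(** Both sides have the same transpose in S. So [theta] is the projection map at s = 1 up to a
    unitor and a braiding, and the projection formula makes it invertible. *)
Lemma theta_projection (t : T) :
  mhom (theta t) == fmor G (runit (F t)) \o projection_map mF adj t one \o braid (G one) t.
Proof.
  apply (adj_faithful (adj := adj)).
  apply (iso_epi (i := monf mF (G one) t)); rewrite theta_counit.
  rewrite !fmor_comp; la; rewrite counit_natural.
  rewrite (comp_assoc _ _ (monf mF (G one) t)), monf_braid; la.
  rewrite (comp_assoc (runit _)), (comp_assoc (runit _)), projection_counit.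
  rewrite comp_assoc, <- braid_natural; la; now rewrite runit_braid.
Qed.

Lemma theta_is_iso (t : T) : right_projection_formula mF adj -> is_iso (theta t).
Proof.
  intros Hp.
  assert (H : is_iso (mhom (theta t))).
  { rewrite theta_projection; apply is_iso_comp; [apply is_iso_comp|].
    - apply is_iso_fmor, is_iso_iso.
    - apply Hp.
    - exact (is_iso_iso (braid_iso (G one) t)). }
  destruct H as [g [H1 H2]].
  assert (L : g \o mact (comparison_module mF adj (F t))
    == mact (free_module A t) \o (idm (acar A) ⊠ g)).
  { apply (split_mono H1); la; rewrite H2, comp_idl, (mhom_linear (theta t)).
    rewrite comp_assoc, <- tens_r_comp; rewrite H2, tensm_id; now idc. }
  exists (@MkModHom T mT A (comparison_module mF adj (F t)) (free_module A t) g L).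
  split; assumption.
Qed.

(** K (F t) is free on t, so a linear map out of it is determined by its restriction along the unit
    t -> G (F t), and that restriction is the transpose of a morphism F t -> s. *)
Lemma comparison_full_free (t : T) (s : S) (h : hom (K (F t)) (K s)) :
  right_projection_formula mF adj ->
  fmor K (eps s \o fmor F (mhom h \o eta t)) == h.
Proof.
  intros Hp; apply (iso_epi (i := iso_of (theta_is_iso t Hp))).
  apply (@free_lin_ext T mT A t (comparison_module mF adj s)
    (fmor K (eps s \o fmor F (mhom h \o eta t)) \o theta t : hom (c := module_cat A) _ _)
    (h \o theta t : hom (c := module_cat A) _ _)).
  change (fmor G (eps s \o fmor F (mhom h \o eta t)) \o mhom (theta t) \o free_unit (A := A) t
    == mhom h \o mhom (theta t) \o free_unit (A := A) t).
  rewrite !(comp_assoc _ (mhom (theta t))), theta_unit; apply adj_r.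
Qed.

Lemma comparison_faithful_free (t : T) (s : S) (f f' : hom (F t) s) :
  fmor G f == fmor G f' -> f == f'.
Proof. intros E; now rewrite <- (adj_l adj f), <- (adj_l adj f'), E. Qed.

Lemma lax_unit (x y : T) :
  lax mF adj (F x) (F y) \o (eta x ⊠ eta y)
    == fmor G (iso_inv (monf mF x y)) \o eta (x ⊗ y).
Proof.
  unfold lax; rw (unit_natural adj (eta x ⊠ eta y)).
  rewrite <- !(fmor_comp G).
  assert (E : iso_inv (monf mF (G (F x)) (G (F y))) \o fmor F (eta x ⊠ eta y)
    == (fmor F (eta x) ⊠ fmor F (eta y)) \o iso_inv (monf mF x y)).
  { apply (iso_epi (i := monf mF x y)); rw (iso_invl (monf mF x y)).
    apply (iso_mono (i := monf mF (G (F x)) (G (F y)))); la.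
    rewrite iso_invr, comp_idl, comp_idr; apply monf_natural. }
  rw E; rewrite tensm_split, !adj_triangle_l, tensm_id; now idc.
Qed.

Lemma swap_middle_natural {C : Cat} {mC : SymMon C} {a x b y a' x' b' y' : C}
    (f : hom a a') (g : hom x x') (h : hom b b') (k : hom y y') :
  swap_middle a' x' b' y' \o ((f ⊠ g) ⊠ (h ⊠ k))
    == ((f ⊠ h) ⊠ (g ⊠ k)) \o swap_middle a x b y.
Proof.
  assert (M : (assoc b' x' y' \o (braid x' b' ⊠ idm y') \o iso_inv (assoc x' b' y'))
      \o (g ⊠ (h ⊠ k))
    == (h ⊠ (g ⊠ k)) \o (assoc b x y \o (braid x b ⊠ idm y) \o iso_inv (assoc x b y))).
  { rw (assoc_inv_natural g h k).
    rw (tensm_split (braid x' b') (g ⊠ h) (idm y') k).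
    rewrite braid_natural, comp_idl, <- (comp_idr k), <- tensm_split; la.
    now rewrite assoc_natural, comp_idr. }
  unfold swap_middle; rw (assoc_natural f g (h ⊠ k)).
  rw (tensm_split (idm a') f (assoc b' x' y' \o (braid x' b' ⊠ idm y')
        \o iso_inv (assoc x' b' y')) (g ⊠ (h ⊠ k))).
  rewrite M, comp_idl, <- (comp_idr f), <- tensm_split; la.
  rewrite assoc_inv_natural, comp_idr; reflexivity.
Qed.

(** [theta] as a morphism of T with unfolded source and target, so that rewriting does not have to
    see through [mcar]. *)
Definition theta_mor (t : T) : hom (G one ⊗ t) (G (F t)) := mhom (theta t).

Lemma theta_mor_counit (t : T) :
  eps (F t) \o fmor F (theta_mor t) \o monf mF (G one) t
    == lunit (F t) \o (eps one ⊠ idm (F t)).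
Proof. exact (theta_counit t). Qed.

(** [theta] turns the Kleisli product of free modules into the lax structure of G. After
    transposition the multiplication of A becomes the unitor of S, and [lunit_swap_middle] compares
    the two sides. *)
Lemma theta_swap (x y : T) :
  theta_mor (x ⊗ y) \o (amul A ⊠ idm (x ⊗ y)) \o swap_middle (G one) x (G one) y
    == fmor G (monf mF x y) \o lax mF adj (F x) (F y) \o (theta_mor x ⊠ theta_mor y).
Proof.
  apply (adj_faithful (adj := adj)).
  apply (iso_epi (i := iso_comp (monf mF (G one ⊗ x) (G one ⊗ y))
                         (tens_iso (monf mF (G one) x) (monf mF (G one) y)))); cbn [iso_fwd iso_comp tens_iso].
  rewrite !fmor_comp; la.
  rw (monf_swap_middle mF (G one) x (G one) y).
  rw (monf_natural_l mF (y := x ⊗ y) (amul A)).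
  rw (theta_mor_counit (x ⊗ y)).
  rw (tensm_split (fmor F (amul A)) (monf mF (G one) (G one)) (idm _) (monf mF x y)).
  rewrite comp_idl; rw (tensm_split (eps one) (fmor F (amul A) \o monf mF (G one) (G one))
     (idm _) (monf mF x y)).
  rewrite comp_idl.
  pose proof (act_counit one) as E; cbn -[fmor] in E |- *.
  rewrite E; clear E.
  rewrite counit_natural.
  rw (monf_natural mF (theta_mor x) (theta_mor y)).
  rewrite (comp_assoc _ (eps _) (fmor F _)), (comp_assoc _ (_ \o _) (monf mF _ _)).
   rewrite lax_counit.
  rw (tensm_split (fmor F (theta_mor x)) (monf mF (G one) x)
        (fmor F (theta_mor y)) (monf mF (G one) y)).
  rw (tensm_split (eps (F x)) (fmor F (theta_mor x) \o monf mF (G one) x)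
        (eps (F y)) (fmor F (theta_mor y) \o monf mF (G one) y)).
  rewrite !theta_mor_counit.
  rewrite tensm_comp, <- lunit_swap_middle; la.
  rw (swap_middle_natural (eps one) (idm (F x)) (eps one) (idm (F y))).
  rewrite <- (lunit_natural (monf mF x y)).
  rw (tensm_split (idm one) (lunit (one (C := S))) (monf mF x y) (idm (F x ⊗ F y))).
  rw (tensm_split (idm one \o lunit one) (eps one ⊠ eps one)
        (monf mF x y \o idm (F x ⊗ F y)) (idm (F x) ⊠ idm (F y))).
  rewrite tensm_id, comp_idl, !comp_idr; reflexivity.
Qed.
End MonAdjoint.

Section Comparison.
Context {o : tri_order} (ho : valid_order o) {T S : Cat} {tT : TensorTri o T}
  {tS : TensorTri o S} {F : Functor T S} (tF : TTFunctor F) {G : Functor S T}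
  (adj : Adjunction F G).
Notation eta := (unit_adj adj).
Notation eps := (counit_adj adj).
Notation phi t := (trif_susp tF t).
Notation A := (unit_algebra tF adj).
Notation K := (comparison tF adj).
Notation D := (module_cat A).
Notation mate := (susp_mate tF adj).
Notation gam := (gamma tF adj).

(** After transposition, where both actions become counits and unitors, this is the compatibility of
    F with suspended tensor products, [ttf_stens_r]. *)
Lemma susp_mate_linear (s : S) :
  mate s \o (fmor susp (mact (comparison_module tF adj s)) \o stens_r (G one) (G s))
    == mact (comparison_module tF adj (susp s)) \o (idm (G one) ⊠ mate s).
Proof.
  apply (adj_faithful (adj := adj)).
  apply (iso_epi (i := monf tF (G one) (susp (G s)))).
  pose proof (act_counit tF adj s) as E1.
  pose proof (act_counit tF adj (susp s)) as E2.
  pose proof (susp_mate_counit' tF adj (s := s) (mact (comparison_module tF adj s))) as E3.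
  set (act1 := mact (comparison_module tF adj s)) in *.
  set (act2 := mact (comparison_module tF adj (susp s))) in *.
  (* The actions are generalised with unfolded types, so that rewriting treats them as ordinary
     morphisms of T. *)
  change (hom (G one ⊗ G s) (G s)) in (type of act1).
  change (hom (G one ⊗ G (susp s)) (G (susp s))) in (type of act2).
  clearbody act1 act2.
  la; rewrite (fmor_comp F (_ \o _) (stens_r _ _)), (fmor_comp F act2); la.
  rewrite E3; clear E3.
  pose proof (ttf_stens_r tF (G one) (G s)) as E4; fcbn in E4; fcbn.
  rewrite (precomp3 E4); la; rewrite <- (fmor_comp susp (_ \o _)), E1; clear E1 E4.
  pose proof (monf_natural_r tF (x := G one) (mate s)) as E5.
  rewrite (comp_assoc _ (fmor F (idm _ ⊠ _))), E5; la; rewrite E2; clear E2 E5.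
  rewrite fmor_comp; rw (symmetry (stens_r_natural (eps one) (eps s))).
  rewrite stens_r_lunit.
  rewrite !(comp_assoc (lunit (susp s))), !tensm_split, susp_mate_counit.
  reflexivity.
Qed.

Definition mateK (s : S) : hom (module_susp A (K s)) (K (susp s)) :=
  @MkModHom T tt_mon A (module_susp_ob (comparison_module tF adj s))
    (comparison_module tF adj (susp s)) (mate s) (susp_mate_linear s).

Lemma mateK_is_iso (s : S) : is_iso (mateK s).
Proof. apply module_is_iso; exact (susp_mate_is_iso tF adj s). Qed.

Definition gammaK : NatIso (functor_comp K susp) (functor_comp (module_susp A) K).
Proof.
  refine (@MkNatIso S D (functor_comp K susp) (functor_comp (module_susp A) K)
    (fun s => iso_sym (iso_of (mateK_is_iso s))) _).
  intros x y f; cbn [iso_sym iso_fwd].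
  apply (iso_mono (i := iso_of (mateK_is_iso y))); la.
  rewrite iso_invr, comp_idl.
  apply (iso_epi (i := iso_of (mateK_is_iso x))).
  rw (iso_invl (iso_of (mateK_is_iso x))); rewrite comp_idr.
  symmetry; exact (susp_mate_natural tF adj f).
Defined.

Lemma gammaK_gamma (s : S) : fmor (forget A) (gammaK s) == gam s.
Proof.
  apply (iso_mono (i := iso_of (susp_mate_is_iso tF adj s))).
  pose proof (iso_invr (iso_of (mateK_is_iso s))) as E1.
  pose proof (iso_invr (iso_of (susp_mate_is_iso tF adj s))) as E2.
  refine (transitivity (y := idm (G (susp s))) _ (symmetry E2)); exact E1.
Qed.

Lemma comparison_dist n (X : ndiag (susp (C := S))) : in_range o n -> dist n X ->
  module_dist n (nimage (F := K) (fun s => gammaK s) X).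
Proof.
  intros Hn HX; pose proof (G_dist ho tF adj Hn HX) as HD.
  refine (dist_iso Hn HD (ntriangle_iso (dist_ntriangle Hn HD) _) _); clear HD;
    unfold nimage; cbn -[gamma gammaK];
    (apply nisomorphic_ext; intros; [reflexivity |]);
    cbn -[gamma gammaK]; rewrite comp_idl, <- (gammaK_gamma (nob X i j)); reflexivity.
Qed.

(** Linearity of the mate and of the image of [phi x] reduces the claim to the units of the
    adjunction, where it is the defining property of the mate. *)
Lemma theta_susp (x : T) :
  gam (F x) \o fmor G (phi x) \o theta_mor tF adj (susp x)
    == fmor susp (theta_mor tF adj x) \o stens_r (G one) x.
Proof.
  apply (iso_mono (i := iso_of (susp_mate_is_iso tF adj (F x)))).
  change (iso_fwd (iso_of (susp_mate_is_iso tF adj (F x)))) with (mate (F x)); la.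
  pose proof (mate_gamma tF adj (F x)) as E0.
  fcbn in E0; fcbn; rewrite E0, comp_idl.
  pose proof (susp_mate_linear (F x)) as E1.
  pose proof (mhom_linear (fmor K (phi x))) as E2.
  change (fmor G (phi x) \o mact (comparison_module tF adj (F (susp x)))
    == mact (comparison_module tF adj (susp (F x))) \o (idm (G one) ⊠ fmor G (phi x))) in E2.
  change (theta_mor tF adj (susp x)) with
    (mact (comparison_module tF adj (F (susp x))) \o (idm (G one) ⊠ eta (susp x))).
  change (theta_mor tF adj x) with
    (mact (comparison_module tF adj (F x)) \o (idm (G one) ⊠ eta x)).
  la.
  set (act1 := mact (comparison_module tF adj (F x))) in *.
  set (act2 := mact (comparison_module tF adj (susp (F x)))) in *.
  set (act3 := mact (comparison_module tF adj (F (susp x)))) in *.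
  change (hom (G one ⊗ G (F x)) (G (F x))) in (type of act1).
  change (hom (G one ⊗ G (susp (F x))) (G (susp (F x)))) in (type of act2).
  change (hom (G one ⊗ G (F (susp x))) (G (F (susp x)))) in (type of act3).
  clearbody act1 act2 act3.
  rewrite E2, fmor_comp; la.
  rw (symmetry (stens_r_natural (idm (G one)) (eta x))).
  rewrite <- comp_assoc in E1; rewrite E1.
  rewrite !comp_assoc, <- !tens_r_comp.
  assert (E : fmor G (phi x) \o eta (susp x) == mate (F x) \o fmor susp (eta x)).
  { apply (adj_faithful (adj := adj)).
    fcbn; rewrite susp_mate_counit', adj_triangle_l, fmor_id, comp_idl.
    apply (adj_l adj). }
  now rewrite E.
Qed.

(** * The idempotent on F (G x) cut out by separability *)

Section Key.
Context (hproj : right_projection_formula tF adj)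
  (s : hom A (A ⊗ A))
  (s1 : amul A \o s == idm (acar A))
  (s2 : (idm (acar A) ⊠ amul A) \o assoc A A A \o (s ⊠ idm (acar A)) == s \o amul A)
  (s3 : (amul A ⊠ idm (acar A)) \o iso_inv (assoc A A A) \o (idm (acar A) ⊠ s)
          == s \o amul A).

(* The A-linear section of [G (eps x)] provided by separability. *)
Definition counit_section (x : S) : hom (K x) (K (F (G x))) :=
  theta tF adj (G x) \o sec_mor s2 s3 (K x).

Lemma counit_sectionE (x : S) :
  fmor K (eps x) \o counit_section x == idm (K x).
Proof.
  assert (E : fmor K (eps x) \o theta tF adj (G x) == act_mor (K x)).
  { change (fmor G (eps x) \o (mact (comparison_module tF adj (F (G x)))
      \o (idm (G one) ⊠ eta (G x))) == mhom (act_mor (K x))).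
    rewrite act_morE; la.
    pose proof (mhom_linear (fmor K (eps x))) as E2.
    change (fmor G (eps x) \o mact (comparison_module tF adj (F (G x)))
      == mact (comparison_module tF adj x) \o (idm (G one) ⊠ fmor G (eps x))) in E2.
    rewrite E2.
    pose (act := mact (comparison_module tF adj x) : hom (G one ⊗ G x) (G x)).
    change (act \o (idm (G one) ⊠ fmor G (eps x)) \o (idm (G one) ⊠ eta (G x)) == act).
    clearbody act; rewrite comp_assoc, <- tens_r_comp, adj_triangle_r, tensm_id.
    apply comp_idr. }
  unfold counit_section; la; rewrite E; apply (act_mor_section s1 s2 s3).
Qed.

Definition sect (x : S) : hom (G x) (G (F (G x))) := mhom (counit_section x).

Lemma sectE (x : S) : fmor G (eps x) \o sect x == idm (G x).
Proof. exact (counit_sectionE x). Qed.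

(** [sect] itself need not come from S, but its composite with the image of eps_x does, as a linear
    map out of a free module; this is the morphism it comes from. It is idempotent because G is
    faithful on maps out of F t. *)
Definition proj (x : S) : hom (F (G x)) (F (G x)) :=
  eps (F (G x)) \o fmor F (sect x).

Lemma proj_G (x : S) : fmor G (proj x) == sect x \o fmor G (eps x).
Proof.
  pose proof (comparison_full_free (mF := tF) (adj := adj)
    (t := G x) (s := F (G x)) (counit_section x \o fmor K (eps x)) hproj) as E.
  change (fmor G (eps (F (G x)) \o fmor F (sect x \o fmor G (eps x) \o eta (G x)))
    == sect x \o fmor G (eps x)) in E.
  rewrite <- E; rewrite (comp_assoc (sect x)), adj_triangle_r, comp_idr; reflexivity.
Qed.

Definition lift_section (x : S) {t : T} (v : hom (F t) x) : hom (F t) (F (G x)) :=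
  eps (F (G x)) \o fmor F (sect x \o (fmor G v \o eta t)).

#[local] Instance lift_section_proper x t : Proper (heq ==> heq) (@lift_section x t).
Proof. intros f g E; unfold lift_section; now rewrite E. Qed.

Lemma eps_lift_section (x : S) {t : T} (v : hom (F t) x) :
  eps x \o lift_section v == v.
Proof.
  unfold lift_section; la; rewrite <- counit_natural, comp_assoc, <- fmor_comp.
  la; rewrite sectE, comp_idl; apply adj_l.
Qed.

Lemma lift_section_eps (x : S) {t : T} (f : hom (F t) (F (G x))) :
  lift_section (eps x \o f) == proj x \o f.
Proof.
  unfold lift_section; rewrite (fmor_comp G); la.
  rewrite <- proj_G, <- (fmor_comp G (proj x)).
  apply adj_l.
Qed.

Lemma proj_idem (x : S) : proj x \o proj x == proj x.
Proof.
  apply (comparison_faithful_free adj).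
  rewrite fmor_comp, proj_G; la; rw (sectE x); now idc.
Qed.

(** [proj x \o f] is the chosen lift of [eps x \o f], so it depends on the latter only. *)
Lemma zero_of_counit_zero (x : S) {t : T} (f : hom (F t) (F (G x))) :
  eps x \o f == zerom _ _ -> proj x \o f == zerom _ _.
Proof.
  intros E; rewrite <- lift_section_eps, E; unfold lift_section.
  rewrite (fmor_zero (G_additive tF adj)), comp_zerol, comp_zeror.
  rewrite (fmor_zero (trif_additive tF)); apply comp_zeror.
Qed.

(** By adjunction, only sources of the form F t matter for maps into values of G. *)
Lemma G_iso_of_bijective {z x : S} (w : hom z x) :
  (forall t (v : hom (F t) x), exists y, w \o y == v) ->
  (forall t (d : hom (F t) z), w \o d == zerom _ _ -> d == zerom _ _) ->
  is_iso (fmor G w).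
Proof.
  intros Hs Hi; apply yoneda_iso.
  - intros t v; destruct (Hs t (eps x \o fmor F v)) as [y Hy].
    exists (fmor G y \o eta t); la; rewrite <- fmor_comp, Hy; apply adj_r.
  - intros t u u' E; apply (adj_faithful (adj := adj)), subm_eq, Hi.
    rewrite comp_subr; apply subm_eq; la; rewrite <- !counit_natural.
    now rewrite !comp_assoc, <- !fmor_comp, E.
Qed.

(* Separability makes K x a retract of K (F (G x)), which gives an idempotent p
   of F (G x) whose image under K has image K x.  As S need not be idempotent
   complete, z is built from the cone of 1 - p rather than from the image of p. *)
Lemma counit_key (x : S) : exists (z : S) (w : hom z x) (h : hom z (F (G x))),
  is_iso (fmor G w) /\ w == eps x \o h.
Proof.
  pose proof (in_range_two ho) as r2.
  pose (q := subm (idm (F (G x))) (proj x)).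
  assert (qp : q \o proj x == zerom _ _).
  { unfold q; rewrite comp_subl, comp_idl, proj_idem; now apply subm_eq. }
  assert (pq : proj x \o q == zerom _ _).
  { unfold q; rewrite comp_subr, comp_idr, proj_idem; now apply subm_eq. }
  assert (q0 : forall y (f : hom y (F (G x))), proj x \o f == zerom _ _ -> q \o f == f).
  { intros y f E; unfold q; rewrite comp_subl, comp_idl, E; apply subm_zero. }
  (* If p were split, the cone of q = 1 - p would be the sum of im p and Sigma (im p), with [a]
     carrying the projection onto im p and [b] the inclusion of Sigma (im p). *)
  destruct (extend2 ho q) as [Z [u [v [HZ Hq]]]].
  pose proof (dist_nt r2 HZ) as TZ.
  set (a := ntr Z 0 2 1 2 \o v).
  set (b := fmor susp (iso_inv u) \o nbd Z 0 1 2).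
  assert (ba : b \o a == zerom _ _).
  { unfold a, b; la; rw (ntriangle_zero2 (i := 1) (j := 2) susp_additive TZ ltac:(lia)).
    now rewrite comp_zeror, comp_zerol. }
  assert (aq : a \o q == zerom _ _).
  { unfold a; rewrite comp_assoc, <- Hq; la.
    rewrite (ntriangle_zero1 (i := 1) (j := 2) TZ) by lia; apply comp_zerol. }
  assert (Hq' : q \o iso_inv u == iso_inv v \o ntr Z 0 1 0 2).
  { apply (iso_mono (i := v)); la; rewrite <- Hq; rw (iso_invr u).
    rewrite iso_invr; now idc. }
  assert (qb : fmor susp q \o b == zerom _ _).
  { unfold b; la; rewrite <- fmor_comp, Hq', fmor_comp; la.
    rw (ntriangle_zero3 (i := 1) (j := 2) TZ ltac:(lia)); apply comp_zeror. }
  assert (exa : forall t (e : hom t (nob Z 1 2)), b \o e == zerom _ _ ->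
    exists f, e == a \o f).
  { intros t e E; destruct (dist2_exact2 ho (v := e) HZ) as [f Hf].
    - apply (iso_mono (i := iso_sym (fiso susp u))); cbn; la; fold b.
      now rewrite E, comp_zeror.
    - exists (iso_inv v \o f); unfold a; la; rw (iso_invr v); rewrite comp_idr; exact Hf. }
  assert (exb : forall t (e : hom t (susp (F (G x)))), fmor susp q \o e == zerom _ _ ->
    exists f, e == b \o f).
  { intros t e E; destruct (dist2_exact3 ho (v := fmor susp u \o e) HZ) as [f Hf].
    - la; rewrite <- fmor_comp, Hq, fmor_comp; la.
      now rewrite comp_assoc, E, comp_zeror.
    - exists f; unfold b; la; rewrite comp_assoc, <- Hf; la.
      rewrite <- fmor_comp, iso_invl, fmor_id; now idc. }
  destruct (dist2_coexact1 ho (v := proj x \o iso_inv v) HZ) as [x0 Hx0].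
  { rewrite comp_assoc, <- Hq'; la; rewrite pq; apply comp_zerol. }
  assert (xa : x0 \o a == proj x).
  { unfold a; la; rewrite <- Hx0; rw (iso_invl v); now idc. }
  clearbody a b; clear Hx0 Hq Hq' u v TZ.
  (* In the same picture [psi] restricts to eps_x on im p, and [chi] is Sigma eps_x on Sigma (im p).
     Passing to the fibre of [chi] removes the second summand as far as G can see. *)
  set (psi := eps x \o x0).
  set (chi := fmor susp (eps x) \o b).
  destruct (fiber ho chi) as [Y [vv [m [HY Hm]]]].
  pose proof (dist_nt r2 HY) as TY.
  set (k := iso_inv vv \o ntr Y 0 1 0 2).
  assert (ck : chi \o k == zerom _ _).
  { apply (iso_mono (i := m)); unfold k; la; rewrite <- Hm; rw (iso_invr vv).
    rewrite comp_idr, (ntriangle_zero1 (i := 1) (j := 2) TY) by lia.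
    now rewrite comp_zeror. }
  exists (nob Y 0 1), (psi \o k), (x0 \o k); split; [|unfold psi; now la].
  apply G_iso_of_bijective.
  (* A lift of [g] to F (G x), pushed forward by [a], is killed by [chi] because b a = 0. *)
  - intros t g.
    destruct (dist2_exact1 ho (v := vv \o (a \o lift_section g)) HY) as [y Hy].
    { la; rewrite Hm; unfold chi; la; rw ba; now rewrite comp_zeror, !comp_zerol, ?comp_zeror. }
    exists y; unfold k; la; rewrite (comp_assoc _ (ntr _ _ _ _ _)), <- Hy; la.
    rw (iso_invl vv); rewrite comp_idr; unfold psi; la; rw xa.
    rewrite <- lift_section_eps || idtac.
    rewrite comp_assoc, <- lift_section_eps, !eps_lift_section; reflexivity.
  - intros t d E.
    assert (Ed : k \o d == zerom _ _).
    { set (e := k \o d).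
      assert (pe : psi \o e == zerom _ _) by (unfold e; now la).
      assert (ce : chi \o e == zerom _ _)
        by (unfold e; la; rewrite ck; apply comp_zerol).
      clearbody e; clear d E.
      (* F t is Sigma (F t') up to isomorphism, so b e desuspends to a map x' with eps x' = 0 and q
         x' = 0. The first gives p x' = 0, hence x' = q x' = 0. *)
      assert (be : b \o e == zerom _ _).
      { destruct (susp_ess_surj t) as [t' [i]].
        pose (I := iso_comp (phi t') (fiso F (iso_sym i)) : Iso (F t) (susp (F t'))).
        destruct (susp_full (b \o e \o iso_inv I)) as [x' Hx'].
        assert (px' : proj x \o x' == zerom _ _).
        { apply zero_of_counit_zero, susp_faithful.
          rewrite fmor_comp, Hx'; la; fold chi; rewrite ce, comp_zerol.
          now rewrite (fmor_zero susp_additive). }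
        assert (x0' : x' == zerom _ _).
        { rewrite <- (q0 _ _ px'); apply susp_faithful.
          rewrite fmor_comp, Hx'; la; rewrite qb, !comp_zerol.
          now rewrite (fmor_zero susp_additive). }
        apply (iso_epi (i := iso_sym I)); cbn [iso_fwd iso_sym].
        now rewrite <- Hx', x0', (fmor_zero susp_additive), comp_zerol. }
      destruct (exa _ _ be) as [f Hf].
      assert (pf : proj x \o f == zerom _ _).
      { rewrite <- proj_idem, comp_assoc; apply zero_of_counit_zero.
        rewrite <- xa; la; fold psi; now rewrite comp_assoc, <- Hf. }
      rewrite Hf, <- (q0 _ _ pf); la; rewrite aq; apply comp_zerol. }
    assert (fd : ntr Y 0 1 0 2 \o d == zerom _ _).
    { apply (iso_mono (i := iso_sym vv)); cbn [iso_fwd iso_sym]; la; fold k.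
      now rewrite Ed, comp_zeror. }
    (* Sigma d is the connecting image of some [u]. A desuspension of [u] lifts to F (G x), and the
       lift is killed by q, so its suspension factors through [b]; hence [u] comes from the middle
       vertex and its connecting image is zero. *)
    destruct (dist2_exact3 ho (v := fmor susp d) HY) as [u Hu].
    { now rewrite <- fmor_comp, fd, (fmor_zero susp_additive). }
    destruct (susp_full (iso_inv m \o u)) as [u' Hu'].
    destruct (exb _ (fmor susp (lift_section u'))) as [t' Ht'].
    { rewrite <- fmor_comp; unfold q; rewrite comp_subl, comp_idl.
      rewrite <- lift_section_eps, eps_lift_section.
      rewrite (proj2 (subm_eq _ _)) by reflexivity.
      apply (fmor_zero susp_additive). }
    assert (Eu : u == ntr Y 0 2 1 2 \o (vv \o t')).
    { la; rewrite Hm; unfold chi; la; rewrite (comp_assoc _ b), <- Ht', (comp_assoc m).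
      rewrite <- fmor_comp, eps_lift_section, Hu'; la; rewrite iso_invr; now idc. }
    apply susp_faithful; rewrite Hu, Eu; la.
    rewrite (ntriangle_zero2 (i := 1) (j := 2) susp_additive TY) by lia.
    now rewrite !comp_zerol, (fmor_zero susp_additive).
Qed.
End Key.
End Comparison.

(** * The Verdier quotient *)

Section Localization.
Context {C : Cat} (W : forall x y : C, hom x y -> Prop).

Section Lift.
Context {D : Cat} (H : Functor C D)
  (HW : forall (x y : C) (w : hom x y), W w -> is_iso (fmor H w)).

Fixpoint loc_map {x y : C} (f : loc_hom W x y) : hom (H x) (H y) :=
  match f in loc_hom _ x y return hom (H x) (H y) with
  | loc_gen _ f => fmor H f
  | loc_inv Ww => iso_inv (iso_of (HW Ww))
  | loc_comp g f => loc_map g \o loc_map f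
  end.

Lemma loc_map_eq {x y : C} (f g : loc_hom W x y) :
  loc_eq f g -> loc_map f == loc_map g.
Proof.
  induction 1; cbn.
  - reflexivity.
  - now symmetry.
  - etransitivity; eassumption.
  - now rewrite IHloc_eq1, IHloc_eq2.
  - apply comp_assoc.
  - rewrite fmor_id; apply comp_idl.
  - rewrite fmor_id; apply comp_idr.
  - now rewrite H0.
  - apply fmor_comp.
  - rewrite fmor_id; exact (iso_invl (iso_of (HW Ww))).
  - rewrite fmor_id; exact (iso_invr (iso_of (HW Ww))).
Qed.

Definition loc_lift : Functor (localization W) D.
Proof.
  refine (@MkFunctor (localization W) D (fun x => H x)
            (fun x y f => loc_map f) _ _ _).
  - intros x y f g E; now apply loc_map_eq.
  - intros x; apply fmor_id.
  - intros x y z g f; reflexivity.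
Defined.
End Lift.

Lemma localize_iso {x y : C} (w : hom x y) : W w -> is_iso (fmor (localize W) w).
Proof.
  intros Ww; exists (loc_inv Ww); split; [apply loc_invl | apply loc_invr].
Qed.

(** Induction on the word [f]: the square for a formal inverse is the square for [w] composed with
    inverses on both sides. *)
Lemma loc_natural {D : Cat} (P R : Functor (localization W) D)
    (a : forall x : C, hom (P x) (R x)) :
  (forall (x y : C) (f : hom x y),
     a y \o fmor P (fmor (localize W) f) == fmor R (fmor (localize W) f) \o a x) ->
  forall (x y : localization W) (f : hom x y), a y \o fmor P f == fmor R f \o a x.
Proof.
  intros Ha x y f; induction f as [x y f|x y w Ww|x y z g IHg f IHf].
  - apply Ha.
  - pose proof (localize_iso Ww) as I.
    apply (iso_epi (i := fiso P (iso_of I))); cbn [iso_fwd fiso].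
    change (iso_fwd (iso_of I)) with (fmor (localize W) w); la.
    assert (E : (loc_inv Ww : hom (c := localization W) y x) \o fmor (localize W) w
      == idm (c := localization W) x) by apply loc_invl.
    rewrite comp_assoc, <- fmor_comp, E, fmor_id, comp_idr.
    rewrite comp_assoc, Ha; la; rewrite <- fmor_comp, E, fmor_id.
    now rewrite comp_idl.
  - change (loc_comp g f) with ((g : hom (c := localization W) y z)
      \o (f : hom (c := localization W) x y)).
    rewrite !fmor_comp; la; rewrite IHg, comp_assoc, IHf; now la.
Qed.
End Localization.

Section Pullback.
Context {C D : Cat} {aD : PreAdd D} (U : Functor C D) (fU : full U) (hU : faithful U).

(** Gives the quotient and its completion the addition of modules, which avoids common denominators
    of fractions. *)
Definition preadd_pullback : PreAdd C.
Proof.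
  refine (@Build_PreAdd C (fun x y => preim fU (zerom (U x) (U y)))
    (fun x y f g => preim fU (addm (fmor U f) (fmor U g)))
    (fun x y f => preim fU (oppm (fmor U f))) _ _ _ _ _ _ _ _).
  - intros x y f f' Hf g g' Hg; apply hU; now rewrite !fmor_preim, Hf, Hg.
  - intros x y f f' Hf; apply hU; now rewrite !fmor_preim, Hf.
  - intros; apply hU; rewrite !fmor_preim; apply addm_assoc.
  - intros; apply hU; rewrite !fmor_preim; apply addm_comm.
  - intros; apply hU; rewrite !fmor_preim; apply addm_zero.
  - intros; apply hU; rewrite !fmor_preim; apply addm_opp.
  - intros; apply hU; rewrite fmor_comp, !fmor_preim, !fmor_comp; apply comp_addl.
  - intros; apply hU; rewrite fmor_comp, !fmor_preim, !fmor_comp; apply comp_addr.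
Defined.

Lemma preadd_pullback_additive :
  is_additive_functor (aC := preadd_pullback) U.
Proof. intros x y f g; apply fmor_preim. Qed.
End Pullback.

Section Cones.
Context {o : tri_order} (ho : valid_order o) {C : Cat} {tC : Tri o C}.

Lemma cone_zero_iso (X : ndiag (susp (Tri := tC))) : dist 2 X ->
  is_zero (nob X 1 2) -> is_iso (ntr X 0 1 0 2).
Proof.
  intros HX Z; apply yoneda_iso.
  - intros t v; destruct (dist2_exact1 ho (v := v) HX) as [u Hu].
    + now apply to_zero.
    + exists u; now symmetry.
  - intros t u u' E; apply subm_eq.
    assert (E0 : ntr X 0 1 0 2 \o subm u u' == zerom _ _)
      by (rewrite comp_subr; now apply subm_eq).
    apply susp_faithful; rewrite (fmor_zero susp_additive).
    destruct (dist2_exact3 ho (v := fmor susp (subm u u')) HX) as [d Hd].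
    + now rewrite <- fmor_comp, E0, (fmor_zero susp_additive).
    + rewrite Hd, (to_zero d (zerom _ _) Z); apply comp_zeror.
Qed.

Lemma iso_cone_zero (X : ndiag (susp (Tri := tC))) : dist 2 X ->
  is_iso (ntr X 0 1 0 2) -> is_zero (nob X 1 2).
Proof.
  intros HX I; apply is_zero_idm.
  pose proof (dist_nt (in_range_two ho) HX) as TX.
  assert (b0 : nbd X 0 1 2 == zerom _ _).
  { apply (iso_mono (i := fiso susp (iso_of I))); cbn.
    rewrite comp_zeror; exact (ntriangle_zero3 (i := 1) (j := 2) TX ltac:(lia)). }
  assert (g0 : ntr X 0 2 1 2 == zerom _ _).
  { apply (iso_epi (i := iso_of I)); cbn; rewrite comp_zerol.
    exact (ntriangle_zero1 (i := 1) (j := 2) TX ltac:(lia)). }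
  destruct (dist2_exact2 ho (v := idm (nob X 1 2)) HX) as [u Hu].
  - rewrite b0; apply comp_zerol.
  - rewrite Hu, g0; apply comp_zerol.
Qed.
End Cones.

(** * The kernel as an ideal, fractions, and full faithfulness on the quotient *)

Section Quotient.
Context {o : tri_order} (ho : valid_order o) {T S : Cat} {tT : TensorTri o T}
  {tS : TensorTri o S} {F : Functor T S} (tF : TTFunctor F) {G : Functor S T}
  (adj : Adjunction F G) (hadd : tens_additive (C := T) tt_mon)
  (hker : kernel_tensor_closed G) (hproj : right_projection_formula tF adj)
  (s : hom (unit_algebra tF adj) (unit_algebra tF adj ⊗ unit_algebra tF adj))
  (s1 : amul (unit_algebra tF adj) \o s == idm (acar (unit_algebra tF adj)))
  (s2 : (idm (acar (unit_algebra tF adj)) ⊠ amul (unit_algebra tF adj))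
     \o assoc (unit_algebra tF adj) (unit_algebra tF adj) (unit_algebra tF adj)
     \o (s ⊠ idm (acar (unit_algebra tF adj))) == s \o amul (unit_algebra tF adj))
  (s3 : (amul (unit_algebra tF adj) ⊠ idm (acar (unit_algebra tF adj)))
     \o iso_inv (assoc (unit_algebra tF adj) (unit_algebra tF adj) (unit_algebra tF adj))
     \o (idm (acar (unit_algebra tF adj)) ⊠ s)
          == s \o amul (unit_algebra tF adj)).
Notation eta := (unit_adj adj).
Notation eps := (counit_adj adj).
Notation A := (unit_algebra tF adj).
Notation K := (comparison tF adj).
Notation D := (module_cat A).
Notation W := (@cone_in_kernel o S T tt_tri G).
Notation Q := (verdier_quotient (o := o) G).
Notation q := (quotient_functor (o := o) G).
Notation gam := (gamma tF adj).

Lemma G_cone_iff (X : ndiag (susp (C := S))) : dist 2 X ->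
  (is_iso (fmor G (ntr X 0 1 0 2)) <-> in_kernel G (nob X 1 2)).
Proof.
  intros HX; pose proof (G_dist ho tF adj (in_range_two ho) HX) as HD; split.
  - intros I; exact (iso_cone_zero ho HD I).
  - intros Z; exact (cone_zero_iso ho HD Z).
Qed.

(** G preserves triangles, so the cone is in the kernel exactly when G inverts the morphism. The
    right-hand side visibly composes and cancels, and replaces cones from here on. *)
Lemma W_iff {x y : S} (f : hom x y) : W f <-> is_iso (fmor G f).
Proof.
  split.
  - intros [X [u [v [HX [E Z]]]]].
    apply (is_iso_cancel_l (g := fmor G v)); [apply is_iso_fmor, is_iso_iso|].
    rewrite <- fmor_comp, <- E, fmor_comp; apply is_iso_comp.
    + now apply G_cone_iff.
    + apply is_iso_fmor, is_iso_iso.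
  - intros I; destruct (extend2 ho f) as [X [u [v [HX E]]]].
    exists X, u, v; split; [exact HX|split; [exact E|]].
    apply G_cone_iff; trivial.
    apply (is_iso_cancel_r (f := fmor G u)); [apply is_iso_fmor, is_iso_iso|].
    rewrite <- fmor_comp, E, fmor_comp.
    apply is_iso_comp; [apply is_iso_fmor, is_iso_iso | exact I].
Qed.

Lemma G_zero_of_iso {x y : S} (i : Iso x y) : in_kernel G y -> in_kernel G x.
Proof. exact (is_zero_isom (fiso G i)). Qed.

(** Up to a braiding, the projection formula writes the image under G as t ⊗ G k. *)
Lemma kernel_free (t : T) (k : S) : in_kernel G k -> in_kernel G (k ⊗ F t).
Proof.
  intros Hk; apply (G_zero_of_iso (braid_iso k (F t))).
  apply (is_zero_isom (iso_sym (iso_of (hproj t k)))).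
  exact (fmor_is_zero (tensor_left_additive hadd t) Hk).
Qed.

Lemma kernel_ideal (k x : S) : in_kernel G k -> in_kernel G (k ⊗ x).
Proof.
  intros Hk.
  destruct (counit_key ho hproj s1 s2 s3 x) as [z [w [h [I E]]]].
  assert (I' : is_iso (fmor G (idm k ⊠ w))).
  { apply W_iff in I; destruct I as [X [u [v [HX [E1 Z]]]]].
    pose proof (stens_r_dist k (in_range_two ho) HX) as HD.
    assert (J : is_iso (fmor G (idm k ⊠ ntr X 0 1 0 2))).
    { apply (proj2 (G_cone_iff HD)); cbn; now apply hker. }
    apply (is_iso_cancel_l (g := fmor G (idm k ⊠ v))).
    - apply is_iso_fmor; exact (is_iso_iso (tens_iso (iso_id k) v)).
    - rewrite <- fmor_comp, <- tens_r_comp, <- E1, tens_r_comp, fmor_comp.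
      apply is_iso_comp; [exact J|].
      apply is_iso_fmor; exact (is_iso_iso (tens_iso (iso_id k) u)). }
  assert (Z : fmor G (idm k ⊠ w) == zerom _ _).
  { rewrite E, tens_r_comp, fmor_comp.
    rewrite (to_zero (fmor G (idm k ⊠ h)) (zerom _ _) (kernel_free (G x) Hk)).
    apply comp_zeror. }
  destruct I' as [g [_ Hg]]; apply is_zero_idm.
  now rewrite <- Hg, Z, comp_zerol.
Qed.

Lemma W_tens_l {x y : S} (w : hom x y) (a : S) :
  is_iso (fmor G w) -> is_iso (fmor G (w ⊠ idm a)).
Proof.
  intros I; apply W_iff in I; destruct I as [X [u [v [HX [E1 Z]]]]].
  pose proof (stens_dist a (in_range_two ho) HX) as HD.
  assert (J : is_iso (fmor G (ntr X 0 1 0 2 ⊠ idm a)))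
    by (apply (proj2 (G_cone_iff HD)); cbn; now apply kernel_ideal).
  apply (is_iso_cancel_l (g := fmor G (v ⊠ idm a))).
  - apply is_iso_fmor; exact (is_iso_iso (tens_iso v (iso_id a))).
  - rewrite <- fmor_comp, <- tens_l_comp, <- E1, tens_l_comp, fmor_comp.
    apply is_iso_comp; [exact J|].
    apply is_iso_fmor; exact (is_iso_iso (tens_iso u (iso_id a))).
Qed.

Lemma W_tens_r {x y : S} (w : hom x y) (a : S) :
  is_iso (fmor G w) -> is_iso (fmor G (idm a ⊠ w)).
Proof.
  intros I; apply (is_iso_cancel_l (g := fmor G (braid a y))).
  - apply is_iso_fmor; exact (is_iso_iso (braid_iso a y)).
  - rewrite <- fmor_comp, braid_natural, fmor_comp; apply is_iso_comp.
    + now apply W_tens_l.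
    + apply is_iso_fmor; exact (is_iso_iso (braid_iso a x)).
Qed.

Lemma W_susp {x y : S} (w : hom x y) :
  is_iso (fmor G w) -> is_iso (fmor G (fmor susp w)).
Proof.
  intros I; apply (is_iso_cancel_l (g := gam y)); [apply is_iso_iso|].
  pose proof (gamma_natural tF adj w) as E; fcbn; fcbn in E; rewrite E.
  apply is_iso_comp; [|apply is_iso_iso].
  now apply is_iso_fmor.
Qed.

(** The square is completed by the fibre of the composite of [f] with the map from [c] to the cone
    of [v]: the cone of [v'] is then that of [v] up to isomorphism. *)
Lemma ore {a b c : S} (v : hom b c) (f : hom a c) : is_iso (fmor G v) ->
  exists z (v' : hom z a) (f' : hom z b), is_iso (fmor G v') /\ v \o f' == f \o v'.
Proof.
  intros I; apply W_iff in I; destruct I as [X [u0 [v0 [HX [E1 Z]]]]].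
  destruct (fiber ho (ntr X 0 2 1 2 \o v0 \o f)) as [Y [vv [m [HY Hm]]]].
  pose proof (dist_nt (in_range_two ho) HY) as TY.
  exists (nob Y 0 1), (iso_inv vv \o ntr Y 0 1 0 2).
  destruct (dist2_exact1 ho (v := v0 \o f \o (iso_inv vv \o ntr Y 0 1 0 2)) HX)
    as [y Hy].
  { apply (iso_mono (i := m)); la; rewrite <- comp_assoc in Hm.
    rewrite <- !comp_assoc in Hm; rewrite <- Hm; rw (iso_invr vv).
    rewrite comp_idr, (ntriangle_zero1 (i := 1) (j := 2) TY) by lia.
    now rewrite comp_zeror. }
  exists (iso_inv u0 \o y); split.
  - rewrite fmor_comp; apply is_iso_comp; [apply is_iso_fmor, is_iso_inv|].
    apply (G_cone_iff HY); exact (G_zero_of_iso (iso_sym m) Z).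
  - apply (iso_mono (i := v0)); la; rewrite <- E1; rw (iso_invr u0).
    rewrite comp_idr, <- Hy; now la.
Qed.

(** Ore squares move all formal inverses to the right, so that a word becomes a single fraction g
    w^-1. *)
Lemma roof {x y : Q} (f : hom x y) : exists (z : S) (w : hom (z : S) x) (g : hom (z : S) y),
  is_iso (fmor G w) /\ f \o fmor q w == fmor q g.
Proof.
  induction f as [x y f|x y w Ww|x y z g IHg f IHf].
  - exists x, (idm (c := S) x), f; split.
    + apply is_iso_fmor; exact (is_iso_iso (iso_id (C := S) x)).
    + rewrite fmor_id; apply comp_idr.
  - exists x, w, (idm (c := S) x); split; [now apply W_iff|].
    rewrite fmor_id; apply loc_invl.
  - destruct IHf as [a [w [f' [Iw Ef]]]]; destruct IHg as [b [v [g' [Iv Eg]]]].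
    destruct (ore (v := v) f' Iv) as [c [v' [h [Iv' E]]]].
    exists c, (w \o v'), (g' \o h); split.
    + rewrite fmor_comp; now apply is_iso_comp.
    + change (loc_comp g f) with ((g : hom (c := Q) y z) \o (f : hom (c := Q) x y)).
      assert (Eq : fmor q f' \o fmor q v' == fmor q v \o fmor q h)
        by (refine (transitivity (symmetry (fmor_comp q f' v'))
              (transitivity _ (fmor_comp q v h))); now rewrite E).
      assert (Ew : fmor q (w \o v') == fmor q w \o fmor q v') by apply (fmor_comp q).
      assert (Eg' : fmor q (g' \o h) == fmor q g' \o fmor q h) by apply (fmor_comp q).
      rewrite Ew, Eg', <- Eg; la; rw Ef; rewrite !comp_assoc; now rewrite Eq.
Qed.

Lemma K_inverts {x y : S} (w : hom x y) : W w -> is_iso (fmor K w).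
Proof. intros Ww; apply module_is_iso; now apply W_iff. Qed.

Definition Kbar : Functor Q D := loc_lift (fun x y w => @K_inverts x y w).

Lemma q_iso {x y : S} (w : hom x y) : is_iso (fmor G w) -> is_iso (fmor q w).
Proof. intros I; apply localize_iso; now apply W_iff. Qed.

(* After composing with the w of [counit_key], equality under G gives equality
   in S, by naturality of the counit. *)
Lemma Kbar_faithful : faithful Kbar.
Proof.
  intros x y f f' E.
  destruct (roof f) as [z [w [g [Iw Eg]]]].
  destruct (roof f') as [z' [w' [g' [Iw' Eg']]]].
  destruct (ore (v := w') w Iw') as [c [a [b [Ia Eab]]]].
  assert (Eq : fmor q w \o fmor q a == fmor q w' \o fmor q b)
    by (rewrite <- !fmor_comp; now rewrite Eab).
  assert (E1 : fmor G (g \o a) == fmor G (g' \o b)).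
  { change (fmor Kbar (fmor q (g \o a)) == fmor Kbar (fmor q (g' \o b))).
    rewrite !(fmor_comp q), <- Eg, <- Eg', (comp_assoc f'), <- Eq, !(fmor_comp Kbar).
    now rewrite E, !comp_assoc. }
  destruct (counit_key ho hproj s1 s2 s3 c) as [d [v [h [Iv Ev]]]].
  assert (E2 : (g \o a) \o v == (g' \o b) \o v).
  { rewrite Ev, <- !(comp_assoc _ (eps c)), <- !counit_natural, E1; reflexivity. }
  assert (E3 : f \o (fmor q w \o fmor q a \o fmor q v)
    == f' \o (fmor q w \o fmor q a \o fmor q v)).
  { assert (q3 : forall x y z t (k : hom (c := S) z t) (j : hom (c := S) y z)
        (i : hom (c := S) x y), fmor q (k \o j \o i) == fmor q k \o fmor q j \o fmor q i)
      by (intros; etransitivity; [apply (fmor_comp q (k \o j) i)|];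
          apply comp_proper; [apply (fmor_comp q k j) | reflexivity]).
    rewrite Eq at 2; la; rewrite Eg, Eg'.
    refine (transitivity (symmetry (q3 _ _ _ _ g a v)) (transitivity _ (q3 _ _ _ _ g' b v))).
    now rewrite E2. }
  assert (I : is_iso (fmor q w \o fmor q a \o fmor q v)).
  { apply is_iso_comp; [apply is_iso_comp|]; now apply q_iso. }
  exact (iso_epi (i := iso_of I) E3).
Qed.

(** The composite of [p] with the image of eps_x comes from S by freeness. With [w == eps x \o h],
    this produces a morphism of S whose image is p G(w), and [w] is invertible in the quotient. *)
Lemma Kbar_full : full Kbar.
Proof.
  intros x y p.
  destruct (counit_key ho hproj s1 s2 s3 x) as [z [w [h [Iw E]]]].
  pose proof (q_iso Iw) as I.
  exists (fmor q (eps y \o fmor F (mhom p) \o h) \o iso_inv (iso_of I)).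
  apply (iso_epi (i := fiso Kbar (iso_of I))); cbn [iso_fwd fiso].
  rewrite <- fmor_comp, (precomp (iso_invl (iso_of I))), comp_idr.
  change (fmor G (eps y \o fmor F (mhom p) \o h) == mhom p \o fmor G w).
  assert (E1 : fmor G (eps y \o fmor F (mhom p)) == mhom p \o fmor G (eps x)).
  { pose proof (comparison_full_free (mF := tF) (adj := adj) (t := G x) (s := y)
      ((p : hom (K x) (K y)) \o fmor K (eps x)) hproj) as E0.
    change (fmor G (eps y \o fmor F (mhom p \o fmor G (eps x) \o eta (G x)))
      == mhom p \o fmor G (eps x)) in E0.
    rewrite <- E0.
    pose (p' := mhom p : hom (G x) (G y)).
    change (fmor G (eps y \o fmor F p')
      == fmor G (eps y \o fmor F (p' \o fmor G (eps x) \o eta (G x)))).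
    now rewrite (comp_assoc p'), adj_triangle_r, comp_idr. }
  rewrite fmor_comp, E1, E, fmor_comp; now la.
Qed.

(** The chain is rectified from its far end: first the tail, then the first morphism is written as a
    fraction, and an Ore square adjusts its target. Beyond index n the lifted chain is arbitrary. *)
Lemma chain_lift (n : nat) : forall (b : nat -> Q) (f : forall i, hom (b i) (b (Datatypes.S i))),
  exists (z : nat -> S) (g : forall i, hom (z i) (z (Datatypes.S i)))
    (w : forall i, hom (z i) (b i : S)),
    (forall i, is_iso (fmor G (w i))) /\
    (forall i, i < n -> f i \o fmor q (w i) == fmor q (w (Datatypes.S i)) \o fmor q (g i)).
Proof.
  induction n as [|n IH]; intros b f.
  - exists b, (fun i => zerom _ _), (fun i => idm (c := S) (b i)); split; [|lia].
    intros i; apply is_iso_fmor; exact (is_iso_iso (iso_id (C := S) _)).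
  - destruct (IH (fun i => b (Datatypes.S i)) (fun i => f (Datatypes.S i)))
      as [z [g [w [Iw E]]]].
    destruct (roof (f 0)) as [y [v [h [Iv Ev]]]].
    destruct (ore (v := w 0) h (Iw 0)) as [y' [v' [h' [Iv' E']]]].
    exists (fun i => match i with 0 => y' | Datatypes.S j => z j end).
    exists (fun i => match i return
      hom (match i with 0 => y' | Datatypes.S j => z j end) (z i)
      with 0 => h' | Datatypes.S j => g j end).
    exists (fun i => match i return
      hom (match i with 0 => y' | Datatypes.S j => z j end) (b i : S)
      with 0 => v \o v' | Datatypes.S j => w j end).
    split.
    + intros [|i]; [rewrite fmor_comp; now apply is_iso_comp | apply Iw].
    + intros [|i] Hi; [|apply E; lia].
      transitivity (fmor q (h \o v')).
      * rewrite fmor_comp; la; rewrite Ev; symmetry; apply (fmor_comp q).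
      * refine (transitivity _ (fmor_comp q (w 0) h')); now rewrite E'.
Qed.
End Quotient.

(** * Octahedra of retracts *)

Section Steps.
Context {C : Cat} {aC : PreAdd C} {Sg : Functor C C}.

(** Structure maps are composites of steps raising j or i by one, and every connecting map is
    obtained from the maps X(j,n) -> Sigma X(0,j). The vertices X(i,i) are zero and impose
    nothing. *)
Lemma nmorphism_steps (aS : is_additive_functor Sg) n (X Y : ndiag Sg) (w : forall i j, hom (nob X i j) (nob Y i j)) :
  is_ntriangle n X -> is_ntriangle n Y ->
  (forall i j, i < j < n -> ntr Y i j i (S j) \o w i j == w i (S j) \o ntr X i j i (S j)) ->
  (forall i j, S i < j <= n -> ntr Y i j (S i) j \o w i j == w (S i) j \o ntr X i j (S i) j) ->
  (forall j, 0 < j < n -> nbd Y 0 j n \o w j n == fmor Sg (w 0 j) \o nbd X 0 j n) ->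
  is_nmorphism n (X := X) (Y := Y) w.
Proof.
  intros [X1 [X2 [X3 X4]]] [Y1 [Y2 [Y3 Y4]]] Hj Hi Hb.
  assert (sq_comp : forall i j i' j' i'' j'', i <= j <= n -> i' <= j' <= n ->
    i'' <= j'' <= n -> i <= i' <= i'' -> j <= j' <= j'' ->
    ntr Y i j i' j' \o w i j == w i' j' \o ntr X i j i' j' ->
    ntr Y i' j' i'' j'' \o w i' j' == w i'' j'' \o ntr X i' j' i'' j'' ->
    ntr Y i j i'' j'' \o w i j == w i'' j'' \o ntr X i j i'' j'').
  { intros i j i' j' i'' j'' H1 H2 H3 H4 H5 E1 E2.
    rewrite <- (Y3 i j i' j'), <- (X3 i j i' j') by assumption.
    rewrite comp_assoc, E1; la; now rewrite E2. }
  assert (sqj : forall d i j, i < j -> j + d <= n ->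
    ntr Y i j i (j + d) \o w i j == w i (j + d) \o ntr X i j i (j + d)).
  { induction d as [|d IH]; intros i j H1 H2.
    - rewrite Nat.add_0_r, Y2, X2 by lia; now idc.
    - rewrite Nat.add_succ_r.
      apply (sq_comp i j i (j + d) i (S (j + d))); try lia.
      + apply IH; lia.
      + apply Hj; lia. }
  assert (sqi : forall d i j, i + d < j -> j <= n ->
    ntr Y i j (i + d) j \o w i j == w (i + d) j \o ntr X i j (i + d) j).
  { induction d as [|d IH]; intros i j H1 H2.
    - rewrite Nat.add_0_r, Y2, X2 by lia; now idc.
    - rewrite Nat.add_succ_r.
      apply (sq_comp i j (i + d) j (S (i + d)) j); try lia.
      + apply IH; lia.
      + apply Hi; lia. }
  assert (sq : forall i j i' j', i <= j <= n -> i' <= j' <= n -> i <= i' -> j <= j' ->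
     ntr Y i j i' j' \o w i j == w i' j' \o ntr X i j i' j').
  { intros i j i' j' H1 H2 H3 H4.
    destruct (Nat.eq_dec i j) as [->|N]; [apply from_zero, X1; lia|].
    destruct (Nat.eq_dec i' j') as [->|N']; [apply to_zero, Y1; lia|].
    apply (sq_comp i j i j' i' j'); try lia.
    - replace j' with (j + (j' - j)) by lia; apply sqj; lia.
    - replace i' with (i + (i' - i)) by lia; apply sqi; lia. }
  split; [exact sq|].
  intros i j k H1 H2.
  destruct (Nat.eq_dec j k) as [->|N]; [apply from_zero, X1; lia|].
  destruct (Nat.eq_dec j 0) as [->|N0].
  { assert (i = 0) by lia; subst i.
    apply to_zero, (fmor_is_zero aS), Y1; lia. }
  assert (E0 : nbd Y 0 j k \o w j k == fmor Sg (w 0 j) \o nbd X 0 j k).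
  { rewrite <- (comp_idl (nbd Y 0 j k)), <- fmor_id, <- (Y2 0 j) by lia.
    rewrite <- (Y4 0 j k 0 j n) by lia.
    rewrite comp_assoc, sq by lia; la.
    destruct (Nat.eq_dec j n) as [->|Nn]; [lia|].
    rewrite Hb by lia; rewrite comp_assoc, (X4 0 j k 0 j n), X2, fmor_id by lia.
    now idc. }
  assert (EY : nbd Y i j k == fmor Sg (ntr Y 0 j i j) \o nbd Y 0 j k).
  { rewrite <- (Y4 0 j k i j k), Y2 by lia; now idc. }
  assert (EX : nbd X i j k == fmor Sg (ntr X 0 j i j) \o nbd X 0 j k).
  { rewrite <- (X4 0 j k i j k), X2 by lia; now idc. }
  rewrite EY, EX, comp_assoc, E0; la.
  rewrite <- !fmor_comp, sq by lia; reflexivity.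
Qed.

Section Strip.
Context (hC : idempotent_complete C) (aS : is_additive_functor Sg)
  (dst : ndiag Sg -> Prop)
  (dst_exact : forall Y, dst Y -> forall t (v : hom t (Sg (nob Y 0 1))),
     fmor Sg (ntr Y 0 1 0 2) \o v == zerom _ _ -> exists u, v == nbd Y 0 1 2 \o u)
  (dst_coexact : forall Y, dst Y -> forall t (v : hom (nob Y 0 2) t),
     v \o ntr Y 0 1 0 2 == zerom _ _ -> exists u, v == u \o ntr Y 0 2 1 2)
  (dst_retract : forall X Y, is_ntriangle 2 Y -> dst X -> nretract 2 Y X -> dst Y).

Definition good_faces (X : ndiag Sg) : Prop :=
  forall phi, monotone_upto 2 3 phi -> phi 0 < phi 1 -> phi 1 < phi 2 ->
    dst (nreindex phi X).

Lemma nreindex_ntriangle m n phi (X : ndiag Sg) : monotone_upto m n phi ->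
  is_ntriangle n X -> is_ntriangle m (nreindex phi X).
Proof.
  intros Hphi [H1 [H2 [H3 H4]]].
  assert (P1 : forall i j, i <= j -> j <= m -> phi i <= phi j)
    by (intros i j A1 A2; apply (Hphi i j); lia).
  assert (P2 : forall j, j <= m -> phi j <= n)
    by (intros j A; apply (Hphi j j); lia).
  split; [|split; [|split]]; cbn; intros;
    [apply H1 | apply H2 | apply H3 | apply H4]; repeat split;
    (apply P1 || apply P2); lia.
Qed.

Lemma nreindex_nmorphism m n phi (X Y : ndiag Sg) w : monotone_upto m n phi ->
  is_nmorphism n (X := X) (Y := Y) w ->
  is_nmorphism m (X := nreindex phi X) (Y := nreindex phi Y)
    (fun i j => w (phi i) (phi j)).
Proof.
  intros Hphi [H1 H2].
  assert (P1 : forall i j, i <= j -> j <= m -> phi i <= phi j)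
    by (intros i j A1 A2; apply (Hphi i j); lia).
  assert (P2 : forall j, j <= m -> phi j <= n)
    by (intros j A; apply (Hphi j j); lia).
  split; cbn; intros; [apply H1 | apply H2]; repeat split;
    (apply P1 || apply P2); lia.
Qed.

Definition face (j k : nat) (i : nat) : nat := match i with 0 => 0 | 1 => j | _ => k end.

Lemma face_dst X j k : good_faces X -> 0 < j < k -> k <= 3 -> dst (nreindex (face j k) X).
Proof.
  intros H Hjk Hk; apply H; cbn; try lia.
  intros [|[|a]] [|[|b]] Hab; cbn; lia.
Qed.

Definition octahedron {x1 x2 x3 : C} (f : hom x1 x2) (g : hom x2 x3) : Prop :=
  exists (X : ndiag Sg) (v1 : Iso x1 (nob X 0 1)) (v2 : Iso x2 (nob X 0 2))
    (v3 : Iso x3 (nob X 0 3)),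
    is_ntriangle 3 X /\ good_faces X /\ ntr X 0 1 0 2 \o v1 == v2 \o f /\ ntr X 0 2 0 3 \o v2 == v3 \o g.

(** On the base, [e] is the idempotent i_k p_k of l_k with image x_k, so the summand of X cut out by
    [e] is a 3-triangle on f, g; its faces are retracts of those of X. *)
Lemma octahedron_split (X : ndiag Sg) e {l1 l2 l3 x1 x2 x3 : C}
    (v1 : Iso l1 (nob X 0 1)) (v2 : Iso l2 (nob X 0 2)) (v3 : Iso l3 (nob X 0 3))
    (i1 : hom x1 l1) (p1 : hom l1 x1) (i2 : hom x2 l2) (p2 : hom l2 x2)
    (i3 : hom x3 l3) (p3 : hom l3 x3)
    (l : hom l1 l2) (m : hom l2 l3) (f : hom x1 x2) (g : hom x2 x3) :
  is_ntriangle 3 X -> good_faces X ->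
  is_nmorphism 3 (X := X) (Y := X) e ->
  (forall i j, i <= j <= 3 -> e i j \o e i j == e i j) ->
  ntr X 0 1 0 2 \o v1 == v2 \o l -> ntr X 0 2 0 3 \o v2 == v3 \o m ->
  p1 \o i1 == idm x1 -> p2 \o i2 == idm x2 -> p3 \o i3 == idm x3 ->
  e 0 1 \o v1 == v1 \o (i1 \o p1) -> e 0 2 \o v2 == v2 \o (i2 \o p2) ->
  e 0 3 \o v3 == v3 \o (i3 \o p3) ->
  l \o i1 == i2 \o f -> m \o i2 == i3 \o g ->
  octahedron f g.
Proof.
  intros TX HX He ee Hl Hm P1 P2 P3 E1 E2 E3 F1 F2.
  destruct (nsplit hC TX He ee) as [Z [s [r [TZ [Hs [Hr [rs sr]]]]]]].
  assert (V : forall k (x lk : C) (v : Iso lk (nob X 0 k)) (i : hom x lk) (p : hom lk x),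
    k <= 3 -> p \o i == idm x -> e 0 k \o v == v \o (i \o p) ->
    is_iso (r 0 k \o v \o i)).
  { intros k x lk v i p Hk P E; exists (p \o iso_inv v \o s 0 k); split; la.
    - rw (sr 0 k ltac:(lia)); rw E; rw (iso_invl v); rewrite comp_idr.
      rewrite P, comp_idl; exact P.
    - rewrite (comp_assoc (r 0 k \o v)), (comp_assoc (r 0 k)), <- E; la.
      rw (iso_invr v); rewrite comp_idr, <- (sr 0 k) by lia; la.
      rw (rs 0 k ltac:(lia)); rewrite comp_idl; apply rs; lia. }
  exists Z, (iso_of (V 1 _ _ v1 i1 p1 ltac:(lia) P1 E1)),
    (iso_of (V 2 _ _ v2 i2 p2 ltac:(lia) P2 E2)),
    (iso_of (V 3 _ _ v3 i3 p3 ltac:(lia) P3 E3)).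
  split; [exact TZ|split; [|split]].
  - intros phi Hphi H1 H2.
    apply (dst_retract (X := nreindex phi X)).
    + exact (nreindex_ntriangle Hphi TZ).
    + now apply HX.
    + exists (fun i j => s (phi i) (phi j)), (fun i j => r (phi i) (phi j)).
      split; [exact (nreindex_nmorphism Hphi Hs)|].
      split; [exact (nreindex_nmorphism Hphi Hr)|].
      intros i j Hij; apply rs; apply Hphi; lia.
  - cbn; la; rewrite (proj1 Hr 0 1 0 2) by lia.
    rewrite (comp_assoc (r 0 2)), Hl; la; rewrite (comp_assoc _ l), F1; now la.
  - cbn; la; rewrite (proj1 Hr 0 2 0 3) by lia.
    rewrite (comp_assoc (r 0 3)), Hm; la; rewrite (comp_assoc _ m), F2; now la.
Qed.

Lemma one_minus_nmorphism n (X : ndiag Sg) e : is_nmorphism n (X := X) (Y := X) e ->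
  is_nmorphism n (X := X) (Y := X) (fun i j => subm (idm _) (e i j)).
Proof.
  intros He; exact (nmorphism_add aS (nmorphism_id n X) (nmorphism_opp aS He)).
Qed.

Lemma one_minus_idempotent {x : C} (e : hom x x) : e \o e == e ->
  subm (idm x) e \o subm (idm x) e == subm (idm x) e.
Proof.
  intros E; rewrite comp_subl, comp_idl, comp_subr, comp_idr, E.
  rewrite (proj2 (subm_eq e e)) by reflexivity; apply subm_zero.
Qed.

Lemma complement_conj {x y : C} (v : Iso x y) (k : hom x x) :
  subm (idm y) (v \o subm (idm x) k \o iso_inv v) \o v == v \o k.
Proof.
  rewrite comp_subl, comp_idl; rw (iso_invl v); rewrite comp_idr, comp_subr, comp_idr.
  apply subm_eq; unfold subm.
  rewrite oppm_add, oppm_opp, <- !addm_assoc, addm_opp_r, addm_zero.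
  apply addm_opp_r.
Qed.

Lemma complement_conj_idem {x y : C} (v : Iso x y) (k : hom x x) : k \o k == k ->
  (v \o subm (idm x) k \o iso_inv v) \o (v \o subm (idm x) k \o iso_inv v)
    == v \o subm (idm x) k \o iso_inv v.
Proof.
  intros E; la; rw (iso_invl v); rewrite comp_idr, (comp_assoc v).
  now rewrite (one_minus_idempotent E).
Qed.

(** The six vertices of a 3-triangle off the diagonal; those on the diagonal are zero. *)
Definition family3 (X : ndiag Sg) (w01 : hom (nob X 0 1) (nob X 0 1))
    (w02 : hom (nob X 0 2) (nob X 0 2)) (w03 : hom (nob X 0 3) (nob X 0 3))
    (w12 : hom (nob X 1 2) (nob X 1 2)) (w13 : hom (nob X 1 3) (nob X 1 3))
    (w23 : hom (nob X 2 3) (nob X 2 3)) (i j : nat) : hom (nob X i j) (nob X i j) :=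
  match i, j with
  | 0, 1 => w01 | 0, 2 => w02 | 0, 3 => w03 | 1, 2 => w12 | 1, 3 => w13 | 2, 3 => w23
  | _, _ => zerom _ _
  end.

Lemma family3_nmorphism (X : ndiag Sg) w01 w02 w03 w12 w13 w23 : is_ntriangle 3 X ->
  ntr X 0 1 0 2 \o w01 == w02 \o ntr X 0 1 0 2 ->
  ntr X 0 2 0 3 \o w02 == w03 \o ntr X 0 2 0 3 ->
  ntr X 1 2 1 3 \o w12 == w13 \o ntr X 1 2 1 3 ->
  ntr X 0 2 1 2 \o w02 == w12 \o ntr X 0 2 1 2 ->
  ntr X 0 3 1 3 \o w03 == w13 \o ntr X 0 3 1 3 ->
  ntr X 1 3 2 3 \o w13 == w23 \o ntr X 1 3 2 3 ->
  nbd X 0 1 3 \o w13 == fmor Sg w01 \o nbd X 0 1 3 ->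
  nbd X 0 2 3 \o w23 == fmor Sg w02 \o nbd X 0 2 3 ->
  is_nmorphism 3 (X := X) (Y := X) (family3 w01 w02 w03 w12 w13 w23).
Proof.
  intros TX A1 A2 A3 A4 A5 A6 B1 B2; apply (nmorphism_steps aS TX TX).
  - intros [|[|[|i]]] [|[|[|j]]] H; try lia; assumption.
  - intros [|[|[|i]]] [|[|[|[|j]]]] H; try lia; assumption.
  - intros [|[|[|j]]] H; try lia; assumption.
Qed.

Lemma family3_idempotent (X : ndiag Sg) w01 w02 w03 w12 w13 w23 :
  w01 \o w01 == w01 -> w02 \o w02 == w02 -> w03 \o w03 == w03 ->
  w12 \o w12 == w12 -> w13 \o w13 == w13 -> w23 \o w23 == w23 ->
  forall i j, family3 (X := X) w01 w02 w03 w12 w13 w23 i j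
     \o family3 w01 w02 w03 w12 w13 w23 i j == family3 w01 w02 w03 w12 w13 w23 i j.
Proof.
  intros ? ? ? ? ? ? [|[|[|i]]] [|[|[|[|j]]]]; cbn; auto; apply comp_zerol.
Qed.

Section Relations.
Context (X : ndiag Sg) (TX : is_ntriangle 3 X).

Lemma tri_comp i j i' j' i'' j'' : i <= j <= 3 -> i' <= j' <= 3 -> i'' <= j'' <= 3 ->
  i <= i' <= i'' -> j <= j' <= j'' ->
  ntr X i' j' i'' j'' \o ntr X i j i' j' == ntr X i j i'' j''.
Proof. apply TX. Qed.

Lemma tri_zero i j i'' j'' k : i <= j <= 3 -> i'' <= j'' <= 3 ->
  i <= k <= i'' -> j <= k <= j'' -> ntr X i j i'' j'' == zerom _ _.
Proof.
  intros; rewrite <- (tri_comp (i' := k) (j' := k)) by lia.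
  rewrite (to_zero (ntr X i j k k) (zerom _ _)) by (apply TX; lia).
  apply comp_zeror.
Qed.

Lemma tri_bd i j k i' j' k' : i <= j <= k -> i' <= j' <= k' -> k <= 3 -> k' <= 3 ->
  i <= i' -> j <= j' -> k <= k' ->
  nbd X i' j' k' \o ntr X j k j' k' == fmor Sg (ntr X i j i' j') \o nbd X i j k.
Proof. apply TX. Qed.
End Relations.

(** The complement of x1 in l1 is killed by the first map, so its suspension splits off X(1,2) and
    X(1,3). With [e] the projection onto the complement, [nu] lifts Sigma e through the connecting
    map, and [w] projects onto the summand generated in this way. *)
Lemma octahedron_strip1 {l1 x1 x2 x3 : C} (i : hom x1 l1) (p : hom l1 x1)
    (f : hom x1 x2) (g : hom x2 x3) :
  p \o i == idm x1 -> octahedron (f \o p) g -> octahedron f g.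
Proof.
  intros pi [X [v1 [v2 [v3 [TX [HX [Hf Hg]]]]]]].
  pose (e := v1 \o subm (idm _) (i \o p) \o iso_inv v1).
  assert (ipip : (i \o p) \o (i \o p) == i \o p)
    by (la; rewrite (comp_assoc i p i), pi; now idc).
  assert (ee : e \o e == e) by (now apply complement_conj_idem).
  assert (fe : ntr X 0 1 0 2 \o e == zerom _ _).
  { unfold e; la; rewrite Hf, (comp_assoc v2), (comp_assoc f), comp_subr, comp_idr; la.
    rewrite pi, comp_idl, (proj2 (subm_eq p p)) by reflexivity.
    now rewrite comp_zeror, comp_zerol, ?comp_zeror, ?comp_zerol. }
  destruct (dst_exact (face_dst (j := 1) (k := 2) HX ltac:(lia) ltac:(lia))
    (v := fmor Sg e)) as [n0 Hn0].
  { cbn; now rewrite <- fmor_comp, fe, (fmor_zero aS). }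
  cbn in n0, Hn0.
  pose (nu := n0 \o fmor Sg e).
  assert (bn : nbd X 0 1 2 \o nu == fmor Sg e).
  { unfold nu; la; rewrite <- Hn0, <- fmor_comp; now rewrite ee. }
  assert (ne : nu \o fmor Sg e == nu).
  { unfold nu; la; rewrite comp_assoc, <- fmor_comp; now rewrite ee. }
  clearbody nu; clear n0 Hn0.
  assert (ba : nbd X 0 1 3 \o ntr X 1 2 1 3 == nbd X 0 1 2).
  { rewrite (tri_bd TX (i := 0) (j := 1) (k := 2)) by lia.
    rewrite (proj1 (proj2 TX)), fmor_id by lia; apply comp_idl. }
  pose (w := family3 (X := X) e (zerom _ _) (zerom _ _) (nu \o nbd X 0 1 2)
    (ntr X 1 2 1 3 \o nu \o nbd X 0 1 3) (zerom _ _)).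
  assert (Hw : is_nmorphism 3 (X := X) (Y := X) w).
  { apply family3_nmorphism; trivial; rewrite ?(fmor_zero aS), ?comp_zeror, ?comp_zerol; la.
    - exact fe.
    - reflexivity.
    - now rewrite (comp_assoc _ _ (ntr X 1 2 1 3)), ba.
    - rewrite comp_assoc, (ntriangle_zero2 (i := 1) (j := 2) aS TX) by lia.
      now rewrite comp_zeror.
    - rewrite comp_assoc, (ntriangle_zero2 (i := 1) (j := 3) aS TX) by lia.
      now rewrite comp_zeror.
    - rewrite (tri_comp TX), (tri_zero TX (k := 2)) by lia; now rewrite !comp_zerol.
    - now rewrite ba, bn.
    - reflexivity. }
  assert (ww : forall a b, w a b \o w a b == w a b).
  { apply family3_idempotent; rewrite ?comp_zerol; try reflexivity; trivial; la.
    - rewrite (comp_assoc nu), bn; now rewrite ne.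
    - rewrite (comp_assoc _ _ (ntr X 1 2 1 3)), ba, (comp_assoc _ _ nu), bn.
      now rewrite (comp_assoc _ nu), ne. }
  refine (octahedron_split (X := X) (e := fun a b => subm (idm _) (w a b))
    (v1 := v1) (v2 := v2) (v3 := v3) (i1 := i) (p1 := p)
    (i2 := idm _) (p2 := idm _) (i3 := idm _) (p3 := idm _) TX HX
    (one_minus_nmorphism Hw) (fun a b _ => one_minus_idempotent (ww a b)) Hf Hg pi
    (comp_idl _) (comp_idl _) (complement_conj v1 (i \o p)) _ _ _ _);
    cbn; rewrite ?subm_zero; idc; try reflexivity.
  rewrite comp_assoc, pi; now idc.
Qed.

(** The complement of x2 in l2 receives nothing from x1 and goes to zero in x3. It contributes to
    X(1,2), where [rho] projects back onto it, and suspended to X(2,3) through [nu]; X(1,3) is not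
    affected. *)
Lemma octahedron_strip2 {l2 x1 x2 x3 : C} (i : hom x2 l2) (p : hom l2 x2)
    (f : hom x1 x2) (g : hom x2 x3) :
  p \o i == idm x2 -> octahedron (i \o f) (g \o p) -> octahedron f g.
Proof.
  intros pi [X [v1 [v2 [v3 [TX [HX [Hf Hg]]]]]]].
  pose (e := v2 \o subm (idm _) (i \o p) \o iso_inv v2).
  assert (ipip : (i \o p) \o (i \o p) == i \o p)
    by (la; rewrite (comp_assoc i p i), pi; now idc).
  assert (ee : e \o e == e) by (now apply complement_conj_idem).
  assert (ef : e \o ntr X 0 1 0 2 == zerom _ _).
  { apply (iso_epi (i := v1)); unfold e; la; rewrite (comp_assoc _ _ v1), Hf.
    rewrite (comp_assoc _ (iso_inv v2)), <- (comp_assoc (iso_inv v2)), iso_invl, comp_idl.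
    rewrite (comp_assoc v2), comp_subl, comp_idl; la.
    rewrite (comp_assoc i p i), pi, comp_idr.
    rewrite (proj2 (subm_eq _ _)) by reflexivity; now rewrite comp_zeror, comp_zerol. }
  assert (ge : ntr X 0 2 0 3 \o e == zerom _ _).
  { unfold e; la; rewrite Hg, (comp_assoc v3), (comp_assoc g), comp_subr, comp_idr; la.
    rewrite pi, comp_idl, (proj2 (subm_eq p p)) by reflexivity.
    now rewrite comp_zeror, comp_zerol, ?comp_zeror, ?comp_zerol. }
  destruct (dst_coexact (face_dst (j := 1) (k := 2) HX ltac:(lia) ltac:(lia))
    (v := e) ef) as [r0 Hr0].
  destruct (dst_exact (face_dst (j := 2) (k := 3) HX ltac:(lia) ltac:(lia))
    (v := fmor Sg e)) as [n0 Hn0].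
  { cbn; now rewrite <- fmor_comp, ge, (fmor_zero aS). }
  cbn in n0, Hn0, r0, Hr0.
  pose (nu := n0 \o fmor Sg e); pose (rho := e \o r0).
  assert (bn : nbd X 0 2 3 \o nu == fmor Sg e).
  { unfold nu; la; rewrite <- Hn0, <- fmor_comp; now rewrite ee. }
  assert (ne : nu \o fmor Sg e == nu).
  { unfold nu; la; rewrite comp_assoc, <- fmor_comp; now rewrite ee. }
  assert (ru : rho \o ntr X 0 2 1 2 == e).
  { unfold rho; la; rewrite comp_assoc, <- Hr0; exact ee. }
  assert (er : e \o rho == rho) by (unfold rho; la; now rewrite ee).
  clearbody nu rho; clear n0 Hn0 r0 Hr0.
  pose (w := family3 (X := X) (zerom _ _) e (zerom _ _) (ntr X 0 2 1 2 \o rho)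
    (zerom _ _) (nu \o nbd X 0 2 3)).
  assert (Hw : is_nmorphism 3 (X := X) (Y := X) w).
  { apply family3_nmorphism; trivial; rewrite ?(fmor_zero aS), ?comp_zeror, ?comp_zerol; la.
    - now symmetry.
    - exact ge.
    - rewrite (tri_comp TX) by lia; rewrite <- (tri_comp TX (i' := 0) (j' := 3)) by lia.
      rewrite <- er; la; rewrite (comp_assoc _ _ e), ge, comp_zeror; apply comp_zerol.
    - now rewrite (comp_assoc _ rho), ru.
    - reflexivity.
    - rewrite comp_assoc, (tri_bd TX (i := 0) (j := 1) (k := 3)) by lia.
      rewrite <- ne; la; rewrite (comp_assoc nu), <- fmor_comp, ef, (fmor_zero aS).
      now rewrite comp_zeror, comp_zerol.
    - reflexivity.
    - now rewrite bn. }
  assert (ww : forall a b, w a b \o w a b == w a b).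
  { apply family3_idempotent; rewrite ?comp_zerol; try reflexivity; trivial; la.
    - rewrite (comp_assoc _ rho), ru, comp_assoc, er; reflexivity.
    - rewrite (comp_assoc nu), bn; now rewrite ne. }
  refine (octahedron_split (X := X) (e := fun a b => subm (idm _) (w a b))
    (v1 := v1) (v2 := v2) (v3 := v3) (i1 := idm _) (p1 := idm _)
    (i2 := i) (p2 := p) (i3 := idm _) (p3 := idm _) TX HX
    (one_minus_nmorphism Hw) (fun a b _ => one_minus_idempotent (ww a b)) Hf Hg
    (comp_idl _) pi (comp_idl _) _ (complement_conj v2 (i \o p)) _ _ _);
    cbn; rewrite ?subm_zero; idc; try reflexivity.
  rewrite comp_assoc, pi; now idc.
Qed.

(** The complement of x3 in l3 receives nothing from x2, so it reappears unsuspended in X(1,3) and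
    X(2,3), where [rho] projects back onto it. *)
Lemma octahedron_strip3 {l3 x1 x2 x3 : C} (i : hom x3 l3) (p : hom l3 x3)
    (f : hom x1 x2) (g : hom x2 x3) :
  p \o i == idm x3 -> octahedron f (i \o g) -> octahedron f g.
Proof.
  intros pi [X [v1 [v2 [v3 [TX [HX [Hf Hg]]]]]]].
  pose (e := v3 \o subm (idm _) (i \o p) \o iso_inv v3).
  assert (ipip : (i \o p) \o (i \o p) == i \o p)
    by (la; rewrite (comp_assoc i p i), pi; now idc).
  assert (ee : e \o e == e) by (now apply complement_conj_idem).
  assert (eg : e \o ntr X 0 2 0 3 == zerom _ _).
  { apply (iso_epi (i := v2)); unfold e; la; rewrite (comp_assoc _ _ v2), Hg.
    rewrite (comp_assoc _ (iso_inv v3)), <- (comp_assoc (iso_inv v3)), iso_invl, comp_idl.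
    rewrite (comp_assoc v3), comp_subl, comp_idl; la.
    rewrite (comp_assoc i p i), pi, comp_idr.
    rewrite (proj2 (subm_eq _ _)) by reflexivity; now rewrite comp_zeror, comp_zerol. }
  destruct (dst_coexact (face_dst (j := 2) (k := 3) HX ltac:(lia) ltac:(lia))
    (v := e) eg) as [r0 Hr0].
  cbn in r0, Hr0; pose (rho := e \o r0).
  assert (ru : rho \o ntr X 0 3 2 3 == e).
  { unfold rho; la; rewrite comp_assoc, <- Hr0; exact ee. }
  assert (er : e \o rho == rho) by (unfold rho; la; now rewrite ee).
  clearbody rho; clear r0 Hr0.
  assert (st : ntr X 1 3 2 3 \o ntr X 0 3 1 3 == ntr X 0 3 2 3)
    by (apply (tri_comp TX); lia).
  pose (w := family3 (X := X) (zerom _ _) (zerom _ _) e (zerom _ _)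
    (ntr X 0 3 1 3 \o rho \o ntr X 1 3 2 3) (ntr X 0 3 2 3 \o rho)).
  assert (Hw : is_nmorphism 3 (X := X) (Y := X) w).
  { apply family3_nmorphism; trivial; rewrite ?(fmor_zero aS), ?comp_zeror, ?comp_zerol; la.
    - reflexivity.
    - now symmetry.
    - rewrite comp_assoc, (tri_comp TX), (tri_zero TX (i := 1) (j := 2) (k := 2)) by lia.
      now rewrite comp_zeror.
    - reflexivity.
    - rewrite comp_assoc, st, comp_assoc, ru; reflexivity.
    - now rewrite st.
    - rewrite (ntriangle_zero2 (i := 1) (j := 3) aS TX) by lia.
      now rewrite !comp_zerol.
    - rewrite (ntriangle_zero2 (i := 2) (j := 3) aS TX) by lia.
      now rewrite comp_zerol. }
  assert (ww : forall a b, w a b \o w a b == w a b).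
  { apply family3_idempotent; rewrite ?comp_zerol; try reflexivity; trivial; la.
    - rewrite (comp_assoc _ _ (ntr X 0 3 1 3)), st, (comp_assoc _ rho (ntr X 0 3 2 3)), ru.
      now rewrite (comp_assoc _ e), er.
    - rewrite (comp_assoc _ rho), ru; now rewrite comp_assoc, er. }
  refine (octahedron_split (X := X) (e := fun a b => subm (idm _) (w a b))
    (v1 := v1) (v2 := v2) (v3 := v3) (i1 := idm _) (p1 := idm _)
    (i2 := idm _) (p2 := idm _) (i3 := i) (p3 := p) TX HX
    (one_minus_nmorphism Hw) (fun a b _ => one_minus_idempotent (ww a b)) Hf Hg
    (comp_idl _) (comp_idl _) pi _ _ (complement_conj v3 (i \o p)) _ _);
    cbn; rewrite ?subm_zero; idc; try reflexivity.
Qed.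

(* The three complements are stripped off one at a time, so that only one of
   the three objects changes in each step. *)
Lemma octahedron_retract {l1 l2 l3 x1 x2 x3 : C}
    (i1 : hom x1 l1) (p1 : hom l1 x1) (i2 : hom x2 l2) (p2 : hom l2 x2)
    (i3 : hom x3 l3) (p3 : hom l3 x3) (f : hom x1 x2) (g : hom x2 x3) :
  p1 \o i1 == idm x1 -> p2 \o i2 == idm x2 -> p3 \o i3 == idm x3 ->
  octahedron (i2 \o f \o p1) (i3 \o g \o p2) -> octahedron f g.
Proof.
  intros P1 P2 P3 H.
  apply (octahedron_strip3 P3), (octahedron_strip2 P2), (octahedron_strip1 P1), H.
Qed.
End Strip.
End Steps.

(** * The octahedral axiom for modules *)

Section ModuleExact.
Context {o : tri_order} (ho : valid_order o) {T : Cat} {tT : TensorTri o T}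
  (hadd : tens_additive (C := T) tt_mon)
  (A : Algebra T) (s : hom A (A ⊗ A))
  (s1 : amul A \o s == idm (acar A))
  (s2 : (idm (acar A) ⊠ amul A) \o assoc A A A \o (s ⊠ idm (acar A)) == s \o amul A)
  (s3 : (amul A ⊠ idm (acar A)) \o iso_inv (assoc A A A) \o (idm (acar A) ⊠ s)
          == s \o amul A).
Notation D := (module_cat A).
#[local] Instance mpa' : PreAdd D := module_preadd hadd A.
Notation Sg := (module_susp A).
Notation und X := (nimage (F := forget A) (fun M => forget_susp A M) X).

(** A lift exists in T; since [v] and the connecting map are linear, its average is still a lift. *)
Lemma module_exact (Y : ndiag Sg) : module_dist 2 Y -> forall t (v : hom t (Sg (nob Y 0 1))),
  fmor Sg (ntr Y 0 1 0 2) \o v == zerom _ _ -> exists u, v == nbd Y 0 1 2 \o u.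
Proof.
  intros HY t v Hv.
  destruct (dist2_exact3 ho (X := und Y) (t := mcar t) (v := mhom v) HY) as [u Hu].
  { exact Hv. }
  exists (average s2 s3 (M := t) (N := nob Y 1 2) u).
  change (mhom v == mhom (nbd Y 0 1 2) \o mhom (average s2 s3 (M := t) (N := nob Y 1 2) u)).
  rewrite <- (average_post s2 s3 (nbd Y 0 1 2)), <- (average_linear s1 s2 s3 v).
  apply average_proper; rewrite Hu; cbn; now rewrite comp_idl.
Qed.

Lemma module_coexact (Y : ndiag Sg) : module_dist 2 Y -> forall t (v : hom (nob Y 0 2) t),
  v \o ntr Y 0 1 0 2 == zerom _ _ -> exists u, v == u \o ntr Y 0 2 1 2.
Proof.
  intros HY t v Hv.
  destruct (dist2_coexact1 ho (X := und Y) (t := mcar t) (v := mhom v) HY) as [u Hu].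
  { exact Hv. }
  exists (average s2 s3 (M := nob Y 1 2) (N := t) u).
  change (mhom v == mhom (average s2 s3 (M := nob Y 1 2) (N := t) u) \o mhom (ntr Y 0 2 1 2)).
  rewrite <- (average_pre s2 s3 (P := t) u (ntr Y 0 2 1 2)), <- (average_linear s1 s2 s3 v).
  apply average_proper; exact Hu.
Qed.
End ModuleExact.

Section Quotient.
Context {o : tri_order} (ho : valid_order o) {T S : Cat} {tT : TensorTri o T}
  {tS : TensorTri o S} (hT : idempotent_complete T)
  {F : Functor T S} (tF : TTFunctor F) {G : Functor S T}
  (adj : Adjunction F G) (hadd : tens_additive (C := T) tt_mon)
  (hproj : right_projection_formula tF adj)
  (s : hom (unit_algebra tF adj) (unit_algebra tF adj ⊗ unit_algebra tF adj))
  (s1 : amul (unit_algebra tF adj) \o s == idm (acar (unit_algebra tF adj)))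
  (s2 : (idm (acar (unit_algebra tF adj)) ⊠ amul (unit_algebra tF adj))
     \o assoc (unit_algebra tF adj) (unit_algebra tF adj) (unit_algebra tF adj)
     \o (s ⊠ idm (acar (unit_algebra tF adj))) == s \o amul (unit_algebra tF adj))
  (s3 : (amul (unit_algebra tF adj) ⊠ idm (acar (unit_algebra tF adj)))
     \o iso_inv (assoc (unit_algebra tF adj) (unit_algebra tF adj) (unit_algebra tF adj))
     \o (idm (acar (unit_algebra tF adj)) ⊠ s)
          == s \o amul (unit_algebra tF adj)).
Notation eta := (unit_adj adj).
Notation eps := (counit_adj adj).
Notation A := (unit_algebra tF adj).
Notation K := (comparison tF adj).
Notation D := (module_cat A).
#[local] Instance mpaD : PreAdd D := module_preadd hadd A.
Notation thetaI t := (iso_of (theta_is_iso (mF := tF) (adj := adj) t hproj)).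

Definition free_in (M : D) : hom M (K (F (mcar M))) :=
  theta tF adj (mcar M) \o sec_mor s2 s3 M.

Definition free_out (M : D) : hom (K (F (mcar M))) M :=
  act_mor M \o iso_inv (thetaI (mcar M)).

Lemma free_out_in (M : D) : free_out M \o free_in M == idm M.
Proof.
  unfold free_in, free_out; la; rw (iso_invl (thetaI (mcar M))).
  rewrite comp_idr; apply (act_mor_section s1 s2 s3).
Qed.

Lemma comparison_additive : is_additive_functor K.
Proof. intros x y f g; exact (G_additive tF adj f g). Qed.

Lemma module_susp_additive : is_additive_functor (module_susp A).
Proof.
  apply (equivalence_additive (module_susp_equivalence A)), module_additive.
Qed.

(** Both maps are padded to maps between modules K (F t). These come from S, where an octahedron
    exists, and its image under K has the chain f, g as a retract of its base. *)
Lemma comparison_octahedron {x1 x2 x3 : D} (f : hom x1 x2) (g : hom x2 x3) :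
  o = Verdier -> octahedron (Sg := module_susp A) (module_dist (A := A) 2) f g.
Proof.
  intros eo; pose proof (in_range_two ho) as r2.
  apply (octahedron_retract (module_idempotent_complete hT (A := A)) module_susp_additive
    (module_exact ho (hadd := hadd) s1 s2 s3) (module_coexact ho (hadd := hadd) s1 s2 s3)
    (fun X Y TY HX HR => module_dist_retract ho hadd r2 TY HX HR)
    (free_out_in x1) (free_out_in x2) (free_out_in x3)).
  set (l1 := free_in x2 \o f \o free_out x1).
  set (l2 := free_in x3 \o g \o free_out x2).
  assert (E1 := comparison_full_free (mF := tF) (adj := adj) (t := mcar x1)
    (s := F (mcar x2)) l1 hproj).
  assert (E2 := comparison_full_free (mF := tF) (adj := adj) (t := mcar x2)
    (s := F (mcar x3)) l2 hproj).
  set (k1 := eps (F (mcar x2)) \o fmor F (mhom l1 \o eta (mcar x1))) in E1.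
  set (k2 := eps (F (mcar x3)) \o fmor F (mhom l2 \o eta (mcar x2))) in E2.
  clearbody k1 k2 l1 l2.
  (* Entry 0 and the entries beyond 3 are fillers; the chain proper is k1, k2. *)
  destruct (tri_octahedral (Tri := tt_tri) eo
    (b := fun i => match i with 0 | 1 => F (mcar x1) | 2 => F (mcar x2) | _ => F (mcar x3) end)
    (fun i => match i return
       hom (match i with 0 | 1 => F (mcar x1) | 2 => F (mcar x2) | _ => F (mcar x3) end)
           (match i with 0 => F (mcar x1) | 1 => F (mcar x2) | _ => F (mcar x3) end)
       with 0 => idm _ | 1 => k1 | 2 => k2 | _ => idm _ end))
    as [X [TX [[v [Hv Hn]] HX]]].
  pose proof (Hn 1 ltac:(lia)) as N1; pose proof (Hn 2 ltac:(lia)) as N2.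
  cbn in v, N1, N2.
  exists (nimage (F := K) (fun x => gammaK tF adj x) X),
    (fiso K (iso_of (Hv 1 ltac:(lia)))), (fiso K (iso_of (Hv 2 ltac:(lia)))),
    (fiso K (iso_of (Hv 3 ltac:(lia)))).
  split; [|split; [|split]].
  - refine (nimage_ntriangle (fun x y f => nat_iso_natural (gammaK tF adj) f) _ TX).
    intros x; apply (fmor_is_zero comparison_additive).
  - intros phi Hphi H1 H2; exact (comparison_dist ho tF adj r2 (HX phi Hphi H1 H2)).
  - refine (transitivity (symmetry (fmor_comp K _ _)) _); cbn [iso_fwd fiso].
    refine (transitivity (@fmor_proper _ _ K _ _ _ _ N1) _).
    refine (transitivity (fmor_comp K _ _) _); now rewrite E1.
  - refine (transitivity (symmetry (fmor_comp K _ _)) _); cbn [iso_fwd fiso].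
    refine (transitivity (@fmor_proper _ _ K _ _ _ _ N2) _).
    refine (transitivity (fmor_comp K _ _) _); now rewrite E2.
Qed.

Lemma nextends_octahedron {C : Cat} {aC : PreAdd C} {Sg : Functor C C} dst (b : nat -> C)
    (f : forall i, hom (b i) (b (Datatypes.S i))) :
  octahedron (Sg := Sg) dst (f 1) (f 2) ->
  exists X : ndiag Sg, is_ntriangle 3 X /\ nextends 3 X f /\
    (forall phi, monotone_upto 2 3 phi ->
       phi 0 < phi 1 -> phi 1 < phi 2 -> dst (nreindex phi X)).
Proof.
  intros [X [v1 [v2 [v3 [TX [HX [N1 N2]]]]]]].
  exists X; split; [exact TX|split; [|exact HX]].
  exists (fun i => match i return hom (b i) (nob X 0 i) with
    | 1 => v1 | 2 => v2 | 3 => v3 | _ => zerom _ _ end); split.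
  - intros [|[|[|[|i]]]] Hi; try lia; apply is_iso_iso.
  - intros [|[|[|i]]] Hi; try lia; assumption.
Qed.

Definition module_tri_structure : Tri o D :=
  module_tri ho hT hadd s1 s2 s3
    (fun eo b f => nextends_octahedron (comparison_octahedron (f 1) (f 2) eo)).
End Quotient.

(** * Triangulations pulled back along a fully faithful functor *)

Section TriPullback.
Context {o : tri_order} (ho : valid_order o) {C D : Cat} (tD : Tri o D)
  (U : Functor C D) (fU : full U) (hU : faithful U) (Sg : Functor C C)
  (sI : NatIso (functor_comp U Sg) (functor_comp susp U)).

Definition pb_preadd : PreAdd C := preadd_pullback fU hU.
#[local] Existing Instance pb_preadd.

Lemma pb_additive : is_additive_functor U.
Proof. exact (preadd_pullback_additive fU hU). Qed.

Lemma pb_susp_equivalence : ess_surj Sg -> is_equivalence Sg.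
Proof.
  apply ff_equivalence.
  - intros x y f.
    destruct (susp_full (sI y \o fmor U f \o iso_inv (sI x))) as [g Hg].
    exists (preim fU g); apply hU, (iso_mono (i := sI y)).
    rewrite (sI_natural sI), fmor_preim, Hg; rw (iso_invl (sI x)); apply comp_idr.
  - intros x y f g E; apply hU, susp_faithful, (iso_epi (i := sI x)).
    rewrite <- !(sI_natural sI); now rewrite E.
Qed.

Definition tri_pullback (addC : is_additive C) (eS : ess_surj Sg)
    (Hb : forall n b (f : forall i, hom (b i) (b (S i))), in_range o n ->
       exists X, created_dist sI n X /\ nextends n X f)
    (Ho : o = Verdier -> forall b (f : forall i, hom (b i) (b (S i))),
       exists X : ndiag Sg, is_ntriangle 3 X /\ nextends 3 X f /\
         (forall phi, monotone_upto 2 3 phi ->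
            phi 0 < phi 1 -> phi 1 < phi 2 -> created_dist sI 2 (nreindex phi X))) :
  Tri o C :=
  tri_create (sI := sI) addC (pb_susp_equivalence eS) hU pb_additive Hb
    (full_extend_morphism (sI := sI) hU fU) Ho.

End TriPullback.

(** * Suspension and triangles of the quotient *)

Section Quotient.
Context {o : tri_order} (ho : valid_order o) {T S : Cat} {tT : TensorTri o T}
  {tS : TensorTri o S} (hT : idempotent_complete T)
  {F : Functor T S} (tF : TTFunctor F) {G : Functor S T}
  (adj : Adjunction F G) (hadd : tens_additive (C := T) tt_mon)
  (hker : kernel_tensor_closed G)
  (hproj : right_projection_formula tF adj)
  (s : hom (unit_algebra tF adj) (unit_algebra tF adj ⊗ unit_algebra tF adj))
  (s1 : amul (unit_algebra tF adj) \o s == idm (acar (unit_algebra tF adj)))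
  (s2 : (idm (acar (unit_algebra tF adj)) ⊠ amul (unit_algebra tF adj))
     \o assoc (unit_algebra tF adj) (unit_algebra tF adj) (unit_algebra tF adj)
     \o (s ⊠ idm (acar (unit_algebra tF adj))) == s \o amul (unit_algebra tF adj))
  (s3 : (amul (unit_algebra tF adj) ⊠ idm (acar (unit_algebra tF adj)))
     \o iso_inv (assoc (unit_algebra tF adj) (unit_algebra tF adj) (unit_algebra tF adj))
     \o (idm (acar (unit_algebra tF adj)) ⊠ s)
          == s \o amul (unit_algebra tF adj)).
Notation A := (unit_algebra tF adj).
Notation K := (comparison tF adj).
Notation D := (module_cat A).
Notation Q := (verdier_quotient (o := o) G).
Notation q := (quotient_functor (o := o) G).
Notation KB := (Kbar ho tF adj).
Notation DTri := (module_tri_structure ho hT hadd hproj s1 s2 s3).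

Let Kfull : full KB := Kbar_full (ho := ho) hproj s1 s2 s3.
Let Kfaith : faithful KB := Kbar_faithful (ho := ho) hproj s1 s2 s3.

Lemma susp_inverts (x y : S) (w : hom x y) : cone_in_kernel (o := o) G w ->
  is_iso (fmor (functor_comp q susp) w).
Proof.
  intros Ww; cbn; apply (q_iso ho tF adj), (W_susp tF adj), (W_iff ho tF adj), Ww.
Qed.

Definition Qsusp : Functor Q Q := loc_lift susp_inverts.

Definition Qsusp_nat : NatIso (functor_comp KB Qsusp) (functor_comp (module_susp A) KB).
Proof.
  refine (@MkNatIso Q D (functor_comp KB Qsusp) (functor_comp (module_susp A) KB)
    (fun x => gammaK tF adj x) _).
  apply (loc_natural (P := functor_comp KB Qsusp) (R := functor_comp (module_susp A) KB)
    (a := fun x => gammaK tF adj x)).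
  intros x y f; exact (nat_iso_natural (gammaK tF adj) f).
Defined.

Definition Qpreadd : PreAdd Q := pb_preadd DTri Kfull Kfaith.
#[local] Existing Instance Qpreadd.

Lemma q_additive : is_additive_functor q.
Proof.
  intros x y f g; apply Kfaith.
  refine (transitivity _ (symmetry (pb_additive DTri Kfull Kfaith (fmor q f) (fmor q g)))).
  exact (comparison_additive tF adj hadd f g).
Qed.

Lemma Q_additive : is_additive Q.
Proof.
  destruct (tri_additive (Tri := tt_tri (C := S))) as [[z Hz] Hb]; split.
  - exists z; exact (fmor_is_zero q_additive Hz).
  - intros x y; destruct (Hb x y) as [c [i [j [p [r [H1 [H2 [H3 [H4 H5]]]]]]]]].
    exists c, (fmor q i), (fmor q j), (fmor q p), (fmor q r).
    assert (H : forall a b d (g : hom (c := S) b d) (f : hom (c := S) a b) h, g \o f == h ->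
      fmor q g \o fmor q f == fmor q h)
      by (intros a b d g f h E; refine (transitivity (symmetry (fmor_comp q g f)) _); now rewrite E).
    assert (Z : forall a b : S, fmor q (zerom a b) == zerom _ _)
      by (intros; apply (fmor_zero q_additive)).
    assert (I : forall a : S, fmor q (idm a) == idm _) by (intros; apply fmor_id).
    split; [|split; [|split; [|split]]].
    + exact (transitivity (H _ _ _ _ _ _ H1) (I _)).
    + exact (transitivity (H _ _ _ _ _ _ H2) (I _)).
    + exact (transitivity (H _ _ _ _ _ _ H3) (Z _ _)).
    + exact (transitivity (H _ _ _ _ _ _ H4) (Z _ _)).
    + refine (transitivity _ (I _)).
      refine (transitivity (symmetry _) (@fmor_proper _ _ q _ _ _ _ H5)).
      refine (transitivity (q_additive _ _) _).
      apply addm_proper; apply (fmor_comp q).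
Qed.

Lemma Qsusp_ess_surj : ess_surj Qsusp.
Proof.
  intros y; destruct (susp_ess_surj (tC := tt_tri (C := S)) y) as [x [i]].
  exists x; constructor; exact (fiso q i).
Qed.

Notation qim X := (nimage (Sg' := Qsusp) (F := q) (fun x => idm _) X).

(** [Kbar] after the quotient functor computes to K on objects and morphisms, so this is exactness
    of K up to identity maps. *)
Lemma qim_dist n (Y : ndiag (susp (C := S))) : in_range o n -> dist n Y ->
  created_dist (tD := DTri) Qsusp_nat n (qim Y).
Proof.
  intros Hn HY; pose proof (comparison_dist ho tF adj Hn HY) as HD.
  change (module_dist n (nimage (F := K) (fun x => gammaK tF adj x) Y)) in HD.
  refine (dist_iso (Tri := DTri) Hn HD _ _); clear HD;
  [ assert (HD := comparison_dist ho tF adj Hn HY);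
    refine (ntriangle_iso (aC := module_preadd hadd A) (module_ntriangle hadd Hn HD) _) |];
  (apply (@nisomorphic_ext D (module_preadd hadd A) (module_susp A) n
     (fun i j => K (nob Y i j)) (fun i j i' j' => fmor K (ntr Y i j i' j')));
   [reflexivity | intros i j k _ _]);
  (assert (E : fmor KB (idm (Qsusp (nob Y i j)) \o fmor q (nbd Y i j k)) == fmor K (nbd Y i j k));
   [ rewrite comp_idl; reflexivity |]);
  exact (comp_proper (reflexivity (gammaK tF adj (nob Y i j) : hom (c := D) _ _)) (symmetry E)).
Qed.

Lemma qim_extends n (b : nat -> Q) f (z : nat -> S) g (w : forall i, hom (z i) (b i : S))
    (Y : ndiag (susp (C := S))) :
  (forall i, is_iso (fmor G (w i))) ->
  (forall i, i < n -> f i \o fmor q (w i) == fmor q (w (Datatypes.S i)) \o fmor q (g i)) ->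
  nextends n Y (b := z) g -> nextends n (qim Y) (b := b) f.
Proof.
  intros Iw Hw [v [Hv Nv]].
  exists (fun i => fmor q (v i) \o iso_inv (iso_of (q_iso ho tF adj (Iw i)))); split.
  - intros i Hi; apply is_iso_comp; [|apply is_iso_inv].
    apply (is_iso_fmor q), Hv, Hi.
  - intros i Hi.
    apply (iso_epi (i := iso_of (q_iso ho tF adj (Iw i)))).
    cbn [ntr nimage].
    rewrite (comp_assoc _ (f i)).
    change (iso_fwd (iso_of (q_iso ho tF adj (Iw i)))) with (fmor q (w i)) at 2.
    rewrite (Hw i) by lia; la.
    rw (iso_invl (iso_of (q_iso ho tF adj (Iw i)))).
    change (fmor q (w (Datatypes.S i))) with
      (iso_fwd (iso_of (q_iso ho tF adj (Iw (Datatypes.S i))))).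
    rw (iso_invl (iso_of (q_iso ho tF adj (Iw (Datatypes.S i))))).
    rewrite !comp_idr.
    refine (transitivity (symmetry (fmor_comp q _ _)) (transitivity _ (fmor_comp q _ _))).
    now rewrite (Nv i Hi).
Qed.
End Quotient.

(** * The tensor product on the quotient *)

Section Bifunctor.
Context {Q : Cat} (t : Q -> Q -> Q)
  (tm : forall {x x' y y' : Q}, hom x x' -> hom y y' -> hom (t x y) (t x' y'))
  (tm_proper : forall x x' y y', Proper (heq ==> heq ==> heq) (@tm x x' y y'))
  (tm_id : forall x y, tm (idm x) (idm y) == idm (t x y))
  (tm_comp : forall x y x' y' x'' y'' (f' : hom x' x'') (f : hom x x')
    (g' : hom y' y'') (g : hom y y'), tm (f' \o f) (g' \o g) == tm f' g' \o tm f g).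

(** Naturality in a localization is proved by induction on words in one variable at a time; this
    assembles the separate statements. *)
Lemma bifunctor_natural3 (a : forall x y z, hom (t (t x y) z) (t x (t y z))) :
  (forall x x' y z (f : hom x x'),
     a x' y z \o tm (tm f (idm y)) (idm z) == tm f (idm (t y z)) \o a x y z) ->
  (forall x y y' z (g : hom y y'),
     a x y' z \o tm (tm (idm x) g) (idm z) == tm (idm x) (tm g (idm z)) \o a x y z) ->
  (forall x y z z' (h : hom z z'),
     a x y z' \o tm (idm (t x y)) h == tm (idm x) (tm (idm y) h) \o a x y z) ->
  forall x x' y y' z z' (f : hom x x') (g : hom y y') (h : hom z z'),
    a x' y' z' \o tm (tm f g) h == tm f (tm g h) \o a x y z.
Proof.
  intros Nx Ny Nz x x' y y' z z' f g h.
  assert (EL : tm (tm f g) h == tm (tm f (idm y')) (idm z')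
      \o tm (tm (idm x) g) (idm z') \o tm (idm (t x y)) h)
    by (rewrite <- !tm_comp; now idc).
  assert (ER : tm f (tm g h) == tm f (idm (t y' z'))
      \o tm (idm x) (tm g (idm z')) \o tm (idm x) (tm (idm y) h))
    by (rewrite <- !tm_comp, <- !tm_id, <- !tm_comp; now idc).
  rewrite EL, ER; la; rewrite Nx; rw (Ny x y y' z' g); now rw (Nz x y z z' h).
Qed.

Lemma bifunctor_natural2 (t' : Q -> Q -> Q)
    (tm' : forall x x' y y' : Q, hom x x' -> hom y y' -> hom (t' x y) (t' x' y'))
    (tm_comp' : forall x y x' y' x'' y'' (f' : hom x' x'') (f : hom x x')
      (g' : hom y' y'') (g : hom y y'), tm' _ _ _ _ (f' \o f) (g' \o g) == tm' _ _ _ _ f' g' \o tm' _ _ _ _ f g)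
    (tm_proper' : forall x x' y y', Proper (heq ==> heq ==> heq) (tm' x x' y y'))
    (a : forall x y, hom (t x y) (t' x y)) :
  (forall x x' y (f : hom x x'), a x' y \o tm f (idm y) == tm' _ _ _ _ f (idm y) \o a x y) ->
  (forall x y y' (g : hom y y'), a x y' \o tm (idm x) g == tm' _ _ _ _ (idm x) g \o a x y) ->
  forall x x' y y' (f : hom x x') (g : hom y y'),
    a x' y' \o tm f g == tm' _ _ _ _ f g \o a x y.
Proof.
  intros Nx Ny x x' y y' f g.
  assert (EL : tm f g == tm f (idm y') \o tm (idm x) g)
    by (rewrite <- tm_comp; now idc).
  assert (ER : tm' _ _ _ _ f g == tm' _ _ _ _ f (idm y') \o tm' _ _ _ _ (idm x) g)
    by (rewrite <- tm_comp'; now idc).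
  rewrite EL, ER; la; rewrite Nx; now rw (Ny x y y' g).
Qed.
End Bifunctor.

Section LocTensor.
Context {C : Cat} {mC : SymMon C} (W : forall x y : C, hom x y -> Prop)
  (Wl : forall (x y a : C) (w : hom x y), W x y w ->
     is_iso (fmor (localize W) (w ⊠ idm a)))
  (Wr : forall (x y a : C) (w : hom x y), W x y w ->
     is_iso (fmor (localize W) (idm a ⊠ w))).
Notation Q := (localization W).
Notation q := (localize W).

Definition loc_tl (a : C) : Functor Q Q :=
  loc_lift (H := functor_comp q (tensor_right a)) (fun x y w => @Wl x y a w).
Definition loc_tr (a : C) : Functor Q Q :=
  loc_lift (H := functor_comp q (tensor_left a)) (fun x y w => @Wr x y a w).

(** One variable is a morphism of C, the other a word; a second induction, in [loc_interchange],
    treats two words. *)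
Lemma loc_interchange_gen (x x' : C) (f : hom x x') (y y' : Q) (g : hom y y') :
  fmor q (f ⊠ idm (y' : C)) \o fmor (loc_tr x) g
    == fmor (loc_tr x') g \o fmor q (f ⊠ idm (y : C)).
Proof.
  apply (loc_natural (P := loc_tr x) (R := loc_tr x')
    (a := fun y => fmor q (f ⊠ idm (y : C)))).
  clear; intros y y' g.
  change (fmor q (f ⊠ idm y') \o fmor q (idm x ⊠ g)
    == fmor q (idm x' ⊠ g) \o fmor q (f ⊠ idm y)).
  refine (transitivity (symmetry (fmor_comp q _ _)) (transitivity _ (fmor_comp q _ _))).
  now rewrite <- tens_lr, <- tens_rl.
Qed.

Lemma loc_interchange (x x' y y' : Q) (f : hom x x') (g : hom y y') :
  fmor (loc_tl y') f \o fmor (loc_tr x) g == fmor (loc_tr x') g \o fmor (loc_tl y) f.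
Proof.
  symmetry.
  apply (loc_natural (P := loc_tl y) (R := loc_tl y')
    (a := fun x => fmor (loc_tr x) g)).
  clear; intros x x' f; symmetry; exact (loc_interchange_gen f g).
Qed.

(** The product of two words is formed one variable at a time. By [loc_interchange] the order does
    not matter, which also makes it functorial. *)
Definition loc_tensm {x x' y y' : Q} (f : hom x x') (g : hom y y') :
    hom (c := Q) ((x : C) ⊗ (y : C)) ((x' : C) ⊗ (y' : C)) :=
  fmor (loc_tl y') f \o fmor (loc_tr x) g.

Lemma loc_tensm_l {x x' : Q} (f : hom x x') (y : C) :
  loc_tensm f (idm (y : Q)) == fmor (loc_tl y) f.
Proof. unfold loc_tensm; rewrite fmor_id; apply comp_idr. Qed.

Lemma loc_tensm_r {y y' : Q} (g : hom y y') (x : C) :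
  loc_tensm (idm (x : Q)) g == fmor (loc_tr x) g.
Proof. unfold loc_tensm; rewrite fmor_id; apply comp_idl. Qed.

Lemma loc_tensm_gen {x x' y y' : C} (f : hom x x') (g : hom y y') :
  loc_tensm (fmor q f) (fmor q g) == fmor q (f ⊠ g).
Proof.
  refine (transitivity (symmetry (fmor_comp q (f ⊠ idm y') (idm x ⊠ g))) _).
  now rewrite <- tens_lr.
Qed.

Lemma loc_tensm_comp {x y x' y' x'' y'' : Q} (f' : hom x' x'') (f : hom x x')
    (g' : hom y' y'') (g : hom y y') :
  loc_tensm (f' \o f) (g' \o g) == loc_tensm f' g' \o loc_tensm f g.
Proof.
  unfold loc_tensm; rewrite !fmor_comp; la.
  apply comp_proper; [|reflexivity].
  rewrite !comp_assoc; apply comp_proper; [reflexivity|].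
  apply loc_interchange.
Qed.

Instance loc_tensm_proper x y x' y' :
  Proper (heq ==> heq ==> heq) (@loc_tensm x x' y y').
Proof. intros f f' Hf g g' Hg; unfold loc_tensm; now rewrite Hf, Hg. Qed.

Lemma loc_tensm_proper' (x x' y y' : Q) :
  Proper (heq ==> heq ==> heq) (@loc_tensm x x' y y').
Proof. apply loc_tensm_proper. Qed.

Lemma loc_tensm_id (x y : Q) :
  loc_tensm (idm x) (idm y) == idm (c := Q) ((x : C) ⊗ (y : C)).
Proof. unfold loc_tensm; rewrite !fmor_id; apply comp_idl. Qed.

Lemma q2 {x y z : C} (g : hom y z) (f : hom x y) :
  (fmor q g : hom (c := Q) _ _) \o fmor q f == fmor q (g \o f).
Proof. symmetry; apply (fmor_comp q). Qed.

Lemma qp {x y : C} (f g : hom x y) : f == g -> fmor q f == fmor q g.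
Proof. intros E; now rewrite E. Qed.

Lemma loc_assoc_natural (x y z x' y' z' : Q)
    (f : hom x x') (g : hom y y') (h : hom z z') :
  fmor q (assoc (x' : C) (y' : C) (z' : C)) \o loc_tensm (loc_tensm f g) h
    == loc_tensm f (loc_tensm g h) \o fmor q (assoc (x : C) (y : C) (z : C)).
Proof.
  assert (Nx : forall (x x' : Q) (y z : C) (f : hom x x'),
    fmor q (assoc (x' : C) y z) \o loc_tensm (loc_tensm f (idm (y : Q))) (idm (z : Q))
    == loc_tensm f (idm ((y ⊗ z : C) : Q)) \o fmor q (assoc (x : C) y z)).
  { clear; intros x x' y z f; rewrite !loc_tensm_l.
    apply (loc_natural (P := functor_comp (loc_tl z) (loc_tl y)) (R := loc_tl (y ⊗ z))
      (a := fun x => fmor q (assoc (x : C) y z))).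
    clear; intros x x' f.
    refine (transitivity (q2 _ _) (transitivity (qp _) (symmetry (q2 _ _)))).
    cbn; rewrite assoc_natural, tensm_id; reflexivity. }
  assert (Ny : forall (y y' : Q) (x z : C) (g : hom y y'),
    fmor q (assoc x (y' : C) z) \o loc_tensm (loc_tensm (idm (x : Q)) g) (idm (z : Q))
    == loc_tensm (idm (x : Q)) (loc_tensm g (idm (z : Q))) \o fmor q (assoc x (y : C) z)).
  { clear; intros y y' x z g; rewrite loc_tensm_l, loc_tensm_r, loc_tensm_r, loc_tensm_l.
    apply (loc_natural (P := functor_comp (loc_tl z) (loc_tr x))
      (R := functor_comp (loc_tr x) (loc_tl z))
      (a := fun y => fmor q (assoc x (y : C) z))).
    clear; intros y y' f.
    refine (transitivity (q2 _ _) (transitivity (qp _) (symmetry (q2 _ _)))).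
    cbn; now rewrite assoc_natural. }
  assert (Nz : forall (z z' : Q) (x y : C) (h : hom z z'),
    fmor q (assoc x y (z' : C)) \o loc_tensm (idm ((x ⊗ y : C) : Q)) h
    == loc_tensm (idm (x : Q)) (loc_tensm (idm (y : Q)) h) \o fmor q (assoc x y (z : C))).
  { clear; intros z z' x y h; rewrite !loc_tensm_r.
    apply (loc_natural (P := loc_tr (x ⊗ y)) (R := functor_comp (loc_tr x) (loc_tr y))
      (a := fun z => fmor q (assoc x y (z : C)))).
    clear; intros z z' f.
    refine (transitivity (q2 _ _) (transitivity (qp _) (symmetry (q2 _ _)))).
    cbn; rewrite <- (tensm_id x y), assoc_natural; reflexivity. }
  exact (bifunctor_natural3 (Q := Q) (t := fun x y => (x : C) ⊗ (y : C))
    (tm := fun x x' y y' f g => loc_tensm f g) loc_tensm_proper' loc_tensm_id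
    (fun x y x' y' x'' y'' f' f g' g => loc_tensm_comp f' f g' g)
    (a := fun x y z => fmor q (assoc (x : C) (y : C) (z : C)))
    (fun x x' y z f => Nx x x' y z f) (fun x y y' z g => Ny y y' x z g)
    (fun x y z z' h => Nz z z' x y h) f g h).
Qed.

Lemma loc_gen_r (x : C) {y y' : C} (g : hom y y') :
  loc_tensm (idm (x : Q)) (fmor q g) == fmor q (idm x ⊠ g).
Proof. exact (loc_tensm_r (fmor q g) x). Qed.

Lemma loc_gen_l (y : C) {x x' : C} (f : hom x x') :
  loc_tensm (fmor q f) (idm (y : Q)) == fmor q (f ⊠ idm y).
Proof. exact (loc_tensm_l (fmor q f) y). Qed.

(** The coherence isomorphisms are images under q, so their equations are those of C; only
    naturality involves words. *)
Definition loc_symmon : SymMon Q.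
Proof.
  unshelve refine (@Build_SymMon Q (fun x y => (x : C) ⊗ (y : C))
    (fun x y x' y' f g => loc_tensm f g) (one : C)
    (fun x y z => fiso q (assoc (x : C) (y : C) (z : C)))
    (fun x => fiso q (lunit (x : C)))
    (fun x => fiso q (runit (x : C))) (fun x y => fmor q (braid (x : C) (y : C)))
    _ _ _ _ _ _ _ _ _ _ _).
  - intros x y; unfold loc_tensm; rewrite !fmor_id; apply comp_idl.
  - intros; apply loc_tensm_comp.
  - intros; apply loc_assoc_natural.
  - intros x y f; cbn [iso_fwd fiso]; rewrite loc_tensm_r.
    apply (loc_natural (P := loc_tr one) (R := functor_id Q)
      (a := fun x => fmor q (lunit (x : C)))).
    clear; intros x y f.
    refine (transitivity (q2 _ _) (transitivity (qp _) (symmetry (q2 _ _)))).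
    apply lunit_natural.
  - intros x y f; cbn [iso_fwd fiso]; rewrite loc_tensm_l.
    apply (loc_natural (P := loc_tl one) (R := functor_id Q)
      (a := fun x => fmor q (runit (x : C)))).
    clear; intros x y f.
    refine (transitivity (q2 _ _) (transitivity (qp _) (symmetry (q2 _ _)))).
    apply runit_natural.
  - intros x y x' y' f g.
    assert (Nf : forall (x x' : Q) (y : C) (f : hom x x'),
      fmor q (braid (x' : C) y) \o loc_tensm f (idm (y : Q))
      == loc_tensm (idm (y : Q)) f \o fmor q (braid (x : C) y)).
    { clear; intros x x' y f; rewrite loc_tensm_l, loc_tensm_r.
      apply (loc_natural (P := loc_tl y) (R := loc_tr y)
        (a := fun x => fmor q (braid (x : C) y))).
      clear; intros x x' f.
      refine (transitivity (q2 _ _) (transitivity (qp _) (symmetry (q2 _ _)))).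
      apply braid_natural. }
    assert (Ng : forall (y y' : Q) (x : C) (g : hom y y'),
      fmor q (braid x (y' : C)) \o loc_tensm (idm (x : Q)) g
      == loc_tensm g (idm (x : Q)) \o fmor q (braid x (y : C))).
    { clear; intros y y' x f; rewrite loc_tensm_l, loc_tensm_r.
      apply (loc_natural (P := loc_tr x) (R := loc_tl x)
        (a := fun y => fmor q (braid x (y : C)))).
      clear; intros y y' f.
      refine (transitivity (q2 _ _) (transitivity (qp _) (symmetry (q2 _ _)))).
      apply braid_natural. }
    exact (bifunctor_natural2 (Q := Q) (t := fun x y => (x : C) ⊗ (y : C))
      (tm := fun x x' y y' f g => loc_tensm f g) loc_tensm_proper'
      (fun x y x' y' x'' y'' f' f g' g => loc_tensm_comp f' f g' g)
      (t' := fun x y => (y : C) ⊗ (x : C)) (tm' := fun x x' y y' f g => loc_tensm g f)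
      (fun x y x' y' x'' y'' f' f g' g => loc_tensm_comp g' g f' f)
      (fun x x' y y' f f' Ef g g' Eg => loc_tensm_proper' Eg Ef)
      (a := fun x y => fmor q (braid (x : C) (y : C)))
      (fun x x' y f => Nf x x' y f) (fun x y y' g => Ng y y' x g) f g).
  - intros w x y z; cbn [iso_fwd fiso].
    refine (transitivity (comp_proper (comp_proper (loc_gen_r w (assoc (x : C) y z))
      (reflexivity _)) (loc_gen_l z (assoc (w : C) x y))) _).
    refine (transitivity (comp_proper (q2 _ _) (reflexivity _)) _).
    refine (transitivity (q2 _ _) (transitivity (qp _) (symmetry (q2 _ _)))).
    apply pentagon.
  - intros x y; cbn [iso_fwd fiso].
    refine (transitivity (comp_proper (loc_gen_r x (lunit (y : C))) (reflexivity _)) _).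
    refine (transitivity _ (symmetry (loc_gen_l y (runit (x : C))))).
    refine (transitivity (q2 _ _) (qp _)); apply unit_triangle.
  - intros x y z; cbn [iso_fwd fiso].
    refine (transitivity _ (symmetry (comp_proper (comp_proper
      (loc_gen_r y (braid (x : C) z)) (reflexivity _)) (loc_gen_l z (braid (x : C) y))))).
    refine (transitivity (comp_proper (q2 _ _) (reflexivity _)) _).
    refine (transitivity (q2 _ _) _).
    refine (transitivity _ (symmetry (comp_proper (q2 _ _) (reflexivity _)))).
    refine (transitivity (qp _) (symmetry (q2 _ _))); apply hexagon.
  - intros x y; refine (transitivity (q2 _ _) _).
    refine (transitivity (qp (braid_involutive _ _)) (fmor_id q _)).
Defined.

End LocTensor.

Lemma tensor_retract {C : Cat} {Sg : Functor C C} {mC : SymMon C}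
    (st : forall x y : C, Iso (Sg x ⊗ y) (Sg (x ⊗ y)))
    (st_nat : forall (x y x' y' : C) (f : hom x x') (g : hom y y'),
       st x' y' \o (fmor Sg f ⊠ g) == fmor Sg (f ⊠ g) \o st x y)
    n (X Y : ndiag Sg) (w : C) :
  nretract n X Y ->
  nretract n (nimage (F := tensor_right w) (fun x => st x w) X)
             (nimage (F := tensor_right w) (fun x => st x w) Y).
Proof. apply nimage_retract; intros x y f; apply st_nat. Qed.

Lemma tensor_isomorphic {C : Cat} {Sg : Functor C C} {mC : SymMon C}
    (st : forall x y : C, Iso (Sg x ⊗ y) (Sg (x ⊗ y)))
    (st_nat : forall (x y x' y' : C) (f : hom x x') (g : hom y y'),
       st x' y' \o (fmor Sg f ⊠ g) == fmor Sg (f ⊠ g) \o st x y)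
    n (X Y : ndiag Sg) (w : C) :
  nisomorphic n X Y ->
  nisomorphic n (nimage (F := tensor_right w) (fun x => st x w) X)
             (nimage (F := tensor_right w) (fun x => st x w) Y).
Proof. apply nimage_isomorphic; intros x y f; apply st_nat. Qed.

Lemma fmor_square {C D : Cat} (F : Functor C D) {x y y' z : C} (g : hom y z) (f : hom x y)
    (g' : hom y' z) (f' : hom x y') :
  g \o f == g' \o f' -> fmor F g \o fmor F f == fmor F g' \o fmor F f'.
Proof. intros E; rewrite <- !fmor_comp; now rewrite E. Qed.

(** * The tensor triangulation of the quotient *)

Section Quotient.
Context {o : tri_order} (ho : valid_order o) {T S : Cat} {tT : TensorTri o T}
  {tS : TensorTri o S} (hT : idempotent_complete T)
  {F : Functor T S} (tF : TTFunctor F) {G : Functor S T}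
  (adj : Adjunction F G) (hadd : tens_additive (C := T) tt_mon)
  (hker : kernel_tensor_closed G)
  (hproj : right_projection_formula tF adj)
  (s : hom (unit_algebra tF adj) (unit_algebra tF adj ⊗ unit_algebra tF adj))
  (s1 : amul (unit_algebra tF adj) \o s == idm (acar (unit_algebra tF adj)))
  (s2 : (idm (acar (unit_algebra tF adj)) ⊠ amul (unit_algebra tF adj))
     \o assoc (unit_algebra tF adj) (unit_algebra tF adj) (unit_algebra tF adj)
     \o (s ⊠ idm (acar (unit_algebra tF adj))) == s \o amul (unit_algebra tF adj))
  (s3 : (amul (unit_algebra tF adj) ⊠ idm (acar (unit_algebra tF adj)))
     \o iso_inv (assoc (unit_algebra tF adj) (unit_algebra tF adj) (unit_algebra tF adj))
     \o (idm (acar (unit_algebra tF adj)) ⊠ s)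
          == s \o amul (unit_algebra tF adj)).
Notation A := (unit_algebra tF adj).
Notation D := (module_cat A).
Notation Q := (verdier_quotient (o := o) G).
Notation q := (quotient_functor (o := o) G).
Notation KB := (Kbar ho tF adj).
Notation DTri := (module_tri_structure ho hT hadd hproj s1 s2 s3).

Notation Kfull := (Kbar_full (ho := ho) hproj s1 s2 s3).
Notation Kfaith := (Kbar_faithful (ho := ho) hproj s1 s2 s3).
Notation Qs := (Qsusp ho tF adj).
Notation Qnat := (Qsusp_nat ho tF adj).
Notation Qadd := (Qpreadd ho hT hadd hproj s1 s2 s3).
Notation qim X := (nimage (Sg' := Qs) (F := q) (fun x => idm _) X).

Lemma qim_any n b (f : forall i, hom (b i : Q) (b (Datatypes.S i))) :
  exists (z : nat -> S) (g : forall i, hom (z i) (z (Datatypes.S i))),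
    forall Y : ndiag (susp (C := S)), nextends n Y g -> nextends n (qim Y) (b := b) f.
Proof.
  destruct (chain_lift ho tF adj n f) as [z [g [w [Iw Hw]]]].
  exists z, g; intros Y HY; exact (qim_extends ho tF adj Iw Hw HY).
Qed.

(** Existence of triangles and octahedra is all that pulling back from modules leaves open: a chain
    is rectified to one of S, completed there and pushed forward. *)
Definition Qtri : Tri o Q.
Proof.
  refine (@tri_pullback o Q D DTri KB Kfull Kfaith Qs Qnat
    (Q_additive ho hT hadd hproj s1 s2 s3) (Qsusp_ess_surj ho tF adj) _ _).
  - intros n b f Hn.
    destruct (qim_any n f) as [z [g H]].
    destruct (tri_extend_base (Tri := tt_tri (C := S)) g Hn) as [Y [HY HE]].
    exists (qim Y); split; [exact (qim_dist ho hT hadd hproj s1 s2 s3 Hn HY) | now apply H].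
  - intros eo b f.
    destruct (qim_any 3 f) as [z [g H]].
    destruct (tri_octahedral (Tri := tt_tri (C := S)) eo g) as [Y [TY [HE HF]]].
    exists (qim Y); split; [|split; [now apply H|]].
    + apply nimage_ntriangle.
      * intros x y f'; idc; reflexivity.
      * intros x; exact (fmor_is_zero (q_additive ho hT hadd hproj s1 s2 s3) (x := x)).
      * exact TY.
    + intros phi Hphi H1 H2.
      exact (qim_dist ho hT hadd hproj s1 s2 s3
        (in_range_two ho) (HF phi Hphi H1 H2)).
Defined.

(** The base of X is rectified to S and completed there, and distinguished triangles on isomorphic
    bases are isomorphic. So the triangulation pulled back from modules is the one inherited from
    S. *)
Lemma Qtri_dist_iff n (X : ndiag Qs) : in_range o n ->
  (dist (Tri := Qtri) n X <-> is_ntriangle n X /\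
     exists Y, dist n Y /\ nisomorphic n X (qim Y)).
Proof.
  intros Hn; split.
  - intros HX; split; [exact (dist_ntriangle (Tri := Qtri) Hn HX)|].
    destruct (qim_any n (fun i => ntr X 0 i 0 (Datatypes.S i))) as [z [g H]].
    destruct (tri_extend_base (Tri := tt_tri (C := S)) g Hn) as [Y [HY HE]].
    exists Y; split; [exact HY|].
    destruct (nextends_inv (tC := Qtri) (H Y HE)) as [v [v' [Hv [N1 N2]]]].
    apply (@dist_unique o Q Qtri ho n X (qim Y) v Hn HX).
    + exact (qim_dist ho hT hadd hproj s1 s2 s3 Hn HY).
    + exact N1.
    + intros i Hi; exists (v' i); now apply Hv.
  - intros [TX [Y [HY I]]].
    refine (dist_iso (Tri := Qtri) Hn _ TX (nisomorphic_sym I)).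
    exact (qim_dist ho hT hadd hproj s1 s2 s3 Hn HY).
Qed.

Lemma tensor_inverts_l (x y a : S) (w : hom x y) : cone_in_kernel (o := o) G w ->
  is_iso (fmor q (w ⊠ idm a)).
Proof.
  intros Ww; apply (q_iso ho tF adj), (W_tens_l ho hadd hker hproj s1 s2 s3), (W_iff ho tF adj), Ww.
Qed.

Lemma tensor_inverts_r (x y a : S) (w : hom x y) : cone_in_kernel (o := o) G w ->
  is_iso (fmor q (idm a ⊠ w)).
Proof.
  intros Ww; apply (q_iso ho tF adj), (W_tens_r ho hadd hker hproj s1 s2 s3), (W_iff ho tF adj), Ww.
Qed.

Definition Qmon : SymMon Q := loc_symmon tensor_inverts_l tensor_inverts_r.

Definition Qstens (x y : Q) : Iso (C := Q) (tens (SymMon := Qmon) (Qs x) y)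
    (Qs (tens (SymMon := Qmon) x y)) :=
  fiso q (stens (x : S) (y : S)).

Lemma Qstens_natural (x y x' y' : Q) (f : hom x x') (g : hom y y') :
  Qstens x' y' \o tensm (SymMon := Qmon) (fmor Qs f) g
    == fmor Qs (tensm (SymMon := Qmon) f g) \o Qstens x y.
Proof.
  assert (N1 : forall (x x' : Q) (y : S) (f : hom x x'),
    Qstens x' y \o tensm (SymMon := Qmon) (fmor Qs f) (idm (y : Q))
    == fmor Qs (tensm (SymMon := Qmon) f (idm (y : Q))) \o Qstens x y).
  { clear; intros x x' y f.
    refine (transitivity (comp_proper (reflexivity _) (loc_tensm_l _ _ _ _)) _).
    refine (transitivity _ (comp_proper (@fmor_proper _ _ Qs _ _ _ _
      (symmetry (loc_tensm_l _ _ _ _))) (reflexivity _))).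
    apply (loc_natural (P := functor_comp (loc_tl tensor_inverts_l y) Qs)
      (R := functor_comp Qs (loc_tl tensor_inverts_l y))
      (a := fun x => Qstens x y)).
    clear; intros x x' f.
    apply (fmor_square q), stens_natural. }
  assert (N2 : forall (y y' : Q) (x : S) (f : hom y y'),
    Qstens x y' \o tensm (SymMon := Qmon) (fmor Qs (idm (x : Q))) f
    == fmor Qs (tensm (SymMon := Qmon) (idm (x : Q)) f) \o Qstens x y).
  { clear; intros y y' x f.
    refine (transitivity (comp_proper (reflexivity _) (transitivity
      (tensm_proper (SymMon := Qmon) (fmor_id Qs x) (reflexivity _))
      (loc_tensm_r _ _ _ _))) _).
    refine (transitivity _ (comp_proper (@fmor_proper _ _ Qs _ _ _ _
      (symmetry (loc_tensm_r _ _ _ _))) (reflexivity _))).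
    apply (loc_natural (P := loc_tr tensor_inverts_r (susp x))
      (R := functor_comp Qs (loc_tr tensor_inverts_r x))
      (a := fun y => Qstens x y)).
    clear; intros y y' f.
    apply (fmor_square q).
    refine (transitivity _ (stens_natural (idm x) f)); now rewrite fmor_id. }
  exact (@bifunctor_natural2 Q (fun x y => (susp (x : S)) ⊗ (y : S))
      (fun x x' y y' f g => tensm (SymMon := Qmon) (fmor Qs f) g)
      (fun x x' y y' f f' Hf g g' Hg => tensm_proper (SymMon := Qmon) (@fmor_proper _ _ Qs _ _ _ _ Hf) Hg)
      (fun x y x' y' x'' y'' f' f g' g => transitivity (tensm_proper (SymMon := Qmon) (fmor_comp Qs f' f) (reflexivity _)) (tensm_comp (SymMon := Qmon) _ _ _ _))
      (fun x y => susp ((x : S) ⊗ (y : S)))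
      (fun x x' y y' f g => fmor Qs (tensm (SymMon := Qmon) f g))
      (fun x y x' y' x'' y'' f' f g' g => transitivity (@fmor_proper _ _ Qs _ _ _ _ (tensm_comp (SymMon := Qmon) f' f g' g)) (fmor_comp Qs _ _))
      (fun x x' y y' f f' Hf g g' Hg => @fmor_proper _ _ Qs _ _ _ _ (tensm_proper (SymMon := Qmon) Hf Hg))
      (fun x y => Qstens x y)
      (fun x x' y f => N1 x x' y f) (fun x y y' g => N2 y y' x g) x x' y y' f g).
Qed.

Definition Qtensor : TensorTri o Q.
Proof.
  refine (@Build_TensorTri o Q Qtri Qmon Qstens Qstens_natural _ _ _ _).
  - intros x; refine (transitivity (symmetry (fmor_comp q _ _))
      (@fmor_proper _ _ q _ _ _ _ (stens_runit _))).
  - intros x y z.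
    refine (transitivity (comp_proper (symmetry (fmor_comp q _ _)) (loc_gen_l _ _ _ _)) _).
    apply (fmor_square q), stens_assoc.
  - intros n X w Hn HX.
    (* [X] is replaced by the image of a triangle of S, for which the product with [w] is formed in
       S. *)
    destruct (proj1 (Qtri_dist_iff X Hn) HX) as [TX [Y [HY I]]].
    pose proof (stens_dist (w : S) Hn HY) as HYw.
    assert (E : nisomorphic n
      (nimage (F := tensor_right (mC := Qmon) w) (fun x => Qstens x w) (qim Y))
      (qim (nimage (F := tensor_right (w : S)) (fun x => stens x w) Y))).
    { apply (@nisomorphic_ext Q Qadd Qs n (fun i j => (nob Y i j ⊗ (w : S) : Q))).
      - intros i j i' j' _ _ _ _; exact (loc_gen_l _ _ _ _).
      - intros i j k _ _.
        refine (transitivity _ (symmetry (comp_idl _))).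
        refine (transitivity _ (symmetry (fmor_comp q _ _))).
        refine (comp_proper (reflexivity _) (transitivity _ (loc_gen_l _ _ _ _))).
        exact (tensm_proper (SymMon := Qmon) (comp_idl _) (reflexivity _)). }
    assert (I' := nisomorphic_trans
      (tensor_isomorphic (mC := Qmon) (st := Qstens) Qstens_natural w I) E).
    apply (proj2 (Qtri_dist_iff _ Hn)); split.
    + refine (ntriangle_iso (aC := Qadd) _ (nisomorphic_sym I')).
      exact (dist_ntriangle (Tri := Qtri) Hn
        (qim_dist ho hT hadd hproj s1 s2 s3 Hn HYw)).
    + exact (ex_intro _ _ (conj HYw I')).
  - refine (transitivity (@fmor_proper _ _ q _ _ _ _ stens_sign) _).
    refine (transitivity (fmor_opp (q_additive ho hT hadd hproj s1 s2 s3) _) _).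
    apply oppm_proper, (fmor_id q).
Defined.

Definition q_tri : TriFunctor (tC := tt_tri (C := S)) (tD := Qtri) q.
Proof.
  refine (@Build_TriFunctor o S Q tt_tri Qtri q (q_additive ho hT hadd hproj s1 s2 s3)
      (@MkNatIso _ _ (functor_comp q susp) (functor_comp Qs q) (fun x => iso_id _) _)
      (fun n X Hn HX => qim_dist ho hT hadd hproj s1 s2 s3 Hn HX)).
Unshelve.
  intros x y f.
  refine (transitivity (@comp_idl Q (susp x) (susp y) (fmor q (fmor susp f))) _).
  exact (symmetry (@comp_idr Q (susp x) (susp y) (fmor q (fmor susp f)))).
Defined.

Definition q_mon : MonFunctor (mD := Qmon) q.
Proof.
  refine (@Build_MonFunctor S Q _ Qmon q (fun x y => iso_id _) (iso_id _) _ _ _ _ _).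
  - intros x y x' y' f g.
    refine (transitivity (@comp_idr Q (x ⊗ y) (x' ⊗ y') (fmor q (f ⊠ g))) _).
    refine (transitivity _ (symmetry (@comp_idl Q (x ⊗ y) (x' ⊗ y') _))).
    symmetry; apply loc_tensm_gen.
  - intros x y z.
    refine (transitivity (comp_proper (@comp_idr Q _ _ (fmor q (assoc x y z)))
      (tensm_id (SymMon := Qmon) (x ⊗ y : S) z)) _).
    refine (transitivity (@comp_idr Q _ _ (fmor q (assoc x y z))) (symmetry _)).
    refine (transitivity (comp_proper (transitivity (@comp_idl Q (x ⊗ (y ⊗ z)) _ _)
      (tensm_id (SymMon := Qmon) x (y ⊗ z : S))) (reflexivity _)) _).
    exact (@comp_idl Q _ _ (fmor q (assoc x y z))).
  - intros x.
    refine (transitivity (comp_proper (@comp_idr Q _ _ (fmor q (lunit x)))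
      (tensm_id (SymMon := Qmon) (one : S) x)) _).
    exact (@comp_idr Q _ _ (fmor q (lunit x))).
  - intros x.
    refine (transitivity (comp_proper (@comp_idr Q _ _ (fmor q (runit x)))
      (tensm_id (SymMon := Qmon) x (one : S))) _).
    exact (@comp_idr Q _ _ (fmor q (runit x))).
  - intros x y.
    refine (transitivity (@comp_idr Q (x ⊗ y) (y ⊗ x) (fmor q (braid x y))) _).
    exact (symmetry (@comp_idl Q (x ⊗ y) (y ⊗ x) (fmor q (braid x y)))).
Defined.

Definition tq : TTFunctor (tC := tS) (tD := Qtensor) q.
Proof.
  refine (@Build_TTFunctor o S Q tS Qtensor q q_tri q_mon _).
  intros x y.
  pose (st := fmor q (stens x y) : hom (c := Q) (susp x ⊗ y) (susp (x ⊗ y))).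
  refine (transitivity (@comp_idr Q _ _ _) (transitivity (@comp_idl Q _ _ st) (symmetry _))).
  refine (transitivity (comp_proper (comp_proper (fmor_id Qs (x ⊗ y : S)) (reflexivity st))
    (tensm_id (SymMon := Qmon) (susp x : S) y)) _).
  exact (transitivity (@comp_idr Q _ _ _) (@comp_idl Q _ _ st)).
Defined.

Lemma verdier_structure : is_verdier_structure Qtensor.
Proof. exists tq; intros n X Hn; exact (Qtri_dist_iff X Hn). Qed.
End Quotient.

(** * Idempotent completions *)

Definition kar_map {C D : Cat} (F : Functor C D) :
  Functor (idempotent_completion C) (idempotent_completion D).
Proof.
  unshelve refine (let k := fun x : KarOb C => @MkKarOb D (F (kob x)) (fmor F (kidem x)) _ in
    @MkFunctor (idempotent_completion C) (idempotent_completion D) k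
    (fun x y f => @MkKarHom D (k x) (k y) (fmor F (kmor f)) _ _) _ _ _).
  - rewrite <- fmor_comp; now rewrite kidem_idem.
  - cbn; rewrite <- fmor_comp; now rewrite kmor_l.
  - cbn; rewrite <- fmor_comp; now rewrite kmor_r.
  - intros x y f g E; cbn in *; now rewrite E.
  - intros x; cbn; reflexivity.
  - intros x y z g f; cbn; apply fmor_comp.
Defined.

Section Kar.
Context {C : Cat}.
Notation KC := (idempotent_completion C).
Implicit Types x y z : KarOb C.

(** Coherence maps of the completion carry an idempotent in front of each factor; these are removed
    one by one until the equation of C remains. *)
Lemma idem_compose {x y z : C} (a : hom x y) (b : hom y z) (e1 : hom x x) (e2 : hom y y) :
  e1 \o e1 == e1 -> a \o e1 == e2 \o a -> (b \o e2) \o (a \o e1) == (b \o a) \o e1.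
Proof. intros I E; la; rw (symmetry E); now rw I. Qed.

Lemma kar_compose x y z (a : hom (kob x) (kob y)) (b : hom (kob y) (kob z)) :
  a \o kidem x == kidem y \o a -> (b \o kidem y) \o (a \o kidem x) == (b \o a) \o kidem x.
Proof.
  intros E; rewrite E; la; rw (kidem_idem y); now rw (symmetry E).
Qed.

(** A map commuting with the idempotents need not be fixed by them; composing with one of them makes
    it so. *)
Definition kar_hom x y (a : hom (kob x) (kob y))
    (E : a \o kidem x == kidem y \o a) : hom (c := KC) x y.
Proof.
  refine (@MkKarHom C x y (a \o kidem x) _ _).
  - rewrite E, <- comp_assoc; now rewrite kidem_idem.
  - now rewrite comp_assoc, kidem_idem.
Defined.

Lemma iso_inv_square {w x y z : C} (a : Iso w x) (b : Iso y z) (f : hom w y) (g : hom x z) :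
  b \o f == g \o a -> iso_inv b \o g == f \o iso_inv a.
Proof.
  intros E; apply (iso_mono (i := b)); rewrite <- !comp_assoc, E.
  rewrite (iso_invr b), (comp_assoc g), (iso_invr a); now idc.
Qed.

Definition kar_iso x y (a : Iso (kob x) (kob y))
    (E : a \o kidem x == kidem y \o a) : Iso (C := KC) x y.
Proof.
  pose proof (iso_inv_square E) as E'; symmetry in E'; symmetry in E'.
  refine (@MkIso KC x y (kar_hom E) (kar_hom E') _ _); cbn.
  - rewrite (kar_compose _ E), iso_invl; now idc.
  - rewrite (kar_compose _ E'), iso_invr; now idc.
Defined.
End Kar.

Section KarMon.
Context {C : Cat} (mC : SymMon C).
Notation KC := (idempotent_completion C).

Definition kar_tens (x y : KarOb C) : KarOb C.
Proof.
  refine (@MkKarOb C (kob x ⊗ kob y) (kidem x ⊠ kidem y) _).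
  rewrite <- tensm_comp; now rewrite !kidem_idem.
Defined.

Definition kar_tensm {x y x' y' : KarOb C} (f : hom (c := KC) x x') (g : hom (c := KC) y y') :
  hom (c := KC) (kar_tens x y) (kar_tens x' y').
Proof.
  refine (@MkKarHom C (kar_tens x y) (kar_tens x' y') (kmor f ⊠ kmor g) _ _); cbn.
  - rewrite <- tensm_comp; now rewrite !kmor_l.
  - rewrite <- tensm_comp; now rewrite !kmor_r.
Defined.

Definition kar_one : KarOb C := @MkKarOb C one (idm one) (comp_idl _).

Definition kar_assoc (x y z : KarOb C) :
  Iso (C := KC) (kar_tens (kar_tens x y) z) (kar_tens x (kar_tens y z)) :=
  kar_iso (x := kar_tens (kar_tens x y) z) (y := kar_tens x (kar_tens y z))
    (a := assoc (kob x) (kob y) (kob z)) (assoc_natural _ _ _).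

Definition kar_lunit (x : KarOb C) : Iso (C := KC) (kar_tens kar_one x) x :=
  kar_iso (x := kar_tens kar_one x) (y := x) (a := lunit (kob x)) (lunit_natural _).

Definition kar_runit (x : KarOb C) : Iso (C := KC) (kar_tens x kar_one) x :=
  kar_iso (x := kar_tens x kar_one) (y := x) (a := runit (kob x)) (runit_natural _).

Definition kar_braid (x y : KarOb C) : hom (c := KC) (kar_tens x y) (kar_tens y x) :=
  kar_hom (x := kar_tens x y) (y := kar_tens y x)
    (a := braid (kob x) (kob y)) (braid_natural _ _).

Lemma kar_tensm_l {x y : KarOb C} (z : KarOb C) (a : hom (kob x) (kob y)) :
  (a \o kidem x) ⊠ kidem z == (a ⊠ idm (kob z)) \o (kidem x ⊠ kidem z).
Proof. rewrite <- tensm_comp; now idc. Qed.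

Lemma kar_tensm_r {x y : KarOb C} (z : KarOb C) (a : hom (kob x) (kob y)) :
  kidem z ⊠ (a \o kidem x) == (idm (kob z) ⊠ a) \o (kidem z ⊠ kidem x).
Proof. rewrite <- tensm_comp; now idc. Qed.

Ltac ktac := first [apply assoc_natural | apply braid_natural
  | rewrite <- !tensm_comp, ?kidem_idem, ?comp_idl; reflexivity
  | rewrite <- !tensm_comp, ?assoc_natural, ?braid_natural, ?comp_idl, ?comp_idr; reflexivity].

Definition kar_symmon : SymMon KC.
Proof.
  refine (@Build_SymMon KC kar_tens (@kar_tensm) kar_one kar_assoc kar_lunit kar_runit
    kar_braid _ _ _ _ _ _ _ _ _ _ _).
  - intros x y x' y' f f' Ef g g' Eg; cbn in *; now rewrite Ef, Eg.
  - intros x y; cbn; reflexivity.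
  - intros; cbn; apply tensm_comp.
  - intros x y z x' y' z' f g h; cbn.
    rewrite <- comp_assoc, <- assoc_natural, !comp_assoc, <- !tensm_comp.
    now rewrite !kmor_r, !kmor_l.
  - intros x y f; cbn.
    rewrite <- comp_assoc, <- lunit_natural, !comp_assoc, <- !tensm_comp; idc.
    now rewrite kmor_r, kmor_l.
  - intros x y f; cbn.
    rewrite <- comp_assoc, <- runit_natural, !comp_assoc, <- !tensm_comp; idc.
    now rewrite kmor_r, kmor_l.
  - intros x y x' y' f g; cbn.
    rewrite <- comp_assoc, <- braid_natural, !comp_assoc, <- !tensm_comp, !kmor_r, !kmor_l.
    reflexivity.
  - intros w x y z; cbn.
    rewrite (kar_tensm_r (x := kar_tens (kar_tens x y) z) (y := kar_tens x (kar_tens y z))).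
    rewrite (kar_tensm_l (x := kar_tens (kar_tens w x) y) (y := kar_tens w (kar_tens x y))).
    cbn.
    rewrite (@idem_compose C _ _ _ (assoc (kob w) (kob x ⊗ kob y) (kob z))) by ktac.
    rewrite (@idem_compose C _ _ _ (assoc (kob w) (kob x) (kob y) ⊠ idm (kob z))) by ktac.
    rewrite (@idem_compose C _ _ _ (assoc (kob w ⊗ kob x) (kob y) (kob z))) by ktac.
    now rewrite pentagon.
  - intros x y; cbn.
    rewrite (kar_tensm_r (x := kar_tens kar_one y) (y := y)).
    rewrite (kar_tensm_l (x := kar_tens x kar_one) (y := x)); cbn.
    rewrite (@idem_compose C _ _ _ (assoc (kob x) one (kob y))) by ktac.
    now rewrite unit_triangle.
  - intros x y z; cbn.
    rewrite (kar_tensm_r (x := kar_tens x z) (y := kar_tens z x)).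
    rewrite (kar_tensm_l (x := kar_tens x y) (y := kar_tens y x)); cbn.
    rewrite (@idem_compose C _ _ _ (braid (kob x) (kob y ⊗ kob z))) by ktac.
    rewrite (@idem_compose C _ _ _ (assoc (kob x) (kob y) (kob z))) by ktac.
    rewrite (@idem_compose C _ _ _ (assoc (kob y) (kob x) (kob z))) by ktac.
    rewrite (@idem_compose C _ _ _ (braid (kob x) (kob y) ⊠ idm (kob z))) by ktac.
    now rewrite hexagon.
  - intros x y; cbn.
    rewrite (@idem_compose C _ _ _ (braid (kob x) (kob y))) by ktac.
    rewrite braid_involutive; now idc.
Defined.
End KarMon.

Definition retracts_onto {C D : Cat} (U : Functor C D) : Prop :=
  forall d : D, exists (x : C) (r : hom (U x) d) (s : hom d (U x)), r \o s == idm d.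

Definition split_unique {C : Cat} {x y y' : C} {r : hom x y} {s : hom y x}
    {r' : hom x y'} {s' : hom y' x} (E : r \o s == idm y) (E' : r' \o s' == idm y')
    (H : s \o r == s' \o r') : Iso y y'.
Proof.
  refine (@MkIso C y y' (r' \o s) (r \o s') _ _).
  - la; rw (symmetry H); rw E; idc; exact E.
  - la; rw H; rw E'; idc; exact E'.
Defined.

(** * Extension of a functor to the idempotent completion *)

Section KarExtension.
Context {C D : Cat} (hD : idempotent_complete D) (U : Functor C D).
Notation KC := (idempotent_completion C).

Lemma kar_split (x : KarOb C) : exists p : { y : D & (hom (U (kob x)) y * hom y (U (kob x)))%type },
  fst (projT2 p) \o snd (projT2 p) == idm _ /\ snd (projT2 p) \o fst (projT2 p) == fmor U (kidem x).
Proof.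
  destruct (hD (e := fmor U (kidem x))) as [y [r [s [E1 E2]]]].
  - rewrite <- fmor_comp; now rewrite kidem_idem.
  - exists (existT _ y (r, s)); now split.
Qed.

Definition kar_image (x : KarOb C) : D := projT1 (proj1_sig (constructive_indefinite_description _ (kar_split x))).
Definition kar_r (x : KarOb C) : hom (U (kob x)) (kar_image x) :=
  fst (projT2 (proj1_sig (constructive_indefinite_description _ (kar_split x)))).
Definition kar_s (x : KarOb C) : hom (kar_image x) (U (kob x)) :=
  snd (projT2 (proj1_sig (constructive_indefinite_description _ (kar_split x)))).

Lemma kar_rs (x : KarOb C) : kar_r x \o kar_s x == idm (kar_image x).
Proof. exact (proj1 (proj2_sig (constructive_indefinite_description _ (kar_split x)))). Qed.

Lemma kar_sr (x : KarOb C) : kar_s x \o kar_r x == fmor U (kidem x).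
Proof. exact (proj2 (proj2_sig (constructive_indefinite_description _ (kar_split x)))). Qed.

Lemma kar_r_idem (x : KarOb C) : kar_r x \o fmor U (kidem x) == kar_r x.
Proof. rewrite <- kar_sr; la; rewrite kar_rs; now idc. Qed.

Lemma kar_idem_s (x : KarOb C) : fmor U (kidem x) \o kar_s x == kar_s x.
Proof. rewrite <- kar_sr; rewrite comp_assoc, kar_rs; now idc. Qed.

Lemma kar_fmor_l {x y : KarOb C} (f : KarHom x y) :
  fmor U (kidem y) \o fmor U (kmor f) == fmor U (kmor f).
Proof. rewrite <- fmor_comp; now rewrite kmor_l. Qed.

Lemma kar_fmor_r {x y : KarOb C} (f : KarHom x y) :
  fmor U (kmor f) \o fmor U (kidem x) == fmor U (kmor f).
Proof. rewrite <- fmor_comp; now rewrite kmor_r. Qed.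

Definition kar_ext : Functor KC D.
Proof.
  unshelve refine (@MkFunctor KC D kar_image
    (fun x y f => kar_r y \o fmor U (kmor f) \o kar_s x) _ _ _).
  - intros x y f g E; cbn in E; now rewrite E.
  - intros x; cbn. rewrite kar_r_idem; apply kar_rs.
  - intros x y z g f; cbn; la; rw (kar_sr y).
    rw (kar_fmor_l f); rewrite fmor_comp; now la.
Defined.

Lemma kar_ext_full : full U -> faithful U -> full kar_ext.
Proof.
  intros fU hU x y g.
  assert (E : fmor U (preim fU (kar_s y \o g \o kar_r x)) == kar_s y \o g \o kar_r x)
    by apply fmor_preim.
  unshelve refine (ex_intro _ (@MkKarHom C x y (preim fU (kar_s y \o g \o kar_r x)) _ _) _);
    cbn.
  - apply hU; rewrite fmor_comp, E; la; now rewrite kar_idem_s.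
  - apply hU; rewrite fmor_comp, E; now rw (kar_r_idem x).
  - rewrite E; la; rewrite kar_rs; rw (kar_rs x); now idc.
Qed.

Lemma kar_ext_faithful : faithful U -> faithful kar_ext.
Proof.
  intros hU x y f g E; cbn in *.
  assert (H : forall f : KarHom x y, fmor U (kmor f) ==
    kar_s y \o (kar_r y \o fmor U (kmor f) \o kar_s x) \o kar_r x).
  { clear; intros f; la; rw (kar_sr y); rw (kar_sr x).
    rewrite kar_fmor_l; now rewrite kar_fmor_r. }
  apply hU; rewrite (H f), (H g); now rewrite E.
Qed.

Lemma kar_s_natural {x y : KarOb C} (f : KarHom x y) :
  kar_s y \o fmor kar_ext (f : hom (c := KC) x y) == fmor U (kmor f) \o kar_s x.
Proof. cbn; la; rw (kar_sr y); now rewrite kar_fmor_l. Qed.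

Lemma kar_r_natural {x y : KarOb C} (f : KarHom x y) :
  fmor kar_ext (f : hom (c := KC) x y) \o kar_r x == kar_r y \o fmor U (kmor f).
Proof. cbn; la; rw (kar_sr x); rw (kar_fmor_r f); reflexivity. Qed.

Definition kar_ext_unit : NatIso (functor_comp kar_ext (to_completion C)) U.
Proof.
  unshelve refine (@MkNatIso C D (functor_comp kar_ext (to_completion C)) U
    (fun x => @MkIso D (kar_image (to_completion C x)) (U x)
       (kar_s (to_completion C x)) (kar_r (to_completion C x)) _ _) _).
  - apply kar_rs.
  - exact (transitivity (kar_sr (to_completion C x)) (fmor_id U x)).
  - intros x y f; exact (kar_s_natural (fmor (to_completion C) f)).
Defined.

(** The idempotent s r of U x lifts to [x] by full faithfulness, and two splittings of one
    idempotent are isomorphic. *)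
Lemma kar_ext_ess_surj : full U -> faithful U -> retracts_onto U -> ess_surj kar_ext.
Proof.
  intros fU hU HU d; destruct (HU d) as [x [r [s E]]].
  assert (Ee : fmor U (preim fU (s \o r)) == s \o r) by apply fmor_preim.
  unshelve refine (let k := @MkKarOb C x (preim fU (s \o r)) _ in _).
  { apply hU; rewrite fmor_comp, !Ee; la; rw E; now idc. }
  exists k; constructor; pose proof (kar_sr k : _ == fmor U (preim fU (s \o r))) as H.
  exact (split_unique (kar_rs k) E (transitivity H Ee)).
Qed.
End KarExtension.

(** * Transport along an equivalence *)

Lemma nreindex_isomorphic {C : Cat} {aC : PreAdd C} {Sg : Functor C C} m n phi (X Y : ndiag Sg) :
  monotone_upto m n phi -> nisomorphic n X Y ->
  nisomorphic m (nreindex phi X) (nreindex phi Y).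
Proof.
  intros Hphi [s [r [Hs [Hr [E E']]]]].
  exists (fun i j => s (phi i) (phi j)), (fun i j => r (phi i) (phi j)).
  split; [exact (nreindex_nmorphism Hphi Hs)|].
  split; [exact (nreindex_nmorphism Hphi Hr)|].
  split; intros i j Hij; [apply E | apply E']; now apply Hphi.
Qed.

Section TriEquivalence.
Context {o : tri_order} {C D : Cat} (tD : Tri o D)
  (E : Functor C D) (fE : full E) (hE : faithful E) (eE : ess_surj E)
  (Sg : Functor C C) (sI : NatIso (functor_comp E Sg) (functor_comp susp E)).
Notation R := (qinv fE hE eE).
Notation rho := (qinv_iso eE).
#[local] Instance tri_equiv_preadd : PreAdd C := pb_preadd tD fE hE.

Lemma equiv_additive : is_additive C.
Proof.
  destruct (tri_additive (Tri := tD)) as [[z Hz] Hb]; split.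
  - exists (R z); intros y; split.
    + destruct (Hz (E y)) as [[f Hf] _].
      exists (preim fE (f \o rho z)); intros g; apply hE.
      rewrite fmor_preim; apply (iso_epi (i := iso_sym (rho z))).
      now rewrite (Hf (fmor E g \o _)), (Hf (_ \o iso_sym (rho z))).
    + destruct (Hz (E y)) as [_ [f Hf]].
      exists (preim fE (iso_inv (rho z) \o f)); intros g; apply hE.
      rewrite fmor_preim; apply (iso_mono (i := rho z)).
      now rewrite (Hf (_ \o fmor E g)), (Hf (rho z \o _)).
  - intros x y; destruct (Hb (E x) (E y)) as [s [i [j [p [r [H1 [H2 [H3 [H4 H5]]]]]]]]].
    exists (R s), (preim fE (iso_inv (rho s) \o i)), (preim fE (iso_inv (rho s) \o j)),
      (preim fE (p \o rho s)), (preim fE (r \o rho s)).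
    assert (Z : forall a b : C, fmor E (zerom a b) == zerom (E a) (E b))
      by (intros; apply (fmor_zero (pb_additive tD fE hE))).
    split; [|split; [|split; [|split]]]; apply hE;
      rewrite ?Z, ?(pb_additive tD fE hE), ?fmor_comp, ?fmor_preim, ?fmor_id; la;
      rewrite ?(precomp (iso_invr (rho s))), ?comp_idr; try assumption.
    transitivity (iso_inv (rho s) \o addm (i \o p) (j \o r) \o rho s).
    + rewrite comp_addr, comp_addl; la; reflexivity.
    + rewrite H5; idc; apply iso_invl.
Qed.

Lemma equiv_ess_surj : ess_surj Sg.
Proof.
  intros y; destruct (susp_ess_surj (tC := tD) (E y)) as [d [i]].
  exists (R d); constructor; apply (preim_iso fE hE).
  refine (iso_comp i (iso_comp (fiso susp (rho d)) _)); exact (sI (R d)).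
Qed.

(** The quasi-inverse carries vertices and structure maps. It has no comparison with suspensions of
    its own, so the connecting maps are lifted through [E]. *)
Definition nlift (X : ndiag (susp (C := D))) : ndiag Sg :=
  @MkNdiag C Sg (fun i j => R (nob X i j)) (fun i j i' j' => fmor R (ntr X i j i' j'))
    (fun i j k => preim fE (iso_inv (sI _) \o fmor susp (iso_inv (rho (nob X i j)))
       \o nbd X i j k \o rho (nob X j k))).

Lemma nlift_isomorphic n X : nisomorphic n (nimage (F := E) (fun x => sI x) (nlift X)) X.
Proof.
  apply (nisomorphic_of_iso (X := nimage (F := E) (fun x => sI x) (nlift X)) (Y := X)
    (w := fun i j => rho (nob X i j))).
  - split; cbn [nimage nlift nob ntr nbd]; intros.
    + change (ntr X i j i' j' \o rho (nob X i j)
        == rho (nob X i' j') \o fmor E (fmor R (ntr X i j i' j'))).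
      rewrite fmor_qinv; la; now rewrite (iso_invr (rho _)), comp_idl.
    + pose (t := sI (R (nob X i j)) : Iso (E (Sg (R (nob X i j)))) (susp (E (R (nob X i j))))).
      change (nbd X i j k \o rho (nob X j k) == fmor susp (rho (nob X i j))
        \o (t \o fmor E (preim fE (iso_inv t
       \o fmor susp (iso_inv (rho (nob X i j))) \o nbd X i j k \o rho (nob X j k))))).
      clearbody t; rewrite fmor_preim; la; rw (iso_invr t); idc; rewrite <- fmor_comp.
      symmetry; refine (transitivity (comp_proper (comp_proper (transitivity
        (@fmor_proper _ _ susp _ _ _ _ (iso_invr (rho (nob X i j)))) (fmor_id susp _))
        (reflexivity _)) (reflexivity _)) _); now idc.
  - intros; apply is_iso_iso.
Qed.

Lemma nlift_extends n X (b : nat -> C) (f : forall i, hom (b i) (b (Datatypes.S i))) :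
  nextends n X (fun i => fmor E (f i)) -> nextends n (nlift X) f.
Proof.
  intros [v [Hv Nv]]; exists (fun i => preim fE (iso_inv (rho _) \o v i)); split.
  - intros i Hi; apply (ff_reflects_iso fE hE); rewrite fmor_preim.
    apply is_iso_comp; [apply is_iso_inv | now apply Hv].
  - intros i Hi; apply hE; change (fmor E (fmor R (ntr X 0 i 0 (Datatypes.S i))
      \o preim fE (y := R (nob X 0 i)) (iso_inv (rho (nob X 0 i)) \o v i))
      == fmor E (preim fE (y := R (nob X 0 (Datatypes.S i)))
           (iso_inv (rho (nob X 0 (Datatypes.S i))) \o v (Datatypes.S i)) \o f i)).
    rewrite !fmor_comp, !fmor_preim, fmor_qinv; la.
    rw (iso_invr (rho (nob X 0 i))); idc; rw (Nv i Hi); reflexivity.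
Qed.

Definition tri_equiv : Tri o C.
Proof.
  refine (@tri_pullback o C D tD E fE hE Sg sI equiv_additive equiv_ess_surj _ _).
  - intros n b f Hn; destruct (tri_extend_base (fun i => fmor E (f i)) Hn) as [X [HX EX]].
    exists (nlift X); split; [|now apply nlift_extends].
    refine (dist_iso Hn HX _ (nisomorphic_sym (nlift_isomorphic n X))).
    exact (ntriangle_iso (dist_ntriangle Hn HX) (nisomorphic_sym (nlift_isomorphic n X))).
  - intros eo b f; destruct (tri_octahedral eo (fun i => fmor E (f i))) as [X [TX [EX FX]]].
    pose proof (nisomorphic_sym (nlift_isomorphic 3 X)) as I.
    exists (nlift X); split; [|split; [now apply nlift_extends|]].
    + apply (ntriangle_reflect (F := E) (th := fun x => sI x)); try assumption.
      * intros x y g; apply (sI_natural sI).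
      * exact (pb_additive tD fE hE).
      * intros x; apply is_iso_iso.
      * exact (ntriangle_iso TX I).
    + intros phi Hphi H1 H2.
      assert (Hn : in_range o 2) by (rewrite eo; cbv; auto).
      pose proof (FX phi Hphi H1 H2) as HX.
      assert (I2 : nisomorphic 2 (nreindex phi X)
         (nimage (F := E) (fun x => sI x) (nreindex phi (nlift X)))) by exact (nreindex_isomorphic Hphi I).
      exact (dist_iso Hn HX (ntriangle_iso (dist_ntriangle Hn HX) I2) I2).
Defined.

Lemma tri_equiv_dist n X : dist (Tri := tri_equiv) n X ->
  dist (Tri := tD) n (nimage (F := E) (fun x => sI x) X).
Proof. intros HX; exact HX. Qed.

Definition tri_equiv_functor : TriFunctor (tC := tri_equiv) E.
Proof.
  exact (@Build_TriFunctor o C D tri_equiv tD E (pb_additive tD fE hE) sI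
    (fun n X _ HX => HX)).
Defined.
End TriEquivalence.

(** Known for the quotient inside modules, and the source of the description of the triangles of the
    completion as direct summands. *)
Definition dist_dense {o : tri_order} {C D : Cat} {tC : Tri o C} {tD : Tri o D}
    {U : Functor C D} (tU : TriFunctor U) : Prop :=
  forall n X, in_range o n -> dist n X ->
    exists Y, dist n Y /\ nretract n X (nimage (F := U) (fun x => trif_susp tU x) Y).

Lemma nmorphism_ext {C : Cat} {Sg : Functor C C} n (X Y : ndiag Sg)
    (w w' : forall i j, hom (nob X i j) (nob Y i j)) :
  (forall i j, w i j == w' i j) -> is_nmorphism n (X := X) (Y := Y) w ->
  is_nmorphism n (X := X) (Y := Y) w'.
Proof.
  intros E [H1 H2]; split; intros.
  - rewrite <- !E; now apply H1.
  - rewrite <- !E; now apply H2.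
Qed.

Lemma retract_reflect {C D : Cat} {Sg : Functor C C} {Sg' : Functor D D}
    {U : Functor C D} (fU : full U) (hU : faithful U)
    (th : forall x : C, hom (U (Sg x)) (Sg' (U x)))
    (th_nat : forall (x y : C) (f : hom x y),
       th y \o fmor U (fmor Sg f) == fmor Sg' (fmor U f) \o th x)
    (th_iso : forall x, is_iso (th x)) n (X Y : ndiag Sg) :
  nretract n (nimage th X) (nimage th Y) -> nretract n X Y.
Proof.
  intros [s [r [Hs [Hr E]]]].
  exists (fun i j => preim fU (s i j)), (fun i j => preim fU (r i j)).
  assert (P : forall X Y : ndiag Sg, forall w : forall i j, hom (nob (nimage th X) i j) (nob (nimage th Y) i j),
    is_nmorphism n (X := nimage th X) (Y := nimage th Y) w ->
    is_nmorphism n (X := X) (Y := Y) (fun i j => preim fU (w i j))).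
  { clear - th_nat th_iso hU; intros X Y w Hw.
    apply (nmorphism_reflect th_nat hU th_iso).
    refine (nmorphism_ext _ Hw); intros i j; symmetry; apply fmor_preim. }
  split; [exact (P X Y s Hs) | split; [exact (P Y X r Hr)|]].
  intros i j Hij; apply hU; rewrite fmor_comp, !fmor_preim, fmor_id; exact (E i j Hij).
Qed.

Section KarSusp.
Context {C D : Cat} (hD : idempotent_complete D) {U : Functor C D} {Sg : Functor C C}
  {Sg' : Functor D D} (t : forall x : C, Iso (U (Sg x)) (Sg' (U x)))
  (t_nat : forall (x y : C) (f : hom x y),
     t y \o fmor U (fmor Sg f) == fmor Sg' (fmor U f) \o t x).
Notation KC := (idempotent_completion C).
Notation I := (to_completion C).
Notation E := (kar_ext hD U).
Notation Ks := (kar_map Sg).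
Notation r x := (kar_r hD U x).
Notation s x := (kar_s hD U x).

Let r' (x : KarOb C) : hom (U (Sg (kob x))) (E (Ks x)) := r (Ks x).
Let s' (x : KarOb C) : hom (E (Ks x)) (U (Sg (kob x))) := s (Ks x).
Let r's' x : r' x \o s' x == idm _. Proof. exact (kar_rs hD U (Ks x)). Qed.
Let s'r' x : s' x \o r' x == fmor U (fmor Sg (kidem x)).
Proof. exact (kar_sr hD U (Ks x)). Qed.
Let s'f x y (f : KarHom x y) :
  s' y \o fmor E (fmor Ks (f : hom (c := KC) x y)) == fmor U (fmor Sg (kmor f)) \o s' x.
Proof. exact (kar_s_natural hD U (fmor Ks (f : hom (c := KC) x y))). Qed.

(** Up to [t], both objects split the same idempotent of Sg' (U (kob x)): one by a chosen splitting,
    the other by suspending one. *)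
Definition kar_susp_iso (x : KarOb C) : Iso (E (Ks x)) (Sg' (E x)).
Proof.
  refine (@MkIso D (E (Ks x)) (Sg' (E x)) (fmor Sg' (r x) \o t (kob x) \o s' x)
    (r' x \o iso_inv (t (kob x)) \o fmor Sg' (s x)) _ _).
  - la; rw (symmetry (fmor_comp Sg' (s x) (r x))); rewrite kar_sr.
    rw (symmetry (t_nat (kidem x))); rw (iso_invl (t (kob x))); idc.
    rw (symmetry (s'r' x)); rw (r's' x); idc; apply r's'.
  - la; rw (s'r' x); rw (t_nat (kidem x)); rw (iso_invr (t (kob x))); idc.
    rewrite <- !fmor_comp; refine (transitivity (@fmor_proper _ _ Sg' _ _ _ _
      (transitivity (comp_proper (kar_r_idem hD U x) (reflexivity _)) (kar_rs hD U x)))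
      (fmor_id Sg' _)).
Defined.

Lemma kar_susp_natural (x y : KarOb C) (f : KarHom x y) :
  kar_susp_iso y \o fmor E (fmor Ks (f : hom (c := KC) x y))
  == fmor Sg' (fmor E (f : hom (c := KC) x y)) \o kar_susp_iso x.
Proof.
  cbn [kar_susp_iso iso_fwd]; la; rw (s'f f); rw (t_nat (kmor f)).
  rewrite <- !fmor_comp, kar_r_natural; reflexivity.
Qed.

Definition kar_susp_nat : NatIso (functor_comp E Ks) (functor_comp Sg' E) :=
  @MkNatIso KC D (functor_comp E Ks) (functor_comp Sg' E) kar_susp_iso kar_susp_natural.

Definition to_kar_susp : NatIso (functor_comp I Sg) (functor_comp Ks I).
Proof.
  unshelve refine (@MkNatIso C KC (functor_comp I Sg) (functor_comp Ks I)
    (fun x => @kar_iso C (I (Sg x)) (Ks (I x)) (iso_id (Sg x)) _) _).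
  - cbn; now rewrite fmor_id.
  - intros x y f; cbn; now idc.
Defined.

Lemma kar_susp_unit (x : C) :
  t x \o kar_ext_unit hD U (Sg x)
  == fmor Sg' (kar_ext_unit hD U x) \o (kar_susp_iso (I x) \o fmor E (to_kar_susp x)).
Proof.
  assert (H1 : fmor Sg' (s (I x)) \o fmor Sg' (r (I x)) == idm (Sg' (U x))).
  { rewrite <- fmor_comp; refine (transitivity (@fmor_proper _ _ Sg' _ _ _ _
      (transitivity (kar_sr hD U (I x)) (fmor_id U x))) (fmor_id Sg' _)). }
  pose proof (kar_s_natural hD U (iso_fwd (to_kar_susp x) : KarHom (I (Sg x)) (Ks (I x)))) as H2.
  change (s' (I x) \o fmor E (to_kar_susp x) == fmor U (idm (Sg x) \o idm (Sg x)) \o s (I (Sg x))) in H2.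
  change (t x \o (s (I (Sg x)) : hom _ (U (Sg x))) == fmor Sg' (s (I x) : hom _ (U x))
    \o (fmor Sg' (r (I x) : hom (U x) _) \o t x \o s' (I x) \o fmor E (to_kar_susp x))).
  rewrite comp_assoc, H2; la; rw H1; rewrite fmor_comp, fmor_id; now idc.
Qed.
End KarSusp.

(** The diagonal of a distinguished n-triangle consists of zero objects, also after tensoring with
    [w]; so 0 ⊗ w = 0 is read off from [stens_dist]. *)
Lemma tens_is_zero {o : tri_order} (ho : valid_order o) {C : Cat} {tC : TensorTri o C}
    (x w : C) : is_zero x -> is_zero (x ⊗ w).
Proof.
  intros Hx; pose proof (in_range_two ho) as H2.
  destruct (tri_extend_base (fun _ => idm x) H2) as [X [HX _]].
  assert (Z : is_zero (nob X 0 0)) by (apply (dist_ntriangle H2 HX); lia).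
  destruct (dist_ntriangle H2 (stens_dist w H2 HX)) as [Zw _].
  destruct (Hx (nob X 0 0)) as [[f _] _], (Z x) as [[g _] _], (Hx x) as [[e He] _].
  refine (is_zero_retract (s := f ⊠ idm w) (r := g ⊠ idm w) _ (Zw 0 (Nat.le_0_l _))).
  rewrite <- tensm_comp, (He (g \o f)), <- (He (idm x)); idc; apply tensm_id.
Qed.

(** * The tensor triangulation of the completion *)

Section KarTensor.
Context {o : tri_order} (ho : valid_order o) {C D : Cat} (tC : TensorTri o C)
  (tD : Tri o D) (hD : idempotent_complete D) {U : Functor C D} (tU : TriFunctor U)
  (fU : full U) (hU : faithful U) (dU : dist_dense tU) (rU : retracts_onto U).
Notation KC := (idempotent_completion C).
Notation I := (to_completion C).
Notation E := (kar_ext hD U).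
Notation Ks := (kar_map (susp (C := C))).
Notation fE := (kar_ext_full (hD := hD) fU hU).
Notation hE := (kar_ext_faithful (hD := hD) hU).
Notation eE := (kar_ext_ess_surj hD fU hU rU).
Notation sI := (kar_susp_nat hD (t := fun x => trif_susp tU x) (trif_is_natural tU)).

Definition kar_tri : Tri o KC := tri_equiv (tD := tD) fE hE eE sI.
Definition kar_ext_tri : TriFunctor (tC := kar_tri) E := tri_equiv_functor (tD := tD) fE hE eE sI.

Lemma to_completion_additive : is_additive_functor (aD := tri_add (Tri := kar_tri)) I.
Proof.
  intros x y f g; apply hE.
  refine (transitivity _ (symmetry (trif_additive kar_ext_tri (fmor I f) (fmor I g)))).
  pose proof (nat_iso_natural (kar_ext_unit hD U)) as N.
  apply (iso_mono (i := kar_ext_unit hD U y)).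
  rewrite comp_addr.
  refine (transitivity (N _ _ (addm f g)) _).
  refine (transitivity _ (symmetry (addm_proper (N _ _ f) (N _ _ g)))).
  rewrite <- comp_addl; now rewrite (trif_additive tU).
Qed.

Lemma kar_image_isomorphic n (Y : ndiag (susp (C := C))) :
  nisomorphic n (nimage (F := U) (fun x => trif_susp tU x) Y)
    (nimage (F := E) (fun x => trif_susp kar_ext_tri x)
      (nimage (Sg' := Ks) (F := I) (fun x => to_kar_susp (Sg := susp) x) Y)).
Proof.
  refine (nisomorphic_sym (nisomorphic_trans (nisomorphic_sym (nimage_nimage
    (th'' := fun x => kar_susp_iso hD (t := fun x => trif_susp tU x) (trif_is_natural tU) (I x)
      \o fmor E (to_kar_susp (Sg := susp) x)) _ n Y)) _)).
  - intros x; reflexivity.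
  - apply (nimage_ext (a := kar_ext_unit hD U)).
    intros x; exact (kar_susp_unit hD (t := fun x => trif_susp tU x) (trif_is_natural tU) x).
Qed.

Definition to_completion_tri : TriFunctor (tD := kar_tri) I.
Proof.
  refine (@Build_TriFunctor o C KC _ kar_tri I to_completion_additive (@to_kar_susp C susp) _).
  intros n X Hn HX.
  refine (dist_iso (Tri := tD) Hn (trif_dist tU Hn HX) _ (kar_image_isomorphic n X)).
  exact (ntriangle_iso (dist_ntriangle Hn (trif_dist tU Hn HX)) (kar_image_isomorphic n X)).
Defined.

(** From left to right this is density in D, reflected along the fully faithful [E]; the converse is
    closure of distinguished triangles under retracts. *)
Lemma kar_dist_iff n (X : ndiag Ks) : in_range o n ->
  (dist (Tri := kar_tri) n X <-> is_ntriangle n X /\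
    exists Y, dist n Y /\
      nretract n X (nimage (F := I) (fun x => trif_susp to_completion_tri x) Y)).
Proof.
  intros Hn; split.
  - intros HX; split; [exact (dist_ntriangle (Tri := kar_tri) Hn HX)|].
    destruct (dU Hn (HX : dist n (nimage (F := E) (fun x => trif_susp kar_ext_tri x) X)))
      as [Y [HY R]].
    exists Y; split; [exact HY|].
    refine (retract_reflect fE hE (th := fun x => trif_susp kar_ext_tri x) _ _
      (nretract_trans R (nisomorphic_retract (kar_image_isomorphic n Y)))).
    + exact (trif_is_natural kar_ext_tri).
    + intros x; apply is_iso_iso.
  - intros [TX [Y [HY R]]].
    exact (@dist_retract o KC kar_tri ho n X _ Hn TX (trif_dist to_completion_tri Hn HY) R).
Qed.

Definition kar_stens (x y : KarOb C) :
    Iso (C := KC) (kar_tens tt_mon (Ks x) y) (Ks (kar_tens tt_mon x y)) :=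
  kar_iso (x := kar_tens tt_mon (Ks x) y) (y := Ks (kar_tens tt_mon x y))
    (a := stens (kob x) (kob y)) (stens_natural _ _).

Lemma kar_stens_natural (x y x' y' : KarOb C) (f : hom (c := KC) x x') (g : hom (c := KC) y y') :
  kar_stens x' y' \o tensm (SymMon := kar_symmon tt_mon) (fmor Ks f) g
    == fmor Ks (tensm (SymMon := kar_symmon tt_mon) f g) \o kar_stens x y.
Proof.
  cbn.
  rewrite <- comp_assoc, <- stens_natural, !comp_assoc, <- !tensm_comp, <- !fmor_comp.
  now rewrite !kmor_r, !kmor_l.
Qed.

(** With [kar_out] it makes I x ⊗ w a retract of I (x ⊗ kob w). This reduces tensoring with an
    object of the completion to tensoring in C. *)
Definition kar_in (w : KarOb C) (x : C) :
  hom (c := KC) (kar_tens tt_mon (I x) w) (I (x ⊗ kob w)).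
Proof.
  refine (@MkKarHom C (kar_tens tt_mon (I x) w) (I (x ⊗ kob w)) (idm x ⊠ kidem w) _ _); cbn.
  - now idc.
  - rewrite <- tensm_comp, kidem_idem; now idc.
Defined.

Definition kar_out (w : KarOb C) (x : C) :
  hom (c := KC) (I (x ⊗ kob w)) (kar_tens tt_mon (I x) w).
Proof.
  refine (@MkKarHom C (I (x ⊗ kob w)) (kar_tens tt_mon (I x) w) (idm x ⊠ kidem w) _ _); cbn.
  - rewrite <- tensm_comp, kidem_idem; now idc.
  - now idc.
Defined.

Lemma kar_out_in (w : KarOb C) (x : C) : kar_out w x \o kar_in w x == idm _.
Proof. cbn; rewrite <- tensm_comp, kidem_idem; now idc. Qed.

Lemma kar_tens_is_zero (x w : KarOb C) :
  is_zero (C := KC) x -> is_zero (C := KC) (kar_tens tt_mon x w).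
Proof.
  intros Hx; destruct (tri_additive (Tri := tt_tri (C := C))) as [[z Hz] _].
  destruct (Hx (I z)) as [[f _] _], (Hx x) as [[e He] _].
  pose proof (fmor_is_zero to_completion_additive Hz) as Z.
  destruct (Z x) as [[g _] _].
  refine (is_zero_retract (aC := tri_add (Tri := kar_tri))
    (s := kar_in w z \o kar_tensm tt_mon f (idm (w : KC))) (r := kar_tensm tt_mon g (idm (w : KC)) \o kar_out w z) _
    (fmor_is_zero to_completion_additive (tens_is_zero ho (kob w) Hz))).
  rewrite <- comp_assoc, (comp_assoc _ (kar_out w z)), kar_out_in, comp_idr.
  refine (transitivity (symmetry (tensm_comp (SymMon := kar_symmon tt_mon) _ _ _ _)) _).
  refine (transitivity (tensm_proper (SymMon := kar_symmon tt_mon)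
    (transitivity (He (g \o f)) (symmetry (He (idm (x : KC))))) (comp_idl _)) _).
  apply (tensm_id (SymMon := kar_symmon tt_mon)).
Qed.

Lemma kar_tens_ntriangle n (X : ndiag Ks) (w : KC) : is_ntriangle n X ->
  is_ntriangle n (nimage (F := tensor_right (mC := kar_symmon tt_mon) w)
    (fun x => kar_stens x w) X).
Proof.
  apply nimage_ntriangle.
  - intros x y f; exact (kar_stens_natural f (idm w)).
  - intros x; apply kar_tens_is_zero.
Qed.

Lemma kar_tens_retract n (Y : ndiag (susp (C := C))) (w : KC) :
  nretract n
    (nimage (F := tensor_right (mC := kar_symmon tt_mon) w) (fun x => kar_stens x w)
       (nimage (F := I) (fun x => trif_susp to_completion_tri x) Y))
    (nimage (F := I) (fun x => trif_susp to_completion_tri x)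
       (nimage (F := tensor_right (kob w)) (fun x => stens x (kob w)) Y)).
Proof.
  exists (fun i j => kar_in w (nob Y i j)), (fun i j => kar_out w (nob Y i j)).
  split; [|split; [|intros i j _; apply kar_out_in]]; split; intros; cbn.
  - rewrite <- !tensm_comp, ?kidem_idem; now idc.
  - la; idc; rewrite <- stens_natural, fmor_id, !comp_assoc, <- !tensm_comp, ?kidem_idem; now idc.
  - rewrite <- !tensm_comp, ?kidem_idem; now idc.
  - la; idc; rewrite <- stens_natural, fmor_id, !comp_assoc, <- !tensm_comp, ?kidem_idem; now idc.
Qed.

Lemma kar_sign : braid (SymMon := kar_symmon tt_mon) (Ks (I one)) (Ks (I one))
  == oppm (PreAdd := tri_add (Tri := kar_tri)) (idm _).
Proof.
  pose proof (tri_add (Tri := kar_tri)) as aK.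
  (* The two objects share their underlying object, but their idempotents agree only up to [==], so
     an isomorphism has to be inserted. *)
  unshelve epose (J := kar_iso (x := I (susp one ⊗ susp one))
    (y := kar_tens tt_mon (Ks (I one)) (Ks (I one))) (a := iso_id (susp one ⊗ susp one)) _).
  { cbn; rewrite fmor_id, tensm_id; reflexivity. }
  apply (iso_epi (i := J)).
  refine (transitivity _ (symmetry (comp_oppl (aC := tri_add (Tri := kar_tri)) _ _))).
  refine (transitivity _ (oppm_proper (transitivity (comp_idr _) (symmetry (comp_idl _))))).
  refine (transitivity _ (comp_oppr (aC := tri_add (Tri := kar_tri)) _ _)).
  refine (transitivity _ (comp_proper (reflexivity _)
    (transitivity (fmor_opp to_completion_additive _) (oppm_proper (fmor_id I _))))).
  cbn; rewrite stens_sign, fmor_id, tensm_id; now idc.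
Qed.

Definition kar_tensor : TensorTri o KC.
Proof.
  refine (@Build_TensorTri o KC kar_tri (kar_symmon tt_mon) kar_stens kar_stens_natural _ _ _ _).
  - intros x; cbn; rewrite fmor_comp.
    rewrite (@idem_compose C _ _ _ (stens (kob x) one)).
    + now rewrite stens_runit.
    + rewrite <- tensm_comp, <- fmor_comp, kidem_idem; now idc.
    + apply stens_natural.
  - intros x y z; cbn; rewrite fmor_comp.
    assert (H : (stens (kob x) (kob y) \o fmor susp (kidem x) ⊠ kidem y) ⊠ kidem z
      == (stens (kob x) (kob y) ⊠ idm (kob z)) \o ((fmor susp (kidem x) ⊠ kidem y) ⊠ kidem z))
      by (rewrite <- tensm_comp; now idc).
    rewrite H.
    assert (J : forall x : KarOb C, fmor susp (kidem x) \o fmor susp (kidem x) == fmor susp (kidem x))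
      by (intros; rewrite <- fmor_comp; now rewrite kidem_idem).
    rewrite (@idem_compose C _ _ _ (stens (kob x ⊗ kob y) (kob z))).
    2: rewrite <- !tensm_comp, <- fmor_comp, <- tensm_comp; now rewrite !kidem_idem.
    2: apply stens_natural.
    rewrite (@idem_compose C _ _ _ (stens (kob x) (kob y) ⊠ idm (kob z))).
    2: rewrite <- !tensm_comp, J; now rewrite !kidem_idem.
    2: rewrite <- !tensm_comp, stens_natural; now idc.
    rewrite (@idem_compose C _ _ _ (assoc (susp (kob x)) (kob y) (kob z))).
    2: rewrite <- !tensm_comp, J; now rewrite !kidem_idem.
    2: apply assoc_natural.
    now rewrite stens_assoc.
  - intros n X w Hn HX.
    destruct (proj1 (kar_dist_iff X Hn) HX) as [TX [Y [HY R]]].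
    apply (proj2 (kar_dist_iff _ Hn)); split; [exact (kar_tens_ntriangle w TX)|].
    exists (nimage (F := tensor_right (kob w)) (fun x => stens x (kob w)) Y).
    split; [exact (stens_dist (kob w) Hn HY)|].
    exact (nretract_trans (tensor_retract (mC := kar_symmon tt_mon) (st := kar_stens)
      kar_stens_natural w R) (kar_tens_retract n Y w)).
  - exact kar_sign.
Defined.

Definition to_completion_mon : MonFunctor (mD := kar_symmon tt_mon) I.
Proof.
  unshelve refine (@Build_MonFunctor C KC _ (kar_symmon tt_mon) I
    (fun x y => @kar_iso C (kar_tens tt_mon (I x) (I y)) (I (x ⊗ y)) (iso_id (x ⊗ y)) _)
    (iso_id (I one)) _ _ _ _ _).
  - cbn; rewrite tensm_id; reflexivity.
  - intros x y x' y' f g; cbn; rewrite !tensm_id; now idc.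
  - intros x y z; cbn; rewrite ?tensm_id; idc; rewrite ?tensm_id; now idc.
  - intros x; cbn; rewrite ?tensm_id; idc; rewrite ?tensm_id; now idc.
  - intros x; cbn; rewrite ?tensm_id; idc; rewrite ?tensm_id; now idc.
  - intros x y; cbn; rewrite ?tensm_id; now idc.
Defined.

Definition to_completion_tt : TTFunctor (tD := kar_tensor) I.
Proof.
  refine (@Build_TTFunctor o C KC tC kar_tensor I to_completion_tri to_completion_mon _).
  intros x y; cbn; rewrite ?tensm_id, ?fmor_id; idc; rewrite ?tensm_id, ?fmor_id; now idc.
Defined.

Lemma completion_structure : is_completion_structure tC kar_tensor.
Proof. exists to_completion_tt; intros n X Hn; exact (kar_dist_iff X Hn). Qed.
End KarTensor.

(** * Transport of a tensor product along an equivalence *)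

Section MonTransfer.
Context {C D : Cat} (mC : SymMon C) (E : Functor C D) (R : Functor D C)
  (rho : forall d : D, Iso (E (R d)) d) (u : forall x : C, Iso (R (E x)) x)
  (rho_nat : forall (d d' : D) (f : hom d d'), rho d' \o fmor E (fmor R f) == f \o rho d)
  (u_nat : forall (x x' : C) (f : hom x x'), u x' \o fmor R (fmor E f) == f \o u x)
  (E_u : forall x : C, fmor E (u x) == rho (E x))
  (R_rho : forall d : D, fmor R (rho d) == u (R d)).

Definition tr_tens (d d' : D) : D := E (R d ⊗ R d').
Definition tr_tensm {a b a' b' : D} (f : hom a a') (g : hom b b') :
  hom (tr_tens a b) (tr_tens a' b') := fmor E (fmor R f ⊠ fmor R g).
Definition tr_one : D := E one.

(** The associator before [E] is applied. Kept in C, it lets each coherence condition be proved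
    there and mapped by [E] at the end. *)
Definition tr_assoc0 (a b c : D) :
    Iso (R (tr_tens a b) ⊗ R c) (R a ⊗ R (tr_tens b c)) :=
  iso_comp (tens_iso (iso_id (R a)) (iso_sym (u (R b ⊗ R c))))
    (iso_comp (assoc (R a) (R b) (R c)) (tens_iso (u (R a ⊗ R b)) (iso_id (R c)))).

Definition tr_assoc (a b c : D) : Iso (tr_tens (tr_tens a b) c) (tr_tens a (tr_tens b c)) :=
  fiso E (tr_assoc0 a b c).

Definition tr_lunit (a : D) : Iso (tr_tens tr_one a) a :=
  iso_comp (rho a) (fiso E (iso_comp (lunit (R a)) (tens_iso (u one) (iso_id (R a))))).

Definition tr_runit (a : D) : Iso (tr_tens a tr_one) a :=
  iso_comp (rho a) (fiso E (iso_comp (runit (R a)) (tens_iso (iso_id (R a)) (u one)))).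

Definition tr_braid (a b : D) : hom (tr_tens a b) (tr_tens b a) := fmor E (braid (R a) (R b)).

Lemma u_inv_nat (x x' : C) (f : hom x x') : fmor R (fmor E f) \o iso_inv (u x) == iso_inv (u x') \o f.
Proof. symmetry; apply iso_inv_square, u_nat. Qed.

Lemma tr_assoc0E (a b c : D) : iso_fwd (tr_assoc0 a b c) == (idm (R a) ⊠ iso_inv (u (R b ⊗ R c)))
  \o assoc (R a) (R b) (R c) \o (u (R a ⊗ R b) ⊠ idm (R c)).
Proof. cbn; now la. Qed.

Lemma tr_assocE (a b c : D) : iso_fwd (tr_assoc a b c) == fmor E ((idm (R a) ⊠ iso_inv (u (R b ⊗ R c)))
  \o assoc (R a) (R b) (R c) \o (u (R a ⊗ R b) ⊠ idm (R c))).
Proof. cbn; now la. Qed.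

Lemma u_tens_l {x x' y y' : C} (k : hom x x') (h : hom y y') :
  (u x' ⊠ idm y') \o (fmor R (fmor E k) ⊠ h) == (k ⊠ h) \o (u x ⊠ idm y).
Proof. rewrite <- !tensm_comp, u_nat; now idc. Qed.

Lemma u_tens_r {x x' y y' : C} (k : hom x x') (h : hom y y') :
  (idm y' ⊠ iso_inv (u x')) \o (h ⊠ k) == (h ⊠ fmor R (fmor E k)) \o (idm y ⊠ iso_inv (u x)).
Proof. rewrite <- !tensm_comp, u_inv_nat; now idc. Qed.

Lemma tr_assoc_natural (a b c a' b' c' : D) (f : hom a a') (g : hom b b') (h : hom c c') :
  tr_assoc a' b' c' \o tr_tensm (tr_tensm f g) h == tr_tensm f (tr_tensm g h) \o tr_assoc a b c.
Proof.
  rewrite !tr_assocE; unfold tr_tensm; apply fmor_square; la.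
  rw (symmetry (u_tens_r (fmor R g ⊠ fmor R h) (fmor R f))).
  rw (u_tens_l (fmor R f ⊠ fmor R g) (fmor R h)).
  now rw (assoc_natural (fmor R f) (fmor R g) (fmor R h)).
Qed.

Lemma fmor_pentagon {a b c d e : C} (f1 : hom a b) (f2 : hom b c) (f3 : hom c d)
    (g1 : hom a e) (g2 : hom e d) :
  f3 \o f2 \o f1 == g2 \o g1 ->
  fmor E f3 \o fmor E f2 \o fmor E f1 == fmor E g2 \o fmor E g1.
Proof. intros H; rewrite <- !fmor_comp; now rewrite H. Qed.

(** Naturality moves the isomorphisms [u] and their inverses past the associators until the pentagon
    of C applies. *)
Lemma tr_pentagon (w x y z : D) :
  tr_tensm (idm w) (tr_assoc x y z) \o tr_assoc w (tr_tens x y) z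
    \o tr_tensm (tr_assoc w x y) (idm z)
  == tr_assoc w x (tr_tens y z) \o tr_assoc (tr_tens w x) y z.
Proof.
  assert (H : (idm (R w) ⊠ fmor R (fmor E (tr_assoc0 x y z))) \o tr_assoc0 w (tr_tens x y) z
    \o (fmor R (fmor E (tr_assoc0 w x y)) ⊠ idm (R z))
    == tr_assoc0 w x (tr_tens y z) \o tr_assoc0 (tr_tens w x) y z).
  2: { refine (fmor_pentagon (transitivity _ H)).
    apply comp_proper; [apply comp_proper; [|reflexivity]|];
      (apply tensm_proper; [|]); first [reflexivity | apply fmor_id]. }
  rewrite !tr_assoc0E; unfold tr_tens; la.
  rw (symmetry (u_tens_r ((idm (R x) ⊠ iso_inv (u (R y ⊗ R z)))
    \o assoc (R x) (R y) (R z) \o (u (R x ⊗ R y) ⊠ idm (R z))) (idm (R w)))).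
  rw (u_tens_l ((idm (R w) ⊠ iso_inv (u (R x ⊗ R y)))
    \o assoc (R w) (R x) (R y) \o (u (R w ⊗ R x) ⊠ idm (R y))) (idm (R z))).
  rewrite !tens_l_comp, !tens_r_comp; la.
  assert (X1 : (idm (R w) ⊠ (u (R x ⊗ R y) ⊠ idm (R z))) \o assoc (R w) (R (E (R x ⊗ R y))) (R z)
    \o ((idm (R w) ⊠ iso_inv (u (R x ⊗ R y))) ⊠ idm (R z)) == assoc (R w) (R x ⊗ R y) (R z)).
  { rewrite <- assoc_natural, comp_assoc, <- tens_l_comp, <- tens_r_comp, (iso_invr (u _)).
    rewrite !tensm_id; now idc. }
  rw X1; clear X1.
  rw (pentagon (R w) (R x) (R y) (R z)).
  rw (symmetry (tens_lr (u (R w ⊗ R x)) (iso_inv (u (R y ⊗ R z))))).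
  rw (tens_rl (u (R w ⊗ R x)) (iso_inv (u (R y ⊗ R z)))).
  rewrite <- (tensm_id (R w) (R x)).
  rw (assoc_natural (idm (R w)) (idm (R x)) (iso_inv (u (R y ⊗ R z)))).
  rewrite <- (tensm_id (R y) (R z)).
  now rw (symmetry (assoc_natural (u (R w ⊗ R x)) (idm (R y)) (idm (R z)))).
Qed.

Lemma tr_lunitE (a : D) : iso_fwd (tr_lunit a)
  == rho a \o fmor E (lunit (R a) \o (u one ⊠ idm (R a))).
Proof. cbn; reflexivity. Qed.

Lemma tr_runitE (a : D) : iso_fwd (tr_runit a)
  == rho a \o fmor E (runit (R a) \o (idm (R a) ⊠ u one)).
Proof. cbn; reflexivity. Qed.

Lemma tr_lunit_natural (a b : D) (f : hom a b) :
  tr_lunit b \o tr_tensm (idm tr_one) f == f \o tr_lunit a.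
Proof.
  rewrite !tr_lunitE, <- comp_assoc, <- rho_nat; unfold tr_tensm, tr_tens.
  rewrite !comp_assoc; apply comp_proper; [reflexivity|].
  apply fmor_square; la; rewrite <- (lunit_natural (fmor R f)), fmor_id.
  rewrite !comp_assoc, <- !tensm_comp; now idc.
Qed.

Lemma tr_runit_natural (a b : D) (f : hom a b) :
  tr_runit b \o tr_tensm f (idm tr_one) == f \o tr_runit a.
Proof.
  rewrite !tr_runitE, <- comp_assoc, <- rho_nat; unfold tr_tensm, tr_tens.
  rewrite !comp_assoc; apply comp_proper; [reflexivity|].
  apply fmor_square; la; rewrite <- (runit_natural (fmor R f)), fmor_id.
  rewrite !comp_assoc, <- !tensm_comp; now idc.
Qed.

(** This uses that the equivalence is an adjoint one: [R_rho] turns the image of [rho] into [u]. *)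
Lemma R_lunit (a : D) :
  fmor R (tr_lunit a) == lunit (R a) \o (u one ⊠ idm (R a)) \o u (R (E one) ⊗ R a).
Proof.
  refine (transitivity (fmor_comp R (rho a) (fmor E (lunit (R a) \o (u one ⊠ idm (R a))))) _).
  rewrite R_rho; apply u_nat.
Qed.

Lemma R_runit (a : D) :
  fmor R (tr_runit a) == runit (R a) \o (idm (R a) ⊠ u one) \o u (R a ⊗ R (E one)).
Proof.
  refine (transitivity (fmor_comp R (rho a) (fmor E (runit (R a) \o (idm (R a) ⊠ u one)))) _).
  rewrite R_rho; apply u_nat.
Qed.

Lemma fmor_triangle {a b c : C} (f1 : hom a b) (f2 : hom b c) (g : hom a c) :
  f2 \o f1 == g -> fmor E f2 \o fmor E f1 == fmor E g.
Proof. intros H; rewrite <- fmor_comp; now rewrite H. Qed.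

Lemma tr_triangle (x y : D) :
  tr_tensm (idm x) (tr_lunit y) \o tr_assoc x tr_one y == tr_tensm (tr_runit x) (idm y).
Proof.
  assert (H : (idm (R x) ⊠ (lunit (R y) \o (u one ⊠ idm (R y)) \o u (R (E one) ⊗ R y)))
    \o ((idm (R x) ⊠ iso_inv (u (R (E one) ⊗ R y))) \o assoc (R x) (R (E one)) (R y)
          \o (u (R x ⊗ R (E one)) ⊠ idm (R y)))
    == (runit (R x) \o (idm (R x) ⊠ u one) \o u (R x ⊗ R (E one))) ⊠ idm (R y)).
  { rewrite !tens_l_comp, !tens_r_comp; la.
    rw (symmetry (tens_r_comp (w := R x) (u (R (E one) ⊗ R y)) (iso_inv (u (R (E one) ⊗ R y))))).
    rewrite (iso_invr (u _)), tensm_id, comp_idr.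
    rw (symmetry (assoc_natural (idm (R x)) (u one) (idm (R y)))).
    now rewrite unit_triangle. }
  refine (fmor_triangle (transitivity _ (transitivity H _))).
  - refine (comp_proper (tensm_proper (fmor_id R x) (R_lunit y)) (tr_assoc0E _ _ _)).
  - refine (symmetry (tensm_proper (R_runit x) (fmor_id R y))).
Qed.

Lemma fmor_hexagon {a b c d b' c' : C} (f1 : hom a b) (f2 : hom b c) (f3 : hom c d)
    (g1 : hom a b') (g2 : hom b' c') (g3 : hom c' d) :
  f3 \o f2 \o f1 == g3 \o g2 \o g1 ->
  fmor E f3 \o fmor E f2 \o fmor E f1 == fmor E g3 \o fmor E g2 \o fmor E g1.
Proof. intros H; rewrite <- !fmor_comp; now rewrite H. Qed.

Lemma tr_hexagon (x y z : D) :
  tr_assoc y z x \o tr_braid x (tr_tens y z) \o tr_assoc x y z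
  == tr_tensm (idm y) (tr_braid x z) \o tr_assoc y x z \o tr_tensm (tr_braid x y) (idm z).
Proof.
  assert (H : tr_assoc0 y z x \o braid (R x) (R (E (R y ⊗ R z))) \o tr_assoc0 x y z
    == (idm (R y) ⊠ fmor R (fmor E (braid (R x) (R z)))) \o tr_assoc0 y x z
       \o (fmor R (fmor E (braid (R x) (R y))) ⊠ idm (R z))).
  2: { refine (fmor_hexagon (transitivity H _)).
    apply comp_proper; [apply comp_proper; [|reflexivity]|];
      (apply tensm_proper; [|]); first [reflexivity | symmetry; apply fmor_id]. }
  rewrite !tr_assoc0E; unfold tr_tens; la.
  rw (symmetry (braid_natural (idm (R x)) (u (R y ⊗ R z)))).
  rw (symmetry (tens_r_comp (w := R x) (u (R y ⊗ R z)) (iso_inv (u (R y ⊗ R z))))).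
  rewrite (iso_invr (u _)), tensm_id, comp_idr.
  rw (hexagon (R x) (R y) (R z)).
  rw (symmetry (u_tens_r (braid (R x) (R z)) (idm (R y)))).
  now rw (u_tens_l (braid (R x) (R y)) (idm (R z))).
Qed.

Definition tr_symmon : SymMon D.
Proof.
  refine (@Build_SymMon D tr_tens (@tr_tensm) tr_one tr_assoc tr_lunit tr_runit tr_braid
    _ _ _ tr_assoc_natural tr_lunit_natural tr_runit_natural _ tr_pentagon tr_triangle
    tr_hexagon _).
  - intros x y x' y' f f' Ef g g' Eg; unfold tr_tensm; now rewrite Ef, Eg.
  - intros x y; unfold tr_tensm; rewrite !fmor_id, tensm_id; apply fmor_id.
  - intros x y x' y' x'' y'' f' f g' g.
    refine (transitivity (@fmor_proper _ _ E _ _ _ _ (transitivity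
      (tensm_proper (fmor_comp R f' f) (fmor_comp R g' g)) (tensm_comp _ _ _ _))) (fmor_comp E _ _)).
  - intros x y x' y' f g; apply fmor_square, braid_natural.
  - intros x y; refine (transitivity (symmetry (fmor_comp E _ _)) _).
    rewrite braid_involutive; apply fmor_id.
Defined.

Definition tr_functor : MonFunctor (mD := tr_symmon) E.
Proof.
  refine (@Build_MonFunctor C D mC tr_symmon E
    (fun x y => fiso E (tens_iso (u x) (u y))) (iso_id (E one)) _ _ _ _ _).
  - intros x y x' y' f g; apply fmor_square; cbn.
    rewrite <- !tensm_comp; now rewrite !u_nat.
  - intros x y z.
    assert (H : assoc x y z \o (u (x ⊗ y) ⊠ u z)
        \o (fmor R (fmor E (u x ⊠ u y)) ⊠ idm (R (E z)))
      == (u x ⊠ u (y ⊗ z)) \o (idm (R (E x)) ⊠ fmor R (fmor E (u y ⊠ u z)))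
        \o tr_assoc0 (E x) (E y) (E z)).
    2: { refine (fmor_hexagon (transitivity (transitivity _ H) _)).
      - refine (comp_proper (reflexivity _) (tensm_proper (reflexivity _) (fmor_id R _))).
      - refine (comp_proper (comp_proper (reflexivity _)
          (tensm_proper (symmetry (fmor_id R _)) (reflexivity _))) (reflexivity _)). }
    rewrite tr_assoc0E; unfold tr_tens.
    rewrite (comp_assoc (assoc x y z)), <- tensm_comp, u_nat; la.
    rw (symmetry (tensm_comp (u x) (idm (R (E x))) (u (y ⊗ z)) (fmor R (fmor E (u y ⊠ u z))))).
    rw (symmetry (tensm_comp (u x \o idm (R (E x))) (idm (R (E x)))
      (u (y ⊗ z) \o fmor R (fmor E (u y ⊠ u z))) (iso_inv (u (R (E y) ⊗ R (E z)))))).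
    rewrite u_nat, (comp_assoc (u y ⊠ u z)), (iso_invr (u _)), !comp_idr.
    rw (symmetry (assoc_natural (u x) (u y) (u z))).
    rw (symmetry (tensm_comp (u x ⊠ u y) (u (R (E x) ⊗ R (E y))) (u z) (idm (R (E z))))).
    now idc.
  - intros x.
    refine (transitivity (comp_proper (reflexivity _) (tensm_id (SymMon := tr_symmon) _ _)) _).
    refine (transitivity (comp_idr _) _).
    refine (transitivity _ (comp_proper (E_u x) (reflexivity _))).
    apply fmor_square; cbn; la; rewrite <- (lunit_natural (u x)), comp_assoc, <- tensm_comp.
    now idc.
  - intros x.
    refine (transitivity (comp_proper (reflexivity _) (tensm_id (SymMon := tr_symmon) _ _)) _).
    refine (transitivity (comp_idr _) _).
    refine (transitivity _ (comp_proper (E_u x) (reflexivity _))).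
    apply fmor_square; cbn; la; rewrite <- (runit_natural (u x)), comp_assoc, <- tensm_comp.
    now idc.
  - intros x y; apply fmor_square; cbn; apply braid_natural.
Defined.
End MonTransfer.

Lemma fmor_triangle2 {C D : Cat} (E : Functor C D) {a b c d : C} (f1 : hom a b) (f2 : hom b c)
    (f3 : hom c d) {b' : C} (g1 : hom a b') (g2 : hom b' d) :
  f3 \o f2 \o f1 == g2 \o g1 ->
  fmor E f3 \o (fmor E f2 \o fmor E f1) == fmor E g2 \o fmor E g1.
Proof. intros H; rewrite <- !fmor_comp, <- comp_assoc; now rewrite H. Qed.

Section TensorTransfer.
Context {o : tri_order} {C D : Cat} (tC : TensorTri o C) (tD : Tri o D)
  (E : Functor C D) (fE : full E) (hE : faithful E) (R : Functor D C)
  (rho : forall d : D, Iso (E (R d)) d) (u : forall x : C, Iso (R (E x)) x)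
  (rho_nat : forall (d d' : D) (f : hom d d'), rho d' \o fmor E (fmor R f) == f \o rho d)
  (u_nat : forall (x x' : C) (f : hom x x'), u x' \o fmor R (fmor E f) == f \o u x)
  (E_u : forall x : C, fmor E (u x) == rho (E x))
  (R_rho : forall d : D, fmor R (rho d) == u (R d))
  (E_add : is_additive_functor E)
  (t : forall x : C, Iso (E (susp x)) (susp (E x)))
  (t_nat : forall (x y : C) (f : hom x y),
     t y \o fmor E (fmor susp f) == fmor susp (fmor E f) \o t x)
  (E_dist : forall n X, in_range o n -> dist n X -> dist n (nimage (fun x => t x) X))
  (lift_dist : forall n (X : ndiag (susp (C := D))), in_range o n -> dist n X ->
     exists Y, dist n Y /\ nisomorphic n X (nimage (F := E) (fun x => t x) Y)).

Definition transfer_mon : SymMon D := tr_symmon tt_mon rho_nat u_nat R_rho.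
#[local] Existing Instance transfer_mon.

(** Compatibility of [R] with suspensions, determined by that of [E] through full faithfulness. *)
Definition transfer_v (d : D) : Iso (R (susp d)) (susp (R d)) :=
  preim_iso fE hE (iso_comp (iso_sym (t (R d))) (iso_comp (fiso susp (iso_sym (rho d))) (rho (susp d)))).
Notation v := transfer_v.

Lemma fmor_v (d : D) : t (R d) \o fmor E (v d) == fmor susp (iso_inv (rho d)) \o rho (susp d).
Proof.
  cbn; rewrite fmor_preim; la; rewrite (iso_invr (t (R d))); now idc.
Qed.

Lemma fmor_v' (d : D) : fmor susp (rho d) \o t (R d) \o fmor E (v d) == rho (susp d).
Proof.
  rewrite comp_assoc, fmor_v; la; rewrite <- fmor_comp, (iso_invr (rho d)), fmor_id; now idc.
Qed.

Lemma v_nat (d d' : D) (f : hom d d') :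
  v d' \o fmor R (fmor susp f) == fmor susp (fmor R f) \o v d.
Proof.
  apply hE, (iso_mono (i := t (R d'))); rewrite !fmor_comp; la.
  rewrite fmor_v, (t_nat (fmor R f)); rw (rho_nat (fmor susp f)).
  rw (fmor_v d); rewrite <- !(fmor_comp susp).
  assert (N : fmor E (fmor R f) \o iso_inv (rho d) == iso_inv (rho d') \o f)
    by (symmetry; apply iso_inv_square; symmetry; symmetry; apply rho_nat).
  rewrite N, fmor_comp; now la.
Qed.

Lemma v_u (x : C) : fmor susp (u x) \o v (E x) \o fmor R (t x) == u (susp x).
Proof.
  apply hE, (iso_mono (i := t x)); rewrite !fmor_comp; la.
  rewrite t_nat; rw (fmor_v (E x)); rewrite E_u; rewrite <- (fmor_comp susp).
  rewrite (iso_invr (rho (E x))), fmor_id, comp_idl, E_u.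
  exact (rho_nat (t x)).
Qed.

Definition transfer_stens (x y : D) : Iso (susp x ⊗ y) (susp (x ⊗ y)) :=
  iso_comp (t (R x ⊗ R y)) (fiso E (iso_comp (stens (R x) (R y)) (tens_iso (v x) (iso_id (R y))))).

Lemma transfer_stens_natural (x y x' y' : D) (f : hom x x') (g : hom y y') :
  transfer_stens x' y' \o (fmor susp f ⊠ g) == fmor susp (f ⊠ g) \o transfer_stens x y.
Proof.
  change (t (R x' ⊗ R y') \o fmor E (stens (R x') (R y') \o (v x' ⊠ idm (R y')))
    \o fmor E (fmor R (fmor susp f) ⊠ fmor R g)
    == fmor susp (fmor E (fmor R f ⊠ fmor R g)) \o (t (R x ⊗ R y)
       \o fmor E (stens (R x) (R y) \o (v x ⊠ idm (R y))))).
  rewrite <- comp_assoc, <- t_nat, !comp_assoc, <- !fmor_comp.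
  apply comp_proper; [reflexivity|]; apply fmor_proper.
  rewrite <- comp_assoc, <- stens_natural, !comp_assoc, <- !tensm_comp, v_nat; now idc.
Qed.

Lemma transfer_stens_runit (x : D) :
  fmor susp (runit x) \o transfer_stens x one == runit (susp x).
Proof.
  change (fmor susp (rho x \o fmor E (runit (R x) \o (idm (R x) ⊠ u one)))
    \o (t (R x ⊗ R (E one)) \o fmor E (stens (R x) (R (E one)) \o (v x ⊠ idm (R (E one)))))
    == rho (susp x) \o fmor E (runit (R (susp x)) \o (idm (R (susp x)) ⊠ u one))).
  rewrite fmor_comp; la; rw (symmetry (t_nat (runit (R x) \o (idm (R x) ⊠ u one)))).
  rewrite <- (fmor_v' x); rewrite !comp_assoc, <- !fmor_comp.
  apply comp_proper; [reflexivity|]; apply comp_proper; [reflexivity|]; apply fmor_proper.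
  rewrite fmor_comp; la; rw (symmetry (stens_natural (idm (R x)) (u one))).
  rw (stens_runit (R x)); rewrite fmor_id.
  rewrite <- (runit_natural (v x)), !comp_assoc, <- !tensm_comp; now idc.
Qed.

Lemma v_R (x : C) (w : C) (g : hom x (susp w)) :
  v (E w) \o fmor R (t w \o fmor E g) == fmor susp (iso_inv (u w)) \o g \o u x.
Proof.
  apply (iso_mono (i := fiso susp (u w))).
  change (fmor susp (u w) \o (v (E w) \o fmor R (t w \o fmor E g))
    == fmor susp (u w) \o (fmor susp (iso_inv (u w)) \o g \o u x)).
  rewrite fmor_comp; la; rw (v_u w); rewrite u_nat, <- (fmor_comp susp), (iso_invr (u w)), fmor_id.
  now idc.
Qed.

Lemma transfer_stens_assoc0 (x y z : D) :
  fmor susp (tr_assoc0 tt_mon u x y z) \o stens (R (E (R x ⊗ R y))) (R z)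
    \o ((v (E (R x ⊗ R y)) \o fmor R (t (R x ⊗ R y) \o fmor E (stens (R x) (R y) \o (v x ⊠ idm (R y)))))
         ⊠ idm (R z))
  == stens (R x) (R (E (R y ⊗ R z))) \o (v x ⊠ idm (R (E (R y ⊗ R z))))
      \o tr_assoc0 tt_mon u (susp x) y z.
Proof.
  rewrite v_R, !tr_assoc0E; unfold tr_tens; rewrite !tens_l_comp, !(fmor_comp susp); la.
  rw (stens_natural (iso_inv (u (R x ⊗ R y))) (idm (R z))).
  rw (symmetry (fmor_comp susp (u (R x ⊗ R y) ⊠ idm (R z)) (iso_inv (u (R x ⊗ R y)) ⊠ idm (R z)))).
  rewrite <- tens_l_comp, (iso_invr (u _)), tensm_id, fmor_id, comp_idr.
  rw (stens_assoc (R x) (R y) (R z)).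
  rw (assoc_natural (v x) (idm (R y)) (idm (R z))).
  rw (symmetry (stens_natural (idm (R x)) (iso_inv (u (R y ⊗ R z))))).
  rewrite fmor_id, tensm_id.
  rw (symmetry (tens_rl (v x) (iso_inv (u (R y ⊗ R z))))).
  now rw (symmetry (tens_lr (v x) (iso_inv (u (R y ⊗ R z))))).
Qed.

Lemma transfer_stens_assoc (x y z : D) :
  fmor susp (assoc x y z) \o transfer_stens (x ⊗ y) z \o (transfer_stens x y ⊠ idm z)
    == transfer_stens x (y ⊗ z) \o assoc (susp x) y z.
Proof.
  change (fmor susp (fmor E (tr_assoc0 tt_mon u x y z))
    \o (t (R (E (R x ⊗ R y)) ⊗ R z) \o fmor E (stens (R (E (R x ⊗ R y))) (R z)
       \o (v (E (R x ⊗ R y)) ⊠ idm (R z))))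
    \o fmor E (fmor R (t (R x ⊗ R y) \o fmor E (stens (R x) (R y) \o (v x ⊠ idm (R y)))) ⊠ fmor R (idm z))
    == t (R x ⊗ R (E (R y ⊗ R z))) \o fmor E (stens (R x) (R (E (R y ⊗ R z)))
      \o (v x ⊠ idm (R (E (R y ⊗ R z))))) \o fmor E (tr_assoc0 tt_mon u (susp x) y z)).
  la; refine (transitivity (comp_proper (comp_proper (symmetry (t_nat _)) (reflexivity _)) (reflexivity _)) _).
  rewrite !comp_assoc; apply comp_proper; [reflexivity|].
  refine (fmor_triangle2 E _); la.
  refine (transitivity _ (transfer_stens_assoc0 x y z)); rewrite comp_assoc.
  apply comp_proper; [reflexivity|].
  rewrite <- tensm_comp, fmor_id; now idc.
Qed.

(** Stated for a general [h]: an identity for tensored triangles, [u y] for the compatibility of [E]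
    itself. *)
Lemma transfer_compat (x : C) {a b : C} (h : hom a b) :
  t (x ⊗ b) \o fmor E (stens x b) \o fmor E (u (susp x) ⊠ h)
    == fmor susp (fmor E (u x ⊠ h)) \o
       (t (R (E x) ⊗ a) \o fmor E (stens (R (E x)) a \o (v (E x) ⊠ idm a)))
       \o fmor E (fmor R (t x) ⊠ idm a).
Proof.
  la; refine (transitivity _ (comp_proper (comp_proper (t_nat _) (reflexivity _)) (reflexivity _))).
  rewrite !comp_assoc; apply comp_proper; [reflexivity|].
  symmetry; refine (fmor_triangle2 E _); la.
  rewrite <- (stens_natural (u x) h), !comp_assoc; apply comp_proper; [reflexivity|].
  rewrite <- !tensm_comp, <- comp_assoc; rewrite v_u; now idc.
Qed.

(** A triangle of D is replaced by the image of one of C; tensoring that image with [w] is the image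
    of tensoring with [R w]. *)
Lemma transfer_dist n (X : ndiag (susp (C := D))) (w : D) : in_range o n -> dist n X ->
  dist n (nimage (F := tensor_right w) (fun x => transfer_stens x w) X).
Proof.
  intros Hn HX; destruct (lift_dist Hn HX) as [Y [HY I]].
  pose proof (E_dist Hn (stens_dist (R w) Hn HY)) as HYw.
  assert (J : nisomorphic n (nimage (F := tensor_right w) (fun x => transfer_stens x w)
      (nimage (fun x => t x) Y))
    (nimage (fun x => t x) (nimage (F := tensor_right (R w)) (fun x => stens x (R w)) Y))).
  { refine (nisomorphic_trans (nisomorphic_sym (nimage_nimage
      (F := E) (G := tensor_right w) (th'' := fun x => transfer_stens (E x) w \o fmor (tensor_right w) (t x)) _ n Y)) _);
      [intros; reflexivity|].
    refine (nisomorphic_trans _ (nimage_nimage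
      (F := tensor_right (R w)) (G := E) (th'' := fun x => t (x ⊗ R w) \o fmor E (stens x (R w))) _ n Y)); [|intros; reflexivity].
    unshelve refine (nimage_ext (a := @MkNatIso C D (functor_comp (tensor_right w) E)
      (functor_comp E (tensor_right (R w)))
      (fun x => fiso E (tens_iso (u x) (iso_id (R w)))) _) _ n Y).
    - intros x y f.
      change (fmor E (u y ⊠ idm (R w)) \o fmor E (fmor R (fmor E f) ⊠ fmor R (idm w))
        == fmor E (f ⊠ idm (R w)) \o fmor E (u x ⊠ idm (R w))).
      apply fmor_square; rewrite <- !tensm_comp, fmor_id, u_nat; now idc.
    - intros x; refine (transitivity (transfer_compat x (idm (R w))) _).
      rewrite comp_assoc; apply comp_proper; [reflexivity|]; apply comp_proper; [reflexivity|].
      exact (@fmor_proper _ _ E _ _ _ _ (tensm_proper (reflexivity _) (symmetry (fmor_id R w)))). }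
  assert (K := nisomorphic_trans (tensor_isomorphic (st := transfer_stens) transfer_stens_natural w I) J).
  exact (dist_iso Hn HYw (ntriangle_iso (dist_ntriangle Hn HYw) (nisomorphic_sym K)) (nisomorphic_sym K)).
Qed.

Lemma transfer_sign : braid (susp one) (susp one) == oppm (idm (susp one ⊗ susp one)).
Proof.
  pose proof (iso_comp (fiso susp (u one)) (v (E one))) as w.
  change (fmor E (braid (R (susp (E one))) (R (susp (E one))))
    == oppm (idm (E (R (susp (E one)) ⊗ R (susp (E one)))))).
  rewrite <- fmor_id, <- (fmor_opp E_add); apply fmor_proper.
  apply (iso_mono (i := tens_iso w w)); cbn.
  rewrite <- braid_natural, stens_sign, comp_oppl, comp_oppr; now idc.
Qed.

Definition transfer_tensor : TensorTri o D :=
  @Build_TensorTri o D tD transfer_mon transfer_stens transfer_stens_natural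
    transfer_stens_runit transfer_stens_assoc transfer_dist transfer_sign.

Definition transfer_functor : TTFunctor (tD := transfer_tensor) E.
Proof.
  refine (@Build_TTFunctor o C D tC transfer_tensor E
    (@Build_TriFunctor o C D _ tD E E_add
      (@MkNatIso C D (functor_comp E susp) (functor_comp susp E) t (fun x y f => t_nat f)) E_dist)
    (tr_functor tt_mon rho_nat u_nat E_u R_rho) _).
  intros x y.
  change (t (x ⊗ y) \o fmor E (stens x y) \o fmor E (u (susp x) ⊠ u y)
    == fmor susp (fmor E (u x ⊠ u y)) \o
       (t (R (E x) ⊗ R (E y)) \o fmor E (stens (R (E x)) (R (E y)) \o (v (E x) ⊠ idm (R (E y)))))
       \o fmor E (fmor R (t x) ⊠ fmor R (idm (E y)))).
  refine (transitivity (transfer_compat x (u y)) (comp_proper (reflexivity _) _)).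
  exact (@fmor_proper _ _ E _ _ _ _ (tensm_proper (reflexivity _) (symmetry (fmor_id R (E y))))).
Defined.
End TensorTransfer.

(** * The tensor product of modules *)

(** Morphisms between values of [Fr] need not come from T. Here they are matched with morphisms f0,
    g0 of S, for which the product of [J] is natural. *)
Lemma transport_square {T S D : Cat} {mT : SymMon T} {mS : SymMon S} {mD : SymMon D}
    {F : Functor T S} {J : Functor S D} {Fr : Functor T D} (mF : MonFunctor F)
    (mJ : MonFunctor J) (a : NatIso (functor_comp J F) Fr) (x x' y y' : T)
    (f : hom (Fr x) (Fr x')) (g : hom (Fr y) (Fr y')) (f0 : hom (F x) (F x'))
    (g0 : hom (F y) (F y')) (L : hom (Fr (x ⊗ y)) (Fr (x' ⊗ y'))) :
  a x' \o fmor J f0 == f \o a x -> a y' \o fmor J g0 == g \o a y ->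
  a (x' ⊗ y') \o fmor J (monf mF x' y' \o (f0 ⊠ g0) \o iso_inv (monf mF x y))
    == L \o a (x ⊗ y) ->
  monf (monfunctor_transport (monfunctor_comp mJ mF) a) x' y' \o (f ⊠ g)
    == L \o monf (monfunctor_transport (monfunctor_comp mJ mF) a) x y.
Proof.
  intros Ef Eg EL; rewrite !monfunctor_transportE.
  pose (a0 := fun z => a z : Iso (J (F z)) (Fr z)).
  change (a x' : Iso _ _) with (a0 x') in *; change (a x : Iso _ _) with (a0 x) in *.
  change (a y' : Iso _ _) with (a0 y') in *; change (a y : Iso _ _) with (a0 y) in *.
  change (a (x' ⊗ y')) with (a0 (x' ⊗ y')) in *; change (a (x ⊗ y)) with (a0 (x ⊗ y)) in *.
  change (monf (monfunctor_comp mJ mF) x y : hom _ _) with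
    (fmor J (monf mF x y) \o monf mJ (F x) (F y)).
  change (monf (monfunctor_comp mJ mF) x' y' : hom _ _) with
    (fmor J (monf mF x' y') \o monf mJ (F x') (F y')).
  clearbody a0.
  assert (Ef' : iso_inv (a0 x') \o f == fmor J f0 \o iso_inv (a0 x))
    by (apply iso_inv_square; exact Ef).
  assert (Eg' : iso_inv (a0 y') \o g == fmor J g0 \o iso_inv (a0 y))
    by (apply iso_inv_square; exact Eg).
  la; rw (symmetry EL); rewrite !fmor_comp; la.
  rw (tensm_split (iso_inv (a0 x')) f (iso_inv (a0 y')) g).
  rewrite Ef', Eg', tensm_comp; la.
  rw (symmetry (monf_natural mJ f0 g0)).
  rw (symmetry (fmor_comp J (iso_inv (monf mF x y)) (monf mF x y))).
  rewrite (iso_invl (monf mF x y)), fmor_id; now idc.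
Qed.

Lemma susp_transport_square {D : Cat} {Sg : Functor D D} {a a' k k' j j' : D}
    (thx : Iso a k) (ths : Iso a' k') (kx : Iso j k) (ks : Iso j' k')
    (fs : hom a' (Sg a)) (c : hom j' (Sg j)) (gm : hom k' (Sg k)) :
  gm \o ths == fmor Sg thx \o fs -> gm \o ks == fmor Sg kx \o c ->
  fmor Sg (iso_comp (iso_sym thx) kx) \o c \o iso_inv (iso_comp (iso_sym ths) ks) == fs.
Proof.
  intros H1 H2; cbn; rewrite fmor_comp; la.
  rw (symmetry H2); rw (iso_invr ks); idc.
  rw H1; rw (symmetry (fmor_comp Sg (iso_inv thx) thx)).
  rewrite (iso_invl thx), fmor_id; now idc.
Qed.

(** * The transported structure and the free functor *)

Section KarTransfer.
Context {o : tri_order} (ho : valid_order o) {C D : Cat} (tC : TensorTri o C)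
  (tD : Tri o D) (hD : idempotent_complete D) {U : Functor C D} (tU : TriFunctor U)
  (fU : full U) (hU : faithful U) (dU : dist_dense tU) (rU : retracts_onto U).
Notation KC := (idempotent_completion C).
Notation I := (to_completion C).
Notation E := (kar_ext hD U).
Notation Ks := (kar_map (susp (C := C))).
Notation fE := (kar_ext_full (hD := hD) fU hU).
Notation hE := (kar_ext_faithful (hD := hD) hU).
Notation eE := (kar_ext_ess_surj hD fU hU rU).
Notation sI := (kar_susp_nat hD (t := fun x => trif_susp tU x) (trif_is_natural tU)).

Notation KTri := (kar_tri hD tU fU hU rU).
Notation KTen := (kar_tensor ho hD fU hU dU rU).
Notation R := (qinv fE hE eE).
Notation kt x := (kar_susp_iso hD (t := fun z => trif_susp tU z) (trif_is_natural tU) x).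

Lemma kar_rho_nat (d d' : D) (f : hom d d') :
  qinv_iso eE d' \o fmor E (fmor R f) == f \o qinv_iso eE d.
Proof. rewrite fmor_qinv; la; rewrite (iso_invr (qinv_iso eE d')); now idc. Qed.

Lemma kar_R_rho (d : D) : fmor R (qinv_iso eE d) == qinv_unit fE hE eE (R d).
Proof.
  apply hE; rewrite fmor_qinv_unit; apply (iso_mono (i := qinv_iso eE d)), kar_rho_nat.
Qed.

Lemma kar_t_nat (x y : KC) (f : hom x y) :
  kt y \o fmor E (fmor Ks f) == fmor susp (fmor E f) \o kt x.
Proof. exact (kar_susp_natural hD (t := fun x => trif_susp tU x) (trif_is_natural tU) f). Qed.

Lemma kar_lift_dist n (X : ndiag (susp (C := D))) : in_range o n -> dist n X ->
  exists Y, dist (Tri := KTri) n Y /\ nisomorphic n X (nimage (F := E) (fun x => kt x) Y).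
Proof.
  intros Hn HX.
  pose proof (nisomorphic_sym (nlift_isomorphic fE hE eE sI n X)) as J.
  exists (nlift fE hE eE sI X); split; [|exact J].
  exact (dist_iso Hn HX (ntriangle_iso (dist_ntriangle Hn HX) J) J).
Qed.

Lemma kar_E_additive : is_additive_functor (aC := tri_add (Tri := KTri)) E.
Proof. exact (pb_additive tD fE hE). Qed.

Lemma kar_E_dist n (X : ndiag Ks) : in_range o n -> dist (Tri := KTri) n X ->
  dist n (nimage (F := E) (fun x => kt x) X).
Proof. intros _; exact (@tri_equiv_dist o KC D tD E fE hE eE Ks sI n X). Qed.

Definition kar_transfer : TensorTri o D :=
  transfer_tensor (tC := KTen) (tD := tD) (E := E) fE hE (R := R) (rho := qinv_iso eE)
    (u := qinv_unit fE hE eE) kar_rho_nat (fun x x' f => qinv_unit_natural fE hE eE f)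
    (fun x => fmor_qinv_unit fE hE eE x) kar_R_rho kar_E_additive (t := fun x => kt x)
    kar_t_nat kar_E_dist kar_lift_dist.

Definition kar_transfer_functor : TTFunctor (tC := KTen) (tD := kar_transfer) E :=
  transfer_functor (tC := KTen) (tD := tD) (E := E) fE hE (R := R) (rho := qinv_iso eE)
    (u := qinv_unit fE hE eE) kar_rho_nat (fun x x' f => qinv_unit_natural fE hE eE f)
    (fun x => fmor_qinv_unit fE hE eE x) kar_R_rho kar_E_additive (t := fun x => kt x)
    kar_t_nat kar_E_dist kar_lift_dist.

Definition kar_transfer_comp {B : Cat} {tB : TensorTri o B} {q : Functor B C} (tq : TTFunctor q) :
  TTFunctor (tD := kar_transfer) (functor_comp E (functor_comp I q)) :=
  ttfunctor_comp kar_transfer_functor (ttfunctor_comp (to_completion_tt ho hD fU hU dU rU) tq).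

Lemma kar_transfer_comp_susp {B : Cat} {tB : TensorTri o B} {q : Functor B C} (tq : TTFunctor q) (x : B) :
  trif_susp tU (q x) \o fmor U (trif_susp tq x) \o kar_ext_unit hD U (q (susp x))
  == fmor susp (kar_ext_unit hD U (q x)) \o
     trif_susp (kar_transfer_comp tq) x.
Proof.
  pose (ku := fun y : C => kar_ext_unit hD U y : Iso (E (to_completion C y)) (U y)).
  pose (ts := fun y : C => to_kar_susp (Sg := susp) y : Iso (to_completion C (susp y)) (Ks (to_completion C y))).
  pose (tu := fun y : C => trif_susp tU y : Iso (U (susp y)) (susp (U y))).
  pose (tqx := trif_susp tq x : hom (q (susp x)) (susp (q x))).
  change (tu (q x) \o fmor U tqx \o ku (q (susp x))
    == fmor susp (ku (q x)) \o (kt (I (q x)) \o fmor E (ts (q x) \o fmor I tqx))).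
  assert (N : ku (susp (q x)) \o fmor E (fmor I tqx) == fmor U tqx \o ku (q (susp x)))
    by exact (nat_iso_natural (kar_ext_unit hD U) tqx).
  assert (M : tu (q x) \o ku (susp (q x)) == fmor susp (ku (q x)) \o (kt (I (q x)) \o fmor E (ts (q x))))
    by exact (kar_susp_unit hD (t := fun x => trif_susp tU x) (trif_is_natural tU) (q x)).
  rewrite comp_assoc, <- N, fmor_comp; la; rewrite M; now la.
Qed.

Context {T B : Cat} {tT : TensorTri o T} {tB : TensorTri o B} {F : Functor T B} (tF : TTFunctor F)
  {q : Functor B C} (tq : TTFunctor q) {K : Functor B D} (lam : NatIso (functor_comp U q) K)
  {Fr : Functor T D} (th : NatIso Fr (functor_comp K F)).
Notation J := (functor_comp E (functor_comp I q)).
Let lam0 (x : B) : Iso (U (q x)) (K x) := lam x.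
Let th0 (x : T) : Iso (Fr x) (K (F x)) := th x.
Let ku (y : C) : Iso (E (I y)) (U y) := kar_ext_unit hD U y.

Definition kar_kappa : NatIso J K.
Proof.
  refine (@MkNatIso B D J K (fun x => iso_comp (lam0 x) (ku (q x))) _).
  intros x y f.
  change (lam0 y \o ku (q y) \o fmor E (fmor I (fmor q f)) == fmor K f \o (lam0 x \o ku (q x))).
  assert (N : ku (q y) \o fmor E (fmor I (fmor q f)) == fmor U (fmor q f) \o ku (q x))
    by exact (nat_iso_natural (kar_ext_unit hD U) (fmor q f)).
  assert (M : lam0 y \o fmor U (fmor q f) == fmor K f \o lam0 x)
    by exact (nat_iso_natural lam f).
  rewrite comp_assoc, N; la; now rewrite M.
Defined.
Let kp (x : B) : Iso (E (I (q x))) (K x) := kar_kappa x.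

Definition kar_alpha : NatIso (functor_comp J F) Fr.
Proof.
  refine (@MkNatIso T D (functor_comp J F) Fr
    (fun x => iso_comp (iso_sym (th0 x)) (kp (F x))) _).
  intros x y f.
  change (iso_inv (th0 y) \o kp (F y) \o fmor J (fmor F f)
    == fmor Fr f \o (iso_inv (th0 x) \o kp (F x))).
  rewrite comp_assoc, (nat_iso_natural kar_kappa (fmor F f) : kp _ \o _ == _ \o kp _); la.
  apply comp_proper; [|reflexivity].
  exact (iso_inv_square (nat_iso_natural th f)).
Defined.

(** [Fr], later the free module functor, becomes tensor-triangulated as an isomorphic copy of [J]
    after [F]. Its structure maps are identified afterwards, by [kar_free_susp] and
    [kar_free_monf]. *)
Definition kar_free : TTFunctor (tD := kar_transfer) Fr :=
  ttfunctor_transport (ttfunctor_comp (kar_transfer_comp tq) tF) kar_alpha.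

Lemma kar_kappa_susp (gK : forall x : B, hom (K (susp x)) (susp (K x))) :
  (forall x, gK x \o lam (susp x)
     == fmor susp (lam x) \o (trif_susp tU (q x) \o fmor U (trif_susp tq x))) ->
  forall x, gK x \o kar_kappa (susp x)
     == fmor susp (kar_kappa x) \o trif_susp (kar_transfer_comp tq) x.
Proof.
  intros H1 x.
  pose (j := trif_susp (kar_transfer_comp tq) x : hom (E (I (q (susp x)))) (susp (E (I (q x))))).
  pose (tu := trif_susp tU (q x) : hom (U (susp (q x))) (susp (U (q x)))).
  pose (tqx := trif_susp tq x : hom (q (susp x)) (susp (q x))).
  assert (M : tu \o fmor U tqx \o ku (q (susp x)) == fmor susp (ku (q x)) \o j)
    by exact (kar_transfer_comp_susp tq x).
  assert (L : gK x \o lam0 (susp x) == fmor susp (lam0 x) \o (tu \o fmor U tqx))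
    by exact (H1 x).
  change (gK x \o (lam0 (susp x) \o ku (q (susp x)))
    == fmor susp (lam0 x \o ku (q x)) \o j).
  rewrite fmor_comp; la; rewrite L; la; rw M; reflexivity.
Qed.

Lemma kar_free_susp (gK : forall x : B, hom (K (susp x)) (susp (K x)))
    (fs : forall x : T, hom (Fr (susp x)) (susp (Fr x))) :
  (forall x, gK x \o lam (susp x)
     == fmor susp (lam x) \o (trif_susp tU (q x) \o fmor U (trif_susp tq x))) ->
  (forall x, gK (F x) \o fmor K (trif_susp tF x) \o th (susp x) == fmor susp (th x) \o fs x) ->
  forall x, trif_susp kar_free x == fs x.
Proof.
  intros H1 H2 x.
  refine (transitivity (ttfunctor_transport_susp (ttfunctor_comp (kar_transfer_comp tq) tF) kar_alpha x) _).
  refine (susp_transport_square (thx := th0 x) (ths := th0 (susp x)) (kx := kp (F x))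
    (ks := kp (F (susp x))) (gm := gK (F x) \o fmor K (trif_susp tF x)) (H2 x) _).
  pose (j := trif_susp (kar_transfer_comp tq) (F x) : hom (E (I (q (susp (F x))))) (susp (E (I (q (F x)))))).
  pose (f := trif_susp tF x : hom (F (susp x)) (susp (F x))).
  change (gK (F x) \o fmor K f \o kp (F (susp x)) == fmor susp (kp (F x)) \o (j \o fmor J f)).
  assert (N : kp (susp (F x)) \o fmor J f == fmor K f \o kp (F (susp x)))
    by exact (nat_iso_natural kar_kappa f).
  assert (M : gK (F x) \o kp (susp (F x)) == fmor susp (kp (F x)) \o j)
    by exact (kar_kappa_susp H1 (F x)).
  rewrite comp_assoc, <- N; la; now rewrite M.
Qed.

Lemma kar_free_monf {x x' y y' : T} (f : hom (Fr x) (Fr x')) (g : hom (Fr y) (Fr y'))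
    (f0 : hom (F x) (F x')) (g0 : hom (F y) (F y')) (L : hom (Fr (x ⊗ y)) (Fr (x' ⊗ y'))) :
  fmor K f0 \o th x == th x' \o f -> fmor K g0 \o th y == th y' \o g ->
  fmor K (monf tF x' y' \o (f0 ⊠ g0) \o iso_inv (monf tF x y)) \o th (x ⊗ y)
    == th (x' ⊗ y') \o L ->
  monf kar_free x' y' \o tensm (SymMon := tt_mon (TensorTri := kar_transfer)) f g
    == L \o monf kar_free x y.
Proof.
  assert (P : forall z z' (h : hom (Fr z) (Fr z')) (h0 : hom (F z) (F z')),
    fmor K h0 \o th z == th z' \o h -> kar_alpha z' \o fmor J h0 == h \o kar_alpha z).
  { intros z z' h h0 H.
    change (iso_inv (th0 z') \o kp (F z') \o fmor J h0 == h \o (iso_inv (th0 z) \o kp (F z))).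
    rewrite comp_assoc, (nat_iso_natural kar_kappa h0 : kp _ \o _ == _ \o kp _); la.
    apply comp_proper; [|reflexivity].
    apply (iso_inv_square (a := th0 z) (b := th0 z')); symmetry; exact H. }
  intros Hf Hg HL.
  apply (transport_square (mF := tF) (kar_transfer_comp tq : MonFunctor _)
    (a := kar_alpha) (f0 := f0) (g0 := g0)).
  - exact (P _ _ _ _ Hf).
  - exact (P _ _ _ _ Hg).
  - exact (P _ _ _ _ HL).
Qed.
End KarTransfer.

(** * The structures on the completion and on modules *)

Section Quotient.
Context {o : tri_order} (ho : valid_order o) {T S : Cat} {tT : TensorTri o T}
  {tS : TensorTri o S} (hT : idempotent_complete T)
  {F : Functor T S} (tF : TTFunctor F) {G : Functor S T}
  (adj : Adjunction F G) (hadd : tens_additive (C := T) tt_mon)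
  (hker : kernel_tensor_closed G)
  (hproj : right_projection_formula tF adj)
  (s : hom (unit_algebra tF adj) (unit_algebra tF adj ⊗ unit_algebra tF adj))
  (s1 : amul (unit_algebra tF adj) \o s == idm (acar (unit_algebra tF adj)))
  (s2 : (idm (acar (unit_algebra tF adj)) ⊠ amul (unit_algebra tF adj))
     \o assoc (unit_algebra tF adj) (unit_algebra tF adj) (unit_algebra tF adj)
     \o (s ⊠ idm (acar (unit_algebra tF adj))) == s \o amul (unit_algebra tF adj))
  (s3 : (amul (unit_algebra tF adj) ⊠ idm (acar (unit_algebra tF adj)))
     \o iso_inv (assoc (unit_algebra tF adj) (unit_algebra tF adj) (unit_algebra tF adj))
     \o (idm (acar (unit_algebra tF adj)) ⊠ s)
          == s \o amul (unit_algebra tF adj)).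
Notation A := (unit_algebra tF adj).
Notation K := (comparison tF adj).
Notation D := (module_cat A).
Notation Q := (verdier_quotient (o := o) G).
Notation q := (quotient_functor (o := o) G).
Notation KB := (Kbar ho tF adj).
Notation DTri := (module_tri_structure ho hT hadd hproj s1 s2 s3).
Notation Kfull := (Kbar_full (ho := ho) hproj s1 s2 s3).
Notation Kfaith := (Kbar_faithful (ho := ho) hproj s1 s2 s3).
Notation Qs := (Qsusp ho tF adj).
Notation Qnat := (Qsusp_nat ho tF adj).
Notation qim X := (nimage (Sg' := Qs) (F := q) (fun x => idm _) X).
Notation QTri := (Qtri ho hT hadd hproj s1 s2 s3).
Notation QTen := (Qtensor ho hT hadd hker hproj s1 s2 s3).
Notation Sg := (module_susp A).
Notation und X := (nimage (F := forget A) (fun M => forget_susp A M) X).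
Notation freed X := (nimage (F := free A) (fun x => free_susp A x) X).

(** The separability section and the action are natural and commute with suspension, so they are
    morphisms of diagrams. *)
Lemma free_retract n (X : ndiag Sg) : nretract n X (freed (und X)).
Proof.
  exists (fun i j => sec_mor s2 s3 (nob X i j)), (fun i j => act_mor (nob X i j)).
  split; [|split]; [split; intros| split; intros | intros; apply (act_mor_section s1 s2 s3)].
  - exact (section_mor_natural s2 s3 (ntr X i j i' j')).
  - change (stens_r A (mcar (nob X i j)) \o (idm (acar A) ⊠ (idm _ \o mhom (nbd X i j k)))
      \o section_hom s (nob X j k) == fmor susp (section_hom s (nob X i j)) \o mhom (nbd X i j k)).
    rewrite comp_idl; rewrite comp_assoc, (section_natural s (nbd X i j k)).
    rewrite <- comp_assoc; apply comp_proper; [|reflexivity].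
    apply section_susp.
  - exact (act_mor_natural (ntr X i j i' j')).
  - refine (transitivity (comp_proper (reflexivity (mhom (nbd X i j k))) (act_morE (nob X j k))) _).
    refine (transitivity _ (comp_proper (@fmor_proper _ _ susp _ _ _ _
      (symmetry (act_morE (nob X i j)))) (reflexivity _))).
    change (mhom (nbd X i j k) \o mact (nob X j k) == fmor susp (mact (nob X i j))
      \o (stens_r A (mcar (nob X i j)) \o (idm (acar A) ⊠ (idm _ \o mhom (nbd X i j k))))).
    rewrite comp_idl, mhom_linear; cbn; now la.
Qed.

Definition theta_nat : NatIso (free A) (functor_comp K F).
Proof.
  refine (@MkNatIso T D (free A) (functor_comp K F)
    (fun t => iso_of (theta_is_iso (mF := tF) (adj := adj) t hproj)) _).
  intros x y f; exact (theta_natural tF adj f).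
Defined.

Lemma theta_susp_module (x : T) :
  gammaK tF adj (F x) \o fmor K (trif_susp tF x) \o theta_nat (susp x)
  == fmor Sg (theta_nat x) \o free_susp A x.
Proof.
  refine (transitivity _ (theta_susp tF adj x)).
  refine (comp_proper (comp_proper (gammaK_gamma tF adj (F x)) (reflexivity _)) (reflexivity _)).
Qed.

(** By [free_retract] it is enough to treat the free modules on a diagram of T, and [theta]
    identifies these with its image under K F. *)
Lemma comparison_dense n (X : ndiag Sg) :
  nretract n X (nimage (F := K) (fun x => gammaK tF adj x)
    (nimage (F := F) (fun x => trif_susp tF x) (und X))).
Proof.
  refine (nretract_trans (free_retract n X) (nisomorphic_retract _)).
  refine (nisomorphic_trans _ (nimage_nimage (aD := module_preadd hadd A) (F := F) (G := K)
    (th'' := fun x => gammaK tF adj (F x) \o fmor K (trif_susp tF x)) _ n (und X))).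
  - apply (nimage_ext (aD := module_preadd hadd A) (a := theta_nat)).
    exact theta_susp_module.
  - intros x; reflexivity.
Qed.

Definition Kbar_tri : TriFunctor (tC := QTri) (tD := DTri) KB.
Proof.
  exact (@Build_TriFunctor o Q D QTri DTri KB (pb_additive DTri Kfull Kfaith) Qnat
    (fun n X _ HX => HX)).
Defined.

Lemma qim_isomorphic n (Y : ndiag (susp (C := S))) :
  nisomorphic n (nimage (F := K) (fun x => gammaK tF adj x) Y)
    (nimage (F := KB) (fun x => Qnat x) (qim Y)).
Proof.
  apply (@nisomorphic_ext D (module_preadd hadd A) (module_susp A) n
     (fun i j => K (nob Y i j)) (fun i j i' j' => fmor K (ntr Y i j i' j')));
   [reflexivity | intros i j k _ _].
  assert (E : fmor KB (idm (Qs (nob Y i j)) \o fmor q (nbd Y i j k)) == fmor K (nbd Y i j k))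
    by (rewrite comp_idl; reflexivity).
  exact (comp_proper (reflexivity (gammaK tF adj (nob Y i j) : hom (c := D) _ _)) (symmetry E)).
Qed.

Lemma und_dist n (X : ndiag Sg) : dist (Tri := DTri) n X -> dist n (und X).
Proof. intros HX; exact HX. Qed.

Lemma Kbar_dense : dist_dense Kbar_tri.
Proof.
  intros n X Hn HX.
  exists (qim (nimage (F := F) (fun x => trif_susp tF x) (und X))); split.
  - exact (qim_dist ho hT hadd hproj s1 s2 s3 Hn (trif_dist tF Hn (und_dist HX))).
  - exact (nretract_trans (comparison_dense n X) (nisomorphic_retract (qim_isomorphic n _))).
Qed.

Lemma Kbar_retracts : retracts_onto KB.
Proof.
  intros M; exists (F (mcar M)), (free_out hproj M), (free_in s2 s3 M).
  apply (free_out_in hproj s1 s2 s3).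
Qed.

Notation hD := (module_idempotent_complete hT (A := A)).

Definition KQtensor : TensorTri o (idempotent_completion Q) :=
  kar_tensor (tC := QTen) (tD := DTri) ho hD (tU := Kbar_tri) Kfull Kfaith Kbar_dense Kbar_retracts.

Lemma KQ_structure : is_completion_structure QTen KQtensor.
Proof.
  exact (completion_structure (tC := QTen) (tD := DTri) ho hD (tU := Kbar_tri)
    Kfull Kfaith Kbar_dense Kbar_retracts).
Qed.

Notation E := (kar_ext hD KB).

Definition Dtensor : TensorTri o D :=
  kar_transfer (tC := QTen) (tD := DTri) ho hD (tU := Kbar_tri) Kfull Kfaith Kbar_dense Kbar_retracts.

Definition E_tt : TTFunctor (tC := KQtensor) (tD := Dtensor) E :=
  kar_transfer_functor (tC := QTen) (tD := DTri) ho hD (tU := Kbar_tri) Kfull Kfaith Kbar_dense Kbar_retracts.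

Lemma E_equivalence : is_equivalence E.
Proof.
  apply ff_equivalence.
  - exact (kar_ext_full (hD := hD) Kfull Kfaith).
  - exact (kar_ext_faithful (hD := hD) Kfaith).
  - exact (kar_ext_ess_surj hD Kfull Kfaith Kbar_retracts).
Qed.

Notation q_tt := (tq ho hT hadd hker hproj s1 s2 s3).
Notation J := (functor_comp E (functor_comp (to_completion Q) q)).

Definition Kbar_q : NatIso (functor_comp KB q) K.
Proof.
  refine (@MkNatIso S D (functor_comp KB q) K (fun x => iso_id (K x)) _).
  intros x y f; exact (transitivity (comp_idl (fmor K f)) (symmetry (comp_idr (fmor K f)))).
Defined.

Definition kappa : NatIso J K := kar_kappa hD Kbar_q.

Definition free_tt : TTFunctor (tC := tT) (tD := Dtensor) (free A) :=
  kar_free (tC := QTen) (tD := DTri) ho hD (tU := Kbar_tri) Kfull Kfaith Kbar_dense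
    Kbar_retracts tF q_tt Kbar_q theta_nat.

Lemma forget_dist n (X : ndiag Sg) : dist (Tri := DTri) n X ->
  dist n (nimage (F := forget A) (fun M => forget_susp A M) X).
Proof. intros HX; exact HX. Qed.

Definition forget_tri : TriFunctor (tC := DTri) (forget A) :=
  @Build_TriFunctor o D T DTri tt_tri (forget A)
    (forget_additive hadd (A := A)) (forget_susp A) (fun n X _ => @forget_dist n X).

Lemma Kbar_q_susp (x : S) :
  (gammaK tF adj x : hom (c := D) _ _) \o Kbar_q (susp x)
  == fmor (susp (Tri := DTri)) (Kbar_q x)
     \o (trif_susp Kbar_tri (q x) \o fmor KB (trif_susp q_tt x)).
Proof.
  refine (transitivity (comp_idr (gammaK tF adj x : hom (c := D) _ _)) _).
  refine (transitivity _ (comp_proper (symmetry (fmor_id Sg (K x))) (reflexivity _))).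
  refine (transitivity _ (symmetry (comp_idl _))).
  refine (transitivity _ (comp_proper (reflexivity _) (symmetry (fmor_id KB (q (susp x)))))).
  exact (symmetry (comp_idr (gammaK tF adj x : hom (c := D) _ _))).
Qed.

Lemma free_tt_susp (x : T) : trif_susp free_tt x == free_susp A x.
Proof.
  exact (kar_free_susp (tC := QTen) (tD := DTri) ho hD (tU := Kbar_tri) Kfull Kfaith
    Kbar_dense Kbar_retracts (tF := tF) (tq := q_tt) (lam := Kbar_q) (th := theta_nat)
    (gK := fun x => gammaK tF adj x) (fs := fun x => free_susp A x) Kbar_q_susp
    theta_susp_module x).
Qed.

Definition J_tt : TTFunctor (tC := tS) (tD := Dtensor) J :=
  kar_transfer_comp (tC := QTen) (tD := DTri) ho hD (tU := Kbar_tri) Kfull Kfaith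
    Kbar_dense Kbar_retracts q_tt.

Lemma J_susp (x : S) : (gammaK tF adj x : hom (c := D) _ _) \o kappa (susp x)
  == fmor (susp (Tri := DTri)) (kappa x) \o trif_susp J_tt x.
Proof.
  exact (kar_kappa_susp (tC := QTen) (tD := DTri) ho hD (tU := Kbar_tri) Kfull Kfaith
    Kbar_dense Kbar_retracts (tq := q_tt) (lam := Kbar_q)
    (gK := fun x => gammaK tF adj x) Kbar_q_susp x).
Qed.

End Quotient.

(** The structure maps enter only through their values up to [==], so that the transported structure
    is not unfolded when the clauses of [is_module_structure] are checked. *)
Lemma module_structure_intro {o : tri_order} {T : Cat} {tT : TensorTri o T} (A : Algebra T)
    (tM : TensorTri o (module_cat A)) (tU : TriFunctor (forget A)) (tF : TTFunctor (free A))
    (e : forall M : Module A, hom (mcar (susp (M : module_cat A))) (susp (mcar M)))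
    (fs : forall x : T, hom (free A (susp x)) (susp (free A x : module_cat A)))
    (L : forall x x' y y' : T, hom (free A x) (free A x') -> hom (free A y) (free A y') ->
       hom (free A (x ⊗ y)) (free A (x' ⊗ y'))) :
  (forall M, trif_susp tU M == e M) ->
  (forall M, e M \o mact (susp (M : module_cat A))
     == fmor susp (mact M) \o stens_r (acar A) (mcar M) \o (idm (acar A) ⊠ e M)) ->
  (forall n (X : ndiag susp), in_range o n ->
     (dist n X <-> dist n (nimage (F := forget A) (fun M => trif_susp tU M) X))) ->
  (forall x, trif_susp tF x == fs x) ->
  (forall x, e (free_module A x) \o mhom (fs x) == stens_r (acar A) x) ->
  (forall x x' y y' f g, mhom (L x x' y y' f g) == kleisli_tens f g) ->
  (forall x x' y y' f g, monf tF x' y' \o (f ⊠ g) == L x x' y y' f g \o monf tF x y) ->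
  is_module_structure tM.
Proof.
  intros H1 H2 H3 H4 H5 H6 H7; exists tU, tF; split; [|split; [exact H3|split]].
  - intros M; refine (transitivity (comp_proper (H1 M) (reflexivity _)) (transitivity (H2 M) _)).
    exact (comp_proper (reflexivity _) (tensm_proper (reflexivity _) (symmetry (H1 M)))).
  - intros x; exact (transitivity (comp_proper (H1 _) (@fmor_proper _ _ (forget A) _ _ _ _ (H4 x))) (H5 x)).
  - intros x x' y y' f g.
    refine (transitivity (@fmor_proper _ _ (forget A) _ _ _ _ (H7 _ _ _ _ f g)) _).
    exact (comp_proper (H6 _ _ _ _ f g) (reflexivity _)).
Qed.

Section Quotient.
Context {o : tri_order} (ho : valid_order o) {T S : Cat} {tT : TensorTri o T}
  {tS : TensorTri o S} (hT : idempotent_complete T)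
  {F : Functor T S} (tF : TTFunctor F) {G : Functor S T}
  (adj : Adjunction F G) (hadd : tens_additive (C := T) tt_mon)
  (hker : kernel_tensor_closed G)
  (hproj : right_projection_formula tF adj)
  (s : hom (unit_algebra tF adj) (unit_algebra tF adj ⊗ unit_algebra tF adj))
  (s1 : amul (unit_algebra tF adj) \o s == idm (acar (unit_algebra tF adj)))
  (s2 : (idm (acar (unit_algebra tF adj)) ⊠ amul (unit_algebra tF adj))
     \o assoc (unit_algebra tF adj) (unit_algebra tF adj) (unit_algebra tF adj)
     \o (s ⊠ idm (acar (unit_algebra tF adj))) == s \o amul (unit_algebra tF adj))
  (s3 : (amul (unit_algebra tF adj) ⊠ idm (acar (unit_algebra tF adj)))
     \o iso_inv (assoc (unit_algebra tF adj) (unit_algebra tF adj) (unit_algebra tF adj))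
     \o (idm (acar (unit_algebra tF adj)) ⊠ s)
          == s \o amul (unit_algebra tF adj)).
Notation A := (unit_algebra tF adj).
Notation K := (comparison tF adj).
Notation D := (module_cat A).
Notation DTri := (module_tri_structure ho hT hadd hproj s1 s2 s3).
Notation Kfull := (Kbar_full (ho := ho) hproj s1 s2 s3).
Notation Kfaith := (Kbar_faithful (ho := ho) hproj s1 s2 s3).

Notation hD := (module_idempotent_complete hT (A := A)).
Notation QTen := (Qtensor ho hT hadd hker hproj s1 s2 s3).
Notation DTen := (Dtensor ho hT hadd hker hproj s1 s2 s3).
Notation eta := (unit_adj adj).
Notation eps := (counit_adj adj).
Notation th x := (theta_nat hproj x).
Notation Kt := (Kbar_tri ho hT hadd hproj s1 s2 s3).

Definition kleisli_mor {x x' y y' : T} (f : hom (free A x) (free A x'))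
    (g : hom (free A y) (free A y')) : hom (free A (x ⊗ y)) (free A (x' ⊗ y')) :=
  free_lin (A := A) (N := free_module A (x' ⊗ y'))
    ((amul A ⊠ idm (x' ⊗ y')) \o swap_middle (acar A) x' (acar A) y' \o (kleisli f ⊠ kleisli g)).

Lemma kleisli_theta {x x' : T} (f : hom (free A x) (free A x')) (f0 : hom (F x) (F x')) :
  fmor K f0 \o theta tF adj x == theta tF adj x' \o f ->
  theta_mor tF adj x' \o kleisli f == fmor G f0 \o eta x.
Proof.
  intros H; unfold kleisli; la.
  rewrite <- (theta_unit tF adj x); unfold free_unit; la.
  apply comp_proper; [|reflexivity]; apply comp_proper; [|reflexivity].
  symmetry; exact H.
Qed.

(** Linear maps out of a free module are compared on generators. There [theta_swap] turns the
    multiplication of A into the lax structure of G, whose naturality produces the product of f0 and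
    g0. *)
Lemma kleisli_comparison {x x' y y' : T} (f : hom (free A x) (free A x'))
    (g : hom (free A y) (free A y')) (f0 : hom (F x) (F x')) (g0 : hom (F y) (F y')) :
  fmor K f0 \o theta tF adj x == theta tF adj x' \o f ->
  fmor K g0 \o theta tF adj y == theta tF adj y' \o g ->
  fmor K (monf tF x' y' \o (f0 ⊠ g0) \o iso_inv (monf tF x y)) \o theta tF adj (x ⊗ y)
    == theta tF adj (x' ⊗ y') \o kleisli_mor f g.
Proof.
  intros Hf Hg; apply kleisli_theta in Hf; apply kleisli_theta in Hg.
  apply (@free_lin_ext T tt_mon A (x ⊗ y) (comparison_module tF adj (F (x' ⊗ y')))
    (fmor K (monf tF x' y' \o (f0 ⊠ g0) \o iso_inv (monf tF x y)) \o theta tF adj (x ⊗ y)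
      : hom (c := D) _ _)
    (theta tF adj (x' ⊗ y') \o kleisli_mor f g : hom (c := D) _ _)).
  change (fmor G (monf tF x' y' \o (f0 ⊠ g0) \o iso_inv (monf tF x y))
      \o mhom (theta tF adj (x ⊗ y)) \o free_unit (A := A) (x ⊗ y)
    == theta_mor tF adj (x' ⊗ y') \o mhom (kleisli_mor f g) \o free_unit (A := A) (x ⊗ y)).
  assert (U : mhom (kleisli_mor f g) \o free_unit (A := A) (x ⊗ y)
    == (amul A ⊠ idm (x' ⊗ y')) \o swap_middle (acar A) x' (acar A) y' \o (kleisli f ⊠ kleisli g))
    by apply (@free_lin_unit T tt_mon A).
  rewrite (comp_assoc _ (mhom (kleisli_mor f g))), U, comp_assoc, theta_unit; la.
  rewrite (theta_swap tF adj x' y').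
  rw (tensm_split (theta_mor tF adj x') (kleisli f) (theta_mor tF adj y') (kleisli g)).
  rewrite Hf, Hg, tensm_comp; la.
  rw (lax_natural tF adj f0 g0); rw (lax_unit tF adj x y).
  rewrite !fmor_comp; now la.
Qed.

Lemma comparison_lift {x x' : T} (f : hom (free A x) (free A x')) :
  exists f0 : hom (F x) (F x'), fmor K f0 \o theta tF adj x == theta tF adj x' \o f.
Proof.
  pose proof (comparison_full_free (mF := tF) (adj := adj)
    (theta tF adj x' \o f \o iso_inv (th x)) hproj) as H.
  set (f0 := eps (F x') \o _) in H; exists f0.
  refine (transitivity (comp_proper H (reflexivity (theta tF adj x))) _).
  refine (transitivity (comp_assoc _ _ _) (transitivity (comp_proper (reflexivity _)
    (iso_invl (th x))) (comp_idr _))).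
Qed.

Notation freeT := (free_tt ho hT hadd hker hproj s1 s2 s3).
Definition forget_tt : TriFunctor (tC := tt_tri (TensorTri := DTen)) (forget A) :=
  forget_tri ho hT hadd hproj s1 s2 s3.

(** Morphisms of free modules need not come from T, but under [theta] they come from S, where their
    product can be formed before it is compared with the Kleisli one. *)
Lemma free_tt_monf {x x' y y' : T} (f : hom (free A x) (free A x'))
    (g : hom (free A y) (free A y')) :
  monf freeT x' y' \o tensm (SymMon := tt_mon (TensorTri := DTen)) f g
  == kleisli_mor f g \o monf freeT x y.
Proof.
  destruct (comparison_lift f) as [f0 Hf], (comparison_lift g) as [g0 Hg].
  exact (kar_free_monf (tC := QTen) (tD := DTri) ho hD (tU := Kt) Kfull Kfaith
    (@Kbar_dense _ ho _ _ _ _ hT _ _ _ _ hadd hproj _ s1 s2 s3) (Kbar_retracts ho hproj s1 s2 s3)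
    (tF := tF) (tq ho hT hadd hker hproj s1 s2 s3) (Kbar_q ho tF adj)
    (th := theta_nat hproj) Hf Hg (kleisli_comparison Hf Hg)).
Qed.

Lemma module_structure : is_module_structure DTen.
Proof.
  refine (@module_structure_intro o T tT A DTen forget_tt freeT (fun M => idm (susp (mcar M)))
    (fun x => free_susp A x) (fun x x' y y' f g => kleisli_mor f g) _ _ _ _ _ _ _).
  - intros M; reflexivity.
  - intros M; rewrite tensm_id, comp_idr; apply comp_idl.
  - intros n X _; reflexivity.
  - exact (free_tt_susp ho hT hadd hker hproj s1 s2 s3).
  - intros x; apply comp_idl.
  - intros; reflexivity.
  - intros x x' y y' f g; exact (free_tt_monf f g).
Qed.
End Quotient.

(** * Closedness *)

Section Exponential.
Context {C : Cat} {mC : SymMon C}.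

Definition is_exp (x w h : C) (e : hom (h ⊗ x) w) : Prop :=
  forall a (f : hom (a ⊗ x) w), exists g : hom a h, e \o (g ⊠ idm x) == f /\
    forall g', e \o (g' ⊠ idm x) == f -> g' == g.

Lemma exp_ext (x w h : C) (e : hom (h ⊗ x) w) (a : C) (g g' : hom a h) : is_exp e ->
  e \o (g ⊠ idm x) == e \o (g' ⊠ idm x) -> g == g'.
Proof.
  intros He E; destruct (He a (e \o (g' ⊠ idm x))) as [k [_ Hk]].
  now rewrite (Hk g E), (Hk g' (reflexivity _)).
Qed.

(** Both sides of the universal property are presheaves in [a], so a bijection on the objects [P i]
    passes to their retracts. *)
Lemma exp_restrict {I : Type} (P : I -> C) (x w h : C) (e : hom (h ⊗ x) w) :
  (forall c : C, exists (i : I) (r : hom (P i) c) (s : hom c (P i)), r \o s == idm c) ->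
  (forall i (f : hom (P i ⊗ x) w), exists g : hom (P i) h, e \o (g ⊠ idm x) == f) ->
  (forall i (g g' : hom (P i) h), e \o (g ⊠ idm x) == e \o (g' ⊠ idm x) -> g == g') ->
  is_exp e.
Proof.
  intros HP Hf Hi a f; destruct (HP a) as [i [r [s E]]].
  destruct (Hf i (f \o (r ⊠ idm x))) as [g Hg].
  assert (G : e \o ((g \o s) ⊠ idm x) == f).
  { rewrite tens_l_comp; la; rewrite Hg; la.
    rw (symmetry (tens_l_comp (w := x) r s)); rewrite E, tensm_id; now idc. }
  exists (g \o s); split; [exact G|].
  intros g' Hg'.
  assert (K : g' \o r == (g \o s) \o r).
  { apply Hi; rewrite (tens_l_comp g' r), (tens_l_comp (g \o s) r); la.
    now rewrite Hg', G. }
  rewrite <- (comp_idr g'), <- (comp_idr (g \o s)), <- E, <- !comp_assoc.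
  now rewrite K.
Qed.

(** The retractions induce an idempotent of [h], namely the internal hom of sx rx into sw rw';
    splitting it gives the exponential of the retracts. *)
Lemma exp_retract (hC : idempotent_complete C) (x w x' w' h : C) (e : hom (h ⊗ x') w')
    (sx : hom x x') (rx : hom x' x) (sw : hom w w') (rw' : hom w' w) :
  rx \o sx == idm x -> rw' \o sw == idm w -> is_exp e ->
  exists (h0 : C) (e0 : hom (h0 ⊗ x) w), is_exp e0.
Proof.
  intros Ex Ew He.
  destruct (He h (sw \o rw' \o e \o (idm h ⊠ (sx \o rx)))) as [p [Hp _]].
  assert (Hp' : forall a (g : hom a h), e \o ((p \o g) ⊠ idm x')
    == sw \o (rw' \o e \o (g ⊠ sx)) \o (idm a ⊠ rx)).
  { intros a g; rewrite tens_l_comp; la; rewrite Hp; la.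
    rewrite (comp_assoc _ (idm h ⊠ (sx \o rx))), (comp_assoc _ (g ⊠ sx)).
    apply comp_proper; [reflexivity|]; rewrite <- !tensm_comp; now idc. }
  assert (Ip : p \o p == p).
  { apply (exp_ext He); rewrite Hp', Hp; la.
    rewrite !(comp_assoc _ _ (idm h ⊠ rx)), !(comp_assoc _ e).
    assert (X : e \o (p ⊠ sx) == sw \o rw' \o e \o (idm h ⊠ sx)).
    { rewrite (tens_lr p sx); la; rewrite Hp; la.
      rw (symmetry (tens_r_comp (w := h) (sx \o rx) sx)); rewrite (comp_assoc sx rx sx), Ex; now idc. }
    rewrite <- !comp_assoc, (comp_assoc _ e), X; la.
    rw Ew; idc; rewrite !comp_assoc, <- tensm_comp; now idc. }
  destruct (hC h p Ip) as [h0 [r [s [E1 E2]]]].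
  exists h0, (rw' \o e \o (s ⊠ sx)).
  assert (HE : forall a (g : hom a h), rw' \o e \o (s ⊠ sx) \o ((r \o g) ⊠ idm x)
    == rw' \o e \o (g ⊠ sx)).
  { intros a g; la; rewrite (comp_assoc _ (s ⊠ sx)), <- tensm_comp, comp_idr, <- comp_assoc, E2.
    rewrite (tens_lr (p \o g) sx), comp_assoc, <- (comp_assoc e), Hp'; la.
    rw Ew; idc; rewrite !comp_assoc, <- !tensm_comp, Ex; now idc. }
  intros a f; destruct (He a (sw \o f \o (idm a ⊠ rx))) as [g [Hg _]].
  exists (r \o g); split.
  - rewrite HE, (tens_lr g sx); la; rewrite (comp_assoc rw' e), Hg; la.
    rw Ew; idc; rewrite comp_assoc, <- tensm_comp, Ex, comp_idl, tensm_id; now idc.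
  - intros g' Hg'.
    assert (X : e \o ((s \o g') ⊠ idm x') == e \o (g ⊠ idm x')).
    { assert (Y : s \o g' == p \o (s \o g')) by (rewrite <- E2; la; rw E1; now idc).
      rewrite Y, Hp', Hg, <- Hg'; la.
      rw (symmetry (tensm_comp s g' sx (idm x))); now idc. }
    rewrite <- (exp_ext He X); la; rewrite E1; now idc.
Qed.
End Exponential.

(** * Internal homs and the suspension *)

Section IntHomTheory.
Context {C : Cat} {mC : SymMon C} (H : IntHom C).

Lemma ihom_ext {a x w : C} (g g' : hom a (ihom H x w)) :
  ev H x w \o (g ⊠ idm x) == ev H x w \o (g' ⊠ idm x) -> g == g'.
Proof.
  intros E; rewrite (curry_unique (reflexivity (ev H x w \o (g ⊠ idm x)))).
  symmetry; apply curry_unique; now symmetry.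
Qed.

Lemma ihom_is_exp (x w : C) : is_exp (ev H x w).
Proof.
  intros a f; exists (curry H f); split; [apply ev_curry | intros; now apply curry_unique].
Qed.

Definition ihom_post (x : C) {w w' : C} (g : hom w w') : hom (ihom H x w) (ihom H x w') :=
  curry H (g \o ev H x w).

Lemma ev_pre {x y : C} (f : hom x y) (w : C) :
  ev H x w \o (ihom_pre H f w ⊠ idm x) == ev H y w \o (idm _ ⊠ f).
Proof. apply ev_curry. Qed.

Lemma ev_post (x : C) {w w' : C} (g : hom w w') :
  ev H x w' \o (ihom_post x g ⊠ idm x) == g \o ev H x w.
Proof. apply ev_curry. Qed.

Lemma ihom_pre_proper {x y : C} (f f' : hom x y) (w : C) :
  f == f' -> ihom_pre H f w == ihom_pre H f' w.
Proof. intros E; apply ihom_ext; rewrite !ev_pre; now rewrite E. Qed.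

Lemma ihom_pre_id (x w : C) : ihom_pre H (idm x) w == idm _.
Proof. apply ihom_ext; now rewrite ev_pre. Qed.

Lemma ihom_pre_comp {x y z : C} (g : hom y z) (f : hom x y) (w : C) :
  ihom_pre H (g \o f) w == ihom_pre H f w \o ihom_pre H g w.
Proof.
  apply ihom_ext; rewrite ev_pre, tens_l_comp; la; rewrite ev_pre; la.
  rewrite (comp_assoc _ (idm _ ⊠ f)), <- (tens_rl (ihom_pre H g w) f).
  rewrite (tens_lr (ihom_pre H g w) f); la; rewrite ev_pre, tens_r_comp; now la.
Qed.

Lemma ihom_post_comp (x : C) {w w' w'' : C} (g : hom w' w'') (f : hom w w') :
  ihom_post x (g \o f) == ihom_post x g \o ihom_post x f.
Proof.
  apply ihom_ext; rewrite ev_post, tens_l_comp; la; rewrite ev_post; la.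
  rewrite !comp_assoc, ev_post; now la.
Qed.

Lemma ihom_post_id (x w : C) : ihom_post x (idm w) == idm _.
Proof. apply ihom_ext; rewrite ev_post, tensm_id; now idc. Qed.

Lemma ihom_post_proper (x : C) {w w' : C} (g g' : hom w w') :
  g == g' -> ihom_post x g == ihom_post x g'.
Proof. intros E; apply ihom_ext; rewrite !ev_post; now rewrite E. Qed.

Lemma ihom_pre_post {x y w w' : C} (f : hom x y) (g : hom w w') :
  ihom_pre H f w' \o ihom_post y g == ihom_post x g \o ihom_pre H f w.
Proof.
  apply ihom_ext; rewrite !tens_l_comp; la; rewrite ev_pre, ev_post; la.
  rewrite (comp_assoc g), ev_pre, (comp_assoc _ (idm _ ⊠ f)), <- (tens_rl (ihom_post y g) f).
  rewrite (tens_lr (ihom_post y g) f); la; now rewrite ev_post.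
Qed.
End IntHomTheory.

Section IntHomSusp.
Context {o : tri_order} (ho : valid_order o) {C : Cat} {tC : TensorTri o C} (H : IntHom C).

(** The identification of which [ihom_susp] is the transpose, composed with evaluation. *)
Definition shift_iso (a x : C) : Iso (susp a ⊗ x) (a ⊗ susp x) :=
  iso_comp (braid_iso (susp x) a) (iso_comp (iso_sym (stens x a))
    (iso_comp (fiso susp (braid_iso a x)) (stens a x))).

Lemma shift_isoE (a x : C) : shift_iso a x ==
  braid (susp x) a \o iso_inv (stens x a) \o fmor susp (braid a x) \o stens a x.
Proof. cbn; now la. Qed.

Lemma stens_inv_natural {x y x' y' : C} (f : hom x x') (g : hom y y') :
  iso_inv (stens x' y') \o fmor susp (f ⊠ g) == (fmor susp f ⊠ g) \o iso_inv (stens x y).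
Proof. apply iso_inv_square, stens_natural. Qed.

Lemma shift_natural {a b x y : C} (g : hom a b) (f : hom x y) :
  shift_iso b y \o (fmor susp g ⊠ f) == (g ⊠ fmor susp f) \o shift_iso a x.
Proof.
  rewrite !shift_isoE; la; rw (stens_natural g f).
  rw (symmetry (fmor_comp susp (braid b y) (g ⊠ f))); rewrite braid_natural, fmor_comp; la.
  rw (stens_inv_natural f g); now rw (braid_natural (fmor susp f) g).
Qed.

Lemma ev_susp {a x w : C} (g : hom a (ihom H (susp x) w)) :
  ev H x w \o ((ihom_susp H x w \o fmor susp g) ⊠ idm x)
    == ev H (susp x) w \o (g ⊠ idm _) \o shift_iso a x.
Proof.
  rewrite tens_l_comp; la; unfold ihom_susp; rewrite ev_curry.
  rewrite (comp_assoc (ev H (susp x) w) (g ⊠ _)), <- (fmor_id susp x), <- shift_natural, shift_isoE.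
  now la.
Qed.

Lemma ev_susp_id (x w : C) : ev H x w \o (ihom_susp H x w ⊠ idm x)
  == ev H (susp x) w \o shift_iso (ihom H (susp x) w) x.
Proof.
  pose proof (ev_susp (idm (ihom H (susp x) w))) as E.
  now rewrite fmor_id, tensm_id, !comp_idr in E.
Qed.

(** Tested on suspended sources, where both composites transpose, along the shift, to evaluations at
    Sigma x. *)
Lemma ihom_susp_cancel {a x w : C} (u u' : hom a (susp (ihom H (susp x) w))) :
  ihom_susp H x w \o u == ihom_susp H x w \o u' -> u == u'.
Proof.
  destruct (susp_ess_surj (tC := tt_tri (C := C)) a) as [b [i]].
  intros E; apply (iso_epi (i := i)).
  destruct (susp_full (u \o i)) as [g Hg], (susp_full (u' \o i)) as [g' Hg'].
  rewrite <- Hg, <- Hg'; apply fmor_proper, (ihom_ext (H := H)).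
  apply (iso_epi (i := shift_iso b x)); rewrite <- !ev_susp.
  rewrite Hg, Hg', <- !comp_assoc, E; reflexivity.
Qed.

Lemma ihom_susp_is_iso (x w : C) : is_iso (ihom_susp H x w).
Proof.
  destruct (susp_ess_surj (tC := tt_tri (C := C)) (ihom H x w)) as [b [i]].
  (* A desuspension [b] of the internal hom maps to the one at Sigma x by transposing evaluation
     along the shift. This gives a right inverse, and cancellation makes it two-sided. *)
  pose (g := curry H (ev H x w \o (i ⊠ idm x) \o iso_inv (shift_iso b x)) : hom b (ihom H (susp x) w)).
  assert (E : ihom_susp H x w \o (fmor susp g \o iso_inv i) == idm _).
  { rewrite <- comp_assoc; transitivity (i \o iso_inv i); [|apply iso_invr].
    apply comp_proper; [|reflexivity]; apply (ihom_ext (H := H)).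
    rewrite ev_susp; unfold g; rewrite ev_curry; la.
    rewrite (comp_assoc _ (iso_inv _)), iso_invl; now idc. }
  exists (fmor susp g \o iso_inv i); split; [|exact E].
  apply ihom_susp_cancel; rewrite <- comp_assoc, E; now idc.
Qed.

Lemma ihom_susp_pre {x y : C} (f : hom x y) (w : C) :
  ihom_susp H x w \o fmor susp (ihom_pre H (fmor susp f) w) == ihom_pre H f w \o ihom_susp H y w.
Proof.
  apply (ihom_ext (H := H)); rewrite ev_susp, ev_pre, tens_l_comp; la.
  rewrite ev_pre, (comp_assoc _ (idm _ ⊠ f)), <- (tens_rl (ihom_susp H y w) f).
  rewrite (tens_lr (ihom_susp H y w) f); la; rewrite (ev_susp_id y w).
  rewrite (comp_assoc _ (idm _ ⊠ _)), <- shift_natural, fmor_id; now la.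
Qed.

Lemma ihom_susp_post (x : C) {w w' : C} (g : hom w w') :
  ihom_susp H x w' \o fmor susp (ihom_post H (susp x) g) == ihom_post H x g \o ihom_susp H x w.
Proof.
  apply (ihom_ext (H := H)); rewrite ev_susp, ev_post, tens_l_comp; la.
  rewrite !ev_post; la; rw (ev_susp_id x w); reflexivity.
Qed.

Definition ihom_k (x w : C) : hom (ihom H x w) (susp (ihom H (susp x) w)) :=
  iso_inv (iso_of (ihom_susp_is_iso x w)).

Lemma ihom_k_l (x w : C) : ihom_k x w \o ihom_susp H x w == idm _.
Proof. exact (iso_invl (iso_of (ihom_susp_is_iso x w))). Qed.

Lemma ihom_k_r (x w : C) : ihom_susp H x w \o ihom_k x w == idm _.
Proof. exact (iso_invr (iso_of (ihom_susp_is_iso x w))). Qed.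

Lemma ihom_k_pre {x y : C} (f : hom x y) (w : C) :
  fmor susp (ihom_pre H (fmor susp f) w) \o ihom_k y w == ihom_k x w \o ihom_pre H f w.
Proof.
  apply ihom_susp_cancel; la; rewrite ihom_susp_pre; rw (ihom_k_r y w); rewrite ihom_k_r; now idc.
Qed.

Lemma ihom_k_post (x : C) {w w' : C} (g : hom w w') :
  fmor susp (ihom_post H (susp x) g) \o ihom_k x w == ihom_k x w' \o ihom_post H x g.
Proof.
  apply ihom_susp_cancel; la; rewrite ihom_susp_post; rw (ihom_k_r x w); rewrite ihom_k_r; now idc.
Qed.

Lemma ihom_is_zero (x w : C) : is_zero x -> is_zero (ihom H x w).
Proof.
  intros Hx; apply is_zero_idm, (ihom_ext (H := H)).
  apply from_zero; refine (is_zero_isom (braid_iso _ _) _); now apply (tens_is_zero ho).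
Qed.

Definition ihom_diag (n : nat) (X : ndiag susp) (w : C) : ndiag susp :=
  @MkNdiag C susp (fun i j => ihom H (nob X (n - j) (n - i)) w)
    (fun i j i' j' => ihom_pre H (ntr X (n - j') (n - i') (n - j) (n - i)) w)
    (fun i j k' => fmor susp (ihom_pre H (nbd X (n - k') (n - j) (n - i)) w)
       \o ihom_k (nob X (n - k') (n - j)) w).

Lemma ihom_diag_ntriangle n (X : ndiag susp) (w : C) :
  is_ntriangle n X -> is_ntriangle n (ihom_diag n X w).
Proof.
  intros [H1 [H2 [H3 H4]]]; split; [|split; [|split]]; cbn; intros.
  - apply ihom_is_zero, H1; lia.
  - rewrite <- ihom_pre_id; apply ihom_pre_proper, H2; lia.
  - rewrite <- ihom_pre_comp; apply ihom_pre_proper, H3; lia.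
  - la; rewrite <- fmor_comp, <- ihom_pre_comp.
    rewrite comp_assoc, <- ihom_k_pre; la; rewrite <- fmor_comp, <- ihom_pre_comp.
    apply comp_proper; [|reflexivity]; apply fmor_proper, ihom_pre_proper.
    symmetry; apply H4; lia.
Qed.

Lemma ihom_diag_pre n (X Y : ndiag susp) (w : C) (u : forall i j, hom (nob X i j) (nob Y i j)) :
  is_nmorphism n (X := X) (Y := Y) u ->
  is_nmorphism n (X := ihom_diag n Y w) (Y := ihom_diag n X w)
    (fun i j => ihom_pre H (u (n - j) (n - i)) w).
Proof.
  intros [N1 N2]; split; cbn; intros.
  - rewrite <- !ihom_pre_comp; apply ihom_pre_proper; symmetry; apply N1; lia.
  - rewrite comp_assoc, <- ihom_k_pre; la; rewrite <- !fmor_comp, <- !ihom_pre_comp.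
    apply comp_proper; [|reflexivity]; apply fmor_proper, ihom_pre_proper.
    symmetry; apply N2; lia.
Qed.

Lemma ihom_diag_post n (X : ndiag susp) (w w' : C) (g : hom w w') :
  is_nmorphism n (X := ihom_diag n X w) (Y := ihom_diag n X w')
    (fun i j => ihom_post H (nob X (n - j) (n - i)) g).
Proof.
  split; cbn; intros.
  - apply ihom_pre_post.
  - rewrite comp_assoc, <- ihom_k_post; la; rewrite <- !fmor_comp, ihom_pre_post; reflexivity.
Qed.

(** The internal hom is contravariant in X, so the retraction onto X becomes a section and
    conversely, while the maps of [w] keep their roles; the two variables commute. *)
Lemma ihom_diag_retract n (X Y : ndiag susp) (w w' : C) (s : hom w w') (r : hom w' w) :
  r \o s == idm w -> nretract n X Y -> nretract n (ihom_diag n X w) (ihom_diag n Y w').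
Proof.
  intros E [a [b [Ha [Hb Eab]]]].
  exists (fun i j => ihom_post H _ s \o ihom_pre H (b (n - j) (n - i)) w),
    (fun i j => ihom_pre H (a (n - j) (n - i)) w \o ihom_post H _ r).
  split; [exact (nmorphism_comp (ihom_diag_pre w Hb) (ihom_diag_post n Y s))|].
  split; [exact (nmorphism_comp (ihom_diag_post n Y r) (ihom_diag_pre w Ha))|].
  intros i j Hij.
  change (ihom_pre H (a (n - j) (n - i)) w \o ihom_post H (nob Y (n - j) (n - i)) r
    \o (ihom_post H (nob Y (n - j) (n - i)) s \o ihom_pre H (b (n - j) (n - i)) w)
    == idm (ihom H (nob X (n - j) (n - i)) w)).
  la; rw (symmetry (ihom_post_comp H (nob Y (n - j) (n - i)) r s)).
  rewrite (ihom_post_proper H _ E), ihom_post_id, comp_idr, <- ihom_pre_comp.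
  rewrite <- ihom_pre_id; apply ihom_pre_proper, Eab; lia.
Qed.
End IntHomSusp.

Lemma exp_iso {C : Cat} {mC : SymMon C} {x w h h' : C} (e : hom (h ⊗ x) w) (e' : hom (h' ⊗ x) w)
    (c : hom h h') : is_exp e -> is_exp e' -> e' \o (c ⊠ idm x) == e -> is_iso c.
Proof.
  intros He He' E; destruct (He h' e') as [d [Hd _]].
  exists d; split; [apply (exp_ext He) | apply (exp_ext He')];
    rewrite tens_l_comp, tensm_id, comp_idr; la.
  - now rewrite Hd.
  - now rewrite E.
Qed.

Lemma int_hom_of_exp {C : Cat} {mC : SymMon C} :
  (forall x w : C, exists (h : C) (e : hom (h ⊗ x) w), is_exp e) -> inhabited (IntHom C).
Proof.
  intros HE; constructor.
  assert (HE' : forall x w : C, exists p : { h : C & hom (h ⊗ x) w }, is_exp (projT2 p))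
    by (intros x w; destruct (HE x w) as [h [e He]]; now exists (existT _ h e)).
  pose (p := fun x w => proj1_sig (constructive_indefinite_description _ (HE' x w))).
  assert (Hp : forall x w, is_exp (projT2 (p x w)))
    by (intros x w; exact (proj2_sig (constructive_indefinite_description _ (HE' x w)))).
  clearbody p.
  pose (cu := fun a x w f => constructive_indefinite_description _ (Hp x w a f)).
  refine (@Build_IntHom C mC (fun x w => projT1 (p x w)) (fun x w => projT2 (p x w))
    (fun a x w f => proj1_sig (cu a x w f)) _ _).
  - intros a x w f; exact (proj1 (proj2_sig (cu a x w f))).
  - intros a x w f g Hg; exact (proj2 (proj2_sig (cu a x w f)) g Hg).
Qed.

(** * Closedness through a dense functor *)

Section Closed.
Context {o : tri_order} (ho : valid_order o) {S C : Cat} {tS : TensorTri o S} {tC : TensorTri o C}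
  {J : Functor S C} (tJ : TTFunctor J) (HS : IntHom S) (HC : IntHom C).
Let sg (x : S) : Iso (J (susp x)) (susp (J x)) := trif_susp tJ x.
Let psi (x y : S) : Iso (J x ⊗ J y) (J (x ⊗ y)) := monf tJ x y.
Let sg_nat (x y : S) (f : hom x y) : sg y \o fmor J (fmor susp f) == fmor susp (fmor J f) \o sg x.
Proof. exact (trif_is_natural tJ f). Qed.

(** The canonical map between internal homs attached to a monoidal functor; it is shown to be
    invertible for z = F t. *)
Definition hom_comparison (z w : S) : hom (J (ihom HS z w)) (ihom HC (J z) (J w)) :=
  curry HC (fmor J (ev HS z w) \o psi (ihom HS z w) z).
Notation c := hom_comparison.

Lemma ev_comparison (z w : S) :
  ev HC (J z) (J w) \o (c z w ⊠ idm (J z)) == fmor J (ev HS z w) \o psi (ihom HS z w) z.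
Proof. apply ev_curry. Qed.

Lemma psi_l {x x' : S} (y : S) (f : hom x x') :
  psi x' y \o (fmor J f ⊠ idm (J y)) == fmor J (f ⊠ idm y) \o psi x y.
Proof. unfold psi; rewrite (monf_natural tJ f (idm y)), fmor_id; reflexivity. Qed.

Lemma psi_r {y y' : S} (x : S) (f : hom y y') :
  psi x y' \o (idm (J x) ⊠ fmor J f) == fmor J (idm x ⊠ f) \o psi x y.
Proof. unfold psi; rewrite (monf_natural tJ (idm x) f), fmor_id; reflexivity. Qed.

Lemma comparison_pre {z z' : S} (f : hom z z') (w : S) :
  c z w \o fmor J (ihom_pre HS f w) == ihom_pre HC (fmor J f) (J w) \o c z' w.
Proof.
  apply (ihom_ext (H := HC)); rewrite !tens_l_comp; la.
  rewrite ev_comparison, ev_pre; rw (psi_l z (ihom_pre HS f w)).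
  rw (symmetry (fmor_comp J (ev HS z w) (ihom_pre HS f w ⊠ idm z))); rewrite ev_pre.
  rw (symmetry (tens_rl (c z' w) (fmor J f))); rw (tens_lr (c z' w) (fmor J f)).
  rewrite ev_comparison; rw (psi_r (ihom HS z' w) f); now rewrite fmor_comp.
Qed.

Lemma shift_stens {D : Cat} {tD : TensorTri o D} (a x : D) :
  stens_r a x \o shift_iso a x == stens a x.
Proof.
  rewrite shift_isoE; unfold stens_r; la.
  rw (braid_involutive (susp x) a); idc; rw (iso_invr (stens x a)); idc.
  rewrite <- fmor_comp, braid_involutive, fmor_id; now idc.
Qed.

Lemma shift_preserved (a z : S) :
  fmor J (shift_iso a z) \o psi (susp a) z
    == psi a (susp z) \o (idm (J a) ⊠ iso_inv (sg z)) \o shift_iso (J a) (J z)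
       \o (sg a ⊠ idm (J z)).
Proof.
  apply (iso_mono (i := iso_comp (sg (a ⊗ z)) (fiso J (stens_r_iso a z)))).
  cbn [iso_fwd iso_comp fiso].
  pose proof (ttf_compat tJ a z) as E1; pose proof (ttf_stens_r tJ a z) as E2.
  change (sg (a ⊗ z) \o fmor J (stens a z) \o psi (susp a) z
    == fmor susp (psi a z) \o stens (J a) (J z) \o (sg a ⊠ idm (J z))) in E1.
  change (sg (a ⊗ z) \o fmor J (stens_r a z) \o psi a (susp z)
    == fmor susp (psi a z) \o stens_r (J a) (J z) \o (idm (J a) ⊠ sg z)) in E2.
  rewrite stens_r_isoE; la.
  rw (symmetry (fmor_comp J (stens_r a z) (shift_iso a z))); rewrite shift_stens, E1.
  rewrite E2; rw (symmetry (tens_r_comp (w := J a) (sg z) (iso_inv (sg z)))).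
  rewrite (iso_invr (sg z)), tensm_id; idc; now rw (shift_stens (J a) (J z)).
Qed.

(** Both sides have the same transpose, because [J] preserves the shift of a suspension from one
    factor to the other. *)
Lemma comparison_susp (z w : S) :
  c z w \o fmor J (ihom_susp HS z w)
    == ihom_susp HC (J z) (J w)
       \o fmor susp (ihom_pre HC (iso_inv (sg z)) (J w) \o c (susp z) w)
       \o sg (ihom HS (susp z) w).
Proof.
  apply (ihom_ext (H := HC)); rewrite (tens_l_comp (c z w)), (tens_l_comp (_ \o _) (sg _)); la.
  rewrite ev_comparison, ev_susp; rw (psi_l z (ihom_susp HS z w)).
  rw (symmetry (fmor_comp J (ev HS z w) (ihom_susp HS z w ⊠ idm z))); rewrite ev_susp_id.
  rewrite fmor_comp; la; rw (shift_preserved (ihom HS (susp z) w) z).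
  rewrite tens_l_comp; la; rewrite ev_pre.
  rw (symmetry (tens_rl (c (susp z) w) (iso_inv (sg z)))).
  rw (tens_lr (c (susp z) w) (iso_inv (sg z))); now rewrite ev_comparison.
Qed.

Context (k : forall z w : S, hom (ihom HS z w) (susp (ihom HS (susp z) w)))
  (kr : forall z w, ihom_susp HS z w \o k z w == idm _).

Lemma comparison_k (z w : S) :
  fmor susp (ihom_pre HC (iso_inv (sg z)) (J w) \o c (susp z) w)
    \o sg (ihom HS (susp z) w) \o fmor J (k z w)
  == ihom_k HC (J z) (J w) \o c z w.
Proof.
  apply (ihom_susp_cancel (H := HC)); la; rewrite <- comparison_susp; la.
  rw (symmetry (fmor_comp J (ihom_susp HS z w) (k z w))); rewrite kr, fmor_id, comp_idr.
  now rewrite ihom_k_r, comp_idl.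
Qed.

Lemma comparison_diag n (Z : ndiag (susp (C := S))) (w : S) :
  (forall i j, is_iso (c (nob Z i j) w)) ->
  nisomorphic n
    (nimage (F := J) (fun x => trif_susp tJ x) (@MkNdiag S susp
        (fun i j => ihom HS (nob Z (n - j) (n - i)) w)
        (fun i j i' j' =>
           ihom_pre HS (ntr Z (n - j') (n - i') (n - j) (n - i)) w)
        (fun i j k' =>
           fmor susp (ihom_pre HS (nbd Z (n - k') (n - j) (n - i)) w)
             \o k (nob Z (n - k') (n - j)) w)))
    (ihom_diag HC n (nimage (F := J) (fun x => trif_susp tJ x) Z) (J w)).
Proof.
  intros Hc; match goal with |- nisomorphic n ?X ?Y =>
    refine (nisomorphic_of_iso (aC := tri_add (C := C)) (X := X) (Y := Y)
      (w := fun i j => c (nob Z (n - j) (n - i)) w) _ _) end; [|intros; apply Hc].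
  split; intros i j.
  - intros i' j' _ _ _ _; symmetry; apply comparison_pre.
  - intros l _ _.
    pose (z := nob Z (n - l) (n - j)); pose (z' := nob Z (n - j) (n - i)).
    pose (b := nbd Z (n - l) (n - j) (n - i) : hom z' (susp z)).
    change (fmor susp (ihom_pre HC (sg z \o fmor J b) (J w)) \o ihom_k HC (J z) (J w) \o c z w
      == fmor susp (c z' w) \o (sg (ihom HS z' w) \o
           fmor J (fmor susp (ihom_pre HS b w) \o k z w))).
    clearbody b z z'.
    rewrite comp_assoc, <- comparison_k, (fmor_comp J); la.
    rw (sg_nat (ihom_pre HS b w)).
    rewrite <- !(fmor_comp susp), comparison_pre, (ihom_pre_comp HC (sg z) (fmor J b)); la.
    rw (symmetry (ihom_pre_comp HC (iso_inv (sg z)) (sg z) (J w))).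
    rewrite (ihom_pre_proper HC _ (iso_invl (sg z))), ihom_pre_id; now idc.
Qed.
End Closed.

(** Every object is a retract of some J (F u), and maps from J (F u) to an image of J are induced
    from S; so J sends the internal hom of F t and w to an internal hom of their images. The others
    are retracts of these. A triangle is a retract of the image of one from T, and its diagram of
    internal homs is then a retract of the image of an exact one of S. *)
Theorem closed_of_dense {o : tri_order} (ho : valid_order o) {T S C : Cat}
    {tT : TensorTri o T} {tS : TensorTri o S} {tC : TensorTri o C}
    (hC : idempotent_complete C) {F : Functor T S} (tF : TTFunctor F)
    {J : Functor S C} (tJ : TTFunctor J) (HS : exists H : IntHom S, ihom_exact H)
    (Jfull : forall (t : T) (s : S) (h : hom (J (F t)) (J s)), exists f, fmor J f == h)
    (Jfaithful : forall (t : T) (s : S) (f g : hom (F t) s), fmor J f == fmor J g -> f == g)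
    (Jret : retracts_onto (functor_comp J F))
    (Jdense : forall n (X : ndiag (susp (C := C))), in_range o n -> dist n X ->
       exists Y, dist n Y /\ nretract n X (nimage (F := J) (fun x => trif_susp tJ x)
         (nimage (F := F) (fun x => trif_susp tF x) Y))) :
  exists H : IntHom C, ihom_exact H.
Proof.
  destruct HS as [HS [k [Hk HE]]].
  assert (Exp : forall (t : T) (w : S),
    is_exp (fmor J (ev HS (F t) w) \o monf tJ (ihom HS (F t) w) (F t))).
  { intros t w; apply (exp_restrict (P := fun u => J (F u))).
    - exact Jret.
    - intros u f.
      destruct (Jfull (u ⊗ t) w (f \o iso_inv (monf tJ (F u) (F t)) \o fmor J (iso_inv (monf tF u t))))
        as [f0 Hf].
      exists (fmor J (curry HS (f0 \o monf tF u t))); la.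
      rewrite (comp_assoc _ (monf tJ _ _)), (psi_l tJ), <- comp_assoc, <- fmor_comp, ev_curry.
      rewrite fmor_comp, Hf; la.
      rw (symmetry (fmor_comp J (iso_inv (monf tF u t)) (monf tF u t))).
      rewrite (iso_invl (monf tF u t)), fmor_id, comp_idr.
      rw (iso_invl (monf tJ (F u) (F t))); now idc.
    - intros u g g' E.
      destruct (Jfull u _ g) as [g0 Hg], (Jfull u _ g') as [g0' Hg'].
      rewrite <- Hg, <- Hg' in *; apply fmor_proper, (ihom_ext (H := HS)).
      rewrite !comp_assoc, !(psi_l tJ), <- !comp_assoc, <- !fmor_comp in E.
      apply (iso_epi (i := monf tJ (F u) (F t))) in E.
      apply (iso_epi (i := iso_sym (monf tF u t))), Jfaithful.
      rewrite !(fmor_comp J _ (iso_sym (monf tF u t))); now rewrite E. }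
  assert (HX : forall x w : C, exists (h : C) (e : hom (h ⊗ x) w), is_exp e).
  { intros x w; destruct (Jret x) as [t [r [s E]]], (Jret w) as [t' [r' [s' E']]].
    exact (exp_retract hC E E' (Exp t (F t'))). }
  destruct (int_hom_of_exp HX) as [HC].
  assert (Hiso : forall (t : T) (w : S), is_iso (hom_comparison tJ HS HC (F t) w)).
  { intros t w; apply (exp_iso (Exp t w) (@ihom_is_exp C _ HC (J (F t)) (J w))).
    apply ev_comparison. }
  exists HC, (fun x w => ihom_k HC x w); split.
  - intros x w; split; [apply ihom_k_l | apply ihom_k_r].
  - intros n X w Hn HX'; change (dist n (ihom_diag HC n X w)).
    destruct (Jdense n X Hn HX') as [Y [HY RY]], (Jret w) as [t [r [s E]]].
    refine (dist_retract ho Hn (ihom_diag_ntriangle ho HC w (dist_ntriangle Hn HX'))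
      (trif_dist tJ Hn (HE n _ (F t) Hn (trif_dist tF Hn HY)))
      (nretract_trans (ihom_diag_retract HC E RY) (nisomorphic_retract (nisomorphic_sym
        (@comparison_diag o S C tS tC J tJ HS HC k (fun z w => proj2 (Hk z w)) n _ (F t) _)))));
      intros; apply Hiso.
Qed.

Lemma kar_idempotent_complete (C : Cat) : idempotent_complete (idempotent_completion C).
Proof.
  intros x e He.
  pose (y := @MkKarOb C (kob x) (kmor e) He : KarOb C).
  exists y, (@MkKarHom C x y (kmor e) He (kmor_r e)), (@MkKarHom C y x (kmor e) (kmor_l e) He).
  split; exact He.
Qed.

(** For the completion: fullness, faithfulness, retracts and density are established for its image
    in modules and reflected along [E]. *)
Lemma closed_of_dense_reflect {o : tri_order} (ho : valid_order o) {T S C' C : Cat}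
    {tT : TensorTri o T} {tS : TensorTri o S} {tC' : TensorTri o C'} {tC : TensorTri o C}
    (hC' : idempotent_complete C') {F : Functor T S} (tF : TTFunctor F)
    {J : Functor S C'} (tJ : TTFunctor J) {E : Functor C' C} (tE : TTFunctor E)
    (fE : full E) (hE : faithful E) (HS : exists H : IntHom S, ihom_exact H)
    (Jfull : forall (t : T) (s : S) (h : hom (E (J (F t))) (E (J s))),
       exists f, fmor E (fmor J f) == h)
    (Jfaithful : forall (t : T) (s : S) (f g : hom (F t) s),
       fmor E (fmor J f) == fmor E (fmor J g) -> f == g)
    (Jret : forall c : C, exists (t : T) (r : hom (E (J (F t))) c) (s : hom c (E (J (F t)))),
       r \o s == idm c)
    (Jdense : forall n (X : ndiag (susp (C := C))), in_range o n -> dist n X ->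
       exists Y, dist n Y /\ nretract n X
         (nimage (F := functor_comp E J) (fun x => trif_susp (ttfunctor_comp tE tJ) x)
         (nimage (F := F) (fun x => trif_susp tF x) Y))) :
  exists H : IntHom C', ihom_exact H.
Proof.
  apply (@closed_of_dense o ho T S C' tT tS tC' hC' F tF J tJ HS).
  - intros t s h; destruct (Jfull t s (fmor E h)) as [f Hf]; exists f; now apply hE.
  - intros t s f g Hfg; apply Jfaithful; now rewrite Hfg.
  - intros c; destruct (Jret (E c)) as [t [r [s Hrs]]].
    exists t, (preim fE r), (preim fE s); apply hE.
    rewrite fmor_comp, !fmor_preim, fmor_id; exact Hrs.
  - intros n X Hn HX.
    destruct (Jdense n _ Hn (trif_dist tE Hn HX)) as [Y [HY R]].
    exists Y; split; [exact HY|].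
    refine (retract_reflect fE hE (th := fun x => trif_susp tE x) (trif_is_natural tE)
      (fun x => is_iso_iso _) (nretract_trans R (nisomorphic_retract _))).
    apply (nimage_nimage (F := J) (G := E)
      (th'' := fun x => trif_susp (ttfunctor_comp tE tJ) x)).
    intros x; reflexivity.
Qed.

Section KarClosed.
Context {o : tri_order} (ho : valid_order o) {C D : Cat} (tC : TensorTri o C)
  (tD : Tri o D) (hD : idempotent_complete D) {U : Functor C D} (tU : TriFunctor U)
  (fU : full U) (hU : faithful U) (dU : dist_dense tU) (rU : retracts_onto U).
Notation KC := (idempotent_completion C).
Notation I := (to_completion C).
Notation E := (kar_ext hD U).
Notation fE := (kar_ext_full (hD := hD) fU hU).
Notation hE := (kar_ext_faithful (hD := hD) hU).

Lemma kar_closed {T B : Cat} {tT : TensorTri o T} {tB : TensorTri o B} {F : Functor T B}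
    (tF : TTFunctor F) {q : Functor B C} (tq : TTFunctor q)
    (HS : exists H : IntHom B, ihom_exact H)
    (Jfull : forall (t : T) (s : B) (h : hom (E (I (q (F t)))) (E (I (q s)))),
       exists f, fmor E (fmor I (fmor q f)) == h)
    (Jfaithful : forall (t : T) (s : B) (f g : hom (F t) s),
       fmor E (fmor I (fmor q f)) == fmor E (fmor I (fmor q g)) -> f == g)
    (Jret : forall c : D, exists (t : T) (r : hom (E (I (q (F t)))) c)
       (s : hom c (E (I (q (F t))))), r \o s == idm c)
    (Jdense : forall n (X : ndiag (susp (C := D))), in_range o n -> dist n X ->
       exists Y, dist n Y /\ nretract n X
         (nimage (F := functor_comp E (functor_comp I q))
           (fun x => trif_susp (kar_transfer_comp ho hD fU hU dU rU tq) x)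
         (nimage (F := F) (fun x => trif_susp tF x) Y))) :
  exists H : IntHom (mC := tt_mon (TensorTri := kar_tensor ho hD fU hU dU rU)) KC,
    ihom_exact (tC := kar_tensor ho hD fU hU dU rU) H.
Proof.
  exact (@closed_of_dense_reflect o ho T B KC D tT tB (kar_tensor ho hD fU hU dU rU)
    (kar_transfer ho hD fU hU dU rU) (@kar_idempotent_complete C) F tF (functor_comp I q)
    (ttfunctor_comp (to_completion_tt ho hD fU hU dU rU) tq) E
    (kar_transfer_functor ho hD fU hU dU rU) fE hE HS Jfull Jfaithful Jret Jdense).
Qed.
End KarClosed.

(** * Closedness of the completion and of modules *)

Section Quotient.
Context {o : tri_order} (ho : valid_order o) {T S : Cat} {tT : TensorTri o T}
  {tS : TensorTri o S} (hT : idempotent_complete T)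
  {F : Functor T S} (tF : TTFunctor F) {G : Functor S T}
  (adj : Adjunction F G) (hadd : tens_additive (C := T) tt_mon)
  (hker : kernel_tensor_closed G)
  (hproj : right_projection_formula tF adj)
  (s : hom (unit_algebra tF adj) (unit_algebra tF adj ⊗ unit_algebra tF adj))
  (s1 : amul (unit_algebra tF adj) \o s == idm (acar (unit_algebra tF adj)))
  (s2 : (idm (acar (unit_algebra tF adj)) ⊠ amul (unit_algebra tF adj))
     \o assoc (unit_algebra tF adj) (unit_algebra tF adj) (unit_algebra tF adj)
     \o (s ⊠ idm (acar (unit_algebra tF adj))) == s \o amul (unit_algebra tF adj))
  (s3 : (amul (unit_algebra tF adj) ⊠ idm (acar (unit_algebra tF adj)))
     \o iso_inv (assoc (unit_algebra tF adj) (unit_algebra tF adj) (unit_algebra tF adj))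
     \o (idm (acar (unit_algebra tF adj)) ⊠ s)
          == s \o amul (unit_algebra tF adj)).
Notation A := (unit_algebra tF adj).
Notation K := (comparison tF adj).
Notation D := (module_cat A).
Notation Q := (verdier_quotient (o := o) G).
Notation q := (quotient_functor (o := o) G).
Notation KB := (Kbar ho tF adj).
Notation DTri := (module_tri_structure ho hT hadd hproj s1 s2 s3).
Notation Kfull := (Kbar_full (ho := ho) hproj s1 s2 s3).
Notation Kfaith := (Kbar_faithful (ho := ho) hproj s1 s2 s3).

Notation hD := (module_idempotent_complete hT (A := A)).
Notation E := (kar_ext hD KB).
Notation QTen := (Qtensor ho hT hadd hker hproj s1 s2 s3).
Notation KTen := (KQtensor ho hT hadd hker hproj s1 s2 s3).
Notation DTen := (Dtensor ho hT hadd hker hproj s1 s2 s3).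
Notation J := (functor_comp E (functor_comp (to_completion Q) q)).
Notation Jt := (J_tt ho hT hadd hker hproj s1 s2 s3).
Notation kp := (kappa ho hT tF adj).

Lemma J_full (t : T) (s' : S) (h : hom (J (F t)) (J s')) : exists f, fmor J f == h.
Proof.
  pose proof (comparison_full_free (mF := tF) (adj := adj)
    (kp s' \o h \o iso_inv (kp (F t))) hproj) as H.
  set (f := counit_adj adj s' \o _) in H; exists f.
  apply (iso_mono (i := kp s')).
  refine (transitivity (nat_iso_natural kp f) _).
  refine (transitivity (comp_proper H (reflexivity _)) _).
  refine (transitivity (comp_assoc _ _ _) _).
  exact (transitivity (comp_proper (reflexivity _) (iso_invl (kp (F t)))) (comp_idr _)).
Qed.

Lemma J_faithful (t : T) (s' : S) (f g : hom (F t) s') : fmor J f == fmor J g -> f == g.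
Proof.
  intros H; apply (comparison_faithful_free adj).
  change (fmor K f == fmor K g).
  apply (iso_epi (i := kp (F t))).
  refine (transitivity (symmetry (nat_iso_natural kp f)) (transitivity _ (nat_iso_natural kp g))).
  exact (comp_proper (reflexivity _) H).
Qed.

Lemma J_retracts (M : D) : exists (t : T) (r : hom (J (F t)) M) (i : hom M (J (F t))),
  r \o i == idm M.
Proof.
  exists (mcar M), (free_out hproj M \o kp (F (mcar M))), (iso_inv (kp (F (mcar M))) \o free_in s2 s3 M).
  refine (transitivity (comp_assoc _ _ _) _).
  refine (transitivity (comp_proper (reflexivity _) (symmetry (comp_assoc _ _ _))) _).
  refine (transitivity (comp_proper (reflexivity _) (comp_proper (iso_invr (kp (F (mcar M)))) (reflexivity _))) _).
  refine (transitivity (comp_proper (reflexivity _) (comp_idl _)) _).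
  exact (free_out_in hproj s1 s2 s3 M).
Qed.

Lemma J_dense n (X : ndiag (susp (Tri := tt_tri (TensorTri := DTen)))) : in_range o n -> dist n X ->
  exists Y, dist n Y /\ nretract n X (nimage (F := J)
    (fun x => trif_susp Jt x) (nimage (F := F) (fun x => trif_susp tF x) Y)).
Proof.
  intros Hn HX.
  exists (nimage (F := forget A) (fun M => forget_susp A M) X); split; [exact HX|].
  refine (nretract_trans (comparison_dense hadd hproj s1 s2 s3 n X) (nisomorphic_retract (nisomorphic_sym _))).
  apply (nimage_ext (aD := module_preadd hadd A) (a := kp)).
  exact (J_susp ho hT hadd hker hproj s1 s2 s3).
Qed.

Context (HS : exists H : IntHom S, ihom_exact H).

Lemma module_closed : exists H : IntHom (mC := tt_mon (TensorTri := DTen)) D,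
  ihom_exact (tC := DTen) H.
Proof.
  exact (@closed_of_dense o ho T S D tT tS DTen hD F tF J Jt HS J_full J_faithful
    J_retracts J_dense).
Qed.

Lemma completion_closed : exists H : IntHom (mC := tt_mon (TensorTri := KTen)) (idempotent_completion Q),
  ihom_exact (tC := KTen) H.
Proof.
  refine (@kar_closed o ho Q D QTen DTri hD KB (Kbar_tri ho hT hadd hproj s1 s2 s3)
    Kfull Kfaith (@Kbar_dense _ ho _ _ _ _ hT _ _ _ _ hadd hproj _ s1 s2 s3) (Kbar_retracts ho hproj s1 s2 s3)
    T S tT tS F tF q (tq ho hT hadd hker hproj s1 s2 s3) HS _ _ _ _).
  - exact J_full.
  - exact J_faithful.
  - exact J_retracts.
  - exact J_dense.
Qed.
End Quotient.

Theorem proposition3p8 (o : tri_order) (ho : valid_order o)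
    (T S : Cat) (tT : TTCat o T) (tS : TTCat o S)
    (hT : idempotent_complete T)
    (F : Functor T S) (tF : TTFunctor F)
    (G : Functor S T) (adj : Adjunction F G)
    (hker : kernel_tensor_closed G)
    (hproj : right_projection_formula tF adj)
    (hsep : separable (unit_algebra tF adj)) :
  exists (tQ : TensorTri o (verdier_quotient G))
         (tK : TTCat o (idempotent_completion (verdier_quotient G)))
         (tM : TTCat o (module_cat (unit_algebra tF adj))),
    is_verdier_structure tQ /\
    is_completion_structure tQ ttc_tensor /\
    is_module_structure ttc_tensor /\
    exists E : Functor (idempotent_completion (verdier_quotient G))
                       (module_cat (unit_algebra tF adj)),
      TTEquivalence E /\
      naturally_isomorphic
        (functor_comp E
           (functor_comp (to_completion (verdier_quotient G))
                         (quotient_functor G)))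
        (comparison tF adj).
Proof.
  (* Since T is closed, tensoring with an object is a left adjoint, hence additive. *)
  assert (hadd : tens_additive (C := T) (tt_mon (TensorTri := ttc_tensor))).
  { destruct (ttc_closed (TTCat := tT)) as [H _]; intros w.
    exact (tensor_right_additive H w (tri_additive (C := T))). }
  destruct hsep as [s [s1 [s2 s3]]].
  exists (Qtensor ho hT hadd hker hproj s1 s2 s3).
  exists (@Build_TTCat o _ (KQtensor ho hT hadd hker hproj s1 s2 s3)
    (completion_closed ho hT hadd hker hproj s1 s2 s3 ttc_closed)).
  exists (@Build_TTCat o _ (Dtensor ho hT hadd hker hproj s1 s2 s3)
    (module_closed ho hT hadd hker hproj s1 s2 s3 ttc_closed)).
  split; [exact (verdier_structure ho hT hadd hker hproj s1 s2 s3)|].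
  split; [exact (KQ_structure ho hT hadd hker hproj s1 s2 s3)|].
  split; [exact (module_structure ho hT hadd hker hproj s1 s2 s3)|].
  exists (kar_ext (module_idempotent_complete hT (A := unit_algebra tF adj)) (Kbar ho tF adj)).
  split; [|exact (inhabits (kappa ho hT tF adj))].
  split; [exact (inhabits (E_tt ho hT hadd hker hproj s1 s2 s3))|].
  exact (E_equivalence ho hT hproj s1 s2 s3).
Qed.
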